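(* Let $\phi:X\to G$ be a measurable function, let $\pi$ be a finite-dimensional irreducible unitary representation of $G$ of dimension $d_\pi$, and let $j\in\{1,\ldots,d_\pi\}$. Assume that $\mathcal L_Y\phi$ exists $\mu_X$-almost everywhere, that $M_\phi\in L^2(X,\mathfrak g)$, and that $\mathcal L_Y(\pi\circ\phi)\in L^\infty\big(X,\mathscr B(\mathbb C^{d_\pi})\big)$. Then the strong limit $$D_{\phi,\pi}:=\mathop{\mathrm{s\text{-}lim}}_{N\to\infty}\frac1N\big[A,(U_{\phi,\pi,j})^N\big](U_{\phi,\pi,j})^{-N}$$ exists and is equal to the operator of multiplication by the matrix-valued function $i\,(d\pi)_{e_G}\big((P_\phi M_\phi)(\cdot)\big)$ in $\mathcal H^{(\pi)}_j$, and (a) $\lim_{N\to\infty}\big\langle\varphi,(U_{\phi,\pi,j})^N\psi\big\rangle=0$ for each $\varphi\in\ker(D_{\phi,\pi})^\perp$ and $\psi\in\mathcal H^{(\pi)}_j$, (b) $U_{\phi,\pi,j}\big|_{\ker(D_{\phi,\pi})^\perp}$ has purely continuous spectrum.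
   Context: Setting. $X$ is a smooth compact second countable Hausdorff manifold with Borel probability measure $\mu_X$, and $\{F_t\}_{t\in\mathbb R}$ is a $C^1$ flow on $X$ preserving $\mu_X$, with continuous vector field $Y$. $G$ is a compact Lie group with normalised Haar measure $\mu_G$, identity $e_G$ and Lie algebra $\mathfrak g$, endowed with an $\mathrm{Ad}$-invariant scalar product $\langle\cdot,\cdot\rangle_{\mathfrak g}$, where $\mathrm{Ad}_gZ=gZg^{-1}$. For $\phi:X\to G$ measurable, $T_\phi(x,g)=(F_1(x),g\phi(x))$ is the skew product and $U_\phi\psi=\psi\circ T_\phi$ the Koopman operator, unitary in $\mathcal H:=L^2(X\times G,\mu_X\otimes\mu_G)$. Degree. $(\mathcal L_Y\phi)(x)=\frac{d}{dt}|_{t=0}\phi(F_t(x))\in T_{\phi(x)}G$ when it exists; $M_\phi:=\mathcal L_Y\phi\cdot\phi^{-1}$ (right translation, values in $T_{e_G}G\simeq\mathfrak g$). $L^2(X,\mathfrak g)$ is the Hilbert space of measurable functions $X\to\mathfrak g$ with scalar product $\int_Xd\mu_X\langle f_1,f_2\rangle_{\mathfrak g}$; $W_\phi$ is the unitary operator in it given by $(W_\phi f)(x)=\mathrm{Ad}_{\phi(x)}f(F_1(x))$; $P_\phi$ is the orthogonal projection onto $\ker(1-W_\phi)$. Representations. $\pi:G\to\mathrm U(d_\pi)$ has matrix elements $\pi_{jk}$; $\mathcal H^{(\pi)}_j:=\bigoplus_{k=1}^{d_\pi}L^2(X,\mu_X)\otimes\{\pi_{jk}\}\subset\mathcal H$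 is a reducing subspace for $U_\phi$, and $U_{\phi,\pi,j}:=U_\phi|_{\mathcal H^{(\pi)}_j}$. $\mathfrak g_\pi$ is the Lie algebra of $\pi(G)$, and $(d\pi)_{e_G}:\mathfrak g\to\mathfrak g_\pi$ the differential of $\pi$ at $e_G$. $\mathscr B(\mathbb C^{d_\pi})$ is the space of $d_\pi\times d_\pi$ complex matrices with operator norm. A function $M:X\to\mathscr B(\mathbb C^{d_\pi})$ in $L^\infty$ acts as a multiplication operator in $\mathcal H^{(\pi)}_j$ by $M\sum_k\varphi_k\otimes\pi_{jk}:=\sum_{k,\ell}M_{k\ell}\varphi_\ell\otimes\pi_{jk}$. Auxiliary operator. $H$ is the self-adjoint operator in $L^2(X,\mu_X)$ given by $H\varphi=\lim_{t\to0}it^{-1}(\varphi\circ F_t-\varphi)$ (generator of the unitary group $\varphi\mapsto\varphi\circ F_t$); it is essentially self-adjoint on $C^1(X)$, where $H\varphi=i\mathcal L_Y\varphi$. $A$ is the self-adjoint operator in $\mathcal H^{(\pi)}_j$ given by $A\sum_k\varphi_k\otimes\pi_{jk}=\sum_kH\varphi_k\otimes\pi_{jk}$, with domain $\bigoplus_k\mathcal D(H)\otimes\{\pi_{jk}\}$. For functions on $X$ with values in matrices, $\mathcal L_Y$ is understood as $-iH$ entrywise; thus the condition $\mathcal L_Y(\pi\circ\phi)\in L^\infty(X,\mathscr B(\mathbb C^{d_\pi}))$ means that the entries of $\pi\circ\phi$ lie in $\mathcal D(H)$ and that $-iH$ applied entrywise is essentially bounded. Under this condition $U_{\phi,\pi,j}\in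 C^1(A)$, i.e. $t\mapsto e^{-itA}U_{\phi,\pi,j}e^{itA}$ is strongly $C^1$, and similarly for its powers; for a bounded operator $S\in C^1(A)$, $[A,S]$ denotes the bounded operator associated with the continuous extension of the form $\varphi\mapsto\langle A\varphi,S\varphi\rangle-\langle\varphi,SA\varphi\rangle$ on $\mathcal D(A)$. ''Purely continuous spectrum'' means no eigenvalues. *)

(* Defs.v *)
From HB Require Import structures.
From mathcomp Require Import all_boot all_order all_algebra.
From mathcomp.real_closed Require Import complex.
From mathcomp Require Import all_classical all_reals all_analysis.

Set Implicit Arguments.
Unset Strict Implicit.
Unset Printing Implicit Defensive.

Import Order.TTheory GRing.Theory Num.Theory.
Import numFieldNormedType.Exports.

Local Open Scope classical_set_scope.
Local Open Scope ring_scope.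

(* Meant for [U] open and [V], [W] finite-dimensional: then the continuity of
   the differential amounts to that of ['d f x v] in [x] for each [v]. *)
Fixpoint Ck_on (R : realType) (V W : normedModType R) (k : nat) (U : set V)
    (f : V -> W) : Prop :=
  match k with
  | 0%N => forall x, U x -> {for x, continuous f}
  | k'.+1 => (forall x, U x -> differentiable f x) /\
             (forall v, Ck_on k' U (fun x => 'd f x v))
  end.

Definition smooth_on (R : realType) (V W : normedModType R) (U : set V)
    (f : V -> W) : Prop := forall k, Ck_on k U f.

(* [chart_map] and [chart_inv] are total; their values outside of [chart_dom]
   and [chart_map @` chart_dom] are irrelevant. *)
Record chart (R : realType) (n : nat) (T : topologicalType) := Chart {
  chart_dom : set T ;
  chart_map :> T -> 'rV[R]_n ;
  chart_inv : 'rV[R]_n -> T ;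
  chart_dom_open : open chart_dom ;
  chart_img_open : open (chart_map @` chart_dom) ;
  chart_mapK : forall x, chart_dom x -> chart_inv (chart_map x) = x ;
  chart_map_continuous :
    forall x, chart_dom x -> {for x, continuous chart_map} ;
  chart_inv_continuous :
    forall v, (chart_map @` chart_dom) v -> {for v, continuous chart_inv} }.

(* Smooth Hausdorff second countable manifold without boundary, of dimension
   [n], whose smooth structure is given by the atlas [chart_at x], [x : T]. *)
HB.mixin Record isManifold (R : realType) (n : nat) T
    of PointedTopological T := {
  chart_at : T -> chart R n T ;
  chart_at_dom : forall x, chart_dom (chart_at x) x ;
  chart_at_compat : forall x y,
    smooth_on
      (chart_at x @` (chart_dom (chart_at x) `&` chart_dom (chart_at y)))
      (chart_at y \o chart_inv (chart_at x)) ;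
  manifold_hausdorff : hausdorff_space T ;
  manifold_second_countable : @second_countable T }.

#[short(type="manifoldType")]
HB.structure Definition Manifold (R : realType) (n : nat) :=
  {T of isManifold R n T & PointedTopological T}.

(* The tangent space at [p] is identified with ['rV[R]_n] by means of the
   preferred chart [chart_at p]. *)
Section tangent.
Context (R : realType) (m n : nat).
Context (M : manifoldType R m) (N : manifoldType R n).

Definition mdiff (f : M -> N) (p : M) : 'rV[R]_m -> 'rV[R]_n :=
  'd (chart_at (f p) \o f \o chart_inv (chart_at p)) (chart_at p p).

Definition mderivable (c : R -> M) (t : R) : Prop :=
  {for t, continuous c} /\ derivable (chart_at (c t) \o c) t 1.

Definition velocity (c : R -> M) (t : R) : 'rV[R]_m :=
  'D_1 (chart_at (c t) \o c) t.

End tangent.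

HB.mixin Record isLieGroup (R : realType) (n : nat) G
    of Manifold R n G & Group G := {
  mulg_continuous : continuous (fun z : G * G => (z.1 * z.2)%g) ;
  mulg_smooth : forall g h : G,
    exists U : set ('rV[R]_n * 'rV[R]_n),
      [/\ open U, U (chart_at g g, chart_at h h) &
          smooth_on U (fun z => chart_at (g * h)%g
            (chart_inv (chart_at g) z.1 * chart_inv (chart_at h) z.2)%g)] ;
  invg_continuous : continuous (fun g : G => (g^-1)%g) ;
  invg_smooth : forall g : G,
    exists U : set 'rV[R]_n,
      [/\ open U, U (chart_at g g) &
          smooth_on U (fun v => chart_at (g^-1)%g
            ((chart_inv (chart_at g) v)^-1)%g)] }.

#[short(type="lieGroupType")]
HB.structure Definition LieGroup (R : realType) (n : nat) :=
  {G of isLieGroup R n G & Manifold R n G & Group G}.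

Definition Ad (R : realType) (n : nat) (G : lieGroupType R n) (g : G) :
    'rV[R]_n -> 'rV[R]_n :=
  mdiff (fun h : G => (g * h * g^-1)%g) 1%g.

Definition Ad_invariant (R : realType) (n : nat) (G : lieGroupType R n)
    (ip : {dot 'rV[R]_n for idfun}) : Prop :=
  forall (g : G) (Y Z : 'rV[R]_n), ip (Ad g Y) (Ad g Z) = ip Y Z.

Notation borel T := (g_sigma_algebraType (@open T)).

Definition haar_probability (R : realType) (n : nat) (G : lieGroupType R n)
    (mu : probability (borel G) R) : Prop :=
  forall (g : G) (A : set (borel G)), measurable A ->
    mu ((fun h : G => (g * h)%g) @^-1` A) = mu A.

Definition C1_flow (R : realType) (n : nat) (X : manifoldType R n)
    (F : R -> X -> X) : Prop :=
  [/\ forall x, F 0 x = x,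
      forall s t x, F (s + t) x = F s (F t x),
      continuous (fun z : R * X => F z.1 z.2) &
      forall t x, exists U : set (R * 'rV[R]_n),
        [/\ open U, U (t, chart_at x x) &
            Ck_on 1%N U (fun z =>
              chart_at (F t x) (F z.1 (chart_inv (chart_at x) z.2)))]].

Definition measure_preserving_flow (R : realType) (n : nat)
    (X : manifoldType R n) (mu : probability (borel X) R)
    (F : R -> X -> X) : Prop :=
  forall t (A : set (borel X)), measurable A -> mu (F t @^-1` A) = mu A.

Section degree.
Context (R : realType) (n m : nat).
Context (X : manifoldType R n) (G : lieGroupType R m).
Context (mu : probability (borel X) R) (F : R -> X -> X) (phi : X -> G).
Context (ip : {dot 'rV[R]_m for idfun}).

Definition Lie_derivable (x : X) : Prop := mderivable (fun t => phi (F t x)) 0.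

Definition Lie_derivative (x : X) : 'rV[R]_m :=
  velocity (fun t => phi (F t x)) 0.

(* [mdiff] of the right translation by [(phi x)^-1] takes values in the tangent
   space at [phi x * (phi x)^-1 = 1], the Lie algebra. *)
Definition M_phi (x : X) : 'rV[R]_m :=
  mdiff (fun g : G => (g * (phi x)^-1)%g) (phi x) (Lie_derivative x).

(* Elements of L^2 spaces are represented by Borel functions, identified when
   they are equal almost everywhere. *)
Definition L2_lie (f : borel X -> 'rV[R]_m) : Prop :=
  (forall i, measurable_fun setT (fun x => f x 0 i)) /\
  (\int[mu]_x (ip (f x) (f x))%:E < +oo)%E.

(* For functions defined up to null sets, such as [M_phi]. *)
Definition L2_lie_class (f : borel X -> 'rV[R]_m) : Prop :=
  exists2 f0, L2_lie f0 & f = f0 %[ae mu].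

Definition W_phi (f : borel X -> 'rV[R]_m) : borel X -> 'rV[R]_m :=
  fun x => Ad (phi x) (f (F 1 x)).

Definition ker_1_sub_W_phi : set (borel X -> 'rV[R]_m) :=
  [set f | L2_lie f /\ W_phi f = f %[ae mu]].

Definition is_P_phi (f p : borel X -> 'rV[R]_m) : Prop :=
  ker_1_sub_W_phi p /\
  exists f0, [/\ L2_lie f0, f = f0 %[ae mu] &
    forall q, ker_1_sub_W_phi q -> \int[mu]_x ip (f0 x - p x) (q x) = 0].

Definition P_phi (f : borel X -> 'rV[R]_m) : borel X -> 'rV[R]_m :=
  xget (fun=> 0) [set p | is_P_phi f p].

End degree.

Section L2.
Context d (T : measurableType d) (R : realType).
Context (mu : {measure set T -> \bar R}).
Local Notation C := R[i].

Definition cmeasurable (f : T -> C) : Prop :=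
  measurable_fun setT (fun x => complex.Re (f x)) /\
  measurable_fun setT (fun x => complex.Im (f x)).

Definition cnorm2 (f : T -> C) : \bar R :=
  Lnorm mu 2%:E (fun x => (Normc.normc (f x))%:E).

Definition L2 (f : T -> C) : Prop := cmeasurable f /\ (cnorm2 f < +oo)%E.

Definition inner (f g : T -> C) : C :=
  ((\int[mu]_x complex.Re ((f x)^* * g x)) +i* (\int[mu]_x complex.Im ((f x)^* * g x)))%C.

Definition bounded_op (K : set (T -> C)) (S : (T -> C) -> (T -> C)) : Prop :=
  [/\ forall psi, K psi -> K (S psi),
      forall (a : C) psi psi', K psi -> K psi' ->
        S (fun z => a * psi z + psi' z)
          = (fun z => a * S psi z + S psi' z) %[ae mu] &
      exists c : R, forall psi, K psi ->
        (cnorm2 (S psi) <= c%:E * cnorm2 psi)%E].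

Definition eucl_norm n (v : 'cV[C]_n) : R :=
  Num.sqrt (\sum_i Normc.normc (v i 0) ^+ 2).

Definition Linfty_mx n (M : T -> 'M[C]_n) : Prop :=
  (forall k l, cmeasurable (fun x => M x k l)) /\
  exists c : R, \forall x \ae mu,
    forall v : 'cV[C]_n, eucl_norm (M x *m v) <= c * eucl_norm v.

End L2.

Definition unitary_irrep (R : realType) (n : nat) (G : lieGroupType R n)
    (d : nat) (pi : G -> 'M[R[i]]_d) : Prop :=
  [/\ (0 < d)%N,
      forall g, pi g \is unitarymx,
      forall g h : G, pi (g * h)%g = pi g *m pi h,
      forall j k, continuous (fun g => complex.Re (pi g j k)) /\
                  continuous (fun g => complex.Im (pi g j k)) &
      (* the rows of [V] span a subspace of C^d; [pi g] acts on the left on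
         column vectors, hence the transposition *)
      forall V : 'M[R[i]]_d, (forall g, (V *m (pi g)^T <= V)%MS) ->
        V = 0 \/ row_full V].

(* The differential of [pi] at the identity, taken entrywise. *)
Definition drep (R : realType) (n : nat) (G : lieGroupType R n) (d : nat)
    (pi : G -> 'M[R[i]]_d) (Z : 'rV[R]_n) : 'M[R[i]]_d :=
  let c : chart R n G := chart_at 1%g in
  \matrix_(j, k)
    ('d (fun v => complex.Re (pi (chart_inv c v) j k)) (c 1%g) Z +i*
     'd (fun v => complex.Im (pi (chart_inv c v) j k)) (c 1%g) Z)%C.

Section operators.
Context (R : realType) (n m : nat).
Context (X : manifoldType R n) (G : lieGroupType R m).
Context (muX : probability (borel X) R) (muG : probability (borel G) R).
Context (F : R -> X -> X) (phi : X -> G).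
Context (d : nat) (pi : G -> 'M[R[i]]_d) (j : 'I_d).
Local Notation C := R[i].
Local Notation XG := (borel X * borel G)%type.
Local Notation mu := (muX \x muG)%E.

Definition skew_product (z : XG) : XG := (F 1 z.1, (z.2 * phi z.1)%g).

Definition skew_product_inv (z : XG) : XG :=
  (F (-1) z.1, (z.2 * (phi (F (-1) z.1))^-1)%g).

Definition koopman (psi : XG -> C) : XG -> C := psi \o skew_product.

Definition koopman_inv (psi : XG -> C) : XG -> C := psi \o skew_product_inv.

(* [generator f h] means that [f] is in the domain of [H] and [H f = h]. *)
Definition generator (f h : borel X -> C) : Prop :=
  [/\ L2 muX f, L2 muX h &
      cnorm2 muX (fun x => 'i%C * (t^-1)%:C%C * (f (F t x) - f x) - h x)
        @[t --> 0^'] --> 0%E].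

(* [L] is the class of -i H (pi \o phi), computed entrywise. *)
Definition Lie_rep_Linfty : Prop :=
  exists2 L : borel X -> 'M[C]_d, Linfty_mx muX L &
    forall k l, generator (fun x => pi (phi x) k l) (fun x => 'i%C * L x k l).

(* The element $\sum_k f_k \otimes \pi_{jk}$, with coefficients [f]. *)
Definition coef_fun (f : 'I_d -> borel X -> C) : XG -> C :=
  fun z => \sum_k f k z.1 * pi z.2 j k.

Definition Hj : set (XG -> C) :=
  [set psi | L2 mu psi /\
    exists2 f, (forall k, L2 muX (f k)) & psi = coef_fun f %[ae mu]].

(* [opA psi psi'] means that [psi] is in the domain of [A] and [A psi = psi']. *)
Definition opA (psi psi' : XG -> C) : Prop :=
  [/\ L2 mu psi, L2 mu psi' &
      exists f h, [/\ forall k, generator (f k) (h k),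
        psi = coef_fun f %[ae mu] & psi' = coef_fun h %[ae mu]]].

Definition is_commutator (S B : (XG -> C) -> (XG -> C)) : Prop :=
  bounded_op mu Hj B /\
  forall psi psi', opA psi psi' ->
    inner mu psi (B psi) = inner mu psi' (S psi) - inner mu psi (S psi').

(* Any two elements of this set agree almost everywhere on [Hj], the domain of A
   being dense; the default value is used only if the form is not bounded. *)
Definition commutator (S : (XG -> C) -> (XG -> C)) :
    (XG -> C) -> (XG -> C) :=
  xget (fun _ _ => 0) [set B | is_commutator S B].

Definition is_multiplication (M : borel X -> 'M[C]_d)
    (D : (XG -> C) -> (XG -> C)) : Prop :=
  Linfty_mx muX M /\
  forall psi f, Hj psi -> (forall k, L2 muX (f k)) ->
    psi = coef_fun f %[ae mu] ->
    D psi = coef_fun (fun k x => \sum_l M x k l * f l x) %[ae mu].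

Definition strong_limit (B : nat -> (XG -> C) -> (XG -> C))
    (D : (XG -> C) -> (XG -> C)) : Prop :=
  bounded_op mu Hj D /\
  forall psi, Hj psi ->
    cnorm2 mu (fun z => B N psi z - D psi z) @[N --> \oo] --> 0%E.

Definition ker_op (D : (XG -> C) -> (XG -> C)) : set (XG -> C) :=
  [set psi | Hj psi /\ D psi = (fun=> 0) %[ae mu]].

Definition orth (K : set (XG -> C)) : set (XG -> C) :=
  [set psi | Hj psi /\ forall xi, K xi -> inner mu xi psi = 0].

Definition purely_continuous_on (S : (XG -> C) -> (XG -> C))
    (K : set (XG -> C)) : Prop :=
  (forall psi, K psi -> K (S psi)) /\
  forall (lambda : C) psi, K psi ->
    S psi = (fun z => lambda * psi z) %[ae mu] -> psi = (fun=> 0) %[ae mu].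

End operators.

Lemma skew_productK (R : realType) (n m : nat) (X : manifoldType R n)
    (G : lieGroupType R m) (F : R -> X -> X) (phi : X -> G) :
  C1_flow F ->
  cancel (skew_product F phi) (skew_product_inv F phi) /\
  cancel (skew_product_inv F phi) (skew_product F phi).
Proof.
move=> [F0 FD _ _]; split=> -[x g]; rewrite /skew_product /skew_product_inv /=.
  by rewrite -FD addNr F0 mulgK.
by rewrite -FD subrr F0 -mulgA mulVg mulg1.
Qed.

(* Main.v *)
From HB Require Import structures.
Require Import Defs.
From mathcomp Require Import all_boot all_order all_algebra.
From mathcomp.real_closed Require Import complex.
From mathcomp Require Import all_classical all_reals all_analysis.
From mathcomp Require Import measurable_realfun.
From mathcomp Require Import ring lra.
Set Implicit Arguments.
Unset Strict Implicit.
Unset Printing Implicit Defensive.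
Import Order.TTheory GRing.Theory Num.Theory.
Import numFieldNormedType.Exports.
Local Open Scope classical_set_scope.
Local Open Scope ring_scope.

(** The proof rests on one commutation relation. Write [U] for the Koopman
    operator, [A] for the generator of the flow acting on coefficients, and [m]
    for the logarithmic derivative of [pi \o phi] along the flow. The product
    rule for the generator gives [A U = U A + i m U] and, by iteration,
    [A U^N = U^N A + i (S N) U^N], where [S N] is the sum of [N] conjugates of
    [m] along the orbit ([generator_product], [famgen_iterkoopc]). Hence the
    commutator of [A] and [U^N], multiplied by [U^-N / N], is multiplication by
    the matrix [i (S N) / N], an average of uniformly bounded matrices.

    The averages converge because they come from the Lie algebra. A continuous
    finite-dimensional representation is differentiable, since it is recovered
    from its integrals against translates of a bump function
    ([rep_differentiable]). The chain rule then identifies [m] with the image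
    under the tangent representation [drep] of [M_phi] ([Lie_derivative_rep],
    [generator_derivative], [logder_drep]), and the conjugates of [m] with the
    images of the iterates of [M_phi] under [W_phi] ([drep_Ad]). So [S N / N]
    is the image of an ergodic average, and the mean ergodic theorem gives its
    limit [drep] of [P_phi M_phi] in mean square ([P_phi_mean_ergodic]). For
    uniformly bounded multipliers, convergence in mean square implies strong
    convergence of the multiplication operators ([mxact_cvg0]); this is the
    first claim, the orthogonality relations of Schur providing the isometry
    between elements of the subspace and their families of coefficients
    ([inner_coef_fun]). That the chosen commutator is the one computed here
    follows from density of the domain of [A], obtained by averaging indicators
    along the flow ([generator_dense], [commutator_unique]).

    For (a), the normalised commutators [DN] are self-adjoint, since [drep] has
    skew-hermitian values, and the inner product of [DN f] with [U^N g] is the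
    difference of those of [A f] with [U^N g] and of [f] with [U^N (A g)],
    divided by [N], so it tends to zero; as [DN f] tends to [D f], correlations
    of elements of the range of [D] decay. The closure of this range is the
    orthogonal complement of the kernel of [D] ([biorthogonal_closure],
    [correlation_decay]). For (b), an eigenvector in that complement would have
    autocorrelations of constant modulus. *)

(** * Local Lipschitz continuity of functions of class C^1 *)

Section calculus.
Context {R : realType}.

Lemma differentiable_eps (V W : normedModType R) (f : V -> W)
    (l : {linear V -> W}) (x : V) : continuous l ->
  (forall e : R, 0 < e -> \forall h \near (0 : V),
     `|f (h + x) - f x - l h| <= e * `|h|) ->
  differentiable f x /\ 'd f x = l :> (V -> W).
Proof.
move=> lc H.
have E : f \o shift x = cst (f x) + l +o_ (0 : V) id.
  apply/eqaddoP => e e0; near=> h.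
  rewrite /= /cst !fctE opprD addrA.
  by near: h; exact: H.
have D := diff_unique lc E.
split=> //; apply/diff_locallyP; rewrite D; split=> //.
Unshelve. all: by end_near. Qed.

Lemma near_eq_differentiable (V W : normedModType R) (f g : V -> W) (x : V) :
  (\forall y \near x, f y = g y) -> differentiable f x ->
  differentiable g x /\ 'd g x = 'd f x :> (V -> W).
Proof.
move=> fg df.
have fgx : f x = g x by exact: nbhs_singleton fg.
apply: differentiable_eps; first exact: diff_continuous.
move=> e e0.
have /eqaddoP/(_ e e0) H := diff_locally df.
have fg' : \forall h \near (0 : V), f (h + x) = g (h + x).
  have : (fun h => h + x) @ (0 : V) --> x.
    by rewrite -[X in _ --> X]add0r; apply: cvgD; [exact: cvg_id|exact: cvg_cst].
  by move=> /(_ _ fg).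
near=> h.
have E : f (h + x) = g (h + x) by near: h.
have : `|(f \o shift x - (cst (f x) + 'd f x)) h| <= e * `|h| by near: h.
by rewrite /= /cst !fctE opprD addrA E fgx.
Unshelve. all: by end_near. Qed.

(** Both points vary: differentiability at [x] alone gives no such bound. *)
Definition loc_lip (V W : normedModType R) (f : V -> W) (x : V) : Prop :=
  exists2 C : R, 0 <= C & exists2 r : R, 0 < r &
    forall y z, ball x r y -> ball x r z -> `|f y - f z| <= C * `|y - z|.

Lemma loc_lip_comp (U V W : normedModType R) (f : U -> V) (g : V -> W) x :
  {for x, continuous f} -> loc_lip f x -> loc_lip g (f x) ->
  loc_lip (g \o f) x.
Proof.
move=> fc [C C0 [r r0 Hf]] [D D0 [s s0 Hg]].
exists (D * C); first exact: mulr_ge0.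
have /fc : nbhs (f x) (ball (f x) s) by exact: nbhsx_ballx.
move=> /nbhs_ballP[t /= t0 Ht].
exists (Num.min r t); first by rewrite lt_min r0 t0.
move=> y z yb zb.
have [y1 y2] : ball x r y /\ ball x t y.
  by split; apply: le_ball yb; rewrite ge_min lexx ?orbT.
have [z1 z2] : ball x r z /\ ball x t z.
  by split; apply: le_ball zb; rewrite ge_min lexx ?orbT.
apply: le_trans (Hg _ _ (Ht _ y2) (Ht _ z2)) _.
by rewrite -mulrA ler_wpM2l// Hf.
Qed.

(** By the mean value theorem for the function [t |-> f (z + t *: (y - z))]. *)
Lemma mean_value_segment (V : normedModType R) (f : V -> R) (y z : V) (K : R) :
  (forall t : R, 0 <= t <= 1 -> differentiable f (z + t *: (y - z)) /\
     `|'d f (z + t *: (y - z)) (y - z)| <= K) ->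
  `|f y - f z| <= K.
Proof.
move=> H.
pose c (t : R) := z + t *: (y - z).
have dc (t : R) : is_diff t c (fun s => s *: (y - z)).
  have := is_diffD (is_diff_cst z t) (is_diff_scalel t (y - z)).
  by rewrite add0r.
have dfc (t : R) : 0 <= t <= 1 ->
    is_derive t 1 (f \o c) ('d f (c t) (y - z)).
  move=> t01; have [df _] := H t t01.
  have h1 : differentiable (f \o c) t by apply: differentiable_comp.
  apply: DeriveDef; first exact: diff_derivable.
  have [dct vct] := dc t.
  by rewrite deriveE// diff_comp//= vct scale1r.
have [||t t01 E] := @MVT_segment R (f \o c) (fun t => 'd f (c t) (y - z)) 0 1 ler01.
- by move=> t /[!in_itv]/= /andP[a b]; apply: dfc; rewrite !ltW.
- apply: derivable_within_continuous => t; rewrite in_itv/= => t01.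
  by have [] := dfc t t01.
have -> : f y - f z = 'd f (c t) (y - z).
  move: E; rewrite subr0 mulr1 /= /c scale0r addr0 scale1r => <-.
  by rewrite [z + _]addrC subrK.
by apply: (H t _).2; move: t01; rewrite in_itv.
Qed.

Lemma rv_coord_le n (v : 'rV[R]_n) i : `|v 0 i| <= `|v|.
Proof.
rewrite /Num.norm/= mx_normrE.
by apply: (le_trans _ (@le_bigmax _ _ _ 0 (fun ij : 'I_1 * 'I_n => `|v ij.1 ij.2|) (0, i))).
Qed.

Lemma rv_norm_le n (v : 'rV[R]_n) K : 0 <= K -> (forall i, `|v 0 i| <= K) ->
  `|v| <= K.
Proof.
move=> K0 H; rewrite /Num.norm/= mx_normrE.
by apply: bigmax_le => // -[i k] _ /=; rewrite (ord1 i).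
Qed.

(** Stands in for finite dimension: finitely many spanning vectors with
    bounded coordinates. Independence is not asked for, which makes the
    property immediate for products. *)
Definition fin_span (V : normedModType R) : Prop :=
  exists (I : finType) (e : I -> V) (a : I -> V -> R) (K : R),
    [/\ 0 <= K, forall u, u = \sum_i a i u *: e i &
      forall i u, `|a i u| <= K * `|u|].

Lemma fin_span_rV n : fin_span 'rV[R]_n.
Proof.
exists 'I_n, (fun i => delta_mx 0 i), (fun i (u : 'rV[R]_n) => u 0 i), 1; split=> //.
- by move=> u; rewrite -row_sum_delta.
- by move=> i u; rewrite mul1r rv_coord_le.
Qed.

Lemma fin_span_prod (V W : normedModType R) :
  fin_span V -> fin_span W -> fin_span (V * W)%type.
Proof.
move=> [I [e [a [K [K0 ae aK]]]]] [J [e' [a' [K' [K'0 ae' aK']]]]].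
exists (I + J)%type.
exists (fun i => match i with inl i => (e i, 0) | inr i => (0, e' i) end).
exists (fun i u => match i with inl i => a i u.1 | inr i => a' i u.2 end).
exists (K + K'); split; first exact: addr_ge0.
- move=> [u v]; rewrite big_sumType/=.
  apply/pair_equal_spec; split => /=.
    rewrite raddf_sum (raddf_sum (@fst V W)) /= [X in _ + X]big1 ?addr0//.
    by move=> i _; rewrite scaler0.
  rewrite raddf_sum (raddf_sum (@snd V W)) /= big1 ?add0r//.
  by move=> i _; rewrite scaler0.
- move=> i [u v]; rewrite /Num.norm/=.
  case: i => k.
    apply: (le_trans (aK k u)); apply: ler_pM => //; first by rewrite lerDl.
    by rewrite le_max lexx.
  apply: (le_trans (aK' k v)); apply: ler_pM => //; first by rewrite lerDr.
  by rewrite le_max lexx orbT.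
Qed.

Lemma ball_segment (V : normedModType R) (x y z : V) (r t : R) : 0 < r ->
  ball x r y -> ball x r z -> 0 <= t <= 1 -> ball x r (z + t *: (y - z)).
Proof.
move=> r0; rewrite -!ball_normE /ball_ /= => yr zr /andP[t0 t1].
have -> : x - (z + t *: (y - z)) = t *: (x - y) + (1 - t) *: (x - z).
  rewrite opprD addrA.
  have -> : y - z = (x - z) - (x - y) by rewrite opprB [RHS]addrC addrA subrK.
  by move: (x - z) (x - y) => u w; rewrite scalerBr opprB scalerBl scale1r addrCA.
apply: (le_lt_trans (ler_normD _ _)); rewrite !normrZ ger0_norm// ger0_norm ?subr_ge0//.
have [->|tn0] := eqVneq t 0; first by rewrite mul0r add0r subr0 mul1r.
have -> : r = t * r + (1 - t) * r by ring.
apply: ltr_leD; first by rewrite ltr_pM2l// lt_neqAle eq_sym tn0.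
by rewrite ler_wpM2l ?subr_ge0// ltW.
Qed.

(** [Ck_on 1] only provides continuity of the differential along each fixed
    vector. Finitely many spanning vectors make the whole differential bounded
    near [x], and the mean value inequality on segments concludes. *)
Lemma C1_loc_lip_scalar (V : normedModType R) (U : set V) (f : V -> R) (x : V) :
  fin_span V -> open U -> U x -> Ck_on 1 U f -> loc_lip f x.
Proof.
move=> [I [e [a [K [K0 ae aK]]]]] oU Ux [df cf].
have /nbhs_ballP[r0 /= r00 rU] : nbhs x U by exact: open_nbhs_nbhs.
pose M := \sum_i (`|'d f x (e i)| + 1).
have near_bd : \forall y \near x, forall i, `|'d f y (e i)| <= M.
  apply: filter_forall => i.
  have ci : {for x, continuous (fun y => 'd f y (e i))} by exact: cf.
  have : \forall y \near x, `|'d f x (e i) - 'd f y (e i)| < 1.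
    by move/cvgrPdist_lt : ci => /(_ 1 ltr01).
  apply: filterS => y yi.
  have h1 : `|'d f y (e i)| <= `|'d f x (e i)| + 1.
    have := ler_normB ('d f x (e i)) ('d f x (e i) - 'd f y (e i)).
    by rewrite opprB addrC subrK => h; apply: (le_trans h); rewrite lerD2l ltW.
  apply: (le_trans h1); rewrite /M (bigD1 i)//= lerDl.
  by apply: sumr_ge0 => j _; apply: addr_ge0.
have [r1 /= r10 r1M] : exists2 r : R, 0 < r & ball x r `<=` [set y | forall i, `|'d f y (e i)| <= M].
  by have /nbhs_ballP[r r0' H] := near_bd; exists r.
have M0 : 0 <= M by apply: sumr_ge0 => i _; rewrite addr_ge0.
exists (#|I|%:R * (K * M)); first by rewrite mulr_ge0// mulr_ge0.
exists (Num.min r0 r1); first by rewrite lt_min r00 r10.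
move=> y z yb zb.
apply: mean_value_segment => t t01.
have cb : ball x (Num.min r0 r1) (z + t *: (y - z)).
  by apply: ball_segment => //; rewrite lt_min r00 r10.
split; first by apply/df/rU; apply: le_ball cb; rewrite ge_min lexx.
set c := z + _.
have -> : 'd f c (y - z) = \sum_i a i (y - z) * 'd f c (e i).
  rewrite {1}(ae (y - z)) linear_sum; apply: eq_bigr => i _.
  by rewrite linearZ.
apply: (le_trans (ler_norm_sum _ _ _)).
have -> : #|I|%:R * (K * M) * `|y - z| = \sum_(i : I) K * `|y - z| * M.
  by rewrite sumr_const -mulr_natl; ring.
apply: ler_sum => i _; rewrite normrM.
apply: ler_pM => //.
have : ball x r1 c by apply: le_ball cb; rewrite ge_min lexx orbT.
by move=> /r1M; apply.
Qed.

Lemma Ck_on1_coord (V : normedModType R) q (U : set V) (f : V -> 'rV[R]_q) k :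
  open U -> Ck_on 1 U f -> Ck_on 1 U (fun y => f y 0 k : R).
Proof.
move=> oU [df cf].
have E x : U x -> differentiable (fun y => f y 0 k : R) x /\
    forall v, 'd (fun y => f y 0 k : R) x v = 'd f x v 0 k.
  move=> Ux.
  pose g := fun N : 'rV[R]_q => N 0 k : R.
  have dg : differentiable g (f x) by exact: differentiable_coord.
  have cg : continuous g by exact: coord_continuous.
  have lg : linear g by move=> a u v; rewrite /g !mxE.
  have -> : (fun y => f y 0 k : R) = g \o f by [].
  split; first by apply: differentiable_comp => //; exact: df.
  move=> v; rewrite diff_comp//; last exact: df.
  pose gl : {linear 'rV[R]_q -> R} := HB.pack g (GRing.isLinear.Build _ _ _ _ g lg).
  have /= -> := @diff_lin R _ _ gl (f x) cg.
  by [].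
split; first by move=> x /E[].
move=> v x Ux.
rewrite /prop_for /continuous_at (E x Ux).2.
apply: (@cvg_trans _ ((fun y => 'd f y v 0 k) @ x)).
  apply: near_eq_cvg; near=> y.
  have Uy : U y by near: y; exact: open_nbhs_nbhs.
  by rewrite (E y Uy).2.
exact: (@cvg_comp _ _ _ (fun y => 'd f y v) (fun N : 'rV_q => N 0 k) _ _ _ (cf v x Ux) (@coord_continuous R 1 q 0 k _)).
Unshelve. all: by end_near. Qed.

Lemma loc_lip_row (V : normedModType R) q (f : V -> 'rV[R]_q) (x : V) :
  (forall k, loc_lip (fun y => f y 0 k : R) x) -> loc_lip f x.
Proof.
move=> H.
have /choice[Cr HCr] : forall k, exists Cr : R * R, [/\ 0 <= Cr.1, 0 < Cr.2 &
    forall y z, ball x Cr.2 y -> ball x Cr.2 z -> `|f y 0 k - f z 0 k| <= Cr.1 * `|y - z|].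
  by move=> k; have [C C0 [r r0 Hk]] := H k; exists (C, r).
exists (\sum_k (Cr k).1); first by rewrite sumr_ge0// => k _; case: (HCr k).
have r0 : 0 < \big[Num.min/1]_k (Cr k).2.
  by apply: lt_bigmin => // k _; case: (HCr k).
exists (\big[Num.min/1]_k (Cr k).2) => // y z yb zb.
apply: rv_norm_le; first by rewrite mulr_ge0// sumr_ge0// => k _; case: (HCr k).
move=> k; rewrite !mxE; have [C0 rk Hk] := HCr k.
have sb w : ball x (\big[Num.min/1]_k (Cr k).2) w -> ball x (Cr k).2 w.
  by move=> wb; apply: le_ball wb; exact: bigmin_le.
apply: (le_trans (Hk _ _ (sb _ yb) (sb _ zb))); apply: ler_wpM2r => //.
by rewrite (bigD1 k)//= lerDl sumr_ge0// => i _; case: (HCr i).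
Qed.

Lemma C1_loc_lip (V : normedModType R) q (U : set V) (f : V -> 'rV[R]_q) (x : V) :
  fin_span V -> open U -> U x -> Ck_on 1 U f -> loc_lip f x.
Proof.
move=> fV oU Ux cf; apply: loc_lip_row => k.
by apply: (@C1_loc_lip_scalar V U) => //; exact: Ck_on1_coord.
Qed.
End calculus.

(** * Bump functions *)

Section bump_function.
Context {R : realType}.

Lemma normM_lip (s t : R) : `|s * `|s| - t * `|t| | <= (`|s| + `|t|) * `|s - t|.
Proof.
have -> : s * `|s| - t * `|t| = s * (`|s| - `|t|) + (s - t) * `|t| by ring.
apply: (le_trans (ler_normD _ _)); rewrite !normrM normr_id mulrDl.
rewrite [`|s - t| * _]mulrC lerD2r ler_wpM2l//.
exact: ler_dist_dist.
Qed.

(** Twice the square of the positive part of [s]. *)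
Definition sqpos (s : R) : R := s * `|s| + s * s.

Lemma sqpos_ge0 s : 0 <= sqpos s.
Proof.
rewrite /sqpos; case: (ger0P s) => h; first by rewrite addr_ge0// mulr_ge0// ltW.
by rewrite mulrN addNr.
Qed.

Lemma sqpos_gt0 s : (0 < sqpos s) = (0 < s).
Proof.
rewrite /sqpos; case: (ltrgtP 0 s) => h; last by rewrite -h !mul0r addr0 ltxx.
  by rewrite gtr0_norm// addr_gt0// mulr_gt0.
by rewrite ltr0_norm// mulrN addNr ltxx.
Qed.

Lemma sqpos_loc_lip (x : R) : loc_lip (sqpos : R -> R) x.
Proof.
exists ((`|x| + 1) *+ 4); first by rewrite mulrn_wge0// addr_ge0.
exists 1 => // s t; rewrite -ball_normE /ball_ /= => xs xt.
have bs : `|s| <= `|x| + 1.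
  by rewrite -[s](subrK x) addrC (le_trans (ler_normD _ _))// lerD2l distrC ltW.
have bt : `|t| <= `|x| + 1.
  by rewrite -[t](subrK x) addrC (le_trans (ler_normD _ _))// lerD2l distrC ltW.
have -> : sqpos s - sqpos t = (s * `|s| - t * `|t|) + (s + t) * (s - t).
  by rewrite /sqpos; ring.
apply: (le_trans (ler_normD _ _)); rewrite normrM.
apply: (@le_trans _ _ ((`|s| + `|t|) * `|s - t| + (`|s| + `|t|) * `|s - t|)).
  by apply: lerD; [exact: normM_lip|apply: ler_wpM2r => //; exact: ler_normD].
rewrite -mulrDl; apply: ler_wpM2r => //; lra.
Qed.

Lemma sqpos_differentiable (x : R) : differentiable (sqpos : R -> R) x.
Proof.
have dsq : differentiable (fun s : R => s * s) x by apply: differentiableM.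
case: (ltrgtP x 0) => x0.
- have : differentiable (cst 0 : R -> R) x by exact: differentiable_cst.
  move/near_eq_differentiable => /(_ (sqpos : R -> R)) [] //; near=> y.
  have y0 : y < 0 by near: y; exact: (open_nbhs_nbhs (conj (@open_lt R 0) x0)).
  by rewrite /sqpos /cst/= ltr0_norm//; ring.
- have : differentiable (fun s : R => s * s + s * s) x by apply: differentiableD.
  move/near_eq_differentiable => /(_ (sqpos : R -> R)) [] //; near=> y.
  have y0 : 0 < y by near: y; exact: (open_nbhs_nbhs (conj (@open_gt R 0) x0)).
  by rewrite /sqpos gtr0_norm.
- rewrite x0.
  have dc0 : differentiable (cst 0 : R -> R) (0 : R) by exact: differentiable_cst.
  have [] // := @differentiable_eps R _ _ (sqpos : R -> R) ('d (cst 0 : R -> R) (0 : R)) 0 (diff_continuous dc0).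
  move=> e e0; near=> h.
  have -> : sqpos (h + 0) - sqpos 0 - 'd (cst 0) (0 : R) h = sqpos h.
    by rewrite diff_cst [h + 0]addr0 {2}/sqpos !mul0r [0 + 0]addr0 !subr0.
  have he : `|h| <= e / 2.
    near: h; apply/nbhs_ballP; exists (e / 2); first by rewrite /= divr_gt0.
    by move=> k; rewrite -ball_normE /ball_ /= sub0r normrN => /ltW.
  rewrite ger0_norm ?sqpos_ge0//.
  have := normr_ge0 h; have := ler_norm h; have := ler_norm (- h).
  rewrite normrN /sqpos; move: (`|h|) he => k; nra.
Unshelve. all: by end_near. Qed.

Lemma sum_loc_lip (V : normedModType R) (I : finType) (f : I -> V -> R) x :
  (forall i, loc_lip (f i) x) -> loc_lip (fun v => \sum_i f i v) x.
Proof.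
move=> H.
have /choice[Cr HCr] : forall k, exists Cr : R * R, [/\ 0 <= Cr.1, 0 < Cr.2 &
    forall y z, ball x Cr.2 y -> ball x Cr.2 z -> `|f k y - f k z| <= Cr.1 * `|y - z|].
  by move=> k; have [C C0 [r r0 Hk]] := H k; exists (C, r).
exists (\sum_k (Cr k).1); first by rewrite sumr_ge0// => k _; case: (HCr k).
exists (\big[Num.min/1]_k (Cr k).2) => [|y z yb zb].
  by apply: lt_bigmin => // k _; case: (HCr k).
have sb k w : ball x (\big[Num.min/1]_k (Cr k).2) w -> ball x (Cr k).2 w.
  by move=> wb; apply: le_ball wb; exact: bigmin_le.
rewrite -sumrB mulr_suml; apply: (le_trans (ler_norm_sum _ _ _)).
by apply: ler_sum => k _; have [_ _] := HCr k; apply; exact: sb.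
Qed.

Section bump.
Variables (n : nat) (a : 'rV[R]_n) (r : R).

Definition sqdist (v : 'rV[R]_n) : R := \sum_i (v 0 i - a 0 i) * (v 0 i - a 0 i).

(** Differentiable and locally Lipschitz, which is what differentiation under
    an integral sign needs. *)
Definition bump (v : 'rV[R]_n) : R := sqpos (r * r - sqdist v).

Lemma sqdist_loc_lip x : loc_lip sqdist x.
Proof.
apply: sum_loc_lip => i.
have -> : (fun v : 'rV[R]_n => (v 0 i - a 0 i) * (v 0 i - a 0 i)) =
  (fun s : R => (s - a 0 i) * (s - a 0 i)) \o (fun v : 'rV[R]_n => v 0 i) by [].
apply: loc_lip_comp.
- exact: coord_continuous.
- exists 1 => //; exists 1 => // y z _ _; rewrite mul1r.
  have -> : y 0 i - z 0 i = (y - z) 0 i by rewrite !mxE.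
  exact: rv_coord_le.
- set b := a 0 i; set y0 := x 0 i.
  exists ((`|y0| + 1 + `|b|) *+ 2); first by rewrite mulrn_wge0// !addr_ge0.
  exists 1 => // s t; rewrite -ball_normE /ball_ /= => xs xt.
  have bs : `|s| <= `|y0| + 1.
    by rewrite -[s](subrK y0) addrC (le_trans (ler_normD _ _))// lerD2l distrC ltW.
  have bt : `|t| <= `|y0| + 1.
    by rewrite -[t](subrK y0) addrC (le_trans (ler_normD _ _))// lerD2l distrC ltW.
  have -> : (s - b) * (s - b) - (t - b) * (t - b) = ((s - b) + (t - b)) * (s - t).
    by ring.
  rewrite normrM; apply: ler_wpM2r => //.
  have := ler_normD (s - b) (t - b); have := ler_normB s b; have := ler_normB t b.
  lra.
Qed.

Lemma sqdist_differentiable x : differentiable sqdist x.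
Proof.
have -> : sqdist = \sum_i (fun v : 'rV[R]_n => (v 0 i - a 0 i) * (v 0 i - a 0 i)).
  by apply/funext => v; rewrite fct_sumE.
apply: differentiable_sum => i.
have d1 : differentiable (fun v : 'rV[R]_n => v 0 i - a 0 i) x.
  by apply: differentiableB => //; exact: differentiable_coord.
exact: (differentiableM d1 d1).
Qed.

Lemma bump_differentiable x : differentiable bump x.
Proof.
have -> : bump = sqpos \o (fun v => r * r - sqdist v) by [].
apply: differentiable_comp; last exact: sqpos_differentiable.
by apply: differentiableB => //; exact: sqdist_differentiable.
Qed.

Lemma bump_loc_lip x : loc_lip bump x.
Proof.
have -> : bump = sqpos \o (fun v => r * r - sqdist v) by [].
apply: loc_lip_comp; last exact: sqpos_loc_lip.
  apply: differentiable_continuous.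
  by apply: differentiableB => //; exact: sqdist_differentiable.
have [C C0 [s s0 H]] := sqdist_loc_lip x.
exists C => //; exists s => // y z yb zb.
rewrite distrC; have -> : r * r - sqdist z - (r * r - sqdist y) = sqdist y - sqdist z by ring.
exact: H.
Qed.

Lemma bump_ge0 v : 0 <= bump v. Proof. exact: sqpos_ge0. Qed.

Lemma bump_center : 0 < r -> 0 < bump a.
Proof.
move=> r0; rewrite sqpos_gt0 /sqdist big1 ?subr0 ?mulr_gt0// => i _.
by rewrite subrr mul0r.
Qed.

Lemma bump_supp v : 0 < r -> bump v != 0 -> `|v - a| <= r.
Proof.
move=> r0 b0; have : 0 < bump v by rewrite lt_neqAle eq_sym b0 bump_ge0.
rewrite sqpos_gt0 subr_gt0 => h.
apply: rv_norm_le; first exact: ltW.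
move=> i; rewrite !mxE.
have : (v 0 i - a 0 i) * (v 0 i - a 0 i) <= sqdist v.
  rewrite /sqdist (bigD1 i)//= lerDl; apply: sumr_ge0 => j _.
  by rewrite -expr2 sqr_ge0.
move=> h2; have h3 := le_lt_trans h2 h.
rewrite leNgt; apply/negP => h4.
have : r * r < `|v 0 i - a 0 i| * `|v 0 i - a 0 i| by rewrite ltr_pM// ltW.
by rewrite -normrM ger0_norm -?expr2 ?sqr_ge0// expr2 => /(lt_trans h3); rewrite ltxx.
Qed.

End bump.
End bump_function.

(** * Charts, and bump functions on a Lie group *)

Section chart_facts.
Context {R : realType} {n : nat} {T : topologicalType} (c : chart R n T).

Lemma chart_invP v : (c @` chart_dom c) v ->
  chart_dom c (chart_inv c v) /\ c (chart_inv c v) = v.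
Proof. by move=> [x xd <-]; rewrite chart_mapK. Qed.

Lemma chart_dom_nbhs x : chart_dom c x -> nbhs x (chart_dom c).
Proof. by move=> xd; apply: open_nbhs_nbhs; split=> //; exact: chart_dom_open. Qed.

Lemma chart_img_nbhs x : chart_dom c x -> nbhs (c x) (c @` chart_dom c).
Proof.
by move=> xd; apply: open_nbhs_nbhs; split; [exact: chart_img_open|exists x].
Qed.

Lemma chart_inv_cvg x : chart_dom c x -> chart_inv c @ (c x) --> x.
Proof.
move=> xd; rewrite -[X in _ --> X](chart_mapK xd).
by apply: chart_inv_continuous; exists x.
Qed.

End chart_facts.

Lemma chart_overlap_open {R : realType} {n : nat} {T : topologicalType}
    (c c' : chart R n T) : open (c @` (chart_dom c `&` chart_dom c')).
Proof.
rewrite openE => v [x [xd xd'] <-]; rewrite /interior.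
have h1 := chart_img_nbhs xd.
have h2 : nbhs (c x) (chart_inv c @^-1` chart_dom c').
  by apply: (chart_inv_cvg xd); exact: chart_dom_nbhs.
apply: filterS (filterI h1 h2) => w [wi wd].
have [e1 e2] := chart_invP wi.
by exists (chart_inv c w).
Qed.

Lemma near_pair_left {A B : topologicalType} (a : A) (b : B) (P : A * B -> Prop) :
  (\forall z \near (a, b), P z) -> \forall v \near a, P (v, b).
Proof.
move=> [[U V] /= [Ua Vb] UV]; apply: filterS Ua => v Uv.
by apply: UV; split => //=; exact: nbhs_singleton Vb.
Qed.

Lemma near_pair_right {A B : topologicalType} (a : A) (b : B) (P : A * B -> Prop) :
  (\forall z \near (a, b), P z) -> \forall z \near (a, b), P (a, z.2).
Proof.
move=> [[U V] /= [Ua Vb] UV]; exists (U, V) => // z [_ Vz].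
by apply: UV; split => //=; exact: nbhs_singleton Ua.
Qed.

Section group_bump.
Context {R : realType} {m : nat} {G : lieGroupType R m}.
Let c : chart R m G := chart_at (1%g : G).
Let v0 := c 1%g.

Lemma chart1_dom : chart_dom c 1%g. Proof. exact: chart_at_dom. Qed.

Lemma chart1_inv : chart_inv c v0 = 1%g.
Proof. by rewrite /v0 chart_mapK//; exact: chart1_dom. Qed.

Lemma mulg_chart_cvg (g0 : G) :
  (fun z : 'rV[R]_m * G => (chart_inv c z.1 * z.2)%g) @ (v0, g0) --> g0.
Proof.
rewrite -[X in _ --> X]mul1g.
have H : (fun z : 'rV[R]_m * G => (chart_inv c z.1, z.2)) @ (v0, g0) --> (1%g, g0).
  apply: cvg_pair => /=.
    by apply: (cvg_comp _ _ cvg_fst); apply: chart_inv_cvg; exact: chart1_dom.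
  exact: cvg_snd.
exact: (cvg_comp _ _ H (@mulg_continuous R m G (1%g, g0))).
Qed.

(** A bump in the chart at the identity, extended by zero. The last clause
    concerns its translates: for [g0] in the domain of the chart they are read
    in charts, where the group law is of class C^1, hence locally Lipschitz
    jointly in both variables; for [g0] outside of it the support, compact and
    therefore closed, is avoided. The Lipschitz bound holds on a neighbourhood
    of [(v0, g0)], so that compactness of [G] can make it uniform in [g0]. *)
Lemma group_bump_ex (N : set G) : nbhs (1%g : G) N ->
  exists f : G -> R, [/\ continuous f, forall g, 0 <= f g, 0 < f 1%g,
    forall g, f g != 0 -> N g &
    forall g0, differentiable (fun v => f (chart_inv c v * g0)%g) v0 /\
      exists2 C : R, 0 <= C & \forall z \near (v0, g0),
        `|f (chart_inv c z.1 * z.2)%g - f z.2| <= C * `|z.1 - v0| ].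
Proof.
move=> N1.
have nb : nbhs v0 ((c @` chart_dom c) `&` (chart_inv c @^-1` N)).
  apply: filterI; first by apply: chart_img_nbhs; exact: chart1_dom.
  by apply: (chart_inv_cvg chart1_dom).
have [r0 /= r00 Hr0] := (nbhs_ballP _ _).1 nb.
pose r := r0 / 2; have r_gt0 : 0 < r by rewrite divr_gt0.
have Hr v : `|v - v0| <= r -> (c @` chart_dom c) v /\ N (chart_inv c v).
  move=> h; apply: Hr0; rewrite -ball_normE /ball_ /= distrC (le_lt_trans h)//.
  by rewrite /r ltr_pdivrMr// mulr_natr mulr2n ltrDl.
pose b := bump v0 r.
pose f (g : G) : R := if `[< chart_dom c g >] then b (c g) else 0.
have fin g : chart_dom c g -> f g = b (c g) by move=> gd; rewrite /f asboolT.
have fsupp g : f g != 0 -> chart_dom c g /\ `|c g - v0| <= r.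
  rewrite /f; case: asboolP => [gd bn|]; last by rewrite eqxx.
  by split => //; apply: bump_supp.
(* The closed set [K] contains the support, so [f] vanishes near every point
   outside of the domain of the chart. *)
pose K := chart_inv c @` [set v | `|v - v0| <= r].
have Kcl : closed K.
  apply: compact_closed; first exact: manifold_hausdorff.
  apply: continuous_compact.
    apply: continuous_in_subspaceT => v /set_mem /= /Hr[vi _].
    exact: chart_inv_continuous.
  apply: bounded_closed_compact.
    exists (`|v0| + r); split; first by rewrite num_real.
    move=> M /= hM v /= hv.
    rewrite -[v](subrK v0) (le_trans (ler_normD _ _))// addrC (le_trans _ (ltW hM))//.
    by rewrite lerD2l.
  have -> : [set v | `|v - v0| <= r] = closed_ball v0 r.
    rewrite closed_ballE// /closed_ball_; apply/seteqP; split=> v /=; by rewrite distrC.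
  exact: closed_ball_closed.
have fK g : ~ K g -> f g = 0.
  move=> gK; apply/eqP/negP => /negP/fsupp[gd gr]; apply: gK.
  by exists (c g) => //; rewrite chart_mapK.
have nearK g0 : ~ chart_dom c g0 -> \forall g \near g0, ~ K g.
  move=> gd; apply: open_nbhs_nbhs; split; first exact: closed_openC.
  move=> [v /= /Hr[vi _] e]; apply: gd; rewrite -e.
  by have [] := chart_invP vi.
exists f; split.
- move=> g0; rewrite /continuous_at; have [gd|gd] := pselect (chart_dom c g0).
    apply: (@cvg_trans _ ((b \o c) @ g0)).
      apply: near_eq_cvg; near=> g.
      by rewrite /= fin//; near: g; exact: chart_dom_nbhs.
    rewrite (fin _ gd); apply: continuous_comp; first exact: chart_map_continuous.
    by apply: differentiable_continuous; exact: bump_differentiable.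
  have -> : f g0 = 0 by rewrite fK//; exact: nbhs_singleton (nearK _ gd).
  apply: (@cvg_trans _ ((fun=> 0 : R) @ g0)); last exact: cvg_cst.
  apply: near_eq_cvg; near=> g.
  by rewrite fK//; near: g; exact: nearK.
- by move=> g; rewrite /f; case: ifP => // _; exact: bump_ge0.
- by rewrite fin; [exact: bump_center|exact: chart1_dom].
- by move=> g /fsupp[gd /Hr[_]]; rewrite chart_mapK.
move=> g0; have mc := @mulg_chart_cvg g0.
have [gd|gd] := pselect (chart_dom c g0); last first.
  have H : \forall z \near (v0, g0), f (chart_inv c z.1 * z.2)%g = 0 /\ f z.2 = 0.
    have h1 : \forall z \near (v0, g0), ~ K (chart_inv c z.1 * z.2)%g.
      exact: (mc _ (nearK _ gd)).
    have h2 : \forall z \near (v0, g0), ~ K z.2.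
      exact: (cvg_snd (nearK _ gd)).
    by apply: filterS (filterI h1 h2) => z [z1 z2]; split; exact: fK.
  split; last first.
    exists 0 => //; apply: filterS H => z [-> ->].
    by rewrite subrr normr0 mul0r.
  have [] // := @near_eq_differentiable R _ _ (cst 0 : _ -> R) (fun v => f (chart_inv c v * g0)%g) v0.
  by apply: filterS (near_pair_left H) => v [].
have [U [oU Uz sU]] := @mulg_smooth R m G 1%g g0.
rewrite mul1g in sU.
(* Inside the domain, [f] at a product is [b \o tau \o M] in the charts at
   [1] and [g0], where [M] is the group law and [tau] the change of charts. *)
pose c0 : chart R m G := chart_at g0.
have g0d : chart_dom c0 g0 by exact: chart_at_dom.
pose w0 := c0 g0.
pose M (z : 'rV[R]_m * 'rV[R]_m) := c0 (chart_inv c z.1 * chart_inv c0 z.2)%g.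
have M0 : M (v0, w0) = w0 by rewrite /M /= chart1_inv mul1g /w0 chart_mapK.
have C1M : Ck_on 1 U M by exact: sU.
have dM : differentiable M (v0, w0) by exact: C1M.1.
have lM : loc_lip M (v0, w0).
  by apply: (C1_loc_lip _ oU) => //; apply: fin_span_prod; exact: fin_span_rV.
pose V := c0 @` (chart_dom c0 `&` chart_dom c).
have Vw0 : V w0 by exists g0.
pose tau := c \o chart_inv c0.
have C1t : Ck_on 1 V tau by exact: (@chart_at_compat R m G g0 1%g).
have dt : differentiable tau w0 by exact: C1t.1.
have lt : loc_lip tau w0.
  by apply: (C1_loc_lip _ _ Vw0) => //; [exact: fin_span_rV|exact: chart_overlap_open].
pose Phi := b \o (tau \o M).
have dtM : differentiable (tau \o M) (v0, w0) by apply: differentiable_comp; rewrite ?M0.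
have dPhi : differentiable Phi (v0, w0).
  by apply: differentiable_comp => //; exact: bump_differentiable.
have lPhi : loc_lip Phi (v0, w0).
  apply: loc_lip_comp; [exact: differentiable_continuous| |exact: bump_loc_lip].
  by apply: loc_lip_comp; rewrite ?M0//; exact: differentiable_continuous.
have fPhi : \forall z \near (v0, g0), f (chart_inv c z.1 * z.2)%g = Phi (z.1, c0 z.2).
  near=> z.
  have zd : chart_dom c (chart_inv c z.1 * z.2)%g.
    by near: z; exact: (mc _ (chart_dom_nbhs gd)).
  have zd0 : chart_dom c0 (chart_inv c z.1 * z.2)%g.
    by near: z; exact: (mc _ (chart_dom_nbhs g0d)).
  have z2d : chart_dom c0 z.2.
    by near: z; exact: (cvg_snd (chart_dom_nbhs g0d)).
  by rewrite fin// /Phi /tau /M /= (chart_mapK z2d) (chart_mapK zd0).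
split.
  have [] // := @near_eq_differentiable R _ _ (fun v => Phi (v, w0)) (fun v => f (chart_inv c v * g0)%g) v0.
    by apply: filterS (near_pair_left fPhi) => v /= ->.
  have -> : (fun v => Phi (v, w0)) = Phi \o (fun v => (v, w0)) by [].
  by apply: differentiable_comp => //; apply: differentiable_pair.
have [C C0 [s s0 HC]] := lPhi.
exists C => //; near=> z.
have e1 : f (chart_inv c z.1 * z.2)%g = Phi (z.1, c0 z.2) by near: z.
have e2 : f z.2 = Phi (v0, c0 z.2).
  have : f (chart_inv c v0 * z.2)%g = Phi (v0, c0 z.2).
    by near: z; exact: near_pair_right fPhi.
  by rewrite chart1_inv mul1g.
have b1 : ball v0 s z.1.
  by near: z; exact: (cvg_fst (nbhsx_ballx _ _ s0)).
have b2 : ball w0 s (c0 z.2).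
  near: z.
  have : (fun z : 'rV[R]_m * G => c0 z.2) @ (v0, g0) --> w0.
    by apply: (cvg_comp _ _ cvg_snd); exact: chart_map_continuous.
  by move=> /(_ _ (nbhsx_ballx _ _ s0)).
rewrite e1 e2.
have -> : `|z.1 - v0| = `|((z.1, c0 z.2) : 'rV[R]_m * 'rV[R]_m) - (v0, c0 z.2)|.
  have -> : ((z.1, c0 z.2) : 'rV[R]_m * 'rV[R]_m) - (v0, c0 z.2) = (z.1 - v0, 0).
    by apply/pair_equal_spec; split => //=; rewrite subrr.
  by rewrite prod_normE /= normr0; apply/esym/max_idPl.
by apply: HC; split => //=; exact: ballxx.
Unshelve. all: by end_near. Qed.

End group_bump.

(** * Measure-preserving maps, Borel measurability and the Haar measure *)

Section measure_preserving.
Context d (T : measurableType d) {R : realType}.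
Variables (mu : {measure set T -> \bar R}) (h : T -> T).
Hypothesis mh : measurable_fun setT h.
Hypothesis muh : forall A, measurable A -> mu (h @^-1` A) = mu A.

Lemma ge0_integral_mp (f : T -> \bar R) : measurable_fun setT f ->
  (forall x, 0 <= f x)%E -> (\int[mu]_x f (h x) = \int[mu]_x f x)%E.
Proof.
move=> mf f0.
have H := @ge0_integral_pushforward _ _ _ _ _ h mh mu setT f measurableT mf (fun y _ => f0 y).
rewrite preimage_setT in H.
rewrite -[LHS]H.
by apply: eq_measure_integral => A mA _; exact: muh.
Qed.

Lemma integral_mp (f : T -> \bar R) : measurable_fun setT f ->
  (\int[mu]_x f (h x) = \int[mu]_x f x)%E.
Proof.
move=> mf; rewrite [LHS]integralE [RHS]integralE.
have mp := measurable_funepos mf; have mn := measurable_funeneg mf.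
congr (_ - _)%E.
  transitivity (\int[mu]_x (f^\+)%E (h x))%E; first by apply: eq_integral => x _; rewrite unlock.
  by apply: (ge0_integral_mp mp) => x; exact: funepos_ge0.
transitivity (\int[mu]_x (f^\-)%E (h x))%E; first by apply: eq_integral => x _; rewrite unlock.
by apply: (ge0_integral_mp mn) => x; exact: funeneg_ge0.
Qed.

Lemma Rintegral_mp (f : T -> R) : measurable_fun setT f ->
  \int[mu]_x f (h x) = \int[mu]_x f x.
Proof.
move=> mf; rewrite /Rintegral; congr fine.
by rewrite -(@integral_mp (EFin \o f))//; exact/measurable_EFinP.
Qed.

Lemma integrable_mp (f : T -> \bar R) :
  mu.-integrable setT f -> mu.-integrable setT (f \o h).
Proof.
move=> /integrableP[mf fi]; apply/integrableP; split.
  exact: measurableT_comp.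
have ma : measurable_fun setT (fun x => `|f x|%E) by exact: measurableT_comp.
by rewrite [X in (X < _)%E](integral_mp ma).
Qed.

Lemma ae_mp (P : T -> Prop) : {ae mu, forall x, P x} -> {ae mu, forall x, P (h x)}.
Proof.
move=> [N [mN N0 NP]]; exists (h @^-1` N); split.
- by rewrite -[_ @^-1` _]setTI; exact: mh.
- by rewrite muh.
- by move=> x Px; apply: NP.
Qed.

End measure_preserving.

Lemma countable_bigcup_measurable d (T : measurableType d) (J : choiceType)
    (I : set J) (F : J -> set T) : countable I ->
  (forall i, I i -> measurable (F i)) -> measurable (\bigcup_(i in I) F i).
Proof.
move=> /countable_injP[e einj] mF.
have -> : \bigcup_(i in I) F i =
    \bigcup_n (\bigcup_(i in I `&` (e @^-1` [set n])) F i).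
  apply/seteqP; split=> x; first by move=> [i Ii Fx]; exists (e i) => //; exists i.
  by move=> [n _ [i [Ii _] Fx]]; exists i.
apply: bigcupT_measurable => n.
have [[i0 [Ii0 ei0]]|H] := pselect (exists i, I i /\ e i = n); last first.
  rewrite bigcup0 ?measurable0// => i [Ii ei].
  by exfalso; apply: H; exists i.
rewrite (_ : \bigcup_(i in _) _ = F i0); first exact: mF.
apply/seteqP; split=> x; last by move=> Fx; exists i0.
move=> [i [Ii ei] Fx]; rewrite (_ : i0 = i)//.
by apply: einj; rewrite ?inE//= ei0 ei.
Qed.

Section borel_measurability.

Lemma open_borel (T : ptopologicalType) (U : set T) : open U ->
  measurable (U : set (borel T)).
Proof. by move=> oU; exact: sub_sigma_algebra. Qed.

Lemma borel_measurable_fun d (A : measurableType d) (T : ptopologicalType)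
    (f : A -> borel T) :
  (forall U : set T, open U -> measurable (f @^-1` U)) -> measurable_fun setT f.
Proof.
move=> H; apply: (@measurability _ _ _ _ setT f (@open T) erefl).
by move=> _ [U oU <-]; rewrite setTI; exact: H.
Qed.

Lemma borel_measurable_funR d (A : measurableType d) {R : realType} (f : A -> R) :
  (forall U : set R, open U -> measurable (f @^-1` U)) -> measurable_fun setT f.
Proof.
move=> H; apply: (measurability _ (RGenOpens.measurableE R)).
by move=> _ [_ [a [b ->] <-]]; rewrite setTI; apply: H; exact: interval_open.
Qed.

Lemma continuous_borel (T T' : ptopologicalType) (f : T -> T') : continuous f ->
  measurable_fun setT (f : borel T -> borel T').
Proof.
move=> /continuousP cf; apply: borel_measurable_fun => U oU.
by apply: open_borel; exact: cf.
Qed.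

Lemma continuous_borelR {R : realType} (T : ptopologicalType) (f : T -> R) :
  continuous f -> measurable_fun setT (f : borel T -> R).
Proof.
move=> /continuousP cf; apply: borel_measurable_funR => U oU.
by apply: open_borel; exact: cf.
Qed.

(** An open set is the union, over the countably many basic open sets [V] of
    the second factor, of the rectangles over [V] with the largest possible
    open base. *)
Lemma open_prod_measurable d1 d2 (A : measurableType d1) (B : measurableType d2)
    (S T : topologicalType) (s : A -> S) (t : B -> T) :
  @second_countable T ->
  (forall U, open U -> measurable (s @^-1` U)) ->
  (forall U, open U -> measurable (t @^-1` U)) ->
  forall W : set (S * T), open W ->
    measurable ((fun z : A * B => (s z.1, t z.2)) @^-1` W).
Proof.
move=> [BT cBT [bTo bT]] ms mt W oW.
pose base V : set S := \bigcup_(U in [set U | open U /\ U `*` V `<=` W]) U.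
have -> : (fun z : A * B => (s z.1, t z.2)) @^-1` W =
    \bigcup_(V in BT) ((s @^-1` base V) `*` (t @^-1` V)).
  apply/seteqP; split=> [[a b] /= Wab|[a b] [V BV [/= [U [_ sub] Ua] Vb]]]; last first.
    exact: sub.
  have [[U V] /= [Us Vt] UVW] : nbhs (s a, t b) W by exact: open_nbhs_nbhs.
  have [V' [BV V'b] V'V] := bT _ _ Vt.
  exists V' => //; split => //=.
  exists (interior U); last by [].
  split; first exact: open_interior.
  by move=> [x y] [/= /interior_subset ? /V'V ?]; exact: UVW.
apply: countable_bigcup_measurable => // V BV.
apply: measurableX; last exact/mt/bTo.
by apply: ms; apply: bigcup_open => U [].
Qed.

End borel_measurability.

Section haar.
Context {R : realType} {m : nat} {G : lieGroupType R m}.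
Variables (muG : probability (borel G) R).
Hypothesis haarG : haar_probability muG.

Lemma measurable_mulg : measurable_fun setT
  (fun z : borel G * borel G => (z.1 * z.2)%g : borel G).
Proof.
apply: borel_measurable_fun => U oU.
have := @open_prod_measurable _ _ (borel G) (borel G) G G id id
  (@manifold_second_countable R m G)
  (fun U oU => open_borel oU) (fun U oU => open_borel oU)
  ((fun z : G * G => (z.1 * z.2)%g) @^-1` U).
apply.
by move: (@mulg_continuous R m G) => /continuousP; exact.
Qed.

Lemma measurable_mulgl (h : G) : measurable_fun setT
  (fun g : borel G => (h * g)%g : borel G).
Proof.
apply: continuous_borel => g.
have H : (fun g : G => (h, g)) @ g --> (h, g) by apply: cvg_pair; [exact: cvg_cst|exact: cvg_id].
exact: (cvg_comp _ _ H (@mulg_continuous R m G (h, g))).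
Qed.

Lemma measurable_mulgr (h : G) : measurable_fun setT
  (fun g : borel G => (g * h)%g : borel G).
Proof.
apply: continuous_borel => g.
have H : (fun g : G => (g, h)) @ g --> (g, h) by apply: cvg_pair; [exact: cvg_id|exact: cvg_cst].
exact: (cvg_comp _ _ H (@mulg_continuous R m G (g, h))).
Qed.

Lemma measurable_invg : measurable_fun setT (fun g : borel G => (g^-1)%g : borel G).
Proof. apply: continuous_borel; exact: invg_continuous. Qed.

(** Integrate the indicator of [A] at [g^-1 * k] over all [(g, k)]:
    integration in [k] first gives the measure of [A], by left invariance, and
    integration in [g] first gives the measure of its inverse. *)
Lemma haar_inv (A : set (borel G)) : measurable A ->
  muG ((fun g : G => (g^-1)%g) @^-1` A) = muG A.
Proof.
move=> mA.
pose h (z : borel G * borel G) : borel G := ((z.1)^-1 * z.2)%g.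
have mh : measurable_fun setT h.
  have h1 : measurable_fun setT (fun z : borel G * borel G => ((z.1)^-1%g : borel G, z.2)).
    apply/measurable_fun_pair => /=.
      by apply: measurableT_comp; [exact: measurable_invg|exact: measurable_fst].
    exact: measurable_snd.
  exact: (measurableT_comp measurable_mulg h1).
have mS : measurable (h @^-1` A) by rewrite -[_ @^-1` _]setTI; exact: mh.
pose f (z : borel G * borel G) : \bar R := (\1_(h @^-1` A) z)%:E.
have mf : measurable_fun setT f by apply/measurable_EFinP; exact: measurable_indic.
have f0 z : (0 <= f z)%E by rewrite lee_fin.
have mA' : measurable ((fun g : G => (g^-1)%g) @^-1` A : set (borel G)).
  by rewrite -[X in measurable X]setTI; exact: measurable_invg.
have ms1 (g : borel G) : measurable ((fun k => (g^-1 * k)%g) @^-1` A : set (borel G)).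
  by rewrite -[X in measurable X]setTI; exact: measurable_mulgl.
have ms2 (k : borel G) : measurable ((fun g => (g^-1 * k)%g) @^-1` A : set (borel G)).
  have -> : ((fun g => (g^-1 * k)%g) @^-1` A : set (borel G)) =
    (fun g => (k^-1 * g)%g) @^-1` ((fun g : G => (g^-1)%g) @^-1` A).
    by apply/seteqP; split => g /=; rewrite invgM invgK.
  by rewrite -[X in measurable X]setTI; exact: measurable_mulgl.
have L g : (\int[muG]_k f (g, k) = muG A)%E.
  rewrite -(@haarG (g^-1)%g A mA).
  have := integral_indic muG measurableT (ms1 g).
  by rewrite setIT.
have L' k : (\int[muG]_g f (g, k) = muG ((fun g : G => (g^-1)%g) @^-1` A))%E.
  rewrite -(@haarG (k^-1)%g _ mA').
  have := integral_indic muG measurableT (ms2 k).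
  rewrite setIT => ->; congr (muG _).
  by apply/seteqP; split => g /=; rewrite invgM invgK.
have := @fubini_tonelli _ _ _ _ _ muG muG f mf f0.
under eq_integral do rewrite L.
under [in RHS]eq_integral do rewrite L'.
by rewrite !integral_cst//= !probability_setT !mule1.
Qed.

(** Inversion exchanges left and right translations. *)
Lemma haar_right (h : G) (A : set (borel G)) : measurable A ->
  muG ((fun g : G => (g * h)%g) @^-1` A) = muG A.
Proof.
move=> mA.
have mA' : measurable ((fun g : G => (g^-1)%g) @^-1` A : set (borel G)).
  by rewrite -[X in measurable X]setTI; exact: measurable_invg.
rewrite -[RHS]haar_inv// -[RHS](haarG (h^-1)%g)//.
rewrite -[RHS]haar_inv; last first.
  by rewrite -[X in measurable X]setTI; exact: measurable_mulgl.
congr (muG _); apply/seteqP; split => g /=; by rewrite invgM !invgK.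
Qed.
End haar.

(** * Complex-valued measurable and integrable functions *)

Section complex_parts.
Context {R : realType}.
Local Notation C := R[i].
Local Notation Re := complex.Re.
Local Notation Im := complex.Im.

Lemma ReD (a b : C) : Re (a + b) = Re a + Re b. Proof. by case: a; case: b. Qed.
Lemma ImD (a b : C) : Im (a + b) = Im a + Im b. Proof. by case: a; case: b. Qed.
Lemma ReN (a : C) : Re (- a) = - Re a. Proof. by case: a. Qed.
Lemma ImN (a : C) : Im (- a) = - Im a. Proof. by case: a. Qed.
Lemma ReB (a b : C) : Re (a - b) = Re a - Re b. Proof. by rewrite ReD ReN. Qed.
Lemma ImB (a b : C) : Im (a - b) = Im a - Im b. Proof. by rewrite ImD ImN. Qed.
Lemma ReM (a b : C) : Re (a * b) = Re a * Re b - Im a * Im b.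
Proof. by case: a; case: b. Qed.
Lemma ImM (a b : C) : Im (a * b) = Re a * Im b + Im a * Re b.
Proof. by case: a => a1 a2; case: b => b1 b2 /=; ring. Qed.
Lemma ReJ (a : C) : Re a^* = Re a. Proof. by case: a. Qed.
Lemma ImJ (a : C) : Im a^* = - Im a. Proof. by case: a. Qed.
Lemma Re_sum I (r : seq I) (P : pred I) (F : I -> C) :
  Re (\sum_(i <- r | P i) F i) = \sum_(i <- r | P i) Re (F i).
Proof. exact: (big_morph (@complex.Re R) (@ReD) erefl). Qed.
Lemma Im_sum I (r : seq I) (P : pred I) (F : I -> C) :
  Im (\sum_(i <- r | P i) F i) = \sum_(i <- r | P i) Im (F i).
Proof. exact: (big_morph (@complex.Im R) (@ImD) erefl). Qed.
Lemma complexRI (a b : C) : Re a = Re b -> Im a = Im b -> a = b.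
Proof. by case: a; case: b => ? ? ? ? /= -> ->. Qed.

(** The squared modulus, free of square roots so that polynomial arithmetic
    applies to it. *)
Definition sqn (a : C) : R := Re a ^+ 2 + Im a ^+ 2.

Lemma sqn_ge0 a : 0 <= sqn a. Proof. by rewrite addr_ge0 ?sqr_ge0. Qed.
Lemma normcE (a : C) : Normc.normc a = Num.sqrt (sqn a). Proof. by case: a. Qed.
Lemma sqnE (a : C) : Normc.normc a ^+ 2 = sqn a.
Proof. by rewrite normcE sqr_sqrtr// sqn_ge0. Qed.
Lemma normc_ge0 (a : C) : 0 <= Normc.normc a. Proof. by rewrite normcE sqrtr_ge0. Qed.
Lemma sqn0 : sqn 0 = 0. Proof. by rewrite /sqn /= expr0n addr0. Qed.
Lemma sqnM (a b : C) : sqn (a * b) = sqn a * sqn b.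
Proof. by rewrite /sqn ReM ImM; ring. Qed.
Lemma sqnN a : sqn (- a) = sqn a. Proof. by rewrite /sqn ReN ImN !sqrrN. Qed.
Lemma sqnJ a : sqn a^* = sqn a. Proof. by rewrite /sqn ReJ ImJ sqrrN. Qed.
Lemma sqn_eq0 a : sqn a = 0 -> a = 0.
Proof.
move=> h; have := sqr_ge0 (Re a); have := sqr_ge0 (Im a); move: h; rewrite /sqn => h h1 h2.
apply: complexRI => /=; apply/eqP; rewrite -sqrf_eq0; apply/eqP; lra.
Qed.
Lemma sqnD (a b : C) : sqn (a + b) <= (sqn a + sqn b) *+ 2.
Proof.
rewrite /sqn ReD ImD; have := sqr_ge0 (Re a - Re b); have := sqr_ge0 (Im a - Im b); nra.
Qed.
Lemma Re_le_normc (a : C) : `|Re a| <= Normc.normc a.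
Proof. by rewrite normcE -sqrtr_sqr ler_wsqrtr// lerDl sqr_ge0. Qed.
Lemma Im_le_normc (a : C) : `|Im a| <= Normc.normc a.
Proof. by rewrite normcE -sqrtr_sqr ler_wsqrtr// lerDr sqr_ge0. Qed.
Lemma normcN (a : C) : Normc.normc (- a) = Normc.normc a.
Proof. by rewrite !normcE sqnN. Qed.
Lemma normcRC (a : R) : Normc.normc (a%:C)%C = `|a|.
Proof. by rewrite normcE /sqn /= expr0n addr0 sqrtr_sqr. Qed.
Lemma normcD (a b : C) : Normc.normc (a + b) <= Normc.normc a + Normc.normc b.
Proof. by have := ler_normD a b; rewrite /Num.norm /= -rmorphD lecR. Qed.
Lemma normc_le (a : C) : Normc.normc a <= `|Re a| + `|Im a|.
Proof.
rewrite normcE -(ger0_norm (addr_ge0 (normr_ge0 (Re a)) (normr_ge0 (Im a)))) -sqrtr_sqr.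
rewrite ler_wsqrtr// /sqn sqrrD !real_normK ?num_real//.
have : 0 <= `|Re a| * `|Im a| *+ 2 by rewrite mulrn_wge0// mulr_ge0.
lra.
Qed.
Lemma mulJ_sqn (a : C) : a^* * a = (sqn a)%:C%C.
Proof. by apply: complexRI; rewrite ?ReM ?ImM ReJ ImJ /sqn /=; ring. Qed.
End complex_parts.

Section cmeas.
Context d (T : measurableType d) {R : realType}.
Local Notation C := R[i].
Local Notation Re := complex.Re.
Local Notation Im := complex.Im.
Implicit Types f g : T -> C.

Lemma cmeasurable_cst (a : C) : cmeasurable (fun _ : T => a).
Proof. by split; exact: measurable_cst. Qed.

Lemma cmeasurableD f g : cmeasurable f -> cmeasurable g -> cmeasurable (fun x => f x + g x).
Proof.
move=> [f1 f2] [g1 g2]; split.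
  by under eq_fun do rewrite ReD; exact: measurable_funD.
by under eq_fun do rewrite ImD; exact: measurable_funD.
Qed.

Lemma cmeasurableN f : cmeasurable f -> cmeasurable (fun x => - f x).
Proof.
move=> [f1 f2]; split.
  by under eq_fun do rewrite ReN; exact: measurableT_comp.
by under eq_fun do rewrite ImN; exact: measurableT_comp.
Qed.

Lemma cmeasurableB f g : cmeasurable f -> cmeasurable g -> cmeasurable (fun x => f x - g x).
Proof. by move=> mf mg; apply: cmeasurableD => //; exact: cmeasurableN. Qed.

Lemma cmeasurableJ f : cmeasurable f -> cmeasurable (fun x => (f x)^*).
Proof.
move=> [f1 f2]; split.
  by under eq_fun do rewrite ReJ.
by under eq_fun do rewrite ImJ; exact: measurableT_comp.
Qed.

Lemma cmeasurableM f g : cmeasurable f -> cmeasurable g -> cmeasurable (fun x => f x * g x).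
Proof.
move=> [f1 f2] [g1 g2]; split.
  by under eq_fun do rewrite ReM; apply: measurable_funB; exact: measurable_funM.
by under eq_fun do rewrite ImM; apply: measurable_funD; exact: measurable_funM.
Qed.

Lemma cmeasurable_sum (I : Type) (s : seq I) (f : I -> T -> C) :
  (forall i, cmeasurable (f i)) -> cmeasurable (fun x => \sum_(i <- s) f i x).
Proof.
move=> mf; elim: s => [|i s IH].
  by under eq_fun do rewrite big_nil; exact: cmeasurable_cst.
by under eq_fun do rewrite big_cons; exact: cmeasurableD.
Qed.

Lemma cmeasurable_sqn f : cmeasurable f -> measurable_fun setT (fun x => sqn (f x)).
Proof. by move=> [f1 f2]; apply: measurable_funD; exact: measurable_funX. Qed.

End cmeas.

Lemma cmeasurable_comp d d' (S : measurableType d) (T : measurableType d') {R : realType}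
  (h : S -> T) (f : T -> R[i]) : measurable_fun setT h -> cmeasurable f ->
  cmeasurable (fun x => f (h x)).
Proof. by move=> mh [f1 f2]; split; [exact: (measurableT_comp f1)|exact: (measurableT_comp f2)]. Qed.

Section cint.
Context d (T : measurableType d) {R : realType} (mu : {measure set T -> \bar R}).
Local Notation C := R[i].
Local Notation Re := complex.Re.
Local Notation Im := complex.Im.
Implicit Types f g : T -> C.

Definition rintegrable (f : T -> R) : Prop := mu.-integrable setT (EFin \o f).

Lemma rintegrableD (f g : T -> R) : rintegrable f -> rintegrable g -> rintegrable (fun x => f x + g x).
Proof. by move=> hf hg; exact: (integrableD measurableT hf hg). Qed.
Lemma rintegrableZ (a : R) (f : T -> R) : rintegrable f -> rintegrable (fun x => a * f x).
Proof. by move=> hf; exact: (integrableZl measurableT a hf). Qed.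
Lemma rintegrableN (f : T -> R) : rintegrable f -> rintegrable (fun x => - f x).
Proof. by move=> hf; exact: (integrableN hf). Qed.
Lemma rintegrableB (f g : T -> R) : rintegrable f -> rintegrable g -> rintegrable (fun x => f x - g x).
Proof. by move=> hf hg; apply: rintegrableD => //; exact: rintegrableN. Qed.
Lemma rintegrable0 : rintegrable (fun=> 0).
Proof. exact: integrable0. Qed.
Lemma rintegrable_sum (I : Type) (s : seq I) (f : I -> T -> R) :
  (forall i, rintegrable (f i)) -> rintegrable (fun x => \sum_(i <- s) f i x).
Proof.
move=> mf; elim: s => [|i s IH].
  by under eq_fun do rewrite big_nil; exact: rintegrable0.
by under eq_fun do rewrite big_cons; exact: rintegrableD.
Qed.
Lemma Rintegral_sum (I : Type) (s : seq I) (f : I -> T -> R) :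
  (forall i, rintegrable (f i)) ->
  \int[mu]_x (\sum_(i <- s) f i x) = \sum_(i <- s) \int[mu]_x f i x.
Proof.
move=> mf; elim: s => [|i s IH].
  rewrite big_nil /Rintegral; under eq_integral do rewrite big_nil.
  by rewrite integral0.
rewrite big_cons -IH -RintegralD//; [|exact: mf|exact: rintegrable_sum].
by apply: eq_Rintegral => x _; rewrite big_cons.
Qed.
Lemma le_rintegrable (f g : T -> R) : measurable_fun setT f ->
  (forall x, `|f x| <= g x) -> rintegrable g -> rintegrable f.
Proof.
move=> mf fg; apply: le_integrable => //; first exact/measurable_EFinP.
by move=> x _ /=; rewrite lee_fin (le_trans (fg x))// ler_norm.
Qed.
Lemma rintegrable_measurable (f : T -> R) : rintegrable f -> measurable_fun setT f.
Proof. by move=> /measurable_int/measurable_EFinP. Qed.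

Definition cintegrable f : Prop :=
  rintegrable (fun x => Re (f x)) /\ rintegrable (fun x => Im (f x)).

Definition cint f : C := ((\int[mu]_x Re (f x)) +i* (\int[mu]_x Im (f x)))%C.

Lemma cintegrableD f g : cintegrable f -> cintegrable g -> cintegrable (fun x => f x + g x).
Proof.
move=> [f1 f2] [g1 g2]; split.
  by under eq_fun do rewrite ReD; exact: rintegrableD.
by under eq_fun do rewrite ImD; exact: rintegrableD.
Qed.

Lemma cintegrableZ a f : cintegrable f -> cintegrable (fun x => a * f x).
Proof.
move=> [f1 f2]; split.
  by under eq_fun do rewrite ReM; apply: rintegrableB; exact: rintegrableZ.
by under eq_fun do rewrite ImM; apply: rintegrableD; exact: rintegrableZ.
Qed.

Lemma cintegrable0 : cintegrable (fun=> 0).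
Proof. by split; exact: rintegrable0. Qed.

Lemma cintegrable_sum (I : Type) (s : seq I) (f : I -> T -> C) :
  (forall i, cintegrable (f i)) -> cintegrable (fun x => \sum_(i <- s) f i x).
Proof.
move=> mf; elim: s => [|i s IH].
  by under eq_fun do rewrite big_nil; exact: cintegrable0.
by under eq_fun do rewrite big_cons; exact: cintegrableD.
Qed.

Lemma cintD f g : cintegrable f -> cintegrable g ->
  cint (fun x => f x + g x) = cint f + cint g.
Proof.
move=> [f1 f2] [g1 g2]; apply: complexRI => /=.
  by rewrite -RintegralD//; apply: eq_Rintegral => x _; rewrite ReD.
by rewrite -RintegralD//; apply: eq_Rintegral => x _; rewrite ImD.
Qed.

Lemma cintZ a f : cintegrable f -> cint (fun x => a * f x) = a * cint f.
Proof.
move=> [f1 f2]; apply: complexRI; rewrite ?ReM ?ImM /=.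
  rewrite -RintegralZl// -RintegralZl// -RintegralB//; [|exact: rintegrableZ|exact: rintegrableZ].
  by apply: eq_Rintegral => x _; rewrite ReM.
rewrite -RintegralZl// -RintegralZl// -RintegralD//; [|exact: rintegrableZ|exact: rintegrableZ].
by apply: eq_Rintegral => x _; rewrite ImM.
Qed.

Lemma cint0 : cint (fun=> 0) = 0.
Proof. by apply: complexRI; rewrite /= /Rintegral integral0. Qed.

Lemma eq_cint f g : f =1 g -> cint f = cint g.
Proof. by move=> fg; congr (_ +i* _)%C; apply: eq_Rintegral => x _; rewrite fg. Qed.

Lemma cint_sum (I : Type) (s : seq I) (f : I -> T -> C) :
  (forall i, cintegrable (f i)) ->
  cint (fun x => \sum_(i <- s) f i x) = \sum_(i <- s) cint (f i).
Proof.
move=> mf; elim: s => [|i s IH].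
  by rewrite big_nil -[RHS]cint0; apply: eq_cint => x; rewrite big_nil.
rewrite big_cons -IH -cintD//; last exact: cintegrable_sum.
by apply: eq_cint => x; rewrite big_cons.
Qed.

End cint.

Section bounded_integrals.
Context d (T : measurableType d) {R : realType} (mu : probability T R).

Lemma bounded_rintegrable (f : T -> R) (M : R) : measurable_fun setT f ->
  (forall x, `|f x| <= M) -> rintegrable mu f.
Proof.
move=> mf fM; apply: (le_rintegrable mf fM).
exact: finite_measure_integrable_cst.
Qed.

Lemma bounded_cvg_Rintegral (k : nat -> T -> R) (M : R) :
  (forall n, measurable_fun setT (k n)) -> (forall n x, `|k n x| <= M) ->
  (forall x, k n x @[n --> \oo] --> 0) -> \int[mu]_x k n x @[n --> \oo] --> 0.
Proof.
move=> mk kM k0.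
have h1 : forall n, measurable_fun setT (fun x => (k n x)%:E).
  by move=> n; exact/measurable_EFinP.
have h2 : {ae mu, forall x, setT x -> (k n x)%:E @[n --> \oo] --> 0%E}.
  by apply: aeW => x _; apply: cvg_EFin; [exact: nearW|exact: k0].
have h3 : mu.-integrable setT (fun=> M%:E) by exact: finite_measure_integrable_cst.
have h4 : {ae mu, forall x n, setT x -> (`|(k n x)%:E| <= M%:E)%E}.
  by apply: aeW => x n _; rewrite lee_fin.
have [_ _ H] := dominated_convergence measurableT h1 (measurable_cst 0%E) h2 h3 h4.
have -> : 0 = fine (\int[mu]_x 0%E) by rewrite integral0.
apply: fine_cvg; rewrite fineK; last by rewrite integral0.
exact: H.
Qed.

End bounded_integrals.

(** * Differentiation under the Haar integral *)

Section haar_positivity.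
Context {R : realType} {m : nat} {G : lieGroupType R m}.
Variables (muG : probability (borel G) R).
Hypothesis haarG : haar_probability muG.
Hypothesis cG : compact [set: G].

Lemma continuous_mulgl (h : G) : continuous (fun g : G => (h * g)%g).
Proof.
move=> g.
have H : (fun g : G => (h, g)) @ g --> (h, g) by apply: cvg_pair; [exact: cvg_cst|exact: cvg_id].
exact: (cvg_comp _ _ H (@mulg_continuous R m G (h, g))).
Qed.

(** Finitely many translates of [U] cover the compact group; if one were null,
    the whole group would be. *)
Lemma haar_open_gt0 (U : set G) : open U -> U 1%g ->
  (0 < muG (U : set (borel G)))%E.
Proof.
move=> oU U1; rewrite lt0e measure_ge0 andbT; apply/negP => /eqP U0.
pose F (g : G) : set G := (fun x => (g^-1 * x)%g) @^-1` U.
have oF g : open (F g) by apply: open_comp => // x _; exact: continuous_mulgl.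
have nF g : muG.-negligible (F g : set (borel G)).
  apply/negligibleP; first exact: open_borel.
  exact: (etrans (haarG (g^-1)%g (open_borel oU)) U0).
have [D _ cov] : finite_subset_cover [set: G] F [set: G].
  move: cG; rewrite compact_cover; apply => // x _; exists x => //.
  by rewrite /F /= mulVg.
have nD : muG.-negligible ([set: G] : set (borel G)).
  apply: (@negligibleS _ _ _ muG _ _ cov); rewrite /cover bigcup_fset.
  elim: (finmap.enum_fset D) => [|g s IH]; first by rewrite big_nil; exact: negligible_set0.
  by rewrite big_cons; exact: negligibleU.
have h := (negligibleP _ measurableT).1 nD.
by have := @probability_setT _ _ _ muG; rewrite h => /esym/eqP; rewrite onee_eq0.
Qed.

End haar_positivity.

Lemma shift_cvg {R : realType} (V : normedModType R) (x : V) :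
  (fun h => h + x) @ (0 : V) --> x.
Proof. by rewrite -[X in _ --> X]add0r; apply: cvgD; [exact: cvg_id|exact: cvg_cst]. Qed.

Lemma compact_bounded_fun {R : realType} (T : ptopologicalType) (f : T -> R) :
  compact [set: T] -> continuous f -> exists M, forall x, `|f x| <= M.
Proof.
move=> cT cf.
have /compact_bounded[M [Mr HM]] : compact (f @` [set: T]).
  by apply: continuous_compact => //; exact: continuous_subspaceT.
by exists (M + 1) => x; apply: (HM (M + 1)); [rewrite ltrDl|exists x].
Qed.

Lemma differentiable_near {R : realType} (V W : normedModType R) (f : V -> W) x (e : R) :
  differentiable f x -> 0 < e ->
  \forall h \near (0 : V), `|f (h + x) - f x - 'd f x h| <= e * `|h|.
Proof.
move=> df e0; have /eqaddoP/(_ e e0) H := diff_locally df.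
near=> h.
have : `|(f \o shift x - (cst (f x) + 'd f x)) h| <= e * `|h| by near: h.
by rewrite /= /cst !fctE opprD addrA.
Unshelve. all: by end_near. Qed.

Section translate_differentiable.
Context {R : realType} {m : nat} {G : lieGroupType R m}.
Variables (muG : probability (borel G) R).
Hypothesis cG : compact [set: G].
Let c : chart R m G := chart_at (1%g : G).
Let v0 := c 1%g.
Variables (f rho : G -> R).
Hypothesis fc : continuous f.
Hypothesis fd : forall g0 : G, differentiable (fun v => f (chart_inv c v * g0)%g) v0.
Hypothesis fl : forall g0 : G, exists2 C : R, 0 <= C & \forall z \near (v0, g0),
        `|f (chart_inv c z.1 * z.2)%g - f z.2| <= C * `|z.1 - v0|.
Hypothesis mrho : measurable_fun setT (rho : borel G -> R).
Hypothesis rho1 : forall g, `|rho g| <= 1.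

(** The Lipschitz constant and the neighbourhood of [v0] depend on [g0]; by
    compactness finitely many of them suffice. *)
Lemma uniform_lip : exists2 C : R, 0 <= C & \forall v \near v0, forall g,
  `|f (chart_inv c v * g)%g - f g| <= C * `|v - v0|.
Proof.
have H : \forall vC \near (nbhs v0, +oo%R : set_system R), [set: G] `<=` [set g |
    `|f (chart_inv c vC.1 * g)%g - f g| <= vC.2 * `|vC.1 - v0|].
  have := (compact_near_coveringP _).1 cG ('rV[R]_m * R)%type
    (filter_prod (nbhs v0) +oo%R) (fun vC g => `|f (chart_inv c vC.1 * g)%g - f g| <= vC.2 * `|vC.1 - v0|) _.
  apply => g0 _.
  have [C C0 [[U V] /= [Uv Vg] UV]] := fl g0.
  exists (V, [set vC : 'rV[R]_m * R | U vC.1 /\ C <= vC.2]) => /=.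
    split => //; exists (U, [set D | C <= D]) => //=; split => //.
    exact: (nbhs_pinfty_ge (num_real C)).
  move=> [g [v D]] /= [Vg' [Uv' CD]].
  apply: (le_trans (UV (v, g) _)) => //=.
  by rewrite ler_wpM2r.
move: H => [[A B] /= [Av [M [Mr MB]]] AB].
exists (Num.max M 0 + 1); first by rewrite addr_ge0// le_max lexx orbT.
apply: filterS Av => v vA g; apply: (AB (v, _)) => //; split => //=.
by apply: MB; rewrite ltr_pwDr// le_max lexx.
Qed.

Let Df (g : G) : {linear 'rV[R]_m -> R} := 'd (fun v => f (chart_inv c v * g)%g) v0.

Let seqn (n : nat) : R := n.+1%:R^-1.

Lemma seqn_gt0 n : 0 < seqn n. Proof. by rewrite invr_gt0. Qed.

Lemma seqn_cvg : seqn n @[n --> \oo] --> 0.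
Proof. exact: cvg_harmonic. Qed.

Lemma Df_cvg g u :
  (seqn n)^-1 * (f (chart_inv c (seqn n *: u + v0) * g)%g - f g) @[n --> \oo]
    --> Df g u.
Proof.
have := deriveE u (fd g); rewrite /Df => <-.
have dv : derivable (fun v => f (chart_inv c v * g)%g) v0 u by exact: diff_derivable.
have H : (fun h => h^-1 *: (((fun v => f (chart_inv c v * g)%g) \o shift v0) (h *: u)
   - f (chart_inv c v0 * g)%g)) @ (0 : R)^' --> 'D_u (fun v => f (chart_inv c v * g)%g) v0.
  exact: dv.
have H2 : seqn n @[n --> \oo] --> (0 : R)^'.
  move=> A A0; have A0' : \forall x \near (0 : R), x != 0 -> A x by exact: A0.
  have [N _ HN] := seqn_cvg A0'; exists N => // n Nn.
  by apply: (HN n Nn); rewrite gt_eqF//; exact: seqn_gt0.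
have := cvg_comp _ _ H2 H.
by rewrite /= chart1_inv mul1g.
Qed.

Lemma Df_measurable u : measurable_fun setT (fun g : borel G => Df g u).
Proof.
have H : forall n : nat, measurable_fun setT (fun g : borel G =>
    (seqn n)^-1 * (f (chart_inv c (seqn n *: u + v0) * g)%g - f g)); last first.
  by apply: (measurable_fun_cvg H) => g _; exact: Df_cvg.
move=> n; apply: measurable_funM => //; apply: measurable_funB.
  apply: (measurableT_comp (continuous_borelR fc)).
  exact: measurable_mulgl.
exact: continuous_borelR.
Qed.

Lemma Df_bound : exists2 C : R, 0 <= C & forall g u, `|Df g u| <= C * `|u|.
Proof.
have [C C0 HC] := uniform_lip; exists C => // g u.
have hn : \forall n \near \oo, `|(seqn n)^-1 * (f (chart_inv c (seqn n *: u + v0) * g)%g - f g)|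
    <= C * `|u|.
  have H2 : (fun n => seqn n *: u + v0) @ \oo --> v0.
    rewrite -[X in _ --> X]add0r; apply: cvgD; last exact: cvg_cst.
    by rewrite -(scale0r u); apply: cvgZl; exact: seqn_cvg.
  near=> n.
  have : forall g, `|f (chart_inv c (seqn n *: u + v0) * g)%g - f g| <= C * `|seqn n *: u + v0 - v0|.
    by near: n; exact: (H2 _ HC).
  move=> /(_ g); have := seqn_gt0 n; move: (seqn n) => s s0.
  rewrite addrK normrZ normrM [`|_^-1|]gtr0_norm ?invr_gt0//.
  rewrite (gtr0_norm s0) => h.
  by rewrite ler_pdivrMl// mulrCA.
have hc := cvg_norm (@Df_cvg g u).
exact: (cvgr_to_le (hc _) hn).
Unshelve. all: by end_near. Qed.

(** Were the integral not differentiable, there would be increments [u n]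
    tending to zero along which the remainder exceeds [e * `|u n|]. The
    integrands of the normalised remainders are dominated through the uniform
    Lipschitz bound and tend to zero pointwise, which contradicts bounded
    convergence. *)
Lemma int_translate_differentiable :
  differentiable (fun v => \int[muG]_g (f (chart_inv c v * g)%g * rho g)) v0.
Proof.
pose J i := \int[muG]_g (Df g (delta_mx 0 i) * rho g).
pose L (u : 'rV[R]_m) := \sum_i u 0 i * J i.
have linL : linear L.
  move=> a u v; rewrite /L scaler_sumr -big_split; apply: eq_bigr => i _.
  by rewrite !mxE /= mulrDl scalerAl.
pose Ll : {linear 'rV[R]_m -> R} := HB.pack L (GRing.isLinear.Build _ _ _ _ L linL).
have cL : continuous Ll.
  move=> u; apply: differentiable_continuous.
  have -> : (Ll : _ -> R) = \sum_i (J i *: (fun u : 'rV[R]_m => u 0 i : R)).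
    apply/funext => v; rewrite fct_sumE /Ll /= /L; apply: eq_bigr => i _.
    by rewrite mulrC.
  by apply: differentiable_sum => i; apply: differentiableZ; exact: differentiable_coord.
apply: (differentiable_eps cL _).1 => e e0; apply: contrapT => Hn.
have [C C0 HC] := uniform_lip; have [C' C'0 HC'] := Df_bound.
pose D (h : 'rV[R]_m) g := f (chart_inv c (h + v0) * g)%g - f g - Df g h.
pose I v := \int[muG]_g (f (chart_inv c v * g)%g * rho g).
have near0 : \forall h \near (0 : 'rV[R]_m), forall g, `|D h g| <= (C + C') * `|h|.
  near=> h.
  have H : forall g : G, `|f (chart_inv c (h + v0) * g)%g - f g| <= C * `|h + v0 - v0|.
    by near: h; exact: (shift_cvg HC).
  move=> g.
  rewrite mulrDl (le_trans (ler_normB _ _))// lerD//.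
  by have := H g; rewrite addrK.
have /choice[u Hu] : forall n, exists h : 'rV[R]_m, [/\ `|h| < seqn n,
    forall g, `|D h g| <= (C + C') * `|h| & e * `|h| < `|I (h + v0) - I v0 - Ll h|].
  move=> n; apply: contrapT => Hc; apply: Hn.
  have hs : \forall h \near (0 : 'rV[R]_m), `|h| < seqn n.
    apply/nbhs_ballP; exists (seqn n); first exact: seqn_gt0.
    by move=> k; rewrite -ball_normE /ball_ /= sub0r normrN.
  apply: filterS2 near0 hs => h h1 h2; rewrite leNgt; apply/negP => h3.
  by apply: Hc; exists h.
have u0 n : 0 < `|u n|.
  rewrite normr_gt0; apply/negP => /eqP un0; have [_ _] := Hu n.
  by rewrite un0 add0r subrr normr0 mulr0 add0r (linear0 Ll) oppr0 normr0 ltxx.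
have mf h : measurable_fun setT (fun g : borel G => f (chart_inv c h * g)%g).
  apply: (measurableT_comp (continuous_borelR fc)); exact: measurable_mulgl.
have mD h : measurable_fun setT (D h : borel G -> R).
  apply: measurable_funB; last exact: Df_measurable.
  by apply: measurable_funB => //; exact: continuous_borelR.
pose k n (g : borel G) := `|u n|^-1 * (D (u n) g * rho g).
have k0 : \int[muG]_g k n g @[n --> \oo] --> 0.
  apply: (@bounded_cvg_Rintegral _ _ _ muG k (C + C')).
  - by move=> n; apply: measurable_funM => //; apply: measurable_funM.
  - move=> n g; rewrite /k normrM normrM gtr0_norm ?invr_gt0// ler_pdivrMl//.
    have [_ H _] := Hu n.
    apply: (le_trans (ler_pM (normr_ge0 _) (normr_ge0 _) (H g) (rho1 g))).
    by rewrite mulr1 mulrC.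
  - move=> g; apply/cvgr0Pnorm_le => e' e'0.
    have H := differentiable_near (fd g) e'0.
    have ucv : u @ \oo --> (0 : 'rV[R]_m).
      apply/cvgr0Pnorm_lt => e1 e10.
      have : \forall n \near \oo, seqn n < e1.
        exact: (cvgr_lt (0 : R) (@seqn_cvg) _ e10).
      apply: filterS => n; apply: lt_trans; by have [] := Hu n.
    near=> n.
    have Hn' : `|D (u n) g| <= e' * `|u n|.
      have : `|f (chart_inv c (u n + v0) * g)%g - f (chart_inv c v0 * g)%g - Df g (u n)| <= e' * `|u n|.
        by near: n; exact: (ucv _ H).
      by rewrite /D chart1_inv mul1g.
    rewrite /k !normrM gtr0_norm ?invr_gt0// ler_pdivrMl//.
    apply: (le_trans (ler_pM (normr_ge0 _) (normr_ge0 _) Hn' (rho1 g))).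
    by rewrite mulr1 mulrC.
have [f1 Hf1] : exists M, forall g, `|f g| <= M.
  exact: compact_bounded_fun.
have intM (F : borel G -> R) M : measurable_fun setT F -> (forall g, `|F g| <= M) ->
    rintegrable muG (fun g => F g * rho g).
  move=> mF FM; apply: (@bounded_rintegrable _ _ _ muG _ M); first exact: measurable_funM.
  by move=> g; rewrite normrM (le_trans (ler_pM _ _ (FM g) (rho1 g)))// mulr1.
have intf h : rintegrable muG (fun g => f (chart_inv c h * g)%g * rho g).
  by apply: (intM _ f1).
have key n : \int[muG]_g k n g = `|u n|^-1 * (I (u n + v0) - I v0 - Ll (u n)).
  have intD w : rintegrable muG (fun g => Df g w * rho g).
    by apply: (intM _ (C' * `|w|)) => //; exact: Df_measurable.
  rewrite /k RintegralZl//; last first.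
    by apply: (intM _ ((C + C') * `|u n|)) => //; have [] := Hu n.
  congr (_ * _).
  have -> : Ll (u n) = \int[muG]_g (Df g (u n) * rho g).
    rewrite /Ll /= /L.
    transitivity (\int[muG]_g (\sum_i u n 0 i * (Df g (delta_mx 0 i) * rho g))).
      rewrite Rintegral_sum; last by move=> i; apply: rintegrableZ.
      by apply: eq_bigr => i _; rewrite RintegralZl//; exact: intD.
    apply: eq_Rintegral => g _.
    rewrite {2}[u n]row_sum_delta linear_sum mulr_suml; apply: eq_bigr => i _.
    by rewrite linearZ /= mulrA.
  have E1 : \int[muG]_g (f (chart_inv c (u n + v0) * g)%g * rho g - f (chart_inv c v0 * g)%g * rho g)
     = I (u n + v0) - I v0 by rewrite RintegralB//; exact: intf.
  rewrite -E1 -RintegralB//; [|by apply: rintegrableB; exact: intf|exact: intD].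
  by apply: eq_Rintegral => g _; rewrite /D chart1_inv mul1g; ring.
have : \forall n \near \oo, `|\int[muG]_g k n g| < e.
  by move: k0 => /cvgr0Pnorm_lt/(_ e e0).
move=> [N _ /(_ N (leqnn N)) /=]; rewrite key normrM gtr0_norm ?invr_gt0//.
rewrite ltr_pdivrMl// ltNge; have [_ _ /ltW] := Hu N.
by rewrite mulrC => ->.
Unshelve. all: by end_near. Qed.

End translate_differentiable.

(** * Differentiability of continuous representations *)

Section rep_facts.
Context {R : realType} {m : nat} {G : lieGroupType R m}.
Local Notation C := R[i].
Local Notation Re := complex.Re.
Local Notation Im := complex.Im.
Variables (d : nat) (pi : G -> 'M[C]_d).
Hypothesis pi_irrep : unitary_irrep pi.

Lemma rep_dim_gt0 : (0 < d)%N. Proof. by case: pi_irrep. Qed.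

Lemma repM g h : pi (g * h)%g = pi g *m pi h. Proof. by case: pi_irrep. Qed.

Definition adj (p q : nat) (M : 'M[C]_(p, q)) : 'M[C]_(q, p) := \matrix_(i, k) (M k i)^*.

Lemma rep_unitary g : pi g *m adj (pi g) = 1%:M.
Proof.
have [_ /(_ g) /unitarymxP + _ _ _] := pi_irrep => <-.
by congr (_ *m _); apply/matrixP => i k; rewrite !mxE.
Qed.

Lemma rep_unitary' g : adj (pi g) *m pi g = 1%:M.
Proof. exact/mulmx1C/rep_unitary. Qed.

Lemma rep1 : pi 1%g = 1%:M.
Proof.
have := repM 1%g 1%g; rewrite mulg1 => h.
have := congr1 (mulmx (adj (pi 1%g))) h.
by rewrite rep_unitary' mulmxA rep_unitary' mul1mx.
Qed.

Lemma repV g : pi (g^-1)%g = adj (pi g).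
Proof.
have h : pi (g^-1)%g *m pi g = 1%:M by rewrite -repM mulVg rep1.
have := congr1 (mulmx^~ (adj (pi g))) h.
by rewrite -mulmxA rep_unitary mulmx1 mul1mx.
Qed.

Lemma rep_sqn_le1 g k l : sqn (pi g k l) <= 1.
Proof.
have := rep_unitary g => /matrixP/(_ k k); rewrite !mxE eqxx /=.
move/(congr1 (fun z : C => Re z)); rewrite Re_sum /= => <-.
rewrite (bigD1 l)//= mxE mulrC mulJ_sqn /= lerDl; apply: sumr_ge0 => s _.
by rewrite mxE mulrC mulJ_sqn /= sqn_ge0.
Qed.

Lemma rep_Re_le1 g k l : `|Re (pi g k l)| <= 1.
Proof.
apply: (le_trans (Re_le_normc _)); rewrite normcE -[leRHS]sqrtr1.
by rewrite ler_wsqrtr// rep_sqn_le1.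
Qed.

Lemma rep_Im_le1 g k l : `|Im (pi g k l)| <= 1.
Proof.
apply: (le_trans (Im_le_normc _)); rewrite normcE -[leRHS]sqrtr1.
by rewrite ler_wsqrtr// rep_sqn_le1.
Qed.

Lemma rep_Re_continuous k l : continuous (fun g => Re (pi g k l)).
Proof. by case: pi_irrep => _ _ _ /(_ k l)[]. Qed.

Lemma rep_Im_continuous k l : continuous (fun g => Im (pi g k l)).
Proof. by case: pi_irrep => _ _ _ /(_ k l)[]. Qed.

Lemma rep_cmeasurable k l : cmeasurable (fun g : borel G => pi g k l).
Proof.
by split; apply: continuous_borelR; [exact: rep_Re_continuous|exact: rep_Im_continuous].
Qed.

End rep_facts.

Lemma unitmx_inj_rows (F : fieldType) n (B : 'M[F]_n) :
  (forall u : 'rV_n, u *m B = 0 -> u = 0) -> B \in unitmx.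
Proof.
move=> H; rewrite -row_free_unit -kermx_eq0; apply/eqP/row_matrixP => i.
by rewrite row0; apply: H; rewrite -row_mul mulmx_ker row0.
Qed.

Section rep_differentiable.
Context {R : realType} {m : nat} {G : lieGroupType R m}.
Local Notation C := R[i].
Local Notation Re := complex.Re.
Local Notation Im := complex.Im.
Local Notation normc := Normc.normc.
Variables (muG : probability (borel G) R).
Hypothesis haarG : haar_probability muG.
Hypothesis cG : compact [set: G].
Variables (d : nat) (pi : G -> 'M[C]_d).
Hypothesis pi_irrep : unitary_irrep pi.
Let c : chart R m G := chart_at (1%g : G).
Let v0 := c 1%g.

(** At the entry of largest modulus of a vector in the kernel, the diagonal
    term would dominate the sum of all the others. *)
Lemma diag_dominant_unit (B : 'M[C]_d) (b e : R) : 0 < b -> 0 <= e ->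
  d%:R * e < b ->
  (forall k l, normc (B k l - (b * (k == l)%:R)%:C%C) <= e) -> B \in unitmx.
Proof.
move=> b0 e0 deb HB; apply: unitmx_inj_rows => u uB.
apply/rowP => l; rewrite mxE.
pose k0 := [arg max_(k > l) normc (u 0 k)]%O.
have k0P k : normc (u 0 k) <= normc (u 0 k0).
  by rewrite /k0; case: arg_maxP => //= i _; apply.
suff h : normc (u 0 k0) <= 0.
  have : normc (u 0 l) <= 0 by exact: (le_trans (k0P l)).
  by rewrite le_eqVlt ltNge normc_ge0 orbF => /eqP/Normc.eq0_normc.
have E : b%:C%C * u 0 k0 = - \sum_k u 0 k * (B k k0 - (b * (k == k0)%:R)%:C%C).
  have := congr1 (fun w : 'rV_d => w 0 k0) uB; rewrite !mxE => h.
  under eq_bigr do rewrite mulrBr.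
  rewrite sumrB h sub0r opprK (bigD1 k0)//= eqxx mulr1 big1 ?addr0 1?mulrC//.
  by move=> k /negbTE ->; rewrite mulr0 mulr0.
have := congr1 (fun z => normc z) E.
rewrite Normc.normcM normcN => E'.
have : b * normc (u 0 k0) <= \sum_(k < d) normc (u 0 k0) * e.
  have -> : b * normc (u 0 k0) = normc (b%:C%C) * normc (u 0 k0).
    by rewrite normcE /sqn /= expr0n addr0 sqrtr_sqr gtr0_norm.
  rewrite E'; elim/big_ind2 : _ => [|x1 x2 y1 y2 h1 h2|k _].
  - by rewrite normcE sqn0 sqrtr0.
  - by apply: (le_trans (normcD _ _)); exact: lerD.
  - rewrite Normc.normcM; apply: ler_pM; rewrite ?normc_ge0//.
rewrite sumr_const card_ord -mulr_natl => h.
have := normc_ge0 (u 0 k0); nra.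
Qed.

(** For a bump [f] near the identity, left invariance of the Haar measure
    gives, writing [B] for the integral of [f pi], that the integral of [f (h
    g) pi (g)] in [g] is [pi (h^-1) *m B]. As [f] is concentrated near the
    identity, [B] is close to a positive multiple of the identity matrix,
    hence invertible. So [pi] depends on [h] only through translates of [f]
    under an integral sign, and such integrals are differentiable. *)
Lemma rep_differentiable k l :
  differentiable (fun v => Re (pi (chart_inv c v) k l)) v0 /\
  differentiable (fun v => Im (pi (chart_inv c v) k l)) v0.
Proof.
(* Chosen so that [d%:R * (2 * (e * b))] is one half of [b], as
   [diag_dominant_unit] requires. *)
pose e : R := (4 * d%:R)^-1.
have d0 : 0 < (d%:R : R) by rewrite ltr0n (rep_dim_gt0 pi_irrep).
have e0 : 0 < e by rewrite invr_gt0 mulr_gt0.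
pose N := [set g | forall k l, `|Re (pi g k l) - (k == l)%:R| <= e /\ `|Im (pi g k l)| <= e].
have N1 : nbhs (1%g : G) N.
  apply: filter_forall => s; apply: filter_forall => t; apply: filterI.
    have := @rep_Re_continuous R m G d pi pi_irrep s t 1%g.
    move/cvgrPdist_le => /(_ e e0); apply: filterS => g.
    rewrite (rep1 pi_irrep) mxE distrC; case: (s == t); by rewrite /= ?mulr1n ?mulr0n.
  have := @rep_Im_continuous R m G d pi pi_irrep s t 1%g.
  move/cvgrPdist_le => /(_ e e0); apply: filterS => g.
  rewrite (rep1 pi_irrep) mxE distrC; case: (s == t); by rewrite /= ?mulr1n ?mulr0n subr0.
have [f [fc f0 f1 fN fP]] := group_bump_ex N1.
have mf : measurable_fun setT (f : borel G -> R) by exact: continuous_borelR.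
have [K fK] := compact_bounded_fun cG fc.
have intf : rintegrable muG f by exact: (@bounded_rintegrable _ _ _ muG f K mf fK).
pose b := \int[muG]_g f g.
have b0 : 0 < b.
  pose U := [set g | f 1%g / 2 < f g].
  have f12 : 0 < f 1%g / 2 by rewrite divr_gt0.
  have oU : open U.
    have -> : U = f @^-1` [set x | f 1%g / 2 < x] by [].
    by apply: open_comp => [g _|]; [exact: fc|exact: open_gt].
  have U1 : U 1%g by rewrite /U /= ltr_pdivrMr// mulr_natr mulr2n ltrDl.
  have mU : measurable (U : set (borel G)) by exact: open_borel.
  have iU : rintegrable muG (\1_U : borel G -> R) by exact: integrable_indic.
  apply: (@lt_le_trans _ _ (\int[muG]_g (f 1%g / 2 * \1_U g))).
    rewrite RintegralZl// mulr_gt0// /Rintegral integral_indic// setIT.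
    rewrite fine_gt0// (haar_open_gt0 haarG cG oU U1) /=.
    by rewrite (le_lt_trans (probability_le1 _ mU))// ltry.
  apply: le_Rintegral => //; first exact: rintegrableZ.
  move=> g _; rewrite /indic; case: (boolP (g \in U)) => [/set_mem gU|_].
    by rewrite mulr1 ltW.
  by rewrite mulr0.
pose B : 'M[C]_d := \matrix_(k, l) cint muG (fun g => (f g)%:C%C * pi g k l).
have intRe (F rho : borel G -> R) : measurable_fun setT F -> (forall g, `|F g| <= K) ->
   measurable_fun setT rho -> (forall g, `|rho g| <= 1) -> rintegrable muG (fun g => F g * rho g).
  move=> mF FK mr r1; apply: (@bounded_rintegrable _ _ _ muG _ K).
    exact: measurable_funM.
  by move=> g; rewrite normrM (le_trans (ler_pM _ _ (FK g) (r1 g)))// mulr1.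
have cintf s t : cintegrable muG (fun g => (f g)%:C%C * pi g s t).
  have [m1 m2] := rep_cmeasurable pi_irrep s t.
  split.
    under eq_fun do rewrite ReM /= mul0r subr0.
    by apply: intRe => // g; exact: rep_Re_le1.
  under eq_fun do rewrite ImM /= mul0r addr0.
  by apply: intRe => // g; exact: rep_Im_le1.
have Bu : B \in unitmx.
  apply: (@diag_dominant_unit B b (2 * (e * b))) => //.
  - by rewrite mulr_ge0// mulr_ge0// ltW.
  - rewrite /e; have -> : d%:R * (2 * ((4 * d%:R)^-1 * b)) = 2^-1 * b.
      by field; rewrite gt_eqF.
    by rewrite mulrC ltr_pdivrMr// mulr_natr mulr2n ltrDl.
  move=> s t.
  have fe (r : borel G -> R) : (forall g, N g -> `|r g| <= e) -> measurable_fun setT r ->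
      rintegrable muG (fun g => f g * r g) -> `|\int[muG]_g (f g * r g)| <= e * b.
    move=> re mr ir; apply: (le_trans (le_normr_Rintegral measurableT ir)).
    rewrite /b -RintegralZl//.
    apply: le_Rintegral => //; first exact: (integrable_norm ir).
      exact: rintegrableZ.
    move=> g _ /=; rewrite normrM ger0_norm// mulrC.
    have [->|fg] := eqVneq (f g) 0; first by rewrite !mulr0.
    by apply: ler_wpM2r => //; apply: re; exact: fN.
  have [mR mI] := rep_cmeasurable pi_irrep s t.
  have iR : rintegrable muG (fun g => f g * Re (pi g s t)).
    by apply: intRe => // g; exact: rep_Re_le1.
  have iI : rintegrable muG (fun g => f g * Im (pi g s t)).
    by apply: intRe => // g; exact: rep_Im_le1.
  have id : rintegrable muG (fun g => f g * (s == t)%:R).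
    by under eq_fun do rewrite mulrC; exact: rintegrableZ.
  apply: (le_trans (normc_le _)); rewrite mxE ReB ImB /= subr0.
  have -> : (\int[muG]_g Re ((f g)%:C%C * pi g s t)) - b * (s == t)%:R =
      \int[muG]_g (f g * (Re (pi g s t) - (s == t)%:R)).
    rewrite /b -RintegralZr// -RintegralB//; last first.
      by under eq_fun do rewrite ReM /= mul0r subr0.
    by apply: eq_Rintegral => g _; rewrite ReM /= mul0r subr0 mulrBr.
  have -> : (\int[muG]_g Im ((f g)%:C%C * pi g s t)) = \int[muG]_g (f g * Im (pi g s t)).
    by apply: eq_Rintegral => g _; rewrite ImM /= mul0r addr0.
  have -> : 2 * (e * b) = e * b + e * b by ring.
  apply: lerD; apply: fe => //.
  - by move=> g /(_ s t)[].
  - exact: measurable_funB.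
  - by under eq_fun do rewrite mulrBr; exact: rintegrableB.
  - by move=> g /(_ s t)[].
have E h : (\matrix_(k, l) cint muG (fun g => (f (h * g)%g)%:C%C * pi g k l)) = pi (h^-1)%g *m B.
  apply/matrixP => s t; rewrite !mxE.
  pose F (g : borel G) := (f g)%:C%C * pi (h^-1 * g)%g s t.
  have mF : cmeasurable F.
    apply: cmeasurableM; first by split => //; exact: measurable_cst.
    exact: (cmeasurable_comp (measurable_mulgl (h^-1)%g) (rep_cmeasurable pi_irrep s t)).
  have -> : cint muG (fun g => (f (h * g)%g)%:C%C * pi g s t) = cint muG F.
    have mh := measurable_mulgl h.
    have hh A (mA : measurable A) := haarG h mA.
    have E1 := @Rintegral_mp _ _ _ muG _ mh hh _ mF.1.
    have E2 := @Rintegral_mp _ _ _ muG _ mh hh _ mF.2.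
    rewrite /cint -E1 -E2; congr (_ +i* _)%C; apply: eq_Rintegral => g _; by rewrite /F mulKg.
  transitivity (cint muG (fun g => \sum_r pi (h^-1)%g s r * ((f g)%:C%C * pi g r t))).
    apply: eq_cint => g; rewrite /F (repM pi_irrep) mxE mulr_sumr; apply: eq_bigr => r _.
    by rewrite mulrCA.
  rewrite cint_sum; last by move=> r; exact: cintegrableZ.
  by apply: eq_bigr => r _; rewrite cintZ// mxE.
have Einv h s t : pi h s t = (\sum_r cint muG (fun g => (f (h * g)%g)%:C%C * pi g t r) * invmx B r s)^*.
  have := congr1 (mulmx^~ (invmx B)) (E h).
  rewrite mulmxK// (repV pi_irrep) => /matrixP/(_ t s).
  by rewrite !mxE => /(congr1 (fun z => z^*)); rewrite conjCK => <-; congr (_^*);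
    apply: eq_bigr => r _; rewrite mxE.
have dRe s t : differentiable (fun v => \int[muG]_g (f (chart_inv c v * g)%g * Re (pi g s t))) v0.
  apply: (@int_translate_differentiable R m G muG cG f (fun g => Re (pi g s t)) fc).
  - by move=> g0; exact: (fP g0).1.
  - by move=> g0; exact: (fP g0).2.
  - by case: (rep_cmeasurable pi_irrep s t).
  - by move=> g; exact: rep_Re_le1.
have dIm s t : differentiable (fun v => \int[muG]_g (f (chart_inv c v * g)%g * Im (pi g s t))) v0.
  apply: (@int_translate_differentiable R m G muG cG f (fun g => Im (pi g s t)) fc).
  - by move=> g0; exact: (fP g0).1.
  - by move=> g0; exact: (fP g0).2.
  - by case: (rep_cmeasurable pi_irrep s t).
  - by move=> g; exact: rep_Im_le1.
split.
  have -> : (fun v => Re (pi (chart_inv c v) k l)) = \sum_r (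
      (Re (invmx B r k) *: (fun v => \int[muG]_g (f (chart_inv c v * g)%g * Re (pi g l r)))) -
      (Im (invmx B r k) *: (fun v => \int[muG]_g (f (chart_inv c v * g)%g * Im (pi g l r))))).
    apply/funext => v; rewrite fct_sumE Einv ReJ Re_sum; apply: eq_bigr => r _.
    rewrite ReM /= mulrC [X in _ - X]mulrC; congr (_ * _ - _ * _).
      by apply: eq_Rintegral => g _; rewrite ReM /= mul0r subr0.
    by apply: eq_Rintegral => g _; rewrite ImM /= mul0r addr0.
  apply: differentiable_sum => r.
  by apply: differentiableB; apply: differentiableZ.
have -> : (fun v => Im (pi (chart_inv c v) k l)) = \sum_r (-
    ((Im (invmx B r k) *: (fun v => \int[muG]_g (f (chart_inv c v * g)%g * Re (pi g l r)))) +
     (Re (invmx B r k) *: (fun v => \int[muG]_g (f (chart_inv c v * g)%g * Im (pi g l r)))))).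
  apply/funext => v; rewrite fct_sumE Einv ImJ Im_sum -sumrN; apply: eq_bigr => r _.
  rewrite ImM /= mulrC [X in _ + X]mulrC; congr (- (_ * _ + _ * _)).
    by apply: eq_Rintegral => g _; rewrite ReM /= mul0r subr0.
  by apply: eq_Rintegral => g _; rewrite ImM /= mul0r addr0.
apply: differentiable_sum => r.
by apply: differentiableN; apply: differentiableD; apply: differentiableZ.
Qed.
End rep_differentiable.

(** * Complex differentials and the adjoint action *)

Lemma leibniz_re {R : realType} (a b c d e f g h : R) :
  a * b + c * d - (e * f + g * h) = a * b - e * f + (d * c - h * g).
Proof. ring. Qed.

Lemma leibniz_im {R : realType} (a b c d e f g h : R) :
  a * b + c * d + (e * f + g * h) = a * b + e * f + (d * c + h * g).
Proof. ring. Qed.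

Section cdiff.
Context {R : realType}.
Local Notation C := R[i].
Local Notation Re := complex.Re.
Local Notation Im := complex.Im.
Variable V : normedModType R.
Implicit Types (f g : V -> C) (x v : V).

Lemma rdiffD (f g : V -> R) x v : differentiable f x -> differentiable g x ->
  'd (fun y => f y + g y : R) x v = 'd f x v + 'd g x v.
Proof. by move=> df dg; exact: (congr1 (fun h : V -> R => h v) (diffD df dg)). Qed.

Lemma rdiffN (f : V -> R) x v : differentiable f x ->
  'd (fun y => - f y : R) x v = - 'd f x v.
Proof. by move=> df; exact: (congr1 (fun h : V -> R => h v) (diffN df)). Qed.

Lemma rdiffM (f g : V -> R) x v : differentiable f x -> differentiable g x ->
  'd (fun y => f y * g y : R) x v = f x * 'd g x v + g x * 'd f x v.
Proof. by move=> df dg; exact: (congr1 (fun h : V -> R => h v) (diffM df dg)). Qed.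

Lemma eq_diff (f g : V -> R) x v : f =1 g -> 'd f x v = 'd g x v.
Proof. by move=> /funext ->. Qed.

Definition cdifferentiable f x : Prop :=
  differentiable (fun y => Re (f y) : R) x /\ differentiable (fun y => Im (f y) : R) x.

Definition cdiff f x v : C :=
  ('d (fun y => Re (f y) : R) x v +i* 'd (fun y => Im (f y) : R) x v)%C.

Lemma cdiff_near f g x : (\forall y \near x, f y = g y) -> cdifferentiable f x ->
  cdifferentiable g x /\ cdiff g x = cdiff f x.
Proof.
move=> fg [f1 f2].
have h1 : \forall y \near x, (Re (f y) : R) = Re (g y) by apply: filterS fg => y ->.
have h2 : \forall y \near x, (Im (f y) : R) = Im (g y) by apply: filterS fg => y ->.
have [d1 e1] := near_eq_differentiable h1 f1.
have [d2 e2] := near_eq_differentiable h2 f2.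
split => //; apply/funext => v; apply: complexRI => /=.
  exact: (congr1 (fun h : V -> R => h v) e1).
exact: (congr1 (fun h : V -> R => h v) e2).
Qed.

Lemma cdiff_cst (a : C) x : cdifferentiable (fun=> a) x /\ cdiff (fun=> a) x = fun=> 0.
Proof.
split; first by split; exact: differentiable_cst.
apply/funext => v; apply: complexRI => /=.
  by rewrite (@diff_cst R V _ (Re a : R) x).
by rewrite (@diff_cst R V _ (Im a : R) x).
Qed.

Lemma cdiffD f g x : cdifferentiable f x -> cdifferentiable g x ->
  cdifferentiable (fun y => f y + g y) x /\
  cdiff (fun y => f y + g y) x = fun v => cdiff f x v + cdiff g x v.
Proof.
move=> [f1 f2] [g1 g2].
have eR : (fun y => Re (f y + g y) : R) = (fun y => Re (f y) : R) + (fun y => Re (g y) : R).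
  by apply/funext => y; rewrite ReD.
have eI : (fun y => Im (f y + g y) : R) = (fun y => Im (f y) : R) + (fun y => Im (g y) : R).
  by apply/funext => y; rewrite ImD.
split; first by split; rewrite ?eR ?eI; exact: differentiableD.
apply/funext => v; apply: complexRI; rewrite ?ReD ?ImD /=.
  by rewrite -(rdiffD v f1 g1); apply: eq_diff => y; rewrite ReD.
by rewrite -(rdiffD v f2 g2); apply: eq_diff => y; rewrite ImD.
Qed.

Lemma cdiff_sum (I : Type) (s : seq I) (f : I -> V -> C) x :
  (forall i, cdifferentiable (f i) x) ->
  cdifferentiable (fun y => \sum_(i <- s) f i y) x /\
  cdiff (fun y => \sum_(i <- s) f i y) x = fun v => \sum_(i <- s) cdiff (f i) x v.
Proof.
move=> df; elim: s => [|i s [IH1 IH2]].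
  have -> : (fun y => \sum_(i <- [::]) f i y) = fun=> 0 by apply/funext => y; rewrite big_nil.
  have [h1 ->] := cdiff_cst 0 x; split => //.
  by apply/funext => y; rewrite big_nil.
have -> : (fun y => \sum_(i <- i :: s) f i y) = fun y => f i y + \sum_(i <- s) f i y.
  by apply/funext => y; rewrite big_cons.
have [h1 ->] := cdiffD (df i) IH1; split => //.
by rewrite IH2; apply/funext => v; rewrite big_cons.
Qed.

Lemma cdiffM f g x : cdifferentiable f x -> cdifferentiable g x ->
  cdifferentiable (fun y => f y * g y) x /\
  cdiff (fun y => f y * g y) x = fun v => f x * cdiff g x v + cdiff f x v * g x.
Proof.
move=> [f1 f2] [g1 g2].
have eR : (fun y => Re (f y * g y) : R) = (fun y => Re (f y) : R) * (fun y => Re (g y) : R)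
    - (fun y => Im (f y) : R) * (fun y => Im (g y) : R).
  by apply/funext => y; rewrite ReM.
have eI : (fun y => Im (f y * g y) : R) = (fun y => Re (f y) : R) * (fun y => Im (g y) : R)
    + (fun y => Im (f y) : R) * (fun y => Re (g y) : R).
  by apply/funext => y; rewrite ImM.
have m1 := differentiableM f1 g1; have m2 := differentiableM f2 g2.
have m3 := differentiableM f1 g2; have m4 := differentiableM f2 g1.
split; first by split; rewrite ?eR ?eI; [exact: differentiableB|exact: differentiableD].
apply/funext => v; apply: complexRI; rewrite ?ReD ?ImD ?ReM ?ImM /=.
  rewrite (eq_diff x v (fun y => ReM (f y) (g y))).
  rewrite (rdiffD v m1 (differentiableN m2)) (rdiffN v m2) (rdiffM v f1 g1) (rdiffM v f2 g2).
  exact: leibniz_re.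
rewrite (eq_diff x v (fun y => ImM (f y) (g y))).
rewrite (rdiffD v m3 m4) (rdiffM v f1 g2) (rdiffM v f2 g1).
exact: leibniz_im.
Qed.

Lemma cdiffZ (a : C) f x : cdifferentiable f x ->
  cdifferentiable (fun y => a * f y) x /\
  cdiff (fun y => a * f y) x = fun v => a * cdiff f x v.
Proof.
move=> df; have [ca ea] := cdiff_cst a x; have [h ->] := cdiffM ca df; split => //.
by apply/funext => v; rewrite ea mul0r addr0.
Qed.

Lemma cdiffJ f x : cdifferentiable f x ->
  cdifferentiable (fun y => (f y)^*) x /\
  cdiff (fun y => (f y)^*) x = fun v => (cdiff f x v)^*.
Proof.
move=> [f1 f2].
have eR : (fun y => Re (f y)^* : R) = (fun y => Re (f y) : R).
  by apply/funext => y; rewrite ReJ.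
have eI : (fun y => Im (f y)^* : R) = - (fun y => Im (f y) : R).
  by apply/funext => y; rewrite ImJ.
split; first by split; rewrite ?eR ?eI//; exact: differentiableN.
apply/funext => v; apply: complexRI; rewrite ?ReJ ?ImJ /=.
  by apply: eq_diff => y; rewrite ReJ.
by rewrite -(rdiffN v f2); apply: eq_diff => y; rewrite ImJ.
Qed.

Lemma cdiff_linD f x u v : cdiff f x (u + v) = cdiff f x u + cdiff f x v.
Proof. by apply: complexRI; rewrite ?ReD ?ImD /= linearD. Qed.

Lemma cdiff_linZ f x (a : R) v : cdiff f x (a *: v) = a%:C%C * cdiff f x v.
Proof.
apply: complexRI; rewrite ?ReM ?ImM /= linearZ mul0r ?subr0 ?addr0 //.
Qed.

End cdiff.

Lemma cdiff_comp {R : realType} (V W : normedModType R) (f : V -> W) (g : W -> R[i]) x :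
  differentiable f x -> cdifferentiable g (f x) ->
  cdifferentiable (g \o f) x /\
  cdiff (g \o f) x = fun v => cdiff g (f x) ('d f x v).
Proof.
move=> df [g1 g2].
have h1 := differentiable_comp df g1; have h2 := differentiable_comp df g2.
split => //; apply/funext => v; apply: complexRI => /=.
  exact: (congr1 (fun h : V -> R => h v) (diff_comp df g1)).
exact: (congr1 (fun h : V -> R => h v) (diff_comp df g2)).
Qed.

Section translations.
Context {R : realType} {m : nat} {G : lieGroupType R m}.
Local Notation c := (chart_at (1%g : G) : chart R m G).
Local Notation v0 := (c 1%g).
Implicit Types g h : G.

Lemma mulg_chart_differentiable g h :
  differentiable (fun z : 'rV[R]_m * 'rV[R]_m => chart_at (g * h)%g
    (chart_inv (chart_at g) z.1 * chart_inv (chart_at h) z.2)%g)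
    (chart_at g g, chart_at h h).
Proof.
have [U [oU Uz sU]] := @mulg_smooth R m G g h.
exact: (sU 1%N).1.
Qed.

Lemma chart_atK g : chart_inv (chart_at g) (chart_at g g) = g.
Proof. by apply: chart_mapK; exact: chart_at_dom. Qed.

Lemma mulgr_differentiable g h :
  differentiable (fun v => chart_at (g * h)%g (chart_inv (chart_at g) v * h)%g) (chart_at g g).
Proof.
have -> : (fun v => chart_at (g * h)%g (chart_inv (chart_at g) v * h)%g) =
  (fun z : 'rV[R]_m * 'rV[R]_m => chart_at (g * h)%g
    (chart_inv (chart_at g) z.1 * chart_inv (chart_at h) z.2)%g) \o (fun v => (v, chart_at h h)).
  by apply/funext => v /=; rewrite chart_atK.
apply: differentiable_comp; last exact: mulg_chart_differentiable.
by apply: differentiable_pair.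
Qed.

Lemma mulgl_differentiable g h :
  differentiable (fun v => chart_at (g * h)%g (g * chart_inv (chart_at h) v)%g) (chart_at h h).
Proof.
have -> : (fun v => chart_at (g * h)%g (g * chart_inv (chart_at h) v)%g) =
  (fun z : 'rV[R]_m * 'rV[R]_m => chart_at (g * h)%g
    (chart_inv (chart_at g) z.1 * chart_inv (chart_at h) z.2)%g) \o (fun v => (chart_at g g, v)).
  by apply/funext => v /=; rewrite chart_atK.
apply: differentiable_comp; last exact: mulg_chart_differentiable.
by apply: differentiable_pair.
Qed.

Definition conj_chart g (v : 'rV[R]_m) := c (g * chart_inv c v * g^-1)%g.

Lemma conj_chart0 g : conj_chart g v0 = v0.
Proof. by rewrite /conj_chart chart_atK mulg1 mulgV. Qed.

Lemma chart_inv_mul_cvg g h : (fun v => (g * chart_inv c v * h)%g) @ v0 --> (g * h)%g.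
Proof.
rewrite -[g in X in _ --> X]mulg1.
have h1 : (fun v => chart_inv c v) @ v0 --> (1%g : G).
  by apply: chart_inv_cvg; exact: chart_at_dom.
have h2 : (fun v => (g * chart_inv c v)%g) @ v0 --> (g * 1)%g.
  by apply: (cvg_comp _ _ h1); exact: continuous_mulgl.
have h3 : continuous (fun x : G => (x * h)%g).
  move=> x; have H : (fun x : G => (x, h)) @ x --> (x, h) by apply: cvg_pair; [exact: cvg_id|exact: cvg_cst].
  exact: (cvg_comp _ _ H (@mulg_continuous R m G (x, h))).
exact: (cvg_comp _ _ h2 (h3 _)).
Qed.

(** Conjugation is a left translation followed by a right one, read in the
    chart at [g] in between. *)
Lemma conj_chart_differentiable g : differentiable (conj_chart g) v0.
Proof.
have := mulgl_differentiable g 1%g; rewrite mulg1 => dl.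
have := mulgr_differentiable g (g^-1)%g; rewrite mulgV => dr.
have E : chart_at g (g * chart_inv c v0)%g = chart_at g g by rewrite chart_atK mulg1.
have dcomp : differentiable ((fun v => c (chart_inv (chart_at g) v * g^-1)%g) \o
   (fun v => chart_at g (g * chart_inv c v)%g)) v0.
  by apply: differentiable_comp => //; rewrite E.
apply: (near_eq_differentiable _ dcomp).1; near=> v => /=.
rewrite chart_mapK//; near: v.
have := @chart_inv_mul_cvg g 1%g; rewrite mulg1 => H.
have : \forall v \near v0, chart_dom (chart_at g) (g * chart_inv c v * 1)%g.
  by apply: H; apply: chart_dom_nbhs; exact: chart_at_dom.
by apply: filterS => v; rewrite mulg1.
Unshelve. all: by end_near. Qed.

Lemma AdE g : Ad g = 'd (conj_chart g) v0 :> (_ -> _).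
Proof. by apply/funext => Z; rewrite /Ad /mdiff mulg1 mulgV. Qed.

End translations.

(** * The tangent representation and Lie derivatives *)

Section rep_tangent.
Context {R : realType} {m : nat} {G : lieGroupType R m}.
Local Notation C := R[i].
Variables (muG : probability (borel G) R).
Hypothesis haarG : haar_probability muG.
Hypothesis cG : compact [set: G].
Variables (d : nat) (pi : G -> 'M[C]_d).
Hypothesis pi_irrep : unitary_irrep pi.
Local Notation c := (chart_at (1%g : G) : chart R m G).
Local Notation v0 := (c 1%g).

Lemma drepE Z k l : drep pi Z k l = cdiff (fun v => pi (chart_inv c v) k l) v0 Z.
Proof. by rewrite mxE. Qed.

Lemma rep_cdifferentiable k l : cdifferentiable (fun v => pi (chart_inv c v) k l) v0.
Proof. exact: (rep_differentiable haarG cG pi_irrep k l). Qed.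

Lemma drepD Y Z : drep pi (Y + Z) = drep pi Y + drep pi Z.
Proof. by apply/matrixP => k l; rewrite [in RHS]mxE !drepE cdiff_linD. Qed.

Lemma drepZ (a : R) Z : drep pi (a *: Z) = a%:C%C *: drep pi Z.
Proof. by apply/matrixP => k l; rewrite [in RHS]mxE !drepE cdiff_linZ. Qed.

Lemma drep0 : drep pi 0 = 0.
Proof. by rewrite -(scale0r 0) drepZ scale0r. Qed.

Lemma drep_sum (I : Type) (s : seq I) (F : I -> 'rV[R]_m) :
  drep pi (\sum_(i <- s) F i) = \sum_(i <- s) drep pi (F i).
Proof. exact: (big_morph _ drepD drep0). Qed.

Lemma drep_coord Z : drep pi Z = \sum_i (Z 0 i)%:C%C *: drep pi (delta_mx 0 i).
Proof. by rewrite {1}[Z]row_sum_delta drep_sum; apply: eq_bigr => i _; rewrite drepZ. Qed.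

(** Differentiate [pi (g * h * g^-1) = pi g *m pi h *m adj (pi g)] in [h] at
    the identity. *)
Lemma drep_Ad g Z : drep pi (Ad g Z) = pi g *m drep pi Z *m adj (pi g).
Proof.
apply/matrixP => k l.
have dk := conj_chart_differentiable g.
have h1 : cdifferentiable (fun v => pi (chart_inv c v) k l) (conj_chart g v0).
  by rewrite conj_chart0; exact: rep_cdifferentiable.
have [h2 e2] := cdiff_comp dk h1.
have ZE : cdiff ((fun v => pi (chart_inv c v) k l) \o conj_chart g) v0 Z = drep pi (Ad g Z) k l.
  by rewrite e2 drepE AdE conj_chart0.
have h3 : \forall v \near v0, ((fun v => pi (chart_inv c v) k l) \o conj_chart g) v =
    \sum_b (\sum_a pi g k a * pi (chart_inv c v) a b) * adj (pi g) b l.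
  have H : \forall v \near v0, chart_dom c (g * chart_inv c v * g^-1)%g.
    have := @chart_inv_mul_cvg R m G g (g^-1)%g; rewrite mulgV => H.
    by apply: H; apply: chart_dom_nbhs; exact: chart_at_dom.
  apply: filterS H => v vd /=; rewrite /conj_chart chart_mapK//.
  rewrite !(repM pi_irrep) (repV pi_irrep) mxE; apply: eq_bigr => b _.
  by rewrite mxE.
have [_ e3] := cdiff_near h3 h2.
have s1 b : cdifferentiable (fun v => \sum_a pi g k a * pi (chart_inv c v) a b) v0 /\
   cdiff (fun v => \sum_a pi g k a * pi (chart_inv c v) a b) v0 =
   fun Z => \sum_a pi g k a * cdiff (fun v => pi (chart_inv c v) a b) v0 Z.
  have hz a := cdiffZ (pi g k a) (rep_cdifferentiable a b).
  have [t1 t2] := cdiff_sum (index_enum 'I_d) (fun a => (hz a).1); split => //.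
  by rewrite t2; apply/funext => w; apply: eq_bigr => a _; rewrite (hz a).2.
have s2 b : cdifferentiable (fun v => (\sum_a pi g k a * pi (chart_inv c v) a b) * adj (pi g) b l) v0 /\
   cdiff (fun v => (\sum_a pi g k a * pi (chart_inv c v) a b) * adj (pi g) b l) v0 =
   fun Z => (\sum_a pi g k a * cdiff (fun v => pi (chart_inv c v) a b) v0 Z) * adj (pi g) b l.
  have [t1 t2] := cdiffZ (adj (pi g) b l) (s1 b).1.
  have -> : (fun v => (\sum_a pi g k a * pi (chart_inv c v) a b) * adj (pi g) b l) =
    (fun v => adj (pi g) b l * (\sum_a pi g k a * pi (chart_inv c v) a b)).
    by apply/funext => v; rewrite mulrC.
  split => //; rewrite t2; apply/funext => w; by rewrite (s1 b).2 mulrC.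
have [_ e4] := cdiff_sum (index_enum 'I_d) (fun b => (s2 b).1).
rewrite -ZE -e3 e4 mxE; apply: eq_bigr => b _; rewrite (s2 b).2 mxE; congr (_ * _).
by rewrite [RHS]mxE; apply: eq_bigr => a _; rewrite drepE.
Qed.

(** Differentiate [pi h *m adj (pi h) = 1%:M] in [h] at the identity. *)
Lemma drep_skew Z : adj (drep pi Z) = - drep pi Z.
Proof.
apply/eqP; rewrite -addr_eq0; apply/eqP/matrixP => k l; rewrite [RHS]mxE.
have h3 : (fun v => \sum_b pi (chart_inv c v) k b * (pi (chart_inv c v) l b)^*) = fun=> (k == l)%:R.
  apply/funext => v; have := rep_unitary pi_irrep (chart_inv c v) => /matrixP/(_ k l).
  by rewrite !mxE => <-; apply: eq_bigr => b _; rewrite mxE.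
have hj b := cdiffJ (rep_cdifferentiable l b).
have hm b := cdiffM (rep_cdifferentiable k b) (hj b).1.
have [t1 t2] := cdiff_sum (index_enum 'I_d) (fun b => (hm b).1).
have := congr1 (fun f => cdiff f v0 Z) h3; rewrite (cdiff_cst _ _).2 t2 => <-.
have -> : \sum_b cdiff (fun v => pi (chart_inv c v) k b * (pi (chart_inv c v) l b)^*) v0 Z =
   \sum_b ((k == b)%:R * (drep pi Z l b)^* + drep pi Z k b * (l == b)%:R).
  apply: eq_bigr => b _; rewrite (hm b).2 (hj b).2 /= !drepE.
  by rewrite chart_atK (rep1 pi_irrep) !mxE conjC_nat.
rewrite big_split /= (bigD1 k)//= eqxx mul1r big1 ?addr0; last first.
  by move=> b; rewrite eq_sym => /negbTE ->; rewrite mul0r.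
rewrite (bigD1 l)//= eqxx mulr1 big1 ?addr0; last first.
  by move=> b; rewrite eq_sym => /negbTE ->; rewrite mulr0.
by rewrite !mxE.
Qed.

End rep_tangent.

Section lie_derivative.
Context {R : realType} {n m : nat} {X : manifoldType R n} {G : lieGroupType R m}.
Local Notation C := R[i].
Variables (muG : probability (borel G) R).
Hypothesis haarG : haar_probability muG.
Hypothesis cG : compact [set: G].
Variables (d : nat) (pi : G -> 'M[C]_d).
Hypothesis pi_irrep : unitary_irrep pi.
Variables (F : R -> X -> X) (phi : X -> G).
Hypothesis FC1 : C1_flow F.
Local Notation c := (chart_at (1%g : G) : chart R m G).
Local Notation v0 := (c 1%g).

(** Near [t = 0], [pi (phi (F t x)) = pi (phi (F t x) * (phi x)^-1) *m pi (phi
    x)], where the argument of the first factor passes through the identity at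
    [t = 0] with velocity [M_phi F phi x]. *)
Lemma Lie_derivative_rep x k l : Lie_derivable F phi x ->
  cdifferentiable (fun t : R => pi (phi (F t x)) k l) 0 /\
  cdiff (fun t : R => pi (phi (F t x)) k l) 0 1 = (drep pi (M_phi F phi x) *m pi (phi x)) k l.
Proof.
have [F0 _ _ _] := FC1.
move=> [cc dd].
pose g := phi x.
have eta0 : phi (F 0 x) = g by rewrite F0.
rewrite /prop_for /continuous_at eta0 in cc; rewrite eta0 in dd.
pose u (t : R) := chart_at g (phi (F t x)).
have du : differentiable u 0 by apply/derivable1_diffP.
pose rho (v : 'rV[R]_m) := c (chart_inv (chart_at g) v * g^-1)%g.
have drho : differentiable rho (u 0).
  rewrite /u eta0 /rho; have := mulgr_differentiable g (g^-1)%g; by rewrite mulgV.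
have rho0 : rho (u 0) = v0 by rewrite /rho /u eta0 chart_atK mulgV.
have dru : differentiable (rho \o u) 0 by exact: differentiable_comp.
have ME : 'd (rho \o u) 0 (1 : R) = M_phi F phi x.
  rewrite (congr1 (fun h : R -> 'rV[R]_m => h 1) (diff_comp du drho)) /=.
  rewrite /M_phi /mdiff /Lie_derivative /velocity mulgV eta0.
  have u0 : u 0 = chart_at g g by rewrite /u eta0.
  have E2 : 'd u 0 (1 : R) = 'D_1 u 0 by rewrite deriveE.
  rewrite E2.
  rewrite u0.
  reflexivity.
have hs : \forall t \near (0 : R), (\sum_b pi (chart_inv c ((rho \o u) t)) k b * pi g b l) =
    pi (phi (F t x)) k l.
  have H1 : \forall t \near (0 : R), chart_dom (chart_at g) (phi (F t x)).
    by apply: cc; apply: chart_dom_nbhs; exact: chart_at_dom.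
  have H2 : \forall t \near (0 : R), chart_dom c (phi (F t x) * g^-1)%g.
    have h3 : (fun y : G => (y * g^-1)%g) @ g --> (1%g : G).
      rewrite -[X in _ --> X](mulgV g).
      have H : (fun y : G => (y, g^-1%g)) @ g --> (g, g^-1%g) by apply: cvg_pair; [exact: cvg_id|exact: cvg_cst].
      exact: (cvg_comp _ _ H (@mulg_continuous R m G (g, g^-1%g))).
    apply: (cvg_comp _ _ cc h3); apply: chart_dom_nbhs; exact: chart_at_dom.
  apply: filterS2 H1 H2 => t t1 t2.
  rewrite /rho /u /= (chart_mapK t1) chart_mapK//.
  transitivity (pi (phi (F t x) * g^-1 * g)%g k l); last by rewrite -mulgA mulVg mulg1.
  by rewrite (repM pi_irrep _ g) mxE.
have hc b : cdifferentiable (fun t => pi (chart_inv c ((rho \o u) t)) k b) 0 /\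
    cdiff (fun t => pi (chart_inv c ((rho \o u) t)) k b) 0 1 = drep pi (M_phi F phi x) k b.
  have q : cdifferentiable (fun v => pi (chart_inv c v) k b) ((rho \o u) 0).
    by rewrite /= rho0; exact: (rep_cdifferentiable haarG cG pi_irrep).
  have [q1 q2] := cdiff_comp dru q; split => //.
  by rewrite [LHS](congr1 (fun h => h 1) q2) ME drepE /= rho0.
have hz b := cdiffZ (pi g b l) (hc b).1.
have hz' b : cdifferentiable (fun t => pi (chart_inv c ((rho \o u) t)) k b * pi g b l) 0 /\
    cdiff (fun t => pi (chart_inv c ((rho \o u) t)) k b * pi g b l) 0 1 =
    drep pi (M_phi F phi x) k b * pi g b l.
  have -> : (fun t => pi (chart_inv c ((rho \o u) t)) k b * pi g b l) =
    (fun t => pi g b l * pi (chart_inv c ((rho \o u) t)) k b).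
    by apply/funext => t; rewrite mulrC.
  have [q1 q2] := hz b; split => //.
  by rewrite [LHS](congr1 (fun h => h 1) q2) (hc b).2 mulrC.
have [t1 t2] := cdiff_sum (index_enum 'I_d) (fun b => (hz' b).1).
have [t3 t4] := cdiff_near hs t1; split => //.
rewrite t4 t2 mxE; apply: eq_bigr => b _; exact: (hz' b).2.
Qed.

End lie_derivative.

Section Ad_measurable.
Context {R : realType} {m : nat} {G : lieGroupType R m}.
Local Notation c := (chart_at (1%g : G) : chart R m G).
Local Notation v0 := (c 1%g).

(** The differential is a limit of difference quotients in the chart at the
    identity; these are Borel in [g] once the chart is extended by zero
    outside of its domain. *)
Lemma Ad_measurable (Z : 'rV[R]_m) i : measurable_fun setT (fun g : borel G => Ad g Z 0 i : R).
Proof.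
pose cc (g : G) : R := if `[< chart_dom c g >] then c g 0 i else 0.
have mcc : measurable_fun setT (cc : borel G -> R).
  have md : measurable (chart_dom c : set (borel G)) by apply: open_borel; exact: chart_dom_open.
  apply: borel_measurable_funR => U oU.
  have oW : open (chart_dom c `&` (fun g : G => (c g 0 i : R)) @^-1` U).
    rewrite openE => g [gd Ug]; rewrite /interior; apply: filterI; first exact: chart_dom_nbhs.
    have h : (fun g : G => (c g 0 i : R)) @ g --> (c g 0 i : R).
      exact: (cvg_comp _ _ (chart_map_continuous gd) (@coord_continuous R 1 m 0 i (c g))).
    by apply: h; exact: open_nbhs_nbhs.
  have [U0|U0] := pselect (U 0).
    have -> : cc @^-1` U = (chart_dom c `&` (fun g : G => (c g 0 i : R)) @^-1` U) `|` ~` chart_dom c.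
      apply/seteqP; split=> g; rewrite /cc /=; case: asboolP => gd.
      - by left.
      - by right.
      - by case=> [[]|].
      - by [].
    by apply: measurableU; [exact: open_borel|exact: measurableC].
  have -> : cc @^-1` U = (chart_dom c `&` (fun g : G => (c g 0 i : R)) @^-1` U).
    apply/seteqP; split=> g; rewrite /cc /=; case: asboolP => gd //; by case.
  exact: open_borel.
pose q (k : nat) (g : borel G) : R := k.+1%:R * (cc (g * chart_inv c (k.+1%:R^-1 *: Z + v0) * g^-1)%g - v0 0 i).
have mq k : measurable_fun setT (q k).
  apply: measurable_funM => //; apply: measurable_funB => //.
  apply: (measurableT_comp mcc).
  set h := chart_inv c _.
  have h1 : measurable_fun setT (fun g : borel G => ((g * h)%g : borel G, (g^-1)%g : borel G)).
    by apply/measurable_fun_pair => /=; [exact: measurable_mulgr|exact: measurable_invg].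
  exact: (measurableT_comp measurable_mulg h1).
apply: (measurable_fun_cvg mq) => g _.
have dk := conj_chart_differentiable g.
have dv : derivable (conj_chart g) v0 Z by exact: diff_derivable.
have H : (fun h : R => h^-1 *: ((conj_chart g \o shift v0) (h *: Z) - conj_chart g v0)) @ (0 : R)^' --> Ad g Z.
  rewrite AdE -(deriveE Z dk); exact: dv.
have H2 : (fun k : nat => (k.+1%:R^-1 : R)) @ \oo --> (0 : R)^'.
  move=> A A0; have A0' : \forall x \near (0 : R), x != 0 -> A x by exact: A0.
  have [N _ HN] := (@cvg_harmonic R) _ A0'; exists N => // k Nk.
  by apply: (HN k Nk); rewrite gt_eqF// invr_gt0.
have H3 := cvg_comp _ _ (cvg_comp _ _ H2 H) (@coord_continuous R 1 m 0 i (Ad g Z)).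
apply: (cvg_trans _ H3); apply: near_eq_cvg.
have nd : \forall v \near v0, chart_dom c (g * chart_inv c v * g^-1)%g.
  have := @chart_inv_mul_cvg R m G g (g^-1)%g; rewrite mulgV => K.
  by apply: K; apply: chart_dom_nbhs; exact: chart_at_dom.
have H4 : (fun k : nat => (k.+1%:R^-1 : R) *: Z + v0) @ \oo --> v0.
  rewrite -[X in _ --> X]add0r; apply: cvgD; last exact: cvg_cst.
  by rewrite -(scale0r Z); apply: cvgZl; exact: cvg_harmonic.
near=> k.
have kd : chart_dom c (g * chart_inv c (k.+1%:R^-1 *: Z + v0) * g^-1)%g.
  by near: k; exact: (H4 _ nd).
by rewrite /q /= !mxE invrK conj_chart0 /cc asboolT.
Unshelve. all: by end_near. Qed.
End Ad_measurable.

(** * Orthogonality and the mean ergodic theorem in semi-inner-product spaces *)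

Lemma harmonic_small {R : realType} (e : R) : 0 < e ->
  exists N : nat, forall n, (N <= n)%N -> n.+1%:R^-1 < e.
Proof.
move=> e0; have [N _ HN] := cvgr_lt (0 : R) (@cvg_harmonic R) _ e0.
by exists N => n Nn; exact: (HN n Nn).
Qed.

Section semi_hilbert.
Context {R : realType} (V : zmodType).
Variables (E : V -> Prop) (sc : R -> V -> V) (q : V -> V -> R).

(** Functions taken up to null sets form such a space without passing to the
    quotient: the form is only semidefinite, and the functions that vanish
    almost everywhere have norm zero. The predicate [E] singles out the square
    integrable ones among all functions. *)
Record semi_inner : Prop := SemiInner {
  si0 : E 0 ;
  siD : forall x y, E x -> E y -> E (x + y) ;
  siN : forall x, E x -> E (- x) ;
  siZ : forall a x, E x -> E (sc a x) ;
  qC : forall x y, E x -> E y -> q x y = q y x ;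
  qD : forall x y z, E x -> E y -> E z -> q (x + y) z = q x z + q y z ;
  qZ : forall a x z, E x -> E z -> q (sc a x) z = a * q x z ;
  qge0 : forall x, E x -> 0 <= q x x }.

Hypothesis H : semi_inner.
Local Hint Resolve si0 siD siN siZ : core.

Lemma siB x y : E x -> E y -> E (x - y). Proof. by move=> Ex Ey; apply: siD => //; exact: siN. Qed.

Lemma q0l z : E z -> q 0 z = 0.
Proof.
move=> Ez; have := qD H (si0 H) (si0 H) Ez; rewrite addr0.
by move=> /(congr1 (fun t => t - q 0 z)); rewrite subrr addrK.
Qed.

Lemma qN x z : E x -> E z -> q (- x) z = - q x z.
Proof.
move=> Ex Ez; apply/eqP; rewrite -addr_eq0 -(qD H)//; last exact: siN.
by rewrite addNr q0l.
Qed.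

Lemma qB x y z : E x -> E y -> E z -> q (x - y) z = q x z - q y z.
Proof. by move=> Ex Ey Ez; rewrite (qD H)// ?qN//; exact: siN. Qed.

Lemma qDr x y z : E x -> E y -> E z -> q z (x + y) = q z x + q z y.
Proof. by move=> Ex Ey Ez; rewrite (qC H)//; [rewrite (qD H)// !(qC H _ Ez)|exact: siD]. Qed.

Lemma qBr x y z : E x -> E y -> E z -> q z (x - y) = q z x - q z y.
Proof. by move=> Ex Ey Ez; rewrite (qC H)//; [rewrite qB// !(qC H _ Ez)|exact: siB]. Qed.

Lemma qZr a x z : E x -> E z -> q z (sc a x) = a * q z x.
Proof. by move=> Ex Ez; rewrite (qC H)//; [rewrite (qZ H)// (qC H)|exact: siZ]. Qed.

(** The choice [t = a / b] minimizes the difference of the two sides; if [b =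
    0], a large [t] forces [a = 0]. *)
Lemma discriminant (a b e : R) : 0 <= b -> 0 <= e ->
  (forall t, 2 * t * a <= e + t ^+ 2 * b) -> a ^+ 2 <= e * b.
Proof.
move=> b0 e0 h; have [bz|bn] := eqVneq b 0.
  have [->|an] := eqVneq a 0; first by rewrite expr0n /= mulr_ge0.
  have := h ((e + 1) / (2 * a)); rewrite bz !mulr0 addr0.
  have -> : 2 * ((e + 1) / (2 * a)) * a = e + 1 by field.
  by rewrite gerDl ler10.
have bp : 0 < b by rewrite lt_neqAle eq_sym bn.
have := h (a / b).
have -> : 2 * (a / b) * a = a ^+ 2 / b + a ^+ 2 / b by field.
have -> : e + (a / b) ^+ 2 * b = e + a ^+ 2 / b by field.
by rewrite lerD2r ler_pdivrMr.
Qed.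

Lemma variation_bound (dl A a b t w : R) :
  dl <= A - 2 * (t * a) + t * (t * b) -> A < dl + w ->
  2 * t * a <= w + t ^+ 2 * b.
Proof.
rewrite expr2 -!mulrA; move: (t * a) (t * (t * b)) => x y; lra.
Qed.

Lemma q_sqD x y : E x -> E y -> q (x + y) (x + y) = q x x + 2 * q x y + q y y.
Proof.
move=> Ex Ey; have Exy := siD H Ex Ey.
by rewrite (qD H)// !qDr// (qC H Ey Ex); ring.
Qed.

Lemma q_sqB x y : E x -> E y -> q (x - y) (x - y) = q x x - 2 * q x y + q y y.
Proof.
move=> Ex Ey; have Exy := siB Ex Ey.
by rewrite qB// !qBr// (qC H Ey Ex); ring.
Qed.

Lemma cauchy_schwarz_sq x y : E x -> E y -> q x y ^+ 2 <= q x x * q y y.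
Proof.
move=> Ex Ey; apply: discriminant; [exact: qge0|exact: qge0|move=> t].
have Et := siZ H t Ey; have := qge0 H (siB Ex Et).
by rewrite q_sqB// qZr// (qZ H)// qZr//; nra.
Qed.

Definition nrm x : R := Num.sqrt (q x x).

Lemma nrm_ge0 x : 0 <= nrm x. Proof. exact: sqrtr_ge0. Qed.

Lemma nrm_sq x : E x -> nrm x ^+ 2 = q x x.
Proof. by move=> Ex; rewrite sqr_sqrtr//; exact: qge0. Qed.

Lemma cauchy_schwarz x y : E x -> E y -> `|q x y| <= nrm x * nrm y.
Proof.
move=> Ex Ey; rewrite -ler_sqr ?nnegrE ?mulr_ge0 ?nrm_ge0//.
by rewrite real_normK ?num_real// exprMn !nrm_sq//; exact: cauchy_schwarz_sq.
Qed.

Lemma nrmD x y : E x -> E y -> nrm (x + y) <= nrm x + nrm y.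
Proof.
move=> Ex Ey; rewrite -ler_sqr ?nnegrE ?addr_ge0 ?nrm_ge0//.
rewrite sqrrD !nrm_sq//; [|exact: siD].
have := cauchy_schwarz Ex Ey; have := ler_norm (q x y); rewrite q_sqD//; lra.
Qed.

Lemma nrmN x : E x -> nrm (- x) = nrm x.
Proof.
move=> Ex; have Ex' := siN H Ex.
by rewrite /nrm (qN Ex Ex') (qC H Ex Ex') (qN Ex Ex) opprK.
Qed.

Lemma nrmB x y : E x -> E y -> nrm (x - y) <= nrm x + nrm y.
Proof. by move=> Ex Ey; rewrite -(nrmN Ey) nrmD//; exact: siN. Qed.

Lemma nrmZ a x : E x -> nrm (sc a x) = `|a| * nrm x.
Proof.
move=> Ex; rewrite /nrm (qZ H)// ?qZr//; last exact: siZ.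
by rewrite mulrA -expr2 sqrtrM ?sqr_ge0// sqrtr_sqr.
Qed.

Lemma nrm0 : nrm 0 = 0. Proof. by rewrite /nrm q0l ?sqrtr0//; exact: si0. Qed.

Lemma nrm_sum (I : Type) (s : seq I) (x : I -> V) : (forall i, E (x i)) ->
  E (\sum_(i <- s) x i) /\ nrm (\sum_(i <- s) x i) <= \sum_(i <- s) nrm (x i).
Proof.
move=> Ex; elim: s => [|i s [IH1 IH2]]; first by rewrite !big_nil nrm0; split => //; exact: si0.
rewrite !big_cons; split; first exact: siD.
by apply: (le_trans (nrmD _ _)) => //; rewrite lerD2l.
Qed.

Lemma q_suml (I : Type) (s : seq I) (x : I -> V) z : E z -> (forall i, E (x i)) ->
  q (\sum_(i <- s) x i) z = \sum_(i <- s) q (x i) z.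
Proof.
move=> Ez Ex; elim: s => [|i s IH]; first by rewrite !big_nil q0l.
by rewrite !big_cons (qD H)// ?IH//; exact: (nrm_sum _ _).1.
Qed.

Lemma nrm_null x z : E x -> E z -> nrm x = 0 -> q x z = 0.
Proof.
move=> Ex Ez x0; apply/eqP; rewrite -normr_le0.
by rewrite (le_trans (cauchy_schwarz Ex Ez))// x0 mul0r.
Qed.

Lemma nrm_lt x e : E x -> 0 < e -> q x x < e ^+ 2 -> nrm x < e.
Proof. by move=> Ex e0 h; rewrite -ltr_sqr ?nnegrE ?nrm_ge0 ?ltW// nrm_sq. Qed.

Definition si_complete : Prop := forall u : nat -> V, (forall n, E (u n)) ->
  (forall e, 0 < e -> exists N, forall n m, (N <= n)%N -> (N <= m)%N -> nrm (u n - u m) < e) ->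
  exists2 l, E l & forall e, 0 < e -> exists N, forall n, (N <= n)%N -> nrm (u n - l) < e.

Hypothesis Hc : si_complete.

Lemma small_eq0 (a b : R) : 0 <= b -> (forall e, 0 < e -> `|a| <= e * b) -> a = 0.
Proof.
move=> b0 h; apply/eqP; rewrite -normr_le0; apply/ler_addgt0Pr => e e0.
rewrite add0r; have b1 : 0 < b + 1 by rewrite ltr_wpDl.
apply: (le_trans (h (e / (b + 1)) _)); first by rewrite divr_gt0.
by rewrite mulrAC ler_pdivrMr// ler_pM2l// lerDl.
Qed.

Section projection.
Variables (K : V -> Prop).
Hypotheses (KE : forall k, K k -> E k) (K0 : K 0)
  (KD : forall k l, K k -> K l -> K (k + l)) (KZ : forall a k, K k -> K (sc a k)).
Hypothesis KN : forall k, K k -> K (- k).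

(** If [u n] in [K] nearly minimizes the distance to [f], then [f - u n] is
    nearly orthogonal to [K], which makes the sequence Cauchy; [s] is its
    limit. As [K] need not be closed, the component of [f] along [K] appears
    through approximations only. *)
Lemma orthogonal_decomposition f : E f -> exists s, [/\ E s, forall k, K k -> q s k = 0 &
  forall e, 0 < e -> exists2 k, K k & nrm (f - k - s) < e].
Proof.
move=> Ef.
pose S := [set r : R | exists2 k, K k & r = q (f - k) (f - k)].
have hi : has_inf S.
  split; first by exists (q (f - 0) (f - 0)); exists 0.
  by exists 0 => r [k Kk ->]; apply: qge0 => //; apply: siB => //; exact: KE.
pose dl := inf S.
have dlP k : K k -> dl <= q (f - k) (f - k).
  by move=> Kk; apply: ge_inf; [case: hi|exists k].
have /choice[u Hu] : forall n : nat, exists k, K k /\ q (f - k) (f - k) < dl + n.+1%:R^-1 ^+ 2.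
  move=> n; have e0 : 0 < (n.+1%:R^-1 : R) ^+ 2 by rewrite exprn_gt0// invr_gt0.
  by have [_ [k Kk ->] h] := inf_adherent e0 hi; exists k.
have Ku n : K (u n) by have [] := Hu n.
have Eu n : E (u n) by exact: KE.
have Efu n : E (f - u n) by exact: siB.
have near_orth n k : K k -> `|q (f - u n) k| <= n.+1%:R^-1 * nrm k.
  move=> Kk; have Ek := KE Kk.
  rewrite -ler_sqr ?nnegrE ?mulr_ge0 ?nrm_ge0 ?invr_ge0//.
  rewrite real_normK ?num_real// exprMn nrm_sq//.
  apply: discriminant; [exact: qge0|exact: sqr_ge0|move=> t].
  have Et := siZ H t Ek.
  have := dlP _ (KD (Ku n) (KZ t Kk)); rewrite opprD addrA q_sqB//.
  rewrite (qZr t Ek (Efu n)) (qZ H t Ek Et) (qZr t Ek Ek) => h1.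
  have [_ h2] := Hu n; exact: (variation_bound h1 h2).
have cauchy : forall e, 0 < e -> exists N, forall n m, (N <= n)%N -> (N <= m)%N ->
    nrm (f - u n - (f - u m)) < e.
  move=> e e0; have e20 : 0 < e / 2 by rewrite divr_gt0.
  have [N HN] := harmonic_small e20; exists N => n p nN pN.
  have -> : f - u n - (f - u p) = u p - u n by rewrite opprB addrC addrA subrK.
  have Kk : K (u p - u n) by apply: KD => //; exact: KN.
  have Ek := KE Kk.
  have E1 : q (u p - u n) (u p - u n) = q (f - u n) (u p - u n) - q (f - u p) (u p - u n).
    rewrite -(qB (Efu n) (Efu p) Ek); congr (q _ _).
    by rewrite opprB [RHS]addrC addrA subrK.
  have h1 := near_orth n _ Kk; have h2 := near_orth p _ Kk.
  have [k0|kn] := eqVneq (nrm (u p - u n)) 0; first by rewrite k0.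
  have kp : 0 < nrm (u p - u n) by rewrite lt_neqAle eq_sym kn nrm_ge0.
  have : nrm (u p - u n) ^+ 2 <= (n.+1%:R^-1 + p.+1%:R^-1) * nrm (u p - u n).
    rewrite nrm_sq// E1 (le_trans (ler_norm _))// (le_trans (ler_normB _ _))//.
    by rewrite mulrDl lerD.
  rewrite expr2 ler_pM2r// => /le_lt_trans; apply.
  by rewrite [ltRHS]splitr ltrD// HN.
have [s Es Hs] := Hc Efu cauchy.
exists s; split => //.
- move=> k Kk; have Ek := KE Kk.
  apply: (@small_eq0 _ (nrm k + nrm k)); first by rewrite addr_ge0// nrm_ge0.
  move=> e e0; have [N1 HN1] := Hs e e0; have [N2 HN2] := harmonic_small e0.
  pose n := maxn N1 N2.
  have h1 := HN1 n (leq_maxl _ _); have h2 := HN2 n (leq_maxr _ _).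
  have -> : q s k = q (f - u n) k - q (f - u n - s) k.
    by rewrite (qB (Efu n) Es Ek); ring.
  rewrite (le_trans (ler_normB _ _))// mulrDr lerD//.
    by rewrite (le_trans (near_orth n k Kk))// ler_wpM2r ?nrm_ge0// ltW.
  rewrite (le_trans (cauchy_schwarz _ Ek))//; first exact: siB.
  by rewrite ler_wpM2r ?nrm_ge0// ltW.
- move=> e e0; have [N HN] := Hs e e0.
  by exists (u N) => //; exact: HN.
Qed.

(** The component [s] of [f] orthogonal to [K] is also orthogonal to [f],
    hence to itself. *)
Lemma biorthogonal_closure f : E f ->
  (forall s, E s -> (forall k, K k -> q s k = 0) -> q f s = 0) ->
  forall e, 0 < e -> exists2 k, K k & nrm (f - k) < e.
Proof.
move=> Ef Hf e e0; have [s [Es sK Hs]] := orthogonal_decomposition Ef.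
have s0 : q s s = 0.
  apply: (@small_eq0 _ (nrm s)); first exact: nrm_ge0.
  move=> t t0; have [k Kk hk] := Hs t t0; have Ek := KE Kk.
  have Efk : E (f - k) by exact: siB.
  have -> : q s s = - q (f - k - s) s.
    by rewrite qB// qB// (Hf s Es sK) (qC H Ek Es) (sK k Kk); ring.
  rewrite normrN (le_trans (cauchy_schwarz _ Es))//; first exact: siB.
  by rewrite ler_wpM2r ?nrm_ge0// ltW.
have [k Kk hk] := Hs e e0; exists k => //.
have Efk : E (f - k) by apply: siB => //; exact: KE.
have -> : f - k = (f - k - s) + s by rewrite subrK.
have := nrmD (siB Efk Es) Es; rewrite [nrm s]/nrm s0 sqrtr0 addr0.
by move=> /le_lt_trans; apply.
Qed.

End projection.

Section mean_ergodic.
Variable W : V -> V.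
Hypotheses (WE : forall x, E x -> E (W x)) (WD : forall x y, W (x + y) = W x + W y)
  (WZ : forall a x, W (sc a x) = sc a (W x))
  (Wq : forall x y, E x -> E y -> q (W x) (W y) = q x y).
Hypotheses (scD : forall a x y, sc a (x + y) = sc a x + sc a y)
  (scN : forall a x, sc a (- x) = - sc a x).

Lemma W0 : W 0 = 0.
Proof. by have := WD 0 0; rewrite addr0 => /(congr1 (fun t => t - W 0)); rewrite subrr addrK. Qed.

Lemma WN x : W (- x) = - W x.
Proof. by apply/eqP; rewrite -addr_eq0 -WD addNr W0. Qed.

Lemma iterE n x : E x -> E (iter n W x).
Proof. by move=> Ex; elim: n => //= n; exact: WE. Qed.

Lemma iterD n x y : iter n W (x + y) = iter n W x + iter n W y.
Proof. by elim: n => //= n ->; rewrite WD. Qed.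

Lemma iterN n x : iter n W (- x) = - iter n W x.
Proof. by elim: n => //= n ->; rewrite WN. Qed.

Lemma iter_q n x y : E x -> E y -> q (iter n W x) (iter n W y) = q x y.
Proof. by move=> Ex Ey; elim: n => //= n IH; rewrite Wq//; exact: iterE. Qed.

Lemma iter_nrm n x : E x -> nrm (iter n W x) = nrm x.
Proof. by move=> Ex; rewrite /nrm iter_q. Qed.

Definition average (N : nat) x := sc N%:R^-1 (\sum_(n < N) iter n W x).

Lemma averageE N x : E x -> E (average N x).
Proof. by move=> Ex; apply: siZ => //; apply: (nrm_sum _ _).1 => i; exact: iterE. Qed.

Lemma averageD N x y : average N (x + y) = average N x + average N y.
Proof. by rewrite /average -scD -big_split; congr (sc _ _); apply: eq_bigr => i _; rewrite iterD. Qed.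

Lemma average_nrm N x : E x -> nrm (average N x) <= nrm x.
Proof.
move=> Ex; have [h1 h2] := nrm_sum (index_enum 'I_N) (fun i : 'I_N => iterE i Ex).
rewrite nrmZ// ger0_norm ?invr_ge0//.
case: N h1 h2 => [|N] h1 h2; first by rewrite invr0 mul0r nrm_ge0.
rewrite ler_pdivrMl// (le_trans h2)//.
under eq_bigr do rewrite iter_nrm//.
by rewrite sumr_const card_ord -[nrm x *+ _]mulr_natl.
Qed.

(** The sum telescopes. *)
Lemma average_coboundary N x : E x -> (0 < N)%N -> nrm (average N (x - W x)) <= N%:R^-1 * (2 * nrm x).
Proof.
move=> Ex N0.
have -> : average N (x - W x) = sc N%:R^-1 (x - iter N W x).
  congr (sc _ _); elim: (N) => [|p IH]; first by rewrite big_ord0 subrr.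
  rewrite big_ord_recr /= IH iterD iterN -iterSr /=.
  by rewrite addrA subrK.
have EN := iterE N Ex; have EB := siB Ex EN.
rewrite nrmZ// ger0_norm ?invr_ge0// ler_wpM2l ?invr_ge0//.
by rewrite (le_trans (nrmB Ex EN))// iter_nrm//; lra.
Qed.

Lemma average_fixed N s : E s -> nrm (W s - s) = 0 -> (0 < N)%N -> nrm (average N s - s) = 0.
Proof.
move=> Es Ws N0.
have Wn n : nrm (iter n W s - s) = 0.
  elim: n => [|n IH]; first by rewrite subrr nrm0.
  have En := iterE n Es; have EW := WE Es.
  have -> : iter n.+1 W s - s = W (iter n W s - s) + (W s - s).
    by rewrite WD WN addrA subrK.
  apply/eqP; rewrite eq_le nrm_ge0 andbT.
  have EB := siB En Es.
  apply: (le_trans (nrmD (WE EB) (siB EW Es))).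
  by rewrite Ws addr0 /nrm (Wq EB EB) -/(nrm _) IH.
have EA := averageE N Es; have EB := siB EA Es.
suff h z : E z -> q (average N s - s) z = 0 by rewrite /nrm h// sqrtr0.
move=> Ez.
rewrite qB// (qZ H)//; last by apply: (nrm_sum _ _).1 => i; exact: iterE.
rewrite q_suml//; last by move=> i; exact: iterE.
have -> : \sum_(i < N) q (iter i W s) z = \sum_(i < N) q s z.
  apply: eq_bigr => i _; have En := iterE i Es.
  by apply/eqP; rewrite -subr_eq0 -qB// (nrm_null _ Ez (Wn i))//; exact: siB.
by rewrite sumr_const card_ord -[q s z *+ _]mulr_natl mulrA mulVf ?mul1r ?subrr// pnatr_eq0 -lt0n.
Qed.

(** The argument of von Neumann for an isometry [W]. The component [s] of [f]
    orthogonal to the coboundaries [x - W x] is invariant, because [q (W s -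
    s) (W s - s)] is twice [q s (s - W s)]. The averages leave [s] in place
    and send coboundaries to zero at the rate [1 / N]. *)
Theorem mean_ergodic f : E f -> exists s, [/\ E s, nrm (W s - s) = 0,
  forall r, E r -> nrm (W r - r) = 0 -> q (f - s) r = 0 &
  forall e, 0 < e -> exists N0, forall N, (N0 <= N)%N -> nrm (average N f - s) < e].
Proof.
move=> Ef; pose K k := exists2 x, E x & k = x - W x.
have KE k : K k -> E k by move=> [x Ex ->]; apply: siB => //; exact: WE.
have K0 : K 0 by exists 0; [exact: si0|rewrite W0 subrr].
have KD k l : K k -> K l -> K (k + l).
  move=> [x Ex ->] [y Ey ->]; exists (x + y); first exact: siD.
  by rewrite WD opprD addrACA.
have KZ a k : K k -> K (sc a k).
  by move=> [x Ex ->]; exists (sc a x); [exact: siZ|rewrite WZ scD scN].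
have KN k : K k -> K (- k).
  by move=> [x Ex ->]; exists (- x); [exact: siN|rewrite WN opprD].
have [s [Es sK Hs]] := orthogonal_decomposition KE K0 KD KZ KN Ef.
have EWs := WE Es.
have Ws : nrm (W s - s) = 0.
  have h : q s (s - W s) = 0 by apply: sK; exists s.
  have h2 : q (W s - s) (W s - s) = 0.
    rewrite q_sqB// Wq// (qC H EWs Es); move: h; rewrite qBr//; lra.
  by rewrite /nrm h2 sqrtr0.
exists s; split => //.
- move=> r Er Wr; have EWr := WE Er.
  apply: (@small_eq0 _ (nrm r)); first exact: nrm_ge0.
  move=> e e0; have [k Kk hk] := Hs e e0; have Ek := KE _ Kk.
  have -> : q (f - s) r = q (f - k - s) r + q k r.
    by rewrite !qB//; [ring|exact: siB].
  have -> : q k r = 0.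
    case: Kk => x Ex ->; have EWx := WE Ex; rewrite qB//.
    have -> : q (W x) r = q (W x) (W r) - q (W x) (W r - r).
      by rewrite qBr//; ring.
    rewrite Wq//; have := cauchy_schwarz EWx (siB EWr Er); rewrite Wr mulr0.
    by rewrite normr_le0 => /eqP ->; ring.
  rewrite addr0 (le_trans (cauchy_schwarz _ Er))//; first by apply: siB => //; exact: siB.
  by rewrite ler_wpM2r ?nrm_ge0// ltW.
- move=> e e0; have e20 : 0 < e / 2 by rewrite divr_gt0.
  have [k0 [x Ex ->] hk] := Hs _ e20.
  have h0 : 0 < e / 2 / (2 * nrm x + 1) by rewrite divr_gt0// ltr_wpDl// mulr_ge0// nrm_ge0.
  have [N0 HN0] := harmonic_small h0.
  exists N0.+1 => -[//|N] NN.
  set k := x - W x in hk.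
  have EWx := WE Ex; have Exk : E k by exact: siB.
  have Efk : E (f - k) by exact: siB.
  have Efks : E (f - k - s) by exact: siB.
  have E1 : average N.+1 f - s = average N.+1 (f - k - s) + average N.+1 k + (average N.+1 s - s).
    rewrite [X in X - s = _](_ : _ = average N.+1 ((f - k - s) + k + s)).
      by rewrite (averageD _ (f - k - s + k) s) (averageD _ (f - k - s) k) addrA.
    by congr (average _ _); rewrite -addrA [k + s]addrC addrA subrK subrK.
  rewrite E1; have Es' := siB (averageE N.+1 Es) Es.
  apply: (le_lt_trans (nrmD (siD H (averageE N.+1 Efks) (averageE N.+1 Exk)) Es')).
  rewrite (@average_fixed N.+1 s Es Ws)// addr0.
  apply: (le_lt_trans (nrmD (averageE N.+1 Efks) (averageE N.+1 Exk))).
  rewrite [ltRHS]splitr; apply: ltr_leD.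
    by apply: (le_lt_trans (average_nrm _ Efks)).
  apply: (le_trans (average_coboundary Ex _)) => //.
  have := HN0 N NN; have nx := nrm_ge0 x.
  rewrite ltr_pdivlMr; last by rewrite ltr_wpDl// mulr_ge0// nrm_ge0.
  move=> h; apply: ltW; apply: (le_lt_trans _ h).
  by rewrite ler_wpM2l ?invr_ge0// lerDl.
Qed.

End mean_ergodic.
End semi_hilbert.

(** * Completeness of real square integrable functions *)

Section ae_summability.
Context d (T : measurableType d) {R : realType} (mu : {measure set T -> \bar R}).

(** The sum of the series is integrable by monotone convergence, hence finite
    almost everywhere. *)
Lemma ae_bounded_sums (g : nat -> T -> R) (M : R) :
  (forall k, measurable_fun setT (g k)) ->
  (forall n, \sum_(0 <= k < n) \int[mu]_x `|g k x|%:E <= M%:E)%E ->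
  {ae mu, forall x, exists B : R, forall n, \sum_(0 <= k < n) `|g k x| <= B}.
Proof.
move=> mg gM.
have mg' k : measurable_fun setT (fun x => `|g k x|%:E).
  by apply/measurable_EFinP; apply: measurableT_comp.
pose h x := (\sum_(0 <= k <oo) `|g k x|%:E)%E.
have mh : measurable_fun setT h by apply: ge0_emeasurable_sum.
have ih : mu.-integrable setT h.
  apply/integrableP; split => //.
  under eq_integral do rewrite gee0_abs ?nneseries_ge0//.
  rewrite integral_nneseries//.
  apply: (@le_lt_trans _ _ M%:E); last exact: ltry.
  apply: lime_le.
    by apply: is_cvg_nneseries => n _ _; exact: integral_ge0.
  by apply: nearW => n; exact: gM.
have := integrable_ae measurableT ih; apply: filterS => x /(_ Logic.I) hx.
exists (fine (h x)) => n; rewrite -lee_fin fineK// -sumEFin.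
by apply: nneseries_lim_ge.
Qed.

Lemma ae_bounded_cvg (a : nat -> R) B : (forall n, \sum_(0 <= k < n) `|a k| <= B) ->
  cvgn (series a) /\ a @ \oo --> 0.
Proof.
move=> aB.
have h : cvgn (series a).
  apply: normed_cvg; apply: nondecreasing_is_cvgn.
    by apply/nondecreasing_seqP => n; rewrite /= !seriesEnat /= big_nat_recr//= lerDl.
  by exists B => _ [n _ <-]; exact: aB.
by split => //; exact: cvg_series_cvg_0.
Qed.

End ae_summability.

Lemma sum_half {R : realType} n : \sum_(0 <= k < n) (2^-1 : R) ^+ k <= 2.
Proof.
have -> : \sum_(0 <= k < n) (2^-1 : R) ^+ k = 2 - 2 * 2^-1 ^+ n.
  elim: n => [|n IH]; first by rewrite big_geq// expr0 mulr1 subrr.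
  by rewrite big_nat_recr//= IH exprS; field.
by rewrite gerBl mulr_ge0// exprn_ge0// invr_ge0.
Qed.

Lemma EFin_Rint d (T : measurableType d) (R : realType) (mu : {measure set T -> \bar R})
    (f : T -> R) : rintegrable mu f -> (\int[mu]_x (f x)%:E = (\int[mu]_x f x)%:E)%E.
Proof. by move=> i; rewrite /Rintegral fineK//; exact: (integrable_fin_num measurableT i). Qed.

Section real_L2.
Context d (T : measurableType d) {R : realType} (mu : probability T R).
Implicit Types f g : T -> R.

Definition real_L2 f : Prop := measurable_fun setT f /\ rintegrable mu (fun x => f x ^+ 2).

Lemma real_L2_int f : real_L2 f -> rintegrable mu f.
Proof.
move=> [mf f2]; apply: (@le_rintegrable _ _ _ mu f (fun x => 1 + f x ^+ 2)) => //.
  move=> x; have := sqr_ge0 (`|f x| - 1); have := normr_ge0 (f x).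
  have := sqr_ge0 (f x); rewrite -[f x ^+ 2]real_normK ?num_real//; nra.
apply: rintegrableD => //; exact: finite_measure_integrable_cst.
Qed.

Lemma real_L2D f g : real_L2 f -> real_L2 g -> real_L2 (fun x => f x + g x).
Proof.
move=> [mf f2] [mg g2]; split; first exact: measurable_funD.
apply: (@le_rintegrable _ _ _ mu _ (fun x => 2 * f x ^+ 2 + 2 * g x ^+ 2)).
- by apply: measurable_funX; exact: measurable_funD.
- move=> x; rewrite ger0_norm ?sqr_ge0//; have := sqr_ge0 (f x - g x); nra.
- by apply: rintegrableD; exact: rintegrableZ.
Qed.

Lemma real_L2Z a f : real_L2 f -> real_L2 (fun x => a * f x).
Proof.
move=> [mf f2]; split; first exact: measurable_funM.
by under eq_fun do rewrite exprMn; exact: rintegrableZ.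
Qed.

Lemma real_L2N f : real_L2 f -> real_L2 (fun x => - f x).
Proof. by move=> /(real_L2Z (-1)); under eq_fun do rewrite mulN1r. Qed.

Lemma real_L2B f g : real_L2 f -> real_L2 g -> real_L2 (fun x => f x - g x).
Proof. by move=> hf hg; apply: real_L2D => //; exact: real_L2N. Qed.

Lemma int_abs_sq f : real_L2 f -> (\int[mu]_x `|f x|) ^+ 2 <= \int[mu]_x (f x ^+ 2).
Proof.
move=> hf; have i1 : rintegrable mu (fun x => `|f x|) := integrable_norm (real_L2_int hf).
have [mf i2] := hf.
have ic (a : R) : rintegrable mu (fun=> a) by exact: finite_measure_integrable_cst.
have cE (a : R) : \int[mu]_x a = a.
  transitivity (a * fine (1%E : \bar R)); last by rewrite /= mulr1.
  rewrite Rintegral_cst//; congr (_ * fine _); exact: probability_setT.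
rewrite -[leRHS]mulr1; apply: discriminant => //.
  by apply: Rintegral_ge0 => x _; exact: sqr_ge0.
move=> t; rewrite mulr1 -subr_ge0.
have -> : \int[mu]_x (f x ^+ 2) + t ^+ 2 - 2 * t * \int[mu]_x `|f x| =
    \int[mu]_x (f x ^+ 2 + t ^+ 2 - 2 * t * `|f x|).
  rewrite RintegralB//; [|exact: rintegrableD|exact: rintegrableZ].
  rewrite RintegralD//; last exact: ic.
  by rewrite (@RintegralZl _ _ _ mu setT (fun x => `|f x|) (2 * t))// cE.
apply: Rintegral_ge0 => x _.
by have := sqr_ge0 (`|f x| - t); rewrite sqrrB real_normK ?num_real//; lra.
Qed.

(** On a probability space the mean of [`|g k|] is at most its norm, so the
    means are summable. *)
Lemma ae_cvg_fast (g : nat -> T -> R) : (forall k, real_L2 (g k)) ->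
  (forall k, \int[mu]_x (g k x ^+ 2) <= (2^-1 ^+ k) ^+ 2) ->
  {ae mu, forall x, cvgn (series (fun k => g k x)) /\ g k x @[k --> \oo] --> 0}.
Proof.
move=> hg gb.
have : {ae mu, forall x, exists B : R, forall n, \sum_(0 <= k < n) `|g k x| <= B}.
  apply: (@ae_bounded_sums _ _ _ mu g 2); first by move=> k; case: (hg k).
  move=> n; apply: (@le_trans _ _ (\sum_(0 <= k < n) ((2^-1 : R) ^+ k)%:E)%E).
    apply: lee_sum => k _.
    have i1 : rintegrable mu (fun x => `|g k x|) := integrable_norm (real_L2_int (hg k)).
    have -> : (\int[mu]_x `|g k x|%:E)%E = (\int[mu]_x `|g k x|)%:E.
      by rewrite /Rintegral fineK//; exact: (integrable_fin_num measurableT i1).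
    rewrite lee_fin -ler_sqr ?nnegrE ?exprn_ge0 ?invr_ge0//.
      exact: le_trans (int_abs_sq (hg k)) (gb k).
    by apply: Rintegral_ge0 => x _.
  by rewrite sumEFin lee_fin sum_half.
by apply: filterS => x [B HB]; exact: ae_bounded_cvg HB.
Qed.

Lemma fatou_real_L2 (h : nat -> T -> R) (f : T -> R) (e : R) :
  (forall k, measurable_fun setT (h k)) -> measurable_fun setT f ->
  (forall x, h k x @[k --> \oo] --> f x) ->
  (exists N, forall k, (N <= k)%N -> (\int[mu]_x (h k x ^+ 2)%:E <= e%:E)%E) ->
  (\int[mu]_x (f x ^+ 2)%:E <= e%:E)%E.
Proof.
move=> mh mf hf [N HN].
have mh' k : measurable_fun setT (fun x => (h k x ^+ 2)%:E).
  by apply/measurable_EFinP; exact: measurable_funX.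
have F := @fatou _ _ _ mu setT measurableT (fun k x => (h (k + N)%N x ^+ 2)%:E)
  (fun k => mh' _) (fun k x _ => sqr_ge0 _).
have E : (\int[mu]_x (f x ^+ 2)%:E = \int[mu]_x limn_einf (fun k => (h (k + N)%N x ^+ 2)%:E))%E.
  apply: eq_integral => x _; apply/esym.
  have c : (fun k => (h (k + N)%N x ^+ 2)%:E) @ \oo --> (f x ^+ 2)%:E.
    apply: cvg_EFin; first exact: nearW.
    rewrite (cvg_shiftn N (fun k => h k x ^+ 2)).
    by under eq_fun do rewrite expr2; rewrite expr2; apply: cvgM.
  rewrite is_cvg_limn_einfE; first exact/cvg_lim.
  by apply/cvg_ex; eexists; exact: c.
rewrite E (le_trans F)//.
rewrite limn_einf_lim; apply: lime_le; first exact: is_cvg_einfs.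
apply: nearW => k; apply: (@le_trans _ _ (\int[mu]_x (h (k + N)%N x ^+ 2)%:E)%E); last first.
  by apply: HN; exact: leq_addl.
by apply: ereal_inf_lbound; exists k => /=.
Qed.

Lemma real_L2_of_bound (f : T -> R) (e : R) : measurable_fun setT f ->
  (\int[mu]_x (f x ^+ 2)%:E <= e%:E)%E -> real_L2 f /\ \int[mu]_x (f x ^+ 2) <= e.
Proof.
move=> mf fe.
have i : rintegrable mu (fun x => f x ^+ 2).
  apply/integrableP; split; first by apply/measurable_EFinP; exact: measurable_funX.
  under eq_integral do rewrite /= ger0_norm ?sqr_ge0//.
  by apply: (le_lt_trans fe); exact: ltry.
split; first by split.
by rewrite /Rintegral -lee_fin fineK//; exact: (integrable_fin_num measurableT i).
Qed.

(** A subsequence whose increments have norm at most [2^-1 ^+ k] converges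
    almost everywhere, and Fatou's lemma bounds the distance to its limit. *)
Theorem riesz_fischer (u : nat -> T -> R) : (forall n, real_L2 (u n)) ->
  (forall e, 0 < e -> exists N, forall n p, (N <= n)%N -> (N <= p)%N ->
     \int[mu]_x ((u n x - u p x) ^+ 2) <= e) ->
  exists2 l, real_L2 l & forall e, 0 < e -> exists N, forall n, (N <= n)%N ->
     \int[mu]_x ((u n x - l x) ^+ 2) <= e.
Proof.
move=> hu cu.
have /choice[N0 HN0] : forall k : nat, exists N, forall n p, (N <= n)%N -> (N <= p)%N ->
     \int[mu]_x ((u n x - u p x) ^+ 2) <= (2^-1 ^+ k) ^+ 2.
  by move=> k; apply: cu; rewrite exprn_gt0// exprn_gt0// invr_gt0.
(* Nondecreasing, and at least [N0 k] and [k]. *)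
pose s k := (\sum_(j < k.+1) (N0 j).+1)%N.
have s_mono : {homo s : k l / (k <= l)%N}.
  move=> k l kl; rewrite /s -(subnKC kl) -addSn.
  by rewrite big_split_ord /= leq_addr.
have sN k : (N0 k <= s k)%N.
  by rewrite /s big_ord_recr /= (leq_trans (leqnSn _))// leq_addl.
have s_inf k : (k <= s k)%N.
  rewrite /s -[X in (X <= _)%N]card_ord -sum1_card (leq_trans _ (_ : (\sum_(j < k) (N0 j).+1 <= _)%N))//.
    by apply: leq_sum.
  by rewrite big_ord_recr /= leq_addr.
pose g k x := u (s k.+1) x - u (s k) x.
have hg k : real_L2 (g k) by exact: real_L2B.
have := @ae_cvg_fast g hg _; case.
  by move=> k; apply: HN0; [exact: (leq_trans (sN k) (s_mono _ _ (leqnSn k)))|exact: sN].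
move=> Nl [mNl Nl0 Nlsub].
(* Set to zero on the exceptional null set, so that the limit exists
   everywhere. *)
pose h k x := u (s k) x * \1_(~` Nl) x.
have mh k : measurable_fun setT (h k).
  apply: measurable_funM; first by case: (hu (s k)).
  by apply: measurable_indic; exact: measurableC.
have ch x : cvgn (fun k => h k x).
  rewrite /h; case: (pselect (Nl x)) => [Nx|Nx].
    rewrite indicE memNset ?mulr0; last by move=> /(_ Nx).
    by under eq_fun do rewrite mulr0; exact: is_cvg_cst.
  rewrite indicE mem_set//; under eq_fun do rewrite mulr1.
  have [c _] : cvgn (series (fun k => g k x)) /\ g k x @[k --> \oo] --> 0.
    by apply: contrapT => hc; apply: Nx; exact: Nlsub.
  have -> : (fun k => u (s k) x) = (fun k => u (s 0%N) x + series (fun k => g k x) k).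
    by apply/funext => k; rewrite seriesEnat /= telescope_sumr// addrC subrK.
  by apply: is_cvgD => //; exact: is_cvg_cst.
pose l x := limn (fun k => h k x).
have hl x : h k x @[k --> \oo] --> l x by exact: ch.
have ml : measurable_fun setT l by apply: (measurable_fun_cvg mh) => x _.
have ul n e : 0 < e -> (exists K, forall k, (K <= k)%N -> \int[mu]_x ((u n x - u (s k) x) ^+ 2) <= e) ->
    real_L2 (fun x => u n x - l x) /\ \int[mu]_x ((u n x - l x) ^+ 2) <= e.
  move=> e0 [K HK]; apply: real_L2_of_bound.
    by apply: measurable_funB => //; case: (hu n).
  apply: (@fatou_real_L2 (fun k x => u n x - h k x)).
  - by move=> k; apply: measurable_funB => //; case: (hu n).
  - by apply: measurable_funB => //; case: (hu n).
  - by move=> x; apply: cvgB; [exact: cvg_cst|exact: hl].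
  exists K => k Kk.
  have -> : (\int[mu]_x ((u n x - h k x) ^+ 2)%:E = \int[mu]_x ((u n x - u (s k) x) ^+ 2)%:E)%E.
    apply: ge0_ae_eq_integral => //.
    - apply/measurable_EFinP; apply: measurable_funX; apply: measurable_funB => //.
      by case: (hu n).
    - by apply/measurable_EFinP; apply: measurable_funX; case: (real_L2B (hu n) (hu (s k))).
    - by move=> x _; rewrite lee_fin sqr_ge0.
    - by move=> x _; rewrite lee_fin sqr_ge0.
    exists Nl; split => // x /= hx; apply: contrapT => nx; apply: hx => _.
    by rewrite /h indicE mem_set// mulr1.
  by rewrite EFin_Rint ?lee_fin; [exact: HK|case: (real_L2B (hu n) (hu (s k)))].
have key e : 0 < e -> exists N, forall n, (N <= n)%N ->
    real_L2 (fun x => u n x - l x) /\ \int[mu]_x ((u n x - l x) ^+ 2) <= e.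
  move=> e0; have [N HN] := cu e e0; exists N => n Nn; apply: ul => //.
  by exists N => k Nk; apply: HN => //; exact: (leq_trans Nk (s_inf k)).
have [N1 HN1] := key 1 ltr01.
exists l; last by move=> e e0; have [N HN] := key e e0; exists N => n Nn; exact: (HN n Nn).2.
have := real_L2B (hu N1) (HN1 N1 (leqnn _)).1.
by under eq_fun do rewrite opprB addrC subrK.
Qed.

End real_L2.

(** * Complex square integrable functions *)

Section complex_L2.
Context d (T : measurableType d) {R : realType} (mu : {measure set T -> \bar R}).
Local Notation C := R[i].
Local Notation Re := complex.Re.
Local Notation Im := complex.Im.
Implicit Types f g : T -> C.

Lemma cnorm2E f : cnorm2 mu f = sqrte (\int[mu]_x (sqn (f x))%:E).
Proof.
rewrite /cnorm2 unlock -poweR12_sqrt; last by apply: integral_ge0 => x _; rewrite lee_fin sqn_ge0.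
congr (_ `^ _)%E; apply: eq_integral => x _.
rewrite gee0_abs ?lee_fin ?normc_ge0// poweR_EFin powR_mulrn ?normc_ge0//.
by rewrite sqnE.
Qed.

Lemma L2P f : L2 mu f <-> cmeasurable f /\ rintegrable mu (fun x => sqn (f x)).
Proof.
rewrite /L2 cnorm2E; split => -[mf h]; split => //.
  apply/integrableP; split; first by apply/measurable_EFinP; exact: cmeasurable_sqn.
  under eq_integral do rewrite /= ger0_norm ?sqn_ge0//.
  by move: h; set I := (\int[mu]_x _)%E; case: I => //= r _; rewrite ltry.
have := integrable_fin_num measurableT h.
by case: (\int[mu]_x _)%E => //= r _; rewrite ltry.
Qed.

Lemma L2_cmeas f : L2 mu f -> cmeasurable f. Proof. by case. Qed.

(** The real Hilbert space underlying the complex one, so that the theory of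
    real semi-inner products applies. *)
Definition re_inner f g : R := \int[mu]_x Re ((f x)^* * g x).

Lemma re_innerE f g : re_inner f g = \int[mu]_x (Re (f x) * Re (g x) + Im (f x) * Im (g x)).
Proof. by apply: eq_Rintegral => x _; rewrite ReM ReJ ImJ mulNr opprK. Qed.

Lemma re_inner_sqn f : re_inner f f = \int[mu]_x sqn (f x).
Proof. by rewrite re_innerE; apply: eq_Rintegral => x _; rewrite /sqn !expr2. Qed.

Lemma L2_prod_int f g : L2 mu f -> L2 mu g -> cintegrable mu (fun x => (f x)^* * g x).
Proof.
move=> /L2P[mf jf] /L2P[mg ig].
have [m1 m2] := cmeasurableM (cmeasurableJ mf) mg.
have i : rintegrable mu (fun x => sqn (f x) + sqn (g x)) by exact: rintegrableD.
have b (a c : C) : `|Re a * Re c| + `|Im a * Im c| + `|Re a * Im c| + `|Im a * Re c| <= 2 * (sqn a + sqn c).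
  rewrite !normrM /sqn -(real_normK (num_real (Re a))) -(real_normK (num_real (Im a))).
  rewrite -(real_normK (num_real (Re c))) -(real_normK (num_real (Im c))).
  move: `|Re a| `|Im a| `|Re c| `|Im c| => x y z t.
  have := sqr_ge0 (x - z); have := sqr_ge0 (y - t); have := sqr_ge0 (x - t); have := sqr_ge0 (y - z).
  nra.
split; apply: (le_rintegrable _ _ (rintegrableZ 2 i)) => // x.
  rewrite ReM ReJ ImJ mulNr opprK; have := b (f x) (g x).
  have := ler_normD (Re (f x) * Re (g x)) (Im (f x) * Im (g x)).
  have := normr_ge0 (Re (f x) * Im (g x)); have := normr_ge0 (Im (f x) * Re (g x)); lra.
rewrite ImM ReJ ImJ mulNr; have := b (f x) (g x).
have := ler_normB (Re (f x) * Im (g x)) (Im (f x) * Re (g x)).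
have := normr_ge0 (Re (f x) * Re (g x)); have := normr_ge0 (Im (f x) * Im (g x)); lra.
Qed.

Lemma L2D f g : L2 mu f -> L2 mu g -> L2 mu (fun x => f x + g x).
Proof.
move=> /L2P[mf jf] /L2P[mg ig]; apply/L2P; split; first exact: cmeasurableD.
have i := rintegrableZ 2 (rintegrableD jf ig).
apply: (le_rintegrable _ _ i); first by apply: cmeasurable_sqn; exact: cmeasurableD.
by move=> x; rewrite ger0_norm ?sqn_ge0// (le_trans (sqnD _ _))// mulr_natl.
Qed.

Lemma L2Z a f : L2 mu f -> L2 mu (fun x => a * f x).
Proof.
move=> /L2P[mf jf]; apply/L2P; split.
  by apply: cmeasurableM => //; exact: cmeasurable_cst.
by under eq_fun do rewrite sqnM; exact: rintegrableZ.
Qed.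

Lemma L20 : L2 mu (fun=> 0).
Proof.
apply/L2P; split; first exact: cmeasurable_cst.
by under eq_fun do rewrite sqn0; exact: rintegrable0.
Qed.

Lemma L2N f : L2 mu f -> L2 mu (fun x => - f x).
Proof. by move=> /(L2Z (-1)); under eq_fun do rewrite mulN1r. Qed.

Lemma L2B f g : L2 mu f -> L2 mu g -> L2 mu (fun x => f x - g x).
Proof. by move=> hf hg; apply: L2D => //; exact: L2N. Qed.

Lemma L2_sum (I : Type) (s : seq I) (f : I -> T -> C) :
  (forall i, L2 mu (f i)) -> L2 mu (fun x => \sum_(i <- s) f i x).
Proof.
move=> mf; elim: s => [|i s IH].
  by under eq_fun do rewrite big_nil; exact: L20.
by under eq_fun do rewrite big_cons; exact: L2D.
Qed.

Definition rscale (a : R) (f : T -> C) : T -> C := fun x => a%:C%C * f x.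

Lemma L2_semi_inner : semi_inner (L2 mu : (T -> C) -> Prop) rscale re_inner.
Proof.
have iR f g : L2 mu f -> L2 mu g -> rintegrable mu (fun x => Re ((f x)^* * g x)).
  by move=> hf hg; case: (L2_prod_int hf hg).
split.
- exact: L20.
- by move=> f g hf hg; exact: L2D.
- by move=> f hf; exact: L2N.
- by move=> a f hf; exact: L2Z.
- move=> f g _ _; rewrite !re_innerE; apply: eq_Rintegral => x _; ring.
- move=> f g h hf hg hh; rewrite /re_inner -RintegralD//; [|exact: iR|exact: iR].
  by apply: eq_Rintegral => x _; rewrite rmorphD mulrDl ReD.
- move=> a f g hf hg; rewrite /re_inner -RintegralZl//; last exact: iR.
  by apply: eq_Rintegral => x _; rewrite !(ReM, ImM, ReJ, ImJ) /=; ring.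
- move=> f _; rewrite re_inner_sqn; apply: Rintegral_ge0 => x _; exact: sqn_ge0.
Qed.

Definition L2_norm f : R := nrm re_inner f.

Lemma cnorm2_L2 f : L2 mu f -> cnorm2 mu f = (L2_norm f)%:E.
Proof.
move=> /L2P[mf jf]; rewrite cnorm2E /L2_norm /nrm re_inner_sqn /Rintegral.
by have := integrable_fin_num measurableT jf; case: (\int[mu]_x _)%E.
Qed.

Lemma inner_cint f g : inner mu f g = cint mu (fun x => (f x)^* * g x).
Proof. by []. Qed.

Lemma Re_inner f g : Re (inner mu f g) = re_inner f g. Proof. by []. Qed.

Lemma inner_Zr a f g : L2 mu f -> L2 mu g -> inner mu f (fun x => a * g x) = a * inner mu f g.
Proof.
move=> hf hg; rewrite !inner_cint -cintZ; last exact: L2_prod_int.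
by apply: eq_cint => x; rewrite mulrCA.
Qed.

Lemma inner_Dr f g h : L2 mu f -> L2 mu g -> L2 mu h ->
  inner mu f (fun x => g x + h x) = inner mu f g + inner mu f h.
Proof.
move=> hf hg hh; rewrite !inner_cint -cintD; [|exact: L2_prod_int..].
by apply: eq_cint => x; rewrite mulrDr.
Qed.

Lemma inner_C f g : L2 mu f -> L2 mu g -> inner mu g f = (inner mu f g)^*.
Proof.
move=> hf hg; apply: complexRI; rewrite ?ReJ ?ImJ /=.
  by apply: eq_Rintegral => x _; rewrite !(ReM, ImM, ReJ, ImJ); ring.
have [_ i] := L2_prod_int hf hg.
rewrite -[RHS]mulN1r -RintegralZl//.
by apply: eq_Rintegral => x _; rewrite !(ReM, ImM, ReJ, ImJ); ring.
Qed.

Lemma inner_Dl f g h : L2 mu f -> L2 mu g -> L2 mu h ->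
  inner mu (fun x => g x + h x) f = inner mu g f + inner mu h f.
Proof.
move=> hf hg hh; rewrite (inner_C hf (L2D hg hh)) inner_Dr// rmorphD /=.
by rewrite -!inner_C.
Qed.

Lemma inner_Zl a f g : L2 mu f -> L2 mu g -> inner mu (fun x => a * g x) f = a^* * inner mu g f.
Proof.
move=> hf hg; rewrite (inner_C hf (L2Z a hg)) inner_Zr// rmorphM /=.
by rewrite -inner_C.
Qed.

Lemma Im_inner f g : L2 mu f -> L2 mu g -> Im (inner mu f g) = re_inner (fun x => 'i%C * f x) g.
Proof.
move=> hf hg; rewrite -Re_inner inner_Zl// ReM ReJ ImJ /=; ring.
Qed.

Lemma ae_sqn0 f : L2 mu f -> re_inner f f = 0 -> f = (fun=> 0) %[ae mu].
Proof.
move=> /L2P[mf jf] f0.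
have h : (\int[mu]_x `|(sqn (f x))%:E| = 0)%E.
  under eq_integral do rewrite gee0_abs ?lee_fin ?sqn_ge0//.
  move: f0; rewrite re_inner_sqn /Rintegral.
  by have := integrable_fin_num measurableT jf; case: (\int[mu]_x _)%E => //= r _ ->.
have := (ae_eq_integral_abs mu measurableT (measurable_int mu jf)).1 h.
apply: filterS => x /(_ Logic.I) /= [h'] _; exact: sqn_eq0.
Qed.

Lemma ae_L2_norm f : L2 mu f -> L2_norm f = 0 -> f = (fun=> 0) %[ae mu].
Proof.
move=> hf f0; apply: ae_sqn0 => //.
by have := nrm_sq L2_semi_inner hf; rewrite -/(L2_norm f) f0 expr0n.
Qed.

Lemma ae_cint f g : cmeasurable f -> cmeasurable g -> f = g %[ae mu] -> cint mu f = cint mu g.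
Proof.
move=> [f1 f2] [g1 g2] fg; congr (_ +i* _)%C; congr fine; apply: ae_eq_integral => //.
- exact/measurable_EFinP.
- exact/measurable_EFinP.
- by apply: filterS fg => x /(_ Logic.I) -> _.
- exact/measurable_EFinP.
- exact/measurable_EFinP.
- by apply: filterS fg => x /(_ Logic.I) -> _.
Qed.

Lemma ae_inner f f' g g' : L2 mu f -> L2 mu f' -> L2 mu g -> L2 mu g' ->
  f = f' %[ae mu] -> g = g' %[ae mu] -> inner mu f g = inner mu f' g'.
Proof.
move=> hf hf' hg hg' ff gg; rewrite !inner_cint; apply: ae_cint.
- by apply: cmeasurableM; [apply: cmeasurableJ|]; exact: L2_cmeas.
- by apply: cmeasurableM; [apply: cmeasurableJ|]; exact: L2_cmeas.
by apply: filterS2 ff gg => x + + _ => /(_ Logic.I) -> /(_ Logic.I) ->.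
Qed.

Lemma ae_cnorm2 f g : cmeasurable f -> cmeasurable g -> f = g %[ae mu] -> cnorm2 mu f = cnorm2 mu g.
Proof.
move=> mf mg fg; rewrite !cnorm2E; congr sqrte; apply: ge0_ae_eq_integral => //.
- by apply/measurable_EFinP; exact: cmeasurable_sqn.
- by apply/measurable_EFinP; exact: cmeasurable_sqn.
- by move=> x _; rewrite lee_fin sqn_ge0.
- by move=> x _; rewrite lee_fin sqn_ge0.
by apply: filterS fg => x /(_ Logic.I) -> _.
Qed.

End complex_L2.

(** * Bounded multipliers, completeness and finite families *)

Section complex_L2_estimates.
Context d (T : measurableType d) {R : realType} (mu : probability T R).
Local Notation C := R[i].
Local Notation Re := complex.Re.
Local Notation Im := complex.Im.
Implicit Types f g w : T -> C.

Lemma cmeasurable_normc f : cmeasurable f -> measurable_fun setT (fun x => Normc.normc (f x)).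
Proof.
move=> mf; under eq_fun do rewrite normcE.
by apply: measurableT_comp; [apply: continuous_measurable_fun; exact: sqrt_continuous|exact: cmeasurable_sqn].
Qed.

Lemma ae_le_L2 f g : cmeasurable f -> L2 mu g ->
  {ae mu, forall x, Normc.normc (f x) <= Normc.normc (g x)} ->
  L2 mu f /\ L2_norm mu f <= L2_norm mu g.
Proof.
move=> mf hg fg; have [mg _] := hg.
have le : (\int[mu]_x (sqn (f x))%:E <= \int[mu]_x (sqn (g x))%:E)%E.
  apply: ae_ge0_le_integral => //.
  - by move=> x _; rewrite lee_fin sqn_ge0.
  - by apply/measurable_EFinP; exact: cmeasurable_sqn.
  - by move=> x _; rewrite lee_fin sqn_ge0.
  - by apply/measurable_EFinP; exact: cmeasurable_sqn.
  apply: filterS fg => x fgx _; rewrite lee_fin -!sqnE ler_sqr ?nnegrE ?normc_ge0//.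
have [_ ig] := (L2P mu g).1 hg.
have hf : L2 mu f.
  apply/L2P; split => //; apply/integrableP; split.
    by apply/measurable_EFinP; exact: cmeasurable_sqn.
  under eq_integral do rewrite /= ger0_norm ?sqn_ge0//.
  by rewrite (le_lt_trans le)// EFin_Rint// ltry.
split => //; have [_ jf] := (L2P mu f).1 hf.
rewrite /L2_norm /nrm ler_wsqrtr// !re_inner_sqn -lee_fin -!EFin_Rint//.
Qed.

Lemma L2_normZ a f : L2 mu f -> L2_norm mu (fun x => a * f x) = Normc.normc a * L2_norm mu f.
Proof.
move=> hf; have [_ jf] := (L2P mu f).1 hf.
rewrite /L2_norm /nrm !re_inner_sqn; under eq_Rintegral do rewrite sqnM.
by rewrite RintegralZl// sqrtrM ?sqn_ge0// normcE.
Qed.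

Lemma L2M_bounded w f c : cmeasurable w -> 0 <= c -> {ae mu, forall x, Normc.normc (w x) <= c} ->
  L2 mu f -> L2 mu (fun x => w x * f x) /\ L2_norm mu (fun x => w x * f x) <= c * L2_norm mu f.
Proof.
move=> mw c0 wc hf; have [mf _] := hf.
have := L2_normZ (c%:C)%C hf; rewrite normcRC (ger0_norm c0) => <-.
apply: ae_le_L2; [exact: cmeasurableM|exact: L2Z|].
apply: filterS wc => x wx; rewrite !Normc.normcM normcRC (ger0_norm c0).
by rewrite ler_wpM2r ?normc_ge0.
Qed.

(** The positive part of [|f| - c] is at most [|f - g|], so that its norm is
    below every [e]. *)
Lemma ae_bound_closed f c : 0 <= c -> cmeasurable f ->
  (forall e, 0 < e -> exists g, [/\ cmeasurable g, {ae mu, forall x, Normc.normc (g x) <= c},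
    L2 mu (fun x => f x - g x) & L2_norm mu (fun x => f x - g x) < e]) ->
  {ae mu, forall x, Normc.normc (f x) <= c}.
Proof.
move=> c0 mf H.
pose h x : C := (Num.max (Normc.normc (f x) - c) 0)%:C%C.
have mh : cmeasurable h.
  split; last exact: measurable_cst.
  apply: measurable_maxr; last exact: measurable_cst.
  by apply: measurable_funB; [exact: cmeasurable_normc|exact: measurable_cst].
have key e : 0 < e -> L2 mu h /\ L2_norm mu h < e.
  move=> e0; have [g [mg gc hfg fge]] := H e e0.
  have [|h1 h2] := @ae_le_L2 h _ mh hfg.
    apply: filterS gc => x gx; rewrite normcRC ger0_norm; last by rewrite le_max lexx orbT.
    rewrite ge_max normc_ge0 andbT.
    have := normcD (f x - g x) (g x); rewrite subrK; lra.
  by split => //; exact: (le_lt_trans h2).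
have [hh _] := key 1 ltr01.
have h0 : L2_norm mu h = 0.
  apply/eqP; rewrite eq_le nrm_ge0 andbT; apply/ler_addgt0Pr => e e0.
  by rewrite add0r ltW//; case: (key e e0).
apply: filterS (ae_L2_norm hh h0) => x /(_ Logic.I) /(congr1 (@complex.Re R)) /= hx.
have : Normc.normc (f x) - c <= Num.max (Normc.normc (f x) - c) 0 by rewrite le_max lexx.
by rewrite hx subr_le0.
Qed.

(** By dominated convergence in [K]. *)
Lemma L2_tail f e : L2 mu f -> 0 < e -> exists K : nat,
  \int[mu]_x Num.max (sqn (f x) - K%:R) 0 <= e.
Proof.
move=> hf e0; have [mf jf] := (L2P mu f).1 hf.
pose k (n : nat) x := Num.max (sqn (f x) - n%:R) 0.
have k0 n x : 0 <= k n x by rewrite /k le_max lexx orbT.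
have mk n : measurable_fun setT (fun x => (k n x)%:E).
  apply/measurable_EFinP; apply: measurable_maxr; last exact: measurable_cst.
  by apply: measurable_funB; [exact: cmeasurable_sqn|exact: measurable_cst].
have kc : {ae mu, forall x, setT x -> (k n x)%:E @[n --> \oo] --> 0%E}.
  apply: aeW => x _; apply: cvg_EFin; first exact: nearW.
  have [N HN] : exists N : nat, sqn (f x) < N%:R.
    by exists (Num.truncn (sqn (f x))).+1; rewrite truncnS_gt.
  apply: cvg_near_cst; exists N => // n /= Nn.
  rewrite /k; apply/max_idPr; rewrite subr_le0 ltW// (lt_le_trans HN)//.
  by rewrite ler_nat.
have kd : {ae mu, forall x n, setT x -> (`|(k n x)%:E| <= (sqn (f x))%:E)%E}.
  apply: aeW => x n _; rewrite gee0_abs ?lee_fin//.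
  by rewrite /k ge_max sqn_ge0 andbT lerBlDr lerDl.
have [_ _ H] := dominated_convergence measurableT mk (measurable_cst 0%E) kc jf kd.
have H' : \int[mu]_x k n x @[n --> \oo] --> 0.
  have -> : 0 = fine (\int[mu]_x 0%E) by rewrite integral0.
  by apply: fine_cvg; rewrite fineK; [exact: H|rewrite integral0].
have [N _ HN] := cvgr_le _ H' _ e0.
by exists N; exact: (HN N (leqnn N)).
Qed.

(** Split [|f|^2] at a height [K]: below it, [w f] is small because [w] is
    small in mean square; the excess over [K] has small integral and [w] is
    bounded there. *)
Lemma small_multiplier f c e : 0 <= c -> L2 mu f -> 0 < e -> exists2 dl : R, 0 < dl &
  forall w, cmeasurable w -> {ae mu, forall x, Normc.normc (w x) <= c} -> L2 mu w ->
    L2_norm mu w < dl -> L2_norm mu (fun x => w x * f x) < e.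
Proof.
move=> c0 hf e0; have [mf jf] := (L2P mu f).1 hf.
have t0 : 0 < e ^+ 2 / 2 / (c ^+ 2 + 1) by rewrite !divr_gt0// ?exprn_gt0// ltr_wpDl// sqr_ge0.
have [K HK] := L2_tail hf t0.
have d0 : 0 < e ^+ 2 / 2 / K.+1%:R by rewrite !divr_gt0// exprn_gt0.
exists (Num.sqrt (e ^+ 2 / 2 / K.+1%:R)); first by rewrite sqrtr_gt0.
move=> w mw wc hw wd.
have [hwf _] := L2M_bounded mw c0 wc hf.
apply: (nrm_lt (L2_semi_inner mu) hwf e0).
have [_ jw] := (L2P mu w).1 hw; have [_ jwf] := (L2P mu _).1 hwf.
pose k x := Num.max (sqn (f x) - K%:R) 0.
have mk : measurable_fun setT k.
  apply: measurable_maxr; last exact: measurable_cst.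
  by apply: measurable_funB; [exact: cmeasurable_sqn|exact: measurable_cst].
have k0 x : 0 <= k x by rewrite /k le_max lexx orbT.
have ik : rintegrable mu k.
  apply: (le_rintegrable mk _ jf) => x; rewrite ger0_norm//.
  by rewrite /k ge_max sqn_ge0 andbT lerBlDr lerDl.
have iS : rintegrable mu (fun x => K%:R * sqn (w x) + c ^+ 2 * k x).
  by apply: rintegrableD; exact: rintegrableZ.
have le : \int[mu]_x sqn (w x * f x) <= \int[mu]_x (K%:R * sqn (w x) + c ^+ 2 * k x).
  rewrite -lee_fin -(EFin_Rint jwf) -(EFin_Rint iS); apply: ae_ge0_le_integral => //.
  - by move=> x _; rewrite lee_fin sqn_ge0.
  - by apply/measurable_EFinP; exact: rintegrable_measurable jwf.
  - by move=> x _; rewrite lee_fin addr_ge0// mulr_ge0 ?sqn_ge0 ?sqr_ge0.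
  - by apply/measurable_EFinP; exact: rintegrable_measurable iS.
  apply: filterS wc => x wx _; rewrite lee_fin sqnM.
  have wx2 : sqn (w x) <= c ^+ 2 by rewrite -sqnE ler_sqr ?nnegrE ?normc_ge0.
  have h1 : sqn (f x) <= K%:R + k x by rewrite -lerBlDl /k le_max lexx.
  have := sqn_ge0 (w x) => h2.
  apply: (@le_trans _ _ (sqn (w x) * (K%:R + k x))); first by rewrite ler_wpM2l.
  by rewrite mulrDr [_ * K%:R]mulrC lerD2l ler_wpM2r.
rewrite re_inner_sqn (le_lt_trans le)// RintegralD//; [|exact: rintegrableZ|exact: rintegrableZ].
rewrite !RintegralZl//.
have hw2 : \int[mu]_x sqn (w x) < e ^+ 2 / 2 / K.+1%:R.
  rewrite -re_inner_sqn -(nrm_sq (L2_semi_inner mu) hw) -/(L2_norm mu w).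
  rewrite -[ltRHS]sqr_sqrtr ?ltW// ltr_sqr ?nnegrE ?nrm_ge0 ?sqrtr_ge0//.
have iw0 : 0 <= \int[mu]_x sqn (w x) by apply: Rintegral_ge0 => x _; exact: sqn_ge0.
have a1 : K%:R * \int[mu]_x sqn (w x) < e ^+ 2 / 2.
  move: hw2; rewrite ltr_pdivlMr// mulrC; apply: le_lt_trans.
  by rewrite ler_wpM2r// ler_nat.
have a2 : c ^+ 2 * \int[mu]_x k x <= e ^+ 2 / 2.
  move: HK; rewrite -/k ler_pdivlMr; last by rewrite ltr_wpDl// sqr_ge0.
  apply: le_trans; rewrite mulrC ler_wpM2l ?lerDl//.
  by apply: Rintegral_ge0 => x _; exact: k0.
by rewrite [ltRHS]splitr; exact: ltr_leD.
Qed.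

End complex_L2_estimates.

Lemma eventually_fin (J : finType) (P : J -> nat -> Prop) :
  (forall j, exists N, forall n, (N <= n)%N -> P j n) ->
  exists N, forall n, (N <= n)%N -> forall j, P j n.
Proof.
move=> /choice[N HN]; exists (\max_j N j) => n Nn j; apply: HN.
by apply: leq_trans Nn; exact: leq_bigmax.
Qed.

Section complex_L2_complete.
Context d (T : measurableType d) {R : realType} (mu : probability T R).
Local Notation C := R[i].
Local Notation Re := complex.Re.
Local Notation Im := complex.Im.
Implicit Types f g w : T -> C.

Lemma L2_real_L2 f : L2 mu f <-> real_L2 mu (fun x => Re (f x)) /\ real_L2 mu (fun x => Im (f x)).
Proof.
split=> [/L2P[mf jf]|[[m1 i1] [m2 i2]]].
  have [m1 m2] := mf.
  split; split => //; apply: (le_rintegrable _ _ jf) => //; try exact: measurable_funX.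
    by move=> x; rewrite ger0_norm ?sqr_ge0// lerDl sqr_ge0.
  by move=> x; rewrite ger0_norm ?sqr_ge0// lerDr sqr_ge0.
by apply/L2P; split => //; exact: rintegrableD.
Qed.

Lemma re_inner_parts f : L2 mu f -> re_inner mu f f = \int[mu]_x (Re (f x) ^+ 2) + \int[mu]_x (Im (f x) ^+ 2).
Proof. by move=> /L2_real_L2[[m1 i1] [m2 i2]]; rewrite re_inner_sqn -RintegralD. Qed.

Lemma bounded_L2 f c : cmeasurable f -> (forall x, Normc.normc (f x) <= c) -> L2 mu f.
Proof.
move=> mf fc; apply/L2P; split => //.
apply: (@bounded_rintegrable _ _ _ mu _ (c ^+ 2)); first exact: cmeasurable_sqn.
move=> x; rewrite ger0_norm ?sqn_ge0// -sqnE ler_sqr ?nnegrE ?normc_ge0//.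
by rewrite (le_trans _ (fc x))// normc_ge0.
Qed.

Lemma L2_complete : si_complete (L2 mu) (re_inner mu).
Proof.
move=> u hu cu.
have H (p : C -> R) : (forall f, L2 mu f -> real_L2 mu (fun x => p (f x))) ->
    (forall a b, p (a - b) = p a - p b) ->
    (forall f, L2 mu f -> \int[mu]_x (p (f x) ^+ 2) <= re_inner mu f f) ->
    exists2 l, real_L2 mu l & forall e, 0 < e -> exists N, forall n, (N <= n)%N ->
      \int[mu]_x ((p (u n x) - l x) ^+ 2) <= e.
  move=> p1 p2 p3; apply: (@riesz_fischer _ _ _ mu (fun n x => p (u n x))); first by move=> n; exact: p1.
  move=> e e0; have [|N HN] := cu (Num.sqrt e); first by rewrite sqrtr_gt0.
  exists N => n m Nn Nm; have := HN n m Nn Nm.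
  have hb := L2B (hu n) (hu m).
  rewrite -ltr_sqr ?nnegrE ?nrm_ge0 ?sqrtr_ge0//.
  rewrite (nrm_sq (L2_semi_inner mu) (hb : L2 mu (u n - u m))).
  rewrite (sqr_sqrtr (ltW e0)) => /ltW; apply: le_trans; apply: le_trans (p3 _ hb).
  by rewrite le_eqVlt; apply/orP; left; apply/eqP; apply: eq_Rintegral => x _; rewrite p2.
have [l1 hl1 Hl1] : exists2 l, real_L2 mu l & forall e, 0 < e -> exists N, forall n, (N <= n)%N ->
      \int[mu]_x ((Re (u n x) - l x) ^+ 2) <= e.
  apply: H; [by move=> f /L2_real_L2[]|exact: ReB|].
  by move=> f hf; rewrite re_inner_parts// lerDl; apply: Rintegral_ge0 => x _; exact: sqr_ge0.
have [l2 hl2 Hl2] : exists2 l, real_L2 mu l & forall e, 0 < e -> exists N, forall n, (N <= n)%N ->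
      \int[mu]_x ((Im (u n x) - l x) ^+ 2) <= e.
  apply: H; [by move=> f /L2_real_L2[]|exact: ImB|].
  by move=> f hf; rewrite re_inner_parts// lerDr; apply: Rintegral_ge0 => x _; exact: sqr_ge0.
have hl : L2 mu (fun x => (l1 x +i* l2 x)%C) by apply/L2_real_L2.
exists (fun x => (l1 x +i* l2 x)%C) => //.
move=> e e0; have e40 : 0 < e ^+ 2 / 4 by rewrite divr_gt0// exprn_gt0.
have [N1 HN1] := Hl1 _ e40; have [N2 HN2] := Hl2 _ e40.
exists (maxn N1 N2) => n; rewrite geq_max => /andP[nN1 nN2].
have hb := L2B (hu n) hl.
apply: (nrm_lt (L2_semi_inner mu) hb e0); rewrite (re_inner_parts hb).
have -> : \int[mu]_x (Re (u n x - (l1 x +i* l2 x)%C) ^+ 2) = \int[mu]_x ((Re (u n x) - l1 x) ^+ 2).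
  by apply: eq_Rintegral => x _; rewrite ReB.
have -> : \int[mu]_x (Im (u n x - (l1 x +i* l2 x)%C) ^+ 2) = \int[mu]_x ((Im (u n x) - l2 x) ^+ 2).
  by apply: eq_Rintegral => x _; rewrite ImB.
have := HN1 n nN1; have := HN2 n nN2; have : 0 < e ^+ 2 by rewrite exprn_gt0.
lra.
Qed.

End complex_L2_complete.

Section families.
Context d (T : measurableType d) {R : realType} (mu : probability T R) (k : nat).
Local Notation C := R[i].
Implicit Types f g : 'I_k -> T -> C.

Definition L2_fam f : Prop := forall i, L2 mu (f i).
Definition fam_inner f g : R := \sum_i re_inner mu (f i) (g i).
Definition fam_rscale (a : R) f : 'I_k -> T -> C := fun i => rscale a (f i).
Definition fam_norm f : R := nrm fam_inner f.

Lemma L2_fam_semi_inner : semi_inner L2_fam fam_rscale fam_inner.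
Proof.
have H := L2_semi_inner mu; split.
- by move=> i; exact: (si0 H).
- by move=> f g hf hg i; exact: (siD H).
- by move=> f hf i; exact: (siN H).
- by move=> a f hf i; exact: (siZ H).
- by move=> f g hf hg; apply: eq_bigr => i _; exact: (qC H).
- by move=> f g h hf hg hh; rewrite /fam_inner -big_split; apply: eq_bigr => i _; exact: (qD H).
- by move=> a f h hf hh; rewrite /fam_inner mulr_sumr; apply: eq_bigr => i _; exact: (qZ H).
- by move=> f hf; apply: sumr_ge0 => i _; exact: (qge0 H).
Qed.

Lemma L2_norm_le_fam_norm f i : L2_fam f -> L2_norm mu (f i) <= fam_norm f.
Proof.
move=> hf; rewrite /L2_norm /fam_norm /nrm ler_wsqrtr// /fam_inner (bigD1 i)//= lerDl.
by apply: sumr_ge0 => j _; exact: (qge0 (L2_semi_inner mu)).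
Qed.

Lemma fam_norm_le_sum f : L2_fam f -> fam_norm f <= \sum_i L2_norm mu (f i).
Proof.
move=> hf; have s0 : 0 <= \sum_i L2_norm mu (f i) by apply: sumr_ge0 => i _; exact: nrm_ge0.
rewrite -ler_sqr ?nnegrE ?nrm_ge0// (nrm_sq L2_fam_semi_inner)// expr2 mulr_suml.
apply: ler_sum => i _; rewrite -(nrm_sq (L2_semi_inner mu))// expr2 ler_wpM2l ?nrm_ge0//.
by rewrite (bigD1 i)//= lerDl sumr_ge0// => j _; exact: nrm_ge0.
Qed.

Lemma fam_norm_small f e : 0 < e -> L2_fam f -> (forall i, L2_norm mu (f i) < e / k.+1%:R) -> fam_norm f < e.
Proof.
move=> e0 hf fe; apply: (le_lt_trans (fam_norm_le_sum hf)).
apply: (@le_lt_trans _ _ (\sum_(i < k) e / k.+1%:R)); first by apply: ler_sum => i _; exact: ltW.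
by rewrite sumr_const card_ord -[_ *+ _]mulr_natl mulrCA gtr_pMr// ltr_pdivrMr// mul1r ltr_nat.
Qed.

Lemma L2_fam_complete : si_complete L2_fam fam_inner.
Proof.
move=> u hu cu.
have /choice[l Hl] : forall i, exists l, L2 mu l /\ forall e, 0 < e -> exists N, forall n, (N <= n)%N ->
    nrm (re_inner mu) (u n i - l) < e.
  move=> i; have [] := @L2_complete _ _ _ mu (fun n => u n i).
  - by move=> n; exact: hu.
  - move=> e e0; have [N HN] := cu e e0; exists N => n m Nn Nm.
    apply: le_lt_trans (HN n m Nn Nm); have := @L2_norm_le_fam_norm (u n - u m) i; apply.
    exact: (siB L2_fam_semi_inner).
  by move=> l hl Hl; exists l.
have hl : L2_fam l by move=> i; case: (Hl i).
exists l => // e e0.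
have e1 : 0 < e / k.+1%:R by rewrite divr_gt0.
have [N HN] := @eventually_fin 'I_k (fun i n => nrm (re_inner mu) (u n i - l i) < e / k.+1%:R)
  (fun i => (Hl i).2 _ e1).
exists N => n Nn; apply: fam_norm_small => //; first exact: (siB L2_fam_semi_inner).
by move=> i; exact: HN.
Qed.

End families.

(** * Continuity in measure of the flow *)

Section Rintegral_linear.
Context d (T : measurableType d) {R : realType} (mu : {measure set T -> \bar R}).
Implicit Types f g : T -> R.

Lemma RintZ a f : rintegrable mu f -> \int[mu]_x (a * f x) = a * \int[mu]_x f x.
Proof. by move=> i; rewrite RintegralZl. Qed.
Lemma RintD f g : rintegrable mu f -> rintegrable mu g ->
  \int[mu]_x (f x + g x) = \int[mu]_x f x + \int[mu]_x g x.
Proof. by move=> i j; rewrite RintegralD. Qed.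
Lemma RintB f g : rintegrable mu f -> rintegrable mu g ->
  \int[mu]_x (f x - g x) = \int[mu]_x f x - \int[mu]_x g x.
Proof. by move=> i j; rewrite RintegralB. Qed.

End Rintegral_linear.

Section lebesgue_translation.
Context {R : realType}.
Local Notation leb := (@lebesgue_measure R).

Lemma measurable_shift (t : R) :
  measurable_fun setT ((fun s : R => s + t) : measurableTypeR R -> measurableTypeR R).
Proof. by apply: measurable_funD => //; exact: measurable_cst. Qed.

Lemma lebesgue_translation (t : R) (A : set (measurableTypeR R)) : measurable A ->
  leb ((fun s : measurableTypeR R => (s + t : measurableTypeR R)) @^-1` A) = leb A.
Proof.
move=> mA; apply/esym.
pose h : {mfun measurableTypeR R >-> measurableTypeR R} :=
  HB.pack ((fun s : R => s + t) : measurableTypeR R -> measurableTypeR R)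
    (isMeasurableFun.Build _ _ _ _ _ (measurable_shift t)).
rewrite (@lebesgue_measure_unique R (pushforward leb h) _ A mA)//.
move=> _ [[a b] _ <-] /=; rewrite /pushforward.
have -> : h @^-1` `]a, b] = `]a - t, b - t]%classic.
  by apply/seteqP; split=> s /=; rewrite !in_itv /= ltrBlDr lerBrDr.
rewrite !lebesgue_measure_itv /= !lte_fin ltrD2r.
by case: ifP => // _; rewrite -!EFinB; congr EFin; ring.
Qed.

End lebesgue_translation.

Section flow.
Context {R : realType} {n : nat} {X : manifoldType R n}.
Variables (mu : probability (borel X) R) (F : R -> X -> X).
Hypotheses (FC1 : C1_flow F) (Fmu : measure_preserving_flow mu F).
Local Notation C := R[i].

Lemma flow0 x : F 0 x = x. Proof. by case: FC1. Qed.
Lemma flowD s t x : F (s + t) x = F s (F t x). Proof. by case: FC1. Qed.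
Lemma flowK t : cancel (F t) (F (- t)).
Proof. by move=> x; rewrite -flowD addNr flow0. Qed.

Lemma flow_joint_continuous : continuous (fun z : R * X => F z.1 z.2).
Proof. by case: FC1. Qed.

Lemma flow_continuous t : continuous (F t).
Proof.
move=> x.
have H : (fun x : X => (t, x)) @ x --> (t, x).
  exact: (@cvg_pair _ _ _ (nbhs x) (nbhs t) (nbhs x) _ _ _ (fun=> t) id (cvg_cst t) cvg_id).
exact: (cvg_comp _ _ H (@flow_joint_continuous (t, x))).
Qed.

Lemma flow_orbit_continuous x : continuous (fun t => F t x).
Proof.
move=> t.
have H : (fun t : R => (t, x)) @ t --> (t, x).
  exact: (@cvg_pair _ _ _ (nbhs t) (nbhs t) (nbhs x) _ _ _ id (fun=> x) cvg_id (cvg_cst x)).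
exact: (cvg_comp _ _ H (@flow_joint_continuous (t, x))).
Qed.

Lemma flow_measurable t : measurable_fun setT (F t : borel X -> borel X).
Proof. by apply: continuous_borel; exact: flow_continuous. Qed.

Lemma flow_joint_measurable :
  measurable_fun setT ((fun z => F z.1 z.2) : measurableTypeR R * borel X -> borel X).
Proof.
apply: borel_measurable_fun => U oU.
have := @open_prod_measurable _ _ (measurableTypeR R) (borel X) R X id id
  (@manifold_second_countable R n X) (fun U oU => open_measurable oU)
  (fun U oU => open_borel oU) ((fun z : R * X => F z.1 z.2) @^-1` U).
by apply; move: flow_joint_continuous => /continuousP; exact.
Qed.

(** Also a mean square, as a difference of indicators takes the values -1, 0
    and 1. *)
Definition displacement (A : set (borel X)) (t : R) : R :=
  \int[mu]_x `|\1_A (F t x) - \1_A x|.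

Definition flow_continuous_set (A : set (borel X)) : Prop :=
  forall e, 0 < e -> exists2 dl : R, 0 < dl & forall t, `|t| < dl -> displacement A t < e.

Lemma measurable_indic_flow (A : set (borel X)) t : measurable A ->
  measurable_fun setT (fun x : borel X => (\1_A (F t x) : R)).
Proof.
move=> mA; apply: (measurableT_comp (f := (\1_A : borel X -> R))); last exact: flow_measurable.
exact: measurable_indic.
Qed.

Lemma displacement_measurable (A : set (borel X)) t : measurable A ->
  measurable_fun setT (fun x : borel X => `|\1_A (F t x) - \1_A x : R|).
Proof.
move=> mA; apply: measurableT_comp => //; apply: measurable_funB; first exact: measurable_indic_flow.
exact: measurable_indic.
Qed.

Lemma indic_cases (A : set (borel X)) x : (\1_A x : R) = 0 \/ (\1_A x : R) = 1.
Proof. by rewrite indicE; case: (x \in A); [right|left]. Qed.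

Lemma displacement_le1 A t x : `|\1_A (F t x) - \1_A x : R| <= 1.
Proof.
by have [->|->] := indic_cases A (F t x); have [->|->] := indic_cases A x;
  rewrite ?subrr ?subr0 ?sub0r ?normrN ?normr1 ?normr0.
Qed.

Lemma displacement_integrable (A : set (borel X)) t : measurable A ->
  rintegrable mu (fun x => `|\1_A (F t x) - \1_A x|).
Proof.
move=> mA; apply: (@bounded_rintegrable _ _ _ mu _ 1); first exact: displacement_measurable.
by move=> x; rewrite normr_id displacement_le1.
Qed.

Lemma indic_integrable (A : set (borel X)) : measurable A -> rintegrable mu (\1_A : borel X -> R).
Proof.
move=> mA; apply: (@bounded_rintegrable _ _ _ mu _ 1); first exact: measurable_indic.
by move=> x; have [->|->] := indic_cases A x; rewrite ?normr1 ?normr0.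
Qed.

Lemma indic_flow_integrable (A : set (borel X)) t : measurable A -> rintegrable mu (fun x => \1_A (F t x)).
Proof.
move=> mA; apply: (@bounded_rintegrable _ _ _ mu _ 1); first exact: measurable_indic_flow.
by move=> x; have [->|->] := indic_cases A (F t x); rewrite ?normr1 ?normr0.
Qed.

Lemma indic_flow_int (A : set (borel X)) t : measurable A -> \int[mu]_x \1_A (F t x) = \int[mu]_x (\1_A x : R).
Proof.
by move=> mA; apply: (Rintegral_mp (flow_measurable t) (Fmu t)); exact: measurable_indic.
Qed.

(** Lower semicontinuity bounds the loss of an open set along the flow, and
    measure preservation makes the gain equal to the loss. *)
Lemma open_flow_continuous (U : set (borel X)) : open (U : set X) -> flow_continuous_set U.
Proof.
move=> oU e e0; have mU : measurable (U : set (borel X)) by exact: open_borel.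
apply: contrapT => H.
have /choice[s Hs] : forall k : nat, exists t, `|t| < k.+1%:R^-1 /\ e <= displacement U t.
  move=> k; apply: contrapT => H2; apply: H; exists k.+1%:R^-1; first by rewrite invr_gt0.
  by move=> t tk; rewrite ltNge; apply/negP => h; apply: H2; exists t.
pose l k (x : borel X) : R := Num.max (\1_U x - \1_U (F (s k) x)) 0.
have ml k : measurable_fun setT (l k : borel X -> R).
  apply: measurable_maxr; last exact: measurable_cst.
  by apply: measurable_funB; [exact: measurable_indic|exact: measurable_indic_flow].
have l1 k x : `|l k x| <= 1.
  rewrite /l; have [->|->] := indic_cases U (F (s k) x); have [->|->] := indic_cases U x;
  rewrite ?subrr ?subr0 ?sub0r ?maxxx ?normr0//.
    by rewrite (max_idPl _)// normr1.
  by rewrite (max_idPr _) ?normr0// oppr_le0.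
have s0 : s k @[k --> \oo] --> 0.
  apply/cvgrPdist_lt => t t0; have [N HN] := harmonic_small t0.
  exists N => // k /= Nk; rewrite sub0r normrN.
  by apply: lt_trans (HN k Nk); case: (Hs k).
have l0 x : l k x @[k --> \oo] --> 0.
  have [Ux|Ux] := pselect (U x); last first.
    apply: cvg_near_cst; apply: nearW => k; rewrite /l [\1_U x]indicE memNset// sub0r.
    by apply/max_idPr; rewrite oppr_le0; have [->|->] := indic_cases U (F (s k) x).
  have c : F (s k) x @[k --> \oo] --> x.
    by have := cvg_comp _ _ s0 (@flow_orbit_continuous x 0); rewrite flow0; exact.
  have : \forall k \near \oo, U (F (s k) x) by apply: c; exact: open_nbhs_nbhs.
  move=> near_U; apply: cvg_near_cst; apply: filterS near_U => k Uk.
  by rewrite /l !indicE !mem_set// subrr maxxx.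
have il k : rintegrable mu (l k) by exact: bounded_rintegrable (ml k) (l1 k).
have E k : displacement U (s k) = 2 * \int[mu]_x l k x.
  have iD : rintegrable mu (fun x => \1_U x - \1_U (F (s k) x)).
    by apply: rintegrableB; [exact: indic_integrable|exact: indic_flow_integrable].
  have -> : 2 * \int[mu]_x l k x = \int[mu]_x (2 * l k x) - \int[mu]_x (\1_U x - \1_U (F (s k) x)).
    have -> : \int[mu]_x (\1_U x - \1_U (F (s k) x)) = 0.
      have E0 := RintB (indic_integrable mU) (indic_flow_integrable (s k) mU).
      by rewrite [LHS]E0 indic_flow_int// subrr.
    by rewrite subr0 (RintZ 2 (il k)).
  rewrite -RintegralB//; last exact: rintegrableZ.
  apply: eq_Rintegral => x _; rewrite /l.
  have [->|->] := indic_cases U (F (s k) x); have [->|->] := indic_cases U x;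
    rewrite ?subrr ?subr0 ?sub0r ?maxxx ?normr0 ?mulr0 ?normr1 ?normrN ?normr1 ?opprK ?subr0//.
    by rewrite (max_idPl _)//; ring.
  by rewrite (max_idPr _) ?oppr_le0//; ring.
have [N _ HN] := cvgr_lt _ (bounded_cvg_Rintegral mu ml l1 l0) (e / 2) (divr_gt0 e0 (ltr0Sn R 1)).
have [_] := Hs N; rewrite E; have := HN N (leqnn N); lra.
Qed.

Lemma displacementC A t : displacement (~` A) t = displacement A t.
Proof.
apply: eq_Rintegral => x _; rewrite !indicE !in_setC.
by case: (x \in A); case: (F t x \in A); rewrite /= ?subrr ?subr0 ?sub0r ?normrN.
Qed.

Lemma displacementU A B t : measurable A -> measurable B ->
  displacement (A `|` B) t <= displacement A t + displacement B t.
Proof.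
move=> mA mB; rewrite -RintegralD//; [|exact: displacement_integrable..].
apply: le_Rintegral => //.
- by apply: displacement_integrable; exact: measurableU.
- by apply: rintegrableD; exact: displacement_integrable.
move=> x _; rewrite !indicE !in_setU.
by case: (x \in A); case: (F t x \in A); case: (x \in B); case: (F t x \in B);
  rewrite /= ?subrr ?subr0 ?sub0r ?normrN ?normr1 ?normr0 ?addr0 ?add0r ?lerDl.
Qed.

Lemma displacement_approx A B t : measurable A -> measurable B -> B `<=` A ->
  displacement A t <= displacement B t + 2 * \int[mu]_x \1_(A `\` B) x.
Proof.
move=> mA mB BA; have mD : measurable (A `\` B) by exact: measurableD.
have -> : 2 * \int[mu]_x \1_(A `\` B) x =
    \int[mu]_x \1_(A `\` B) (F t x) + \int[mu]_x (\1_(A `\` B) x : R).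
  by rewrite indic_flow_int//; ring.
have i1 := displacement_integrable t mA; have i2 := displacement_integrable t mB.
have i3 := indic_integrable mD; have i4 := indic_flow_integrable t mD.
rewrite -RintegralD// -RintegralD//; last exact: rintegrableD.
apply: le_Rintegral => //; first by apply: rintegrableD => //; exact: rintegrableD.
move=> x _; rewrite !indicE !in_setD.
have h y : y \in B -> y \in A by rewrite !inE; exact: BA.
have := h x; have := h (F t x).
by case: (x \in A); case: (F t x \in A); case: (x \in B); case: (F t x \in B) => h1 h2;
  rewrite /= ?subrr ?subr0 ?sub0r ?normrN ?normr1 ?normr0 ?addr0 ?add0r ?lerDl ?lerDr//;
  move: (h1 isT) (h2 isT).
Qed.

(** These sets form a sigma-algebra: a complement has the same displacement,
    and a countable union is approximated in measure by finite unions,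
    uniformly in time since the flow preserves the measure. *)
Lemma borel_flow_continuous (A : set (borel X)) : measurable A -> flow_continuous_set A.
Proof.
pose P := [set A : set (borel X) | measurable A /\ flow_continuous_set A].
suff H : measurable `<=` P by move=> /H[].
apply: smallest_sub; last by move=> U oU; split; [exact: open_borel|exact: open_flow_continuous].
split.
- split; first exact: measurable0.
  move=> e e0; exists 1 => // t _; rewrite /displacement.
  by under eq_Rintegral do rewrite !indicE !in_set0 subrr normr0; rewrite /Rintegral integral0.
- move=> E [mE cE]; rewrite setTD; split; first exact: measurableC.
  move=> e e0; have [dl dl0 H] := cE e e0; exists dl => // t td.
  by rewrite displacementC H.
move=> {}A HA; have mA k : measurable (A k : set (borel X)) by case: (HA k).
have mU : measurable (\bigcup_k A k : set (borel X)) by exact: bigcupT_measurable.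
split => // e e0.
pose B k : set (borel X) := \big[setU/set0]_(i < k) A i.
have mB k : measurable (B k) by apply: bigsetU_measurable.
have BA k : B k `<=` \bigcup_k A k by rewrite /B -bigcup_mkord => x [i _ Aix]; exists i.
have cB k : flow_continuous_set (B k).
  elim: k => [|k IH] a a0.
    exists 1 => // t _; rewrite /B big_ord0 /displacement.
    by under eq_Rintegral do rewrite !indicE !in_set0 subrr normr0; rewrite /Rintegral integral0.
  have a20 : 0 < a / 2 by rewrite divr_gt0.
  have [d1 d10 H1] := IH _ a20; have [d2 d20 H2] := (HA k).2 _ a20.
  exists (Num.min d1 d2); first by rewrite lt_min d10.
  move=> t; rewrite lt_min => /andP[t1 t2].
  rewrite /B big_ord_recr /= (le_lt_trans (displacementU _ (mB k) (mA k)))//.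
  have := H1 t t1; have := H2 t t2; lra.
have c0 : \int[mu]_x (\1_(\bigcup_k A k `\` B m) x : R) @[m --> \oo] --> 0.
  apply: (@bounded_cvg_Rintegral _ _ _ mu _ 1).
  - by move=> m; apply: measurable_indic; exact: measurableD.
  - by move=> m x; have [->|->] := indic_cases (\bigcup_k A k `\` B m) x; rewrite ?normr1 ?normr0.
  move=> x; have [[i _ Aix]|Ax] := pselect ((\bigcup_k A k) x).
    apply: cvg_near_cst; exists i.+1 => // m /= im.
    rewrite indicE memNset// => -[_]; apply; rewrite /B -bigcup_mkord.
    by exists i.
  by apply: cvg_near_cst; apply: nearW => m; rewrite indicE memNset// => -[].
have e40 : 0 < e / 4 by rewrite divr_gt0.
have [m _ Hm] := cvgr_lt _ c0 _ e40; have {Hm} := Hm m (leqnn m) => /= Hm.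
have e20 : 0 < e / 2 by rewrite divr_gt0.
have [dl dl0 H] := cB m _ e20; exists dl => // t td.
rewrite (le_lt_trans (displacement_approx _ mU (mB m) (BA m)))//.
have := H t td; lra.
Qed.

End flow.

(** * The generator of the flow *)

Lemma ae_imp2 d (T : measurableType d) (R : realType) (mu : {measure set T -> \bar R})
    (P Q S : T -> Prop) : {ae mu, forall x, P x} -> {ae mu, forall x, Q x} ->
  (forall x, P x -> Q x -> S x) -> {ae mu, forall x, S x}.
Proof. by move=> hP hQ H; apply: filterS2 hP hQ. Qed.

Lemma ae_imp d (T : measurableType d) (R : realType) (mu : {measure set T -> \bar R})
    (P S : T -> Prop) : {ae mu, forall x, P x} ->
  (forall x, P x -> S x) -> {ae mu, forall x, S x}.
Proof. by move=> hP H; apply: filterS hP. Qed.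

Lemma limit_of_shift {R : realType} (a b : nat -> R) (l c : R) :
  a k @[k --> \oo] --> l -> b k @[k --> \oo] --> 0 -> (forall k, b k = a k - c) -> l = c.
Proof.
move=> al b0 /funext E; apply/eqP; rewrite -subr_eq0; apply/eqP.
have : b k @[k --> \oo] --> l - c by rewrite E; apply: cvgB => //; exact: cvg_cst.
by move=> h; rewrite -(cvg_lim _ h)// (cvg_lim _ b0).
Qed.

Section measure_preserving_L2.
Context d (T : measurableType d) {R : realType} (mu : {measure set T -> \bar R}).
Variable h : T -> T.
Hypothesis mh : measurable_fun setT h.
Hypothesis muh : forall A, measurable A -> mu (h @^-1` A) = mu A.
Local Notation C := R[i].
Implicit Types f g : T -> C.

Lemma L2_mp f : L2 mu f -> L2 mu (fun x => f (h x)).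
Proof.
move=> /L2P[mf jf]; apply/L2P; split; first exact: cmeasurable_comp.
exact: (integrable_mp mh muh jf).
Qed.

Lemma re_inner_mp f g : L2 mu f -> L2 mu g -> re_inner mu (fun x => f (h x)) (fun x => g (h x)) = re_inner mu f g.
Proof.
move=> [mf _] [mg _].
apply: (Rintegral_mp mh muh (f := fun x => complex.Re ((f x)^* * g x))).
by have [] := cmeasurableM (cmeasurableJ mf) mg.
Qed.

Lemma L2_norm_mp f : L2 mu f -> L2_norm mu (fun x => f (h x)) = L2_norm mu f.
Proof. by move=> hf; rewrite /L2_norm /nrm re_inner_mp. Qed.

Lemma inner_mp f g : L2 mu f -> L2 mu g ->
  inner mu (fun x => f (h x)) (fun x => g (h x)) = inner mu f g.
Proof.
move=> hf hg; apply: complexRI; first by rewrite !Re_inner re_inner_mp.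
rewrite !Im_inner//; [|exact: L2_mp|exact: L2_mp].
exact: (re_inner_mp (L2Z 'i%C hf) hg).
Qed.

End measure_preserving_L2.

Section generator.
Context {R : realType} {n : nat} {X : manifoldType R n}.
Variables (mu : probability (borel X) R) (F : R -> X -> X).
Hypotheses (FC1 : C1_flow F) (Fmu : measure_preserving_flow mu F).
Local Notation C := R[i].
Local Notation N2 := (L2_norm mu).
Implicit Types f g h u L : borel X -> C.

Local Notation mF t := (flow_measurable FC1 t).

Lemma L2_flow t f : L2 mu f -> L2 mu (fun x => f (F t x)).
Proof. exact: (L2_mp (mF t) (Fmu t)). Qed.

Lemma L2_norm_flow t f : L2 mu f -> N2 (fun x => f (F t x)) = N2 f.
Proof. exact: (L2_norm_mp (mF t) (Fmu t)). Qed.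

Lemma re_inner_flow t f g : L2 mu f -> L2 mu g -> re_inner mu (fun x => f (F t x)) (fun x => g (F t x)) = re_inner mu f g.
Proof. exact: (re_inner_mp (mF t) (Fmu t)). Qed.

Lemma ae_flow t (P : borel X -> Prop) : {ae mu, forall x, P x} -> {ae mu, forall x, P (F t x)}.
Proof. exact: (ae_mp (mF t) (Fmu t)). Qed.

Definition diff_quot t f (x : borel X) : C := 'i%C * (t^-1)%:C%C * (f (F t x) - f x).

Lemma L2_diff_quot t f : L2 mu f -> L2 mu (diff_quot t f).
Proof. by move=> hf; apply: L2Z; apply: L2B => //; exact: L2_flow. Qed.

Lemma generatorP f h : generator mu F f h <-> [/\ L2 mu f, L2 mu h &
  forall e, 0 < e -> exists2 dl : R, 0 < dl & forall t, t != 0 -> `|t| < dl ->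
    N2 (fun x => diff_quot t f x - h x) < e].
Proof.
split=> -[hf hh H]; split=> //.
  move=> e e0.
  have c : N2 (fun x => diff_quot t f x - h x) @[t --> 0^'] --> 0.
    have : cnorm2 mu (fun x => diff_quot t f x - h x) @[t --> 0^'] --> 0%E by [].
    have -> : (fun t => cnorm2 mu (fun x => diff_quot t f x - h x)) = (fun t => (N2 (fun x => diff_quot t f x - h x))%:E).
      by apply/funext => t; rewrite cnorm2_L2//; apply: L2B => //; exact: L2_diff_quot.
    by move=> /fine_cvg.
  have := cvgr_lt _ c _ e0 => -[dl /= dl0 Hd]; exists dl => // t t0 td.
  by apply: Hd => //=; rewrite sub0r normrN.
have -> : (fun t => cnorm2 mu (fun x => 'i%C * (t^-1)%:C%C * (f (F t x) - f x) - h x)) =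
    (fun t => (N2 (fun x => diff_quot t f x - h x))%:E).
  by apply/funext => t; rewrite cnorm2_L2//; apply: L2B => //; exact: L2_diff_quot.
apply: cvg_EFin; first exact: nearW.
apply/cvgrPdist_lt => e e0; have [dl dl0 Hd] := H e e0.
exists dl => //= t /=; rewrite !sub0r !normrN => td t0.
by rewrite ger0_norm ?nrm_ge0//; exact: Hd.
Qed.

Lemma generator_L2 f h : generator mu F f h -> L2 mu f /\ L2 mu h.
Proof. by case. Qed.

Lemma generator0 : generator mu F (fun=> 0) (fun=> 0).
Proof.
apply/generatorP; split; [exact: L20|exact: L20|move=> e e0; exists 1 => // t _ _].
have -> : (fun x : borel X => diff_quot t (fun=> 0) x - 0) = 0.
  by apply/funext => x; rewrite /diff_quot subrr mulr0 subr0.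
by rewrite [X in X < _](nrm0 (L2_semi_inner mu)).
Qed.

Lemma generatorD f h f' h' : generator mu F f h -> generator mu F f' h' ->
  generator mu F (fun x => f x + f' x) (fun x => h x + h' x).
Proof.
move=> /generatorP[hf hh H] /generatorP[hf' hh' H']; apply/generatorP.
split; [exact: L2D|exact: L2D|move=> e e0].
have e20 : 0 < e / 2 by rewrite divr_gt0.
have [d1 d10 H1] := H _ e20; have [d2 d20 H2] := H' _ e20.
exists (Num.min d1 d2); first by rewrite lt_min d10.
move=> t t0; rewrite lt_min => /andP[/(H1 t t0) h1 /(H2 t t0) h2].
have -> : (fun x => diff_quot t (fun x => f x + f' x) x - (h x + h' x)) =
  (fun x => diff_quot t f x - h x) + (fun x => diff_quot t f' x - h' x).
  by apply/funext => x; rewrite /diff_quot fctE; ring.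
have := nrmD (L2_semi_inner mu) (L2B (L2_diff_quot t hf) hh) (L2B (L2_diff_quot t hf') hh').
move: h1 h2; rewrite /L2_norm; lra.
Qed.

Lemma generatorZ a f h : generator mu F f h -> generator mu F (fun x => a * f x) (fun x => a * h x).
Proof.
move=> /generatorP[hf hh H]; apply/generatorP; split; [exact: L2Z|exact: L2Z|move=> e e0].
have a0 : 0 < Normc.normc a + 1 by rewrite ltr_wpDl// normc_ge0.
have [dl dl0 Hd] := H (e / (Normc.normc a + 1)) (divr_gt0 e0 a0).
exists dl => // t t0 td.
have -> : (fun x => diff_quot t (fun x => a * f x) x - a * h x) = (fun x => a * (diff_quot t f x - h x)).
  by apply/funext => x; rewrite /diff_quot; ring.
rewrite L2_normZ; last by apply: L2B => //; exact: L2_diff_quot.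
have := Hd t t0 td; rewrite ltr_pdivlMr// mulrC; apply: le_lt_trans.
by rewrite ler_wpM2r ?nrm_ge0// lerDl.
Qed.

Lemma generator_sum (I : Type) (s : seq I) (f h : I -> borel X -> C) :
  (forall i, generator mu F (f i) (h i)) ->
  generator mu F (fun x => \sum_(i <- s) f i x) (fun x => \sum_(i <- s) h i x).
Proof.
move=> H; elim: s => [|i s IH].
  have -> : (fun x => \sum_(i <- [::]) f i x) = (fun=> 0) by apply/funext => x; rewrite big_nil.
  have -> : (fun x => \sum_(i <- [::]) h i x) = (fun=> 0) by apply/funext => x; rewrite big_nil.
  exact: generator0.
have -> : (fun x => \sum_(j <- i :: s) f j x) = (fun x => f i x + \sum_(j <- s) f j x).
  by apply/funext => x; rewrite big_cons.
have -> : (fun x => \sum_(j <- i :: s) h j x) = (fun x => h i x + \sum_(j <- s) h j x).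
  by apply/funext => x; rewrite big_cons.
exact: generatorD.
Qed.

Lemma generator_flow s f h : generator mu F f h ->
  generator mu F (fun x => f (F s x)) (fun x => h (F s x)).
Proof.
move=> /generatorP[hf hh H]; apply/generatorP; split; [exact: L2_flow|exact: L2_flow|].
move=> e e0; have [dl dl0 Hd] := H e e0; exists dl => // t t0 td.
have -> : (fun x => diff_quot t (fun x => f (F s x)) x - h (F s x)) = (fun x => diff_quot t f (F s x) - h (F s x)).
  by apply/funext => x; rewrite /diff_quot -!(flowD FC1) [s + t]addrC.
rewrite (@L2_norm_flow s (fun x => diff_quot t f x - h x)); first exact: Hd.
by apply: L2B => //; exact: L2_diff_quot.
Qed.

(** Measure preservation moves the flow to the other side with time reversed;
    the change of sign of [t] compensates the conjugation of the factor [i]. *)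
Lemma diff_quot_symmetric t f g : L2 mu f -> L2 mu g -> re_inner mu (diff_quot t f) g = re_inner mu f (diff_quot (- t) g).
Proof.
move=> hf hg; pose a : C := 'i%C * (t^-1)%:C%C.
have hft := L2_flow t hf; have hgt := L2_flow (- t) hg.
have H := L2_semi_inner mu.
have adj (f' g' : borel X -> C) : re_inner mu (fun x => a * f' x) g' = re_inner mu f' (fun x => - a * g' x).
  by apply: eq_Rintegral => x _; rewrite !(ReM, ImM, ReJ, ImJ, ReN, ImN) /=; ring.
rewrite [LHS](adj (fun x => f (F t x) - f x)).
have -> : diff_quot (- t) g = (fun x => - a * (g (F (- t) x) - g x)).
  by apply/funext => x; rewrite /diff_quot /a invrN rmorphN /= mulrN.
rewrite -!adj; have haf := L2Z a hf; have haft := L2Z a hft.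
have -> : (fun x => a * (f (F t x) - f x)) = (fun x => a * f (F t x)) - (fun x => a * f x).
  by apply/funext => x; rewrite mulrBr.
rewrite (qB H haft haf hg) (qBr H hgt hg haf); congr (_ - _).
rewrite -(re_inner_flow t haf hgt); congr (re_inner _ _ _).
by apply/funext => x; rewrite (flowK FC1).
Qed.

Lemma generator_re_inner_symmetric f f' g g' : generator mu F f f' -> generator mu F g g' ->
  re_inner mu f' g = re_inner mu f g'.
Proof.
move=> /generatorP[hf hf' Hf] /generatorP[hg hg' Hg]; have H := L2_semi_inner mu.
apply/eqP; rewrite -subr_eq0; apply/eqP.
apply: (@small_eq0 _ _ (N2 g + N2 f)); first by rewrite addr_ge0 ?nrm_ge0.
move=> e e0; have [d1 d10 H1] := Hf _ e0; have [d2 d20 H2] := Hg _ e0.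
pose t := Num.min d1 d2 / 2.
have m0 : 0 < Num.min d1 d2 by rewrite lt_min d10.
have t0 : 0 < t by rewrite divr_gt0.
have td : t < Num.min d1 d2 by rewrite /t; lra.
have [t1 t2] : t < d1 /\ t < d2 by move: td; rewrite lt_min => /andP.
have {}H1 : N2 (diff_quot t f - f') < e by apply: H1; rewrite ?gt_eqF ?gtr0_norm.
have {}H2 : N2 (diff_quot (- t) g - g') < e by apply: H2; rewrite ?oppr_eq0 ?gt_eqF ?normrN ?gtr0_norm.
have hdf := L2_diff_quot t hf; have hdg := L2_diff_quot (- t) hg.
have -> : re_inner mu f' g - re_inner mu f g' = re_inner mu f (diff_quot (- t) g - g') - re_inner mu (diff_quot t f - f') g.
  by rewrite (qB H hdf hf' hg) (qBr H hdg hg' hf) diff_quot_symmetric//; ring.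
rewrite (le_trans (ler_normB _ _))// mulrDr addrC lerD//.
  rewrite (le_trans (cauchy_schwarz H (siB H hdf hf') hg))//.
  by rewrite ler_wpM2r ?nrm_ge0// ltW.
rewrite (le_trans (cauchy_schwarz H hf (siB H hdg hg')))// mulrC.
by rewrite ler_wpM2r ?nrm_ge0// ltW.
Qed.

Lemma generator_symmetric f f' g g' : generator mu F f f' -> generator mu F g g' ->
  inner mu f' g = inner mu f g'.
Proof.
move=> Hf Hg; have [hf hf'] := generator_L2 Hf; have [hg hg'] := generator_L2 Hg.
apply: complexRI; first by rewrite !Re_inner; exact: generator_re_inner_symmetric.
by rewrite !Im_inner//; apply: generator_re_inner_symmetric Hg; exact: generatorZ.
Qed.

Lemma generator_cmeasurable u L : generator mu F u (fun x => 'i%C * L x) -> cmeasurable L.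
Proof.
move=> /generator_L2[_ [mL _]].
have -> : L = (fun x => - 'i%C * ('i%C * L x)).
  by apply/funext => x; apply: complexRI; rewrite !(ReM, ImM, ReN, ImN) /=; ring.
by apply: cmeasurableM => //; exact: cmeasurable_cst.
Qed.

(** A bounded derivative makes [u] Lipschitz along the flow: the increment over
    time [t] is the sum of those over times [t / k], each close to [t / k]
    times the derivative. *)
Lemma generator_lipschitz u L c t : 0 <= c -> generator mu F u (fun x => 'i%C * L x) ->
  {ae mu, forall x, Normc.normc (L x) <= c} ->
  {ae mu, forall x, Normc.normc (u (F t x) - u x) <= c * `|t|}.
Proof.
move=> c0 Hu Lc; have [hu hiL] := generator_L2 Hu.
have mL := generator_cmeasurable Hu.
have hL : L2 mu L.
  have := L2Z (- 'i%C) hiL; congr (L2 _ _).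
  by apply/funext => x; apply: complexRI; rewrite !(ReM, ImM, ReN, ImN) /=; ring.
have [->|tn0] := eqVneq t 0.
  by apply: aeW => x; rewrite (flow0 FC1) subrr normr0 mulr0 normcE sqn0 sqrtr0.
have ta : 0 < `|t| by rewrite normr_gt0.
apply: ae_bound_closed; first by rewrite mulr_ge0.
  by have [] := L2B (L2_flow t hu) hu.
move=> e e0; have /generatorP[_ _ H] := Hu.
have [dl dl0 Hd] := H (e / `|t|) (divr_gt0 e0 ta).
have [k Hk] := harmonic_small (divr_gt0 dl0 ta).
have {}Hk : k.+1%:R^-1 < dl / `|t| by exact: Hk.
pose s := t / k.+1%:R.
have k0 : (k.+1%:R : R) != 0 by rewrite pnatr_eq0.
have sn0 : s != 0 by rewrite mulf_neq0// invr_eq0.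
have sd : `|s| < dl.
  by rewrite normrM normfV (ger0_norm (ler0n R _)) mulrC -ltr_pdivlMr.
have {Hd}Hd := Hd s sn0 sd.
pose r x := u (F s x) - u x - s%:C%C * L x.
have hr : L2 mu r by apply: L2B; [apply: L2B => //; exact: L2_flow|exact: L2Z].
have rE : r = (fun x => (- 'i%C * s%:C%C) * (diff_quot s u x - 'i%C * L x)).
  apply/funext => x; rewrite /r /diff_quot.
  have E : (s%:C%C : C) * (s^-1)%:C%C = 1 by rewrite -rmorphM /= mulfV.
  have I2 : ('i%C : C) * 'i%C = -1 by apply: complexRI; rewrite !(ReM, ImM) /=; ring.
  rewrite mulrBr.
  have -> : - 'i%C * s%:C%C * ('i%C * (s^-1)%:C%C * (u (F s x) - u x)) =
    - ('i%C * 'i%C) * (s%:C%C * (s^-1)%:C%C) * (u (F s x) - u x) by ring.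
  have -> : - 'i%C * s%:C%C * ('i%C * L x) = - ('i%C * 'i%C) * (s%:C%C * L x) by ring.
  by rewrite I2 E opprK !mul1r.
have nr : N2 r < e / k.+1%:R.
  rewrite rE L2_normZ; last by apply: L2B => //; exact: L2_diff_quot.
  have -> : Normc.normc (- 'i%C * s%:C%C : C) = `|s|.
    by rewrite normcE /sqn !(ReM, ImM, ReN, ImN) /= -sqrtr_sqr; congr Num.sqrt; ring.
  rewrite normrM normfV (ger0_norm (ler0n R _)) -mulrA.
  rewrite mulrCA [ltRHS]mulrC ltr_pM2l ?invr_gt0//.
  by move: Hd; rewrite ltr_pdivlMr// mulrC.
pose g (x : borel X) : C := \sum_(i < k.+1) s%:C%C * L (F (i%:R * s) x).
have mg : cmeasurable g.
  apply: cmeasurable_sum => i; apply: cmeasurableM; first exact: cmeasurable_cst.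
  exact: (cmeasurable_comp (mF (i%:R * s)) mL).
have gc : {ae mu, forall x, Normc.normc (g x) <= c * `|t|}.
  have : {ae mu, forall x, forall i : 'I_k.+1, Normc.normc (L (F (i%:R * s) x)) <= c}.
    by apply: filter_forall => i; exact: (ae_flow (i%:R * s) Lc).
  move=> /ae_imp; apply => x Hx; rewrite /g.
  have -> : c * `|t| = \sum_(i < k.+1) `|s| * c.
    rewrite sumr_const card_ord -[_ *+ _]mulr_natl normrM normfV (ger0_norm (ler0n R _)).
    by field.
  elim/big_ind2: _ => [|a a' b b' ab ab'|i _].
  - by rewrite normcE sqn0 sqrtr0.
  - by rewrite (le_trans (normcD _ _))// lerD.
  by rewrite Normc.normcM normcRC ler_wpM2l.
have E : (fun x => u (F t x) - u x - g x) = \sum_(i < k.+1) (fun x => r (F (i%:R * s) x)).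
  apply/funext => x; rewrite fct_sumE.
  have -> : t = k.+1%:R * s by rewrite /s; field.
  rewrite /g; elim: k.+1 => [|p IH]; first by rewrite !big_ord0 mul0r (flow0 FC1) subrr subr0.
  rewrite !big_ord_recr /= -IH /r -(flowD FC1).
  have -> : s + p%:R * s = p.+1%:R * s by rewrite -natr1; ring.
  ring.
have [h1 h2] := nrm_sum (L2_semi_inner mu) (index_enum 'I_k.+1)
  (x := fun (i : 'I_k.+1) x => r (F (i%:R * s) x)) (fun i => L2_flow _ hr).
exists g; split => //; rewrite E//.
apply: (le_lt_trans h2).
under eq_bigr do rewrite -/(N2 _) L2_norm_flow//.
by rewrite sumr_const card_ord -[_ *+ _]mulr_natl mulrC -ltr_pdivlMr.
Qed.

(** With [Q] the difference quotient and [ut] for [u \o F t], the difference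
    quotient of the product minus its expected limit is [ut (Q f - h) + (ut -
    u) h + (Q u - i L) f]. In the first term [ut] is bounded; in the other two
    a fixed function is multiplied by functions that tend to zero in mean
    square and are bounded uniformly in [t], by [generator_lipschitz] for the
    last one. *)
Theorem generator_product u L f h c : (forall x, Normc.normc (u x) <= 1) -> 0 <= c ->
  {ae mu, forall x, Normc.normc (L x) <= c} ->
  generator mu F u (fun x => 'i%C * L x) -> generator mu F f h ->
  generator mu F (fun x => u x * f x) (fun x => u x * h x + 'i%C * L x * f x).
Proof.
move=> u1 c0 Lc Hu Hf; have lip := generator_lipschitz _ c0 Hu Lc.
have mL := generator_cmeasurable Hu.
have /generatorP[hu hiL H1] := Hu; have /generatorP[hf hh H2] := Hf.
have mu' : cmeasurable u by case: hu.
have u1' : {ae mu, forall x, Normc.normc (u x) <= 1} by exact: aeW.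
have miL : cmeasurable (fun x => 'i%C * L x) by case: hiL.
have niL a : Normc.normc ('i%C * a : C) = Normc.normc a.
  by rewrite Normc.normcM [X in X * _]normcE /sqn /= expr0n expr1n add0r sqrtr1 mul1r.
have iLc : {ae mu, forall x, Normc.normc ('i%C * L x) <= c}.
  by apply: filterS Lc => x; rewrite niL.
have [huf _] := L2M_bounded mu' ler01 u1' hf.
have [huh _] := L2M_bounded mu' ler01 u1' hh.
have [hLf _] := L2M_bounded miL c0 iLc hf.
apply/generatorP; split; [exact: huf|exact: L2D|move=> e e0].
have e30 : 0 < e / 3 by rewrite divr_gt0.
have [da da0 Ha] := H2 _ e30.
have [wb wb0 Hb] := small_multiplier (c := 2) (ler0n R 2) hh e30.
have [wc wc0 Hc] := small_multiplier (c := c + c) (addr_ge0 c0 c0) hf e30.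
have [dc dc0 Hdc] := H1 _ wc0.
have [db db0 Hdb] := H1 _ ltr01.
have b0 : 0 < wb / (1 + N2 (fun x => 'i%C * L x)) by rewrite divr_gt0// ltr_pwDl ?nrm_ge0.
exists (Num.min (Num.min da db) (Num.min dc (wb / (1 + N2 (fun x => 'i%C * L x))))).
  by rewrite !lt_min da0 db0 dc0 b0.
move=> t t0; rewrite !lt_min => /andP[/andP[ta tb] /andP[tc tn]].
pose ut (x : borel X) := u (F t x).
have hut : L2 mu ut by exact: L2_flow.
have mut : cmeasurable ut by case: hut.
have ut1 : {ae mu, forall x, Normc.normc (ut x) <= 1} by apply: aeW => x; exact: u1.
have hd : L2 mu (fun x => ut x - u x) by exact: L2B.
have hA : L2 mu (fun x => diff_quot t f x - h x) by apply: L2B => //; exact: L2_diff_quot.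
have hB : L2 mu (fun x => diff_quot t u x - 'i%C * L x) by apply: L2B => //; exact: L2_diff_quot.
have mdq : cmeasurable (diff_quot t u) by have [] := L2_diff_quot t hu.
have [hI nI] := L2M_bounded mut ler01 ut1 hA.
have d2 : {ae mu, forall x, Normc.normc (ut x - u x) <= 2}.
  apply: aeW => x; rewrite (le_trans (normcD _ _))// normcN.
  by have := u1 x; have := u1 (F t x); rewrite /ut; lra.
have [hII _] := L2M_bounded hd.1 (ler0n R 2) d2 hh.
have dqE x : ut x - u x = - 'i%C * t%:C%C * diff_quot t u x.
  rewrite /diff_quot /ut.
  have E : (t%:C%C : C) * (t^-1)%:C%C = 1 by rewrite -rmorphM /= mulfV.
  have I2 : ('i%C : C) * 'i%C = -1 by apply: complexRI; rewrite !(ReM, ImM) /=; ring.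
  have -> : - 'i%C * t%:C%C * ('i%C * (t^-1)%:C%C * (u (F t x) - u x)) =
    - ('i%C * 'i%C) * (t%:C%C * (t^-1)%:C%C) * (u (F t x) - u x) by ring.
  by rewrite I2 E opprK !mul1r.
have nit a : Normc.normc (- 'i%C * t%:C%C * a : C) = `|t| * Normc.normc a.
  rewrite Normc.normcM; congr (_ * _).
  by rewrite normcE /sqn !(ReM, ImM, ReN, ImN) /= -sqrtr_sqr; congr Num.sqrt; ring.
have tp : 0 < `|t| by rewrite normr_gt0.
have dc' : {ae mu, forall x, Normc.normc (diff_quot t u x - 'i%C * L x) <= c + c}.
  apply: (ae_imp2 (lip t) Lc) => x; rewrite -/(ut x) dqE nit mulrC ler_pM2r// => h1 h2.
  by rewrite (le_trans (normcD _ _))// normcN niL lerD.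
have [hIII _] := L2M_bounded hB.1 (addr_ge0 c0 c0) dc' hf.
have EE : (fun x => diff_quot t (fun x => u x * f x) x - (u x * h x + 'i%C * L x * f x)) =
   (fun x => ut x * (diff_quot t f x - h x)) + (fun x => (ut x - u x) * h x) +
   (fun x => (diff_quot t u x - 'i%C * L x) * f x).
  by apply/funext => x; rewrite !fctE /diff_quot /ut; ring.
have HS := L2_semi_inner mu.
have n1 : N2 (fun x => ut x * (diff_quot t f x - h x)) < e / 3.
  by apply: (le_lt_trans nI); rewrite mul1r; exact: Ha.
have n2' : N2 (fun x => (ut x - u x) * h x) < e / 3.
  apply: Hb => //; first exact: hd.1.
  have -> : (fun x => ut x - u x) = (fun x => - 'i%C * t%:C%C * diff_quot t u x) by apply/funext.
  rewrite L2_normZ; last exact: L2_diff_quot.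
  have -> : Normc.normc (- 'i%C * t%:C%C : C) = `|t|.
    by have := nit 1; rewrite mulr1 => ->; rewrite [X in _ * X]normcE /sqn /= expr0n expr1n addr0 sqrtr1 mulr1.
  have : N2 (diff_quot t u) <= 1 + N2 (fun x => 'i%C * L x).
    have -> : diff_quot t u = (diff_quot t u - (fun x => 'i%C * L x)) + (fun x => 'i%C * L x) by rewrite subrK.
    apply: (le_trans (nrmD HS (siB HS (L2_diff_quot t hu) hiL) hiL)); rewrite lerD2r ltW//.
    exact: Hdb.
  move=> h1; rewrite ltr_pdivlMr in tn; last by rewrite ltr_pwDl ?nrm_ge0.
  by apply: le_lt_trans tn; rewrite ler_wpM2l.
have n3 : N2 (fun x => (diff_quot t u x - 'i%C * L x) * f x) < e / 3.
  by apply: Hc => //; [exact: hB.1|exact: Hdc].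
rewrite EE; have := nrmD HS (siD HS hI hII) hIII; have := nrmD HS hI hII.
move: n1 n2' n3; rewrite /L2_norm; lra.
Qed.

(** The difference quotients converge to [i L] in mean square, hence almost
    everywhere along a sequence of times, where their limit is [i] times the
    pointwise derivative. *)
Lemma generator_derivative u L l : generator mu F u (fun x => 'i%C * L x) ->
  {ae mu, forall x, cdifferentiable (fun t : R => u (F t x)) 0 /\ cdiff (fun t : R => u (F t x)) 0 1 = l x} ->
  {ae mu, forall x, L x = l x}.
Proof.
move=> Hu Hl; have /generatorP[hu hL H] := Hu.
have /choice[N HN] : forall k : nat, exists N : nat, (k <= N)%N /\
    L2_norm mu (fun x => diff_quot N.+1%:R^-1 u x - 'i%C * L x) < 2^-1 ^+ k.
  move=> k; have [|dl dl0 Hd] := H (2^-1 ^+ k); first by rewrite exprn_gt0// invr_gt0.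
  have [N HN] := harmonic_small dl0; exists (maxn k N); split; first exact: leq_maxl.
  apply: Hd; first by rewrite invr_eq0 pnatr_eq0.
  by rewrite ger0_norm ?invr_ge0//; apply: HN; exact: leq_maxr.
pose g k x := diff_quot (N k).+1%:R^-1 u x - 'i%C * L x.
have hg k : L2 mu (g k) by apply: L2B => //; exact: L2_diff_quot.
have qg k : re_inner mu (g k) (g k) <= (2^-1 ^+ k) ^+ 2.
  rewrite -(nrm_sq (L2_semi_inner mu) (hg k)) ler_sqr ?nnegrE ?nrm_ge0 ?exprn_ge0 ?invr_ge0//.
  by rewrite ltW//; case: (HN k).
have c1 : {ae mu, forall x, complex.Re (g k x) @[k --> \oo] --> 0}.
  have := @ae_cvg_fast _ _ _ mu (fun k x => complex.Re (g k x)) _ _.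
  case=> [k|k|A [mA A0 HA]]; first by have /L2_real_L2[] := hg k.
    apply: le_trans (qg k); rewrite (re_inner_parts (hg k)) lerDl; apply: Rintegral_ge0 => x _; exact: sqr_ge0.
  by exists A; split => // x hx; apply: HA => hx'; apply: hx; case: hx'.
have c2 : {ae mu, forall x, complex.Im (g k x) @[k --> \oo] --> 0}.
  have := @ae_cvg_fast _ _ _ mu (fun k x => complex.Im (g k x)) _ _.
  case=> [k|k|A [mA A0 HA]]; first by have /L2_real_L2[] := hg k.
    apply: le_trans (qg k); rewrite (re_inner_parts (hg k)) lerDr; apply: Rintegral_ge0 => x _; exact: sqr_ge0.
  by exists A; split => // x hx; apply: HA => hx'; apply: hx; case: hx'.
pose s k : R := (N k).+1%:R^-1.
have s0 : s k @[k --> \oo] --> 0^'.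
  move=> A [dl /= dl0 HA]; have [K HK] := harmonic_small dl0; exists K => // k /= Kk.
  apply: HA; rewrite ?sub0r ?normrN /=; last by rewrite invr_eq0 pnatr_eq0.
  rewrite sub0r normrN ger0_norm ?invr_ge0//; apply: HK; apply: (leq_trans Kk); by case: (HN k).
have dcvg (v : R -> R) : differentiable v 0 -> (s k)^-1 * (v (s k) - v 0) @[k --> \oo] --> 'd v 0 1.
  move=> dv; have : derivable v 0 1 by exact: diff_derivable.
  rewrite -deriveE// => c.
  have c' : (h^-1 *: (v (h *: 1 + 0) - v 0)) @[h --> 0^'] --> 'D_1 v 0 by exact: c.
  have := cvg_comp _ _ s0 c'.
  by apply: cvg_trans; apply: near_eq_cvg; apply: nearW => k /=; rewrite addr0 /GRing.scale /= mulr1.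
apply: (ae_imp2 (filterI c1 c2) Hl) => x [k1 k2] [[d1 d2] dl].
have e1 := dcvg _ d1; have e2 := dcvg _ d2.
have sne k : (s k)^-1 != 0 by rewrite /s invrK pnatr_eq0.
have gR k : complex.Re (g k x) = - ((s k)^-1 * (complex.Im (u (F (s k) x)) - complex.Im (u (F 0 x)))) + complex.Im (L x).
  by rewrite /g /diff_quot (flow0 FC1) -/(s k) !(ReM, ImM, ReD, ImD, ReN, ImN) /=; ring.
have gI k : complex.Im (g k x) = ((s k)^-1 * (complex.Re (u (F (s k) x)) - complex.Re (u (F 0 x)))) - complex.Re (L x).
  by rewrite /g /diff_quot (flow0 FC1) -/(s k) !(ReM, ImM, ReD, ImD, ReN, ImN) /=; ring.
rewrite -dl; apply: complexRI => /=; apply/esym.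
  exact: (limit_of_shift e1 k2 gI).
have gR' k : - complex.Re (g k x) = (s k)^-1 * (complex.Im (u (F (s k) x)) - complex.Im (u (F 0 x))) - complex.Im (L x).
  by rewrite gR; ring.
have k1' : - complex.Re (g k x) @[k --> \oo] --> 0 by rewrite -oppr0; exact: cvgN.
exact: (limit_of_shift e2 k1' gR').
Qed.

End generator.

(** * Density of the domain of the generator *)

Section density.
Context {R : realType} {n : nat} {X : manifoldType R n}.
Variables (mu : probability (borel X) R) (F : R -> X -> X).
Hypotheses (FC1 : C1_flow F) (Fmu : measure_preserving_flow mu F).
Local Notation C := R[i].
Local Notation N2 := (L2_norm mu).
Local Notation leb := (@lebesgue_measure R).

Lemma L2_norm_real_le (r : borel X -> R) : measurable_fun setT r -> (forall x, `|r x| <= 1) ->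
  L2 mu (fun x => (r x)%:C%C) /\ N2 (fun x => (r x)%:C%C) <= Num.sqrt (\int[mu]_x `|r x|).
Proof.
move=> mr r1.
have hr : L2 mu (fun x => (r x)%:C%C).
  apply: (@bounded_L2 _ _ _ mu _ 1); first by split => //; exact: measurable_cst.
  by move=> x; rewrite normcRC.
split => //; rewrite /L2_norm /nrm ler_wsqrtr// re_inner_sqn; apply: le_Rintegral => //.
- by have [] := (L2P mu _).1 hr.
- apply: (@bounded_rintegrable _ _ _ mu _ 1); first exact: measurableT_comp.
  by move=> x; rewrite normr_id.
move=> x _; rewrite /sqn /= expr0n addr0 -real_normK ?num_real// expr2.
by rewrite ler_piMl.
Qed.

Variable A : set (borel X).
Hypothesis mA : measurable A.

(** Half-open, so that adjacent windows add up without overlap. *)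
Definition window (a b s : R) : R := \1_`]a, b]%classic s.

Lemma window_cases a b s : window a b s = 0 \/ window a b s = 1.
Proof. by rewrite /window indicE; case: (s \in _); [right|left]. Qed.

Lemma window_measurable a b : measurable_fun setT (window a b : measurableTypeR R -> R).
Proof. by apply: measurable_indic; exact: measurable_itv. Qed.

Lemma window_int a b : a <= b -> (\int[leb]_s (window a b s)%:E = (b - a)%:E)%E.
Proof.
move=> ab; have h := integral_indic leb measurableT (measurable_itv `]a, b]).
rewrite setIT in h; transitivity (lebesgue_measure (`]a, b]%classic : set R)); first exact: h.
rewrite lebesgue_measure_itv /= lte_fin; case: ltP => // ba.
by have -> : a = b; [apply/eqP; rewrite eq_le ab|rewrite subrr].
Qed.

Lemma windowE a b s : window a b s = ((a < s) && (s <= b))%:R.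
Proof.
rewrite /window indicE; congr ((_ : bool)%:R).
by apply/idP/idP; rewrite inE /= in_itv.
Qed.

Lemma window_shift a b t s : window (a + t) (b + t) (s + t) = window a b s.
Proof. by rewrite !windowE ltrD2r lerD2r. Qed.

Lemma window_split a c b s : a <= c -> c <= b -> window a b s = window a c s + window c b s.
Proof.
move=> ac cb; rewrite !windowE; case: (leP s c) => sc.
  by rewrite (le_trans sc cb) andbT addr0.
by rewrite (le_lt_trans ac sc) andbF add0r.
Qed.

Lemma orbit_measurable x : measurable_fun setT (fun s : measurableTypeR R => (\1_A (F s x) : R)).
Proof.
apply: (measurableT_comp (f := (\1_A : borel X -> R))); first exact: measurable_indic.
apply: borel_measurable_fun => U oU.
by apply: open_measurable; move: (flow_orbit_continuous FC1 (x := x)) => /continuousP; exact.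
Qed.

Lemma window_rintegrable a b : rintegrable leb (window a b).
Proof.
have [ab|/ltW ba] := leP a b.
  apply/integrableP; split; first by apply/measurable_EFinP; exact: window_measurable.
  have -> : (\int[leb]_s `|(EFin \o window a b) s| = \int[leb]_s (window a b s)%:E)%E.
    apply: eq_integral => s _ /=; rewrite ger0_norm//.
  by rewrite window_int// ltry.
have -> : window a b = fun=> 0; last exact: rintegrable0.
by apply/funext => s; rewrite /window set_itv_ge ?indic0// bnd_simp -leNgt.
Qed.

Lemma window_mul_rintegrable a b (f : R -> R) :
  measurable_fun setT (f : measurableTypeR R -> R) -> (forall s, `|f s| <= 1) ->
  rintegrable leb (fun s => window a b s * f s).
Proof.
move=> mf f1.
apply: (le_rintegrable _ _ (window_rintegrable a b)).
  by apply: measurable_funM => //; exact: window_measurable.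
move=> s; have [->|->] := window_cases a b s; first by rewrite mul0r normr0.
by rewrite mul1r.
Qed.

(** The time that the orbit of [x] spends in [A] between the times [a] and
    [b]. *)
Definition occupation (a b : R) (x : borel X) : R := \int[leb]_s (window a b s * \1_A (F s x)).

Lemma indic_norm_le1 x : `|\1_A x : R| <= 1.
Proof. by have [->|->] := indic_cases A x; rewrite ?normr1 ?normr0. Qed.

Lemma occupation_rintegrable a b x : rintegrable leb (fun s => window a b s * \1_A (F s x)).
Proof.
by apply: window_mul_rintegrable; [exact: orbit_measurable|move=> s; exact: indic_norm_le1].
Qed.

Lemma occupation_flow a b t x : occupation a b (F t x) = occupation (a + t) (b + t) x.
Proof.
rewrite /occupation.
have := @Rintegral_mp _ _ _ leb (fun s : measurableTypeR R => (s + t : measurableTypeR R)) (measurable_shift t)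
  (lebesgue_translation t) (fun s => window (a + t) (b + t) s * \1_A (F s x)).
move=> <-; last first.
  by apply: measurable_funM; [exact: window_measurable|exact: orbit_measurable].
by apply: eq_Rintegral => s _; rewrite window_shift (flowD FC1).
Qed.

Lemma occupation_split a c b x : a <= c -> c <= b ->
  occupation a b x = occupation a c x + occupation c b x.
Proof.
move=> ac cb; rewrite -[RHS]RintD; [|exact: occupation_rintegrable|exact: occupation_rintegrable].
by apply: eq_Rintegral => s _; rewrite -mulrDl -window_split.
Qed.

Lemma flow_pair_measurable : measurable_fun setT
  (fun z : borel X * measurableTypeR R => (\1_A (F z.2 z.1) : R)).
Proof.
apply: (measurableT_comp (f := (\1_A : borel X -> R))); first exact: measurable_indic.
apply: (measurableT_comp (flow_joint_measurable FC1) (g := fun z : borel X * measurableTypeR R => (z.2, z.1))).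
by apply/measurable_fun_pair => /=; [exact: measurable_snd|exact: measurable_fst].
Qed.

Lemma window_pair_measurable a b : measurable_fun setT
  (fun z : borel X * measurableTypeR R => window a b z.2).
Proof. exact: (measurableT_comp (window_measurable a b) (@measurable_snd _ _ _ _)). Qed.

Lemma occupation_measurable a b : measurable_fun setT (occupation a b).
Proof.
pose f (z : borel X * measurableTypeR R) : \bar R := (window a b z.2 * \1_A (F z.2 z.1))%:E.
have mf : measurable_fun setT f.
  apply/measurable_EFinP; apply: measurable_funM; first exact: window_pair_measurable.
  exact: flow_pair_measurable.
have f0 z : (0 <= f z)%E.
  by rewrite lee_fin mulr_ge0//; have [->|->] := window_cases a b z.2.
have := @measurable_fun_fubini_tonelli_F _ _ _ _ _ leb f mf f0.
move=> h; apply/measurable_EFinP; apply: eq_measurable_fun h => x _.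
by rewrite /fubini_F /occupation /f /= EFin_Rint//; exact: occupation_rintegrable.
Qed.

(** By Tonelli's theorem the left-hand side is at most the mean over the
    window of the displacements in time [s - a]. *)
Lemma occupation_average a t e : 0 < t -> 0 <= e ->
  (forall s, `|s| <= t -> displacement mu F A s <= e) ->
  \int[mu]_x `|t^-1 * occupation a (a + t) x - \1_A (F a x)| <= e.
Proof.
move=> t0 e0 He.
have tn : t != 0 by rewrite gt_eqF.
have aat : a <= a + t by rewrite lerDl ltW.
pose k (z : borel X * measurableTypeR R) : R := window a (a + t) z.2 * `|\1_A (F z.2 z.1) - \1_A (F a z.1)|.
have mk : measurable_fun setT k.
  apply: measurable_funM; first exact: window_pair_measurable.
  apply: measurableT_comp => //; apply: measurable_funB; first exact: flow_pair_measurable.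
  exact: (measurableT_comp (measurable_indic_flow FC1 a mA) (@measurable_fst _ _ _ _)).
have k0 z : 0 <= k z by rewrite mulr_ge0//; have [->|->] := window_cases a (a + t) z.2.
have ik x : rintegrable leb (fun s => k (x, s)).
  apply: (@window_mul_rintegrable a (a + t) (fun s => `|\1_A (F s x) - \1_A (F a x)|)).
    apply: measurableT_comp => //; apply: measurable_funB; first exact: orbit_measurable.
    exact: measurable_cst.
  move=> s; rewrite normr_id.
  by have [->|->] := indic_cases A (F s x); have [->|->] := indic_cases A (F a x);
    rewrite ?subrr ?subr0 ?sub0r ?normrN ?normr1 ?normr0.
have avg x : `|t^-1 * occupation a (a + t) x - \1_A (F a x)| <= t^-1 * \int[leb]_s k (x, s).
  have -> : \1_A (F a x) = t^-1 * \int[leb]_s (window a (a + t) s * \1_A (F a x)).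
    have -> : \int[leb]_s (window a (a + t) s * \1_A (F a x)) = \1_A (F a x) * \int[leb]_s window a (a + t) s.
      rewrite -RintZ; last exact: window_rintegrable.
      by apply: eq_Rintegral => s _; rewrite mulrC.
    rewrite /Rintegral window_int//= [a + t]addrC addrK.
    by rewrite mulrCA mulVf// mulr1.
  have iw : rintegrable leb (fun s => window a (a + t) s * \1_A (F a x)).
    by apply: window_mul_rintegrable => //; move=> s; exact: indic_norm_le1.
  rewrite -mulrBr -RintB//; last exact: occupation_rintegrable.
  rewrite normrM (ger0_norm (_ : 0 <= t^-1)) ?invr_ge0 ?(ltW t0)// ler_pM2l ?invr_gt0//.
  apply: (le_trans (le_normr_Rintegral measurableT _)).
    by apply: rintegrableB => //; exact: occupation_rintegrable.
  rewrite le_eqVlt; apply/orP; left; apply/eqP; apply: eq_Rintegral => s _.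
  rewrite -mulrBr normrM ger0_norm//; by have [->|->] := window_cases a (a + t) s.
have r1 x : `|t^-1 * occupation a (a + t) x - \1_A (F a x)| <= 1.
  apply: (le_trans (avg x)); rewrite ler_pdivrMl// mulr1.
  have -> : t = \int[leb]_s window a (a + t) s by rewrite /Rintegral window_int//= [a + t]addrC addrK.
  apply: le_Rintegral => //; [exact: (ik x)|exact: window_rintegrable|].
  move=> s _; rewrite /k /= -[leRHS]mulr1 ler_wpM2l//.
  by have [->|->] := indic_cases A (F s x); have [->|->] := indic_cases A (F a x);
    rewrite ?subrr ?subr0 ?sub0r ?normrN ?normr1 ?normr0.
have mr : measurable_fun setT (fun x => `|t^-1 * occupation a (a + t) x - \1_A (F a x)|).
  apply: measurableT_comp => //; apply: measurable_funB; last exact: measurable_indic_flow.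
  by apply: measurable_funM; [exact: measurable_cst|exact: occupation_measurable].
have ir : rintegrable mu (fun x => `|t^-1 * occupation a (a + t) x - \1_A (F a x)|).
  by apply: (bounded_rintegrable mu mr (M := 1)) => x; rewrite normr_id.
have mkE : measurable_fun setT (fun z => (k z)%:E) by exact/measurable_EFinP.
have k0E z : (0 <= (k z)%:E)%E by rewrite lee_fin.
have inner_le s : (\int[mu]_x (k (x, s))%:E <= (window a (a + t) s * e)%:E)%E.
  have [w0|w1] := window_cases a (a + t) s.
    rewrite /k /= w0 mul0r; under eq_integral do rewrite mul0r.
    by rewrite integral0.
  have /andP[as1 as2] : (a < s) && (s <= a + t).
    by move: w1; rewrite windowE; case: (_ && _) => // /eqP; rewrite eq_sym oner_eq0.
  have sa : `|s - a| <= t by rewrite ger0_norm ?subr_ge0 ?(ltW as1)// lerBlDl.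
  rewrite /k /= w1 mul1r; under eq_integral do rewrite mul1r.
  have := displacement_integrable mu FC1 (s - a) mA => iD.
  have := He _ sa; rewrite -lee_fin /displacement -EFin_Rint//; apply: le_trans.
  rewrite -[leRHS](ge0_integral_mp (flow_measurable FC1 a) (Fmu a)); last by move=> x; rewrite lee_fin.
    rewrite le_eqVlt; apply/orP; left; apply/eqP; apply: eq_integral => x _.
    by rewrite -(flowD FC1) subrK.
  by apply/measurable_EFinP; exact: rintegrable_measurable iD.
rewrite -lee_fin -EFin_Rint//.
apply: (@le_trans _ _ (\int[mu]_x (t^-1%:E * \int[leb]_s (k (x, s))%:E))%E).
  apply: ge0_le_integral => //.
  - exact/measurable_EFinP.
  - apply: measurable_funeM; exact: (@measurable_fun_fubini_tonelli_F _ _ _ _ _ leb _ mkE k0E).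
  by move=> x _; rewrite (EFin_Rint (ik x)) -EFinM lee_fin; exact: avg.
rewrite ge0_integralZl//; last 3 first.
- exact: (@measurable_fun_fubini_tonelli_F _ _ _ _ _ leb _ mkE k0E).
- by move=> x _; apply: integral_ge0 => s _.
- by rewrite lee_fin invr_ge0 ltW.
rewrite (@fubini_tonelli _ _ _ _ _ mu leb _ mkE k0E).
apply: (@le_trans _ _ (t^-1%:E * \int[leb]_s (window a (a + t) s * e)%:E)%E).
  apply: lee_wpmul2l; first by rewrite lee_fin invr_ge0 ltW.
  apply: ge0_le_integral => //.
  - by move=> s _; apply: integral_ge0 => x _.
  - exact: (@measurable_fun_fubini_tonelli_G _ _ _ _ _ mu _ mkE k0E).
  by apply/measurable_EFinP; apply: measurable_funM; [exact: window_measurable|exact: measurable_cst].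
under eq_integral do rewrite EFinM muleC.
rewrite ge0_integralZl//; last 2 first.
- by apply/measurable_EFinP; exact: window_measurable.
- by move=> s _; rewrite lee_fin; have [->|->] := window_cases a (a + t) s.
rewrite window_int// -!EFinM lee_fin [a + t]addrC addrK.
by rewrite mulrCA mulVf// mulr1.
Qed.

Lemma occupation_bound t x : 0 < t -> `|t^-1 * occupation 0 t x| <= 1.
Proof.
move=> t0; rewrite normrM (ger0_norm (_ : 0 <= t^-1)) ?invr_ge0 ?(ltW t0)// ler_pdivrMl// mulr1.
apply: (le_trans (le_normr_Rintegral measurableT (occupation_rintegrable 0 t x))).
have E : t = \int[leb]_s window 0 t s by rewrite /Rintegral window_int ?(ltW t0)//= subr0.
rewrite [leRHS]E; apply: le_Rintegral => //.
- exact: (integrable_norm (occupation_rintegrable 0 t x)).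
- exact: window_rintegrable.
move=> s _; have [->|->] := window_cases 0 t s; first by rewrite mul0r normr0.
by rewrite mul1r indic_norm_le1.
Qed.

Definition cindic (x : borel X) : C := (\1_A x : R)%:C%C.
Definition flow_average (t : R) (x : borel X) : C := (t^-1 * occupation 0 t x)%:C%C.

Lemma L2_cindic : L2 mu cindic.
Proof.
apply: (L2_norm_real_le (r := (\1_A : borel X -> R)) _ _).1; first exact: measurable_indic.
by move=> x; exact: indic_norm_le1.
Qed.

Lemma L2_flow_average t : 0 < t -> L2 mu (flow_average t).
Proof.
move=> t0; apply: (L2_norm_real_le (r := fun x => t^-1 * occupation 0 t x) _ _).1.
  by apply: measurable_funM; [exact: measurable_cst|exact: occupation_measurable].
by move=> x; exact: occupation_bound.
Qed.

Lemma displacement_small e : 0 < e -> exists2 dl : R, 0 < dl &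
  forall s, `|s| < dl -> Num.sqrt (displacement mu F A s) < e.
Proof.
move=> e0; have [dl dl0 H] := borel_flow_continuous FC1 Fmu mA (exprn_gt0 2 e0).
exists dl => // s sd; rewrite -[ltRHS]ger0_norm ?(ltW e0)// -sqrtr_sqr ltr_sqrt ?exprn_gt0//.
exact: H.
Qed.

Lemma window_average_small e : 0 < e -> exists2 dl : R, 0 < dl &
  forall a t, 0 < t -> t < dl ->
    let r := fun x => (t^-1 * occupation a (a + t) x - \1_A (F a x))%:C%C : C in
    L2 mu r /\ N2 r < e.
Proof.
move=> e0; have e2 : 0 < (e / 2) ^+ 2 by rewrite exprn_gt0// divr_gt0.
have [dl dl0 H] := borel_flow_continuous FC1 Fmu mA e2.
exists dl => // a t t0 td r.
have He s : `|s| <= t -> displacement mu F A s <= (e / 2) ^+ 2.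
  by move=> st; rewrite ltW// H// (le_lt_trans st).
have avg := occupation_average a t0 (ltW e2) He.
have [] := L2_norm_real_le (r := fun x => t^-1 * occupation a (a + t) x - \1_A (F a x)).
- apply: measurable_funB; last exact: measurable_indic_flow.
  by apply: measurable_funM; [exact: measurable_cst|exact: occupation_measurable].
- move=> x; have E : t^-1 * occupation a (a + t) x = t^-1 * occupation 0 t (F a x).
    by rewrite occupation_flow// add0r [t + a]addrC.
  have : 0 <= t^-1 * occupation 0 t (F a x).
    rewrite mulr_ge0 ?invr_ge0 ?(ltW t0)//; apply: Rintegral_ge0 => s _.
    by rewrite mulr_ge0//; have [->|->] := window_cases 0 t s.
  have := occupation_bound (F a x) t0; rewrite E !ler_norml.
  by have [->|->] := indic_cases A (F a x) => /andP[h1 h2] h3; apply/andP; split; lra.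
move=> hr nr; split => //; apply: (le_lt_trans nr).
apply: (@le_lt_trans _ _ (e / 2)); last by lra.
rewrite -[leRHS]ger0_norm ?divr_ge0 ?(ltW e0)// -sqrtr_sqr ler_wsqrtr//.
Qed.

(** Averaging the indicator over a time window produces an element of the domain
    of the generator: its difference quotients are differences of averages
    over short windows at both ends. *)
Lemma generator_flow_average t : 0 < t ->
  generator mu F (flow_average t) (fun x => 'i%C * (t^-1)%:C%C * (cindic (F t x) - cindic x)).
Proof.
move=> t0; have tn : t != 0 by rewrite gt_eqF.
have hg := L2_flow_average t0.
have hh : L2 mu (fun x => 'i%C * (t^-1)%:C%C * (cindic (F t x) - cindic x)).
  apply: L2Z; apply: L2B; last exact: L2_cindic.
  exact: (L2_flow FC1 Fmu t L2_cindic).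
set h := (fun x => _) in hh *.
apply/(generatorP FC1 Fmu); split => // e e0.
have c0 : 0 < t * (e / 4) by rewrite mulr_gt0// divr_gt0.
have HS := L2_semi_inner mu.
have ni (r : C) : Normc.normc ('i%C * (t^-1)%:C%C * r : C) = t^-1 * Normc.normc r.
  rewrite Normc.normcM; congr (_ * _).
  rewrite normcE -[RHS](ger0_norm (_ : 0 <= t^-1)) ?invr_ge0 ?(ltW t0)// -sqrtr_sqr.
  by congr Num.sqrt; rewrite /sqn !(ReM, ImM) /=; ring.
have [d1 d10 H1] := window_average_small c0.
have [d2 d20 H2] := displacement_small c0.
exists (Num.min d1 d2); first by rewrite lt_min d10.
(* Negative times reduce to positive ones by composing with the flow, at the
   cost of displacing [h]. *)
have pos s : 0 < s -> s < d1 -> N2 (fun x => diff_quot F s (flow_average t) x - h x) < e / 2.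
  move=> s0 sd; have [hr1 nr1] := H1 t s s0 sd; have [hr0 nr0] := H1 0 s s0 sd.
  have sn : s != 0 by rewrite gt_eqF.
  set r1 := (fun x => _) in hr1 nr1; set r0 := (fun x => _) in hr0 nr0.
  have E : (fun x => diff_quot F s (flow_average t) x - h x) = (fun x => 'i%C * (t^-1)%:C%C * (r1 - r0) x).
    apply/funext => x; have -> : (r1 - r0) x = r1 x - r0 x by [].
    rewrite /diff_quot /flow_average /h /cindic /r1 /r0 occupation_flow !add0r.
    have sp1 := occupation_split x (ltW s0) (_ : s <= t + s); rewrite lerDr in sp1.
    have sp2 := occupation_split x (ltW t0) (_ : t <= t + s); rewrite lerDl in sp2.
    have sp : occupation s (t + s) x = occupation 0 t x + occupation t (t + s) x - occupation 0 s x.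
      by have := sp1 (ltW t0); rewrite (sp2 (ltW s0)) => ->; ring.
    rewrite sp (flow0 FC1); apply: complexRI; rewrite !(ReM, ImM, ReD, ImD, ReN, ImN) /=.
      by ring.
    by field; rewrite tn sn.
  have hB : L2 mu (r1 - r0) by exact: (siB HS).
  rewrite E L2_normZ//; have := ni 1; rewrite mulr1 => ->.
  have -> : Normc.normc (1 : C) = 1 by rewrite normcE /sqn /= expr0n expr1n addr0 sqrtr1.
  rewrite mulr1 ltr_pdivrMl//; apply: (le_lt_trans (nrmB HS hr1 hr0)).
  rewrite /L2_norm in nr1 nr0; move: nr1 nr0; move: (nrm _ r1) (nrm _ r0) => a b.
  move=> aE bE; have -> : t * (e / 2) = t * (e / 4) + t * (e / 4) by field.
  exact: ltrD.
move=> s sn; rewrite lt_min => /andP[s1 s2].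
have [s0|s0|/eqP] := ltgtP s 0; last by rewrite (negPf sn).
  have sm0 : 0 < - s by rewrite oppr_gt0.
  have sm1 : - s < d1 by move: s1; rewrite ltr0_norm.
  have p := pos _ sm0 sm1.
  have hq : L2 mu (fun x => diff_quot F (- s) (flow_average t) x - h x) by apply: L2B => //; exact: L2_diff_quot.
  have hhs : L2 mu (fun x => h (F (- s) x)) by exact: L2_flow.
  have E : (fun x => diff_quot F s (flow_average t) x - h x) =
     (fun x => (fun y => diff_quot F (- s) (flow_average t) y - h (F (- s) y)) (F s x)).
    apply/funext => x; rewrite /diff_quot (flowK FC1) invrN rmorphN /=.
    by congr (_ - _); ring.
  have hE : L2 mu (fun y => diff_quot F (- s) (flow_average t) y - h (F (- s) y)) by apply: L2B => //; exact: L2_diff_quot.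
  rewrite E (L2_norm_flow FC1 Fmu s hE).
  have -> : (fun y => diff_quot F (- s) (flow_average t) y - h (F (- s) y)) =
    (fun y => diff_quot F (- s) (flow_average t) y - h y) - (fun y => h (F (- s) y) - h y).
    by apply/funext => y; rewrite !fctE; ring.
  have hB : L2 mu (fun y => h (F (- s) y) - h y) by exact: L2B.
  apply: (le_lt_trans (nrmB HS hq hB)).
  suff : N2 (fun y => h (F (- s) y) - h y) < e / 2 by move: p; rewrite /L2_norm; lra.
  pose w (x : borel X) : C := (\1_A (F (- s) x) - \1_A x : R)%:C%C.
  have [hw nw] : L2 mu w /\ N2 w < t * (e / 4).
    have [|x|h1 h2] := L2_norm_real_le (r := fun x => \1_A (F (- s) x) - \1_A x).
    - by apply: measurable_funB; [exact: measurable_indic_flow|exact: measurable_indic].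
    - exact: displacement_le1.
    by split => //; apply: (le_lt_trans h2); apply: H2; rewrite normrN.
  have hwt := L2_flow FC1 Fmu t hw.
  have -> : (fun y => h (F (- s) y) - h y) = (fun x => 'i%C * (t^-1)%:C%C * ((fun x => w (F t x)) - w) x).
    apply/funext => x; rewrite /h /w /cindic !fctE -!(flowD FC1) [t - s]addrC !rmorphB /=.
    ring.
  rewrite L2_normZ; last exact: (siB HS hwt hw).
  have := ni 1; rewrite mulr1 => ->.
  have -> : Normc.normc (1 : C) = 1 by rewrite normcE /sqn /= expr0n expr1n addr0 sqrtr1.
  rewrite mulr1 ltr_pdivrMl//; apply: (le_lt_trans (nrmB HS hwt hw)).
  have := L2_norm_flow FC1 Fmu t hw; rewrite /L2_norm in nw * => ->.
  move: nw; move: (nrm _ w) => a.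
  move=> aE; have -> : t * (e / 2) = t * (e / 4) + t * (e / 4) by field.
  exact: ltrD.
have : N2 (fun x => diff_quot F s (flow_average t) x - h x) < e / 2.
  by apply: pos => //; move: s1; rewrite gtr0_norm.
by move=> /lt_trans; apply; lra.
Qed.

Lemma flow_average_close e : 0 < e -> exists t,
  0 < t /\ N2 (fun x => flow_average t x - cindic x) < e.
Proof.
move=> e0; have [dl dl0 H] := window_average_small e0.
have d20 : 0 < dl / 2 by rewrite divr_gt0.
exists (dl / 2); split => //.
have [|_] := H 0 (dl / 2) d20; first by lra.
congr (L2_norm _ _ < _); apply/funext => x.
by rewrite add0r (flow0 FC1) rmorphB.
Qed.

End density.

(** Test on the sets where [u] is positive and where it is negative. *)
Lemma int_sets_eq0 d (T : measurableType d) (R : realType) (mu : {measure set T -> \bar R})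
    (u : T -> R) : rintegrable mu u ->
  (forall A, measurable A -> \int[mu]_x (u x * \1_A x) = 0) -> {ae mu, forall x, u x = 0}.
Proof.
move=> iu H; have mu' := rintegrable_measurable iu.
have mP : measurable [set x | 0 < u x].
  by have := mu' measurableT `]0, +oo[%classic (measurable_itv _); rewrite setTI;
     congr measurable; apply/seteqP; split => x /=; rewrite in_itv /= andbT.
have mN : measurable [set x | u x < 0].
  by have := mu' measurableT `]-oo, 0[%classic (measurable_itv _); rewrite setTI;
     congr measurable; apply/seteqP; split => x /=; rewrite in_itv /=.
have ii A : measurable A -> rintegrable mu (fun x => u x * \1_A x).
  move=> mA; apply: (le_rintegrable _ _ (integrable_norm iu)).
    by apply: measurable_funM => //; exact: measurable_indic.
  by move=> x; rewrite indicE; case: (x \in A); rewrite ?mulr1 ?mulr0 ?normr0 /=.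
have E : \int[mu]_x `|u x| = 0.
  have -> : \int[mu]_x `|u x| = \int[mu]_x (u x * \1_[set x | (0 < u x)%R] x - u x * \1_[set x | (u x < 0)%R] x).
    apply: eq_Rintegral => x _; rewrite !indicE.
    have -> : (x \in [set x | (0 < u x)%R]) = (0 < u x) by apply/idP/idP; rewrite inE.
    have -> : (x \in [set x | (u x < 0)%R]) = (u x < 0) by apply/idP/idP; rewrite inE.
    by case: (ltgtP (u x) 0) => [h|h|->]; rewrite ?(ltr0_norm h) ?(gtr0_norm h) ?normr0 /=; ring.
  by rewrite RintB; [rewrite !H// subrr|exact: ii|exact: ii].
have h : (\int[mu]_x `|(u x)%:E| = 0)%E.
  have := EFin_Rint (integrable_norm iu : rintegrable mu (fun x => `|u x|)).
  by rewrite E.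
have := (ae_eq_integral_abs mu measurableT (measurable_int mu iu)).1 h.
by move=> /ae_imp; apply => x /(_ Logic.I) [].
Qed.

Section density_of_domain.
Context {R : realType} {n : nat} {X : manifoldType R n}.
Variables (mu : probability (borel X) R) (F : R -> X -> X).
Hypotheses (FC1 : C1_flow F) (Fmu : measure_preserving_flow mu F).
Local Notation C := R[i].

(** A function orthogonal to the domain is orthogonal to all time averages of
    indicators, hence to all indicators because the flow is continuous in
    measure; therefore it vanishes. *)
Theorem generator_dense f e : L2 mu f -> 0 < e ->
  exists g h, generator mu F g h /\ L2_norm mu (fun x => f x - g x) < e.
Proof.
have HS := L2_semi_inner mu.
pose K (g : borel X -> C) : Prop := exists h, generator mu F g h.
have KE g : K g -> L2 mu g by move=> [h /generator_L2[]].
have K0 : K 0 by exists (fun=> 0); exact: generator0.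
have KD g g' : K g -> K g' -> K (g + g').
  by move=> [h Hh] [h' Hh']; exists (fun x => h x + h' x); exact: generatorD.
have KZ a g : K g -> K (rscale a g).
  by move=> [h Hh]; exists (fun x => a%:C%C * h x); exact: generatorZ.
have KN g : K g -> K (- g).
  move=> [h Hh]; exists (fun x => -1 * h x).
  have -> : - g = (fun x => -1 * g x) by apply/funext => x; rewrite mulN1r.
  exact: generatorZ.
move=> hf e0.
have H := biorthogonal_closure HS (@L2_complete _ _ _ mu) KE K0 KD KZ KN hf.
have [|g [h Hh] Hg] := H _ e e0; last by exists g, h.
move=> s hs sK.
suff s0 : L2_norm mu s = 0 by rewrite (qC HS hf hs) (nrm_null HS hs hf).
have key (A : set (borel X)) (a : C) : measurable A -> re_inner mu s (fun x => a * cindic A x) = 0.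
  move=> mA; have hA := L2_cindic mu mA.
  apply: (@small_eq0 _ _ (L2_norm mu s * Normc.normc a)); first by rewrite mulr_ge0 ?nrm_ge0 ?normc_ge0.
  move=> z z0; have [t [t0 Ht]] := flow_average_close FC1 Fmu mA z0.
  have hg := L2_flow_average mu FC1 mA t0.
  have Kg : K (fun x => a * flow_average F A t x).
    eexists; apply: (generatorZ FC1 Fmu a); exact: (generator_flow_average FC1 Fmu mA t0).
  have -> : re_inner mu s (fun x => a * cindic A x) =
      re_inner mu s ((fun x => a * cindic A x) - (fun x => a * flow_average F A t x)).
    by rewrite (qBr HS (L2Z a hA) (L2Z a hg) hs) (sK _ Kg) subr0.
  rewrite (le_trans (cauchy_schwarz HS hs (siB HS (L2Z a hA) (L2Z a hg))))//.
  rewrite mulrCA ler_wpM2l ?nrm_ge0//.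
  have -> : (fun x => a * cindic A x) - (fun x => a * flow_average F A t x) =
     (fun x => - a * (flow_average F A t x - cindic A x)).
    by apply/funext => x; rewrite !fctE; ring.
  have := L2_normZ (- a) (L2B hg hA); rewrite /L2_norm => ->; rewrite normcN mulrC.
  by rewrite ler_wpM2r ?normc_ge0// ltW.
have [hsRe hsIm] := (L2_real_L2 mu s).1 hs.
have hRe : {ae mu, forall x, complex.Re (s x) = 0}.
  apply: int_sets_eq0; first exact: real_L2_int.
  move=> A mA; have := key A 1 mA; rewrite /re_inner => h; rewrite -[RHS]h; apply: eq_Rintegral => x _.
  by rewrite mul1r !(ReM, ImM, ReJ, ImJ) /=; ring.
have hIm : {ae mu, forall x, complex.Im (s x) = 0}.
  apply: int_sets_eq0; first exact: real_L2_int.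
  move=> A mA; have := key A 'i%C mA; rewrite /re_inner => h; rewrite -[RHS]h; apply: eq_Rintegral => x _.
  by rewrite !(ReM, ImM, ReJ, ImJ) /=; ring.
have [|_] := ae_le_L2 hs.1 (si0 HS : L2 mu 0).
  apply: (ae_imp2 hRe hIm) => x h1 h2.
  by have -> : s x = 0 by apply: complexRI.
rewrite /L2_norm (nrm0 HS) => h; apply/eqP; rewrite eq_le h; exact: nrm_ge0.
Qed.

End density_of_domain.

(** * Schur orthogonality, coefficients and the skew product *)

Section product_integrals.
Context d1 d2 (T1 : measurableType d1) (T2 : measurableType d2) {R : realType}.
Variables (m1 : probability T1 R) (m2 : probability T2 R).
Local Notation C := R[i].
Local Notation Re := complex.Re.
Local Notation Im := complex.Im.
Local Notation mu := (m1 \x m2)%E.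

Lemma prod_rintegrable (u : T1 -> R) (v : T2 -> R) (c : R) : rintegrable m1 u ->
  measurable_fun setT v -> (forall y, `|v y| <= c) ->
  rintegrable mu (fun z => u z.1 * v z.2).
Proof.
move=> iu mv vc; have mu' := rintegrable_measurable iu.
have mf : measurable_fun setT (fun z : T1 * T2 => (u z.1 * v z.2)%:E).
  apply/measurable_EFinP; apply: measurable_funM.
    exact: (measurableT_comp mu' (@measurable_fst _ _ _ _)).
  exact: (measurableT_comp mv (@measurable_snd _ _ _ _)).
apply/(integrable12ltyP m1 m2 mf).
have iuc : rintegrable m1 (fun x => c * `|u x|) := rintegrableZ c (integrable_norm iu).
apply: (@le_lt_trans _ _ (\int[m1]_x (c * `|u x|)%:E)%E); last by rewrite EFin_Rint// ltry.
have mabs : measurable_fun setT (fun z : T1 * T2 => `|(u z.1 * v z.2)%:E|%E).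
  exact: measurableT_comp.
apply: ge0_le_integral => //.
- by move=> x _; apply: integral_ge0 => y _.
- exact: (@measurable_fun_fubini_tonelli_F _ _ _ _ _ m2 _ mabs (fun z => abse_ge0 _)).
- by apply/measurable_EFinP; exact: rintegrable_measurable iuc.
move=> x _; apply: (@le_trans _ _ (\int[m2]_y (c * `|u x|)%:E)%E).
  apply: ge0_le_integral => //.
  - apply: measurableT_comp => //; apply/measurable_EFinP.
    exact: (measurable_funM (measurable_cst (u x)) mv).
  by move=> y _; rewrite /= lee_fin normrM mulrC ler_wpM2r.
by rewrite integral_cst//= probability_setT mule1.
Qed.

Lemma prod_Rintegral (u : T1 -> R) (v : T2 -> R) (c : R) : rintegrable m1 u ->
  measurable_fun setT v -> (forall y, `|v y| <= c) ->
  \int[mu]_z (u z.1 * v z.2) = \int[m1]_x u x * \int[m2]_y v y.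
Proof.
move=> iu mv vc; have i := prod_rintegrable iu mv vc.
have iv : rintegrable m2 v by exact: bounded_rintegrable vc.
rewrite /Rintegral -(integral12_prod_meas1 i).
have -> : (\int[m1]_x fubini_F m2 (EFin \o (fun z => (u z.1 * v z.2)%R)) x =
    \int[m1]_x ((\int[m2]_y v y) * u x)%R%:E)%E.
  apply: eq_integral => x _; rewrite /fubini_F /= EFin_Rint; last exact: rintegrableZ.
  by rewrite RintZ// mulrC.
transitivity (\int[m1]_x ((\int[m2]_y v y) * u x)) => //.
by rewrite RintZ// mulrC.
Qed.

Lemma cintegrable_prod (u : T1 -> C) (v : T2 -> C) (c : R) : cintegrable m1 u -> cmeasurable v ->
  (forall y, `|Re (v y)| <= c) -> (forall y, `|Im (v y)| <= c) ->
  cintegrable mu (fun z => u z.1 * v z.2).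
Proof.
move=> [u1 u2] [v1 v2] c1 c2; split.
  under eq_fun do rewrite ReM.
  by apply: rintegrableB; [exact: (prod_rintegrable u1 v1 c1)|exact: (prod_rintegrable u2 v2 c2)].
under eq_fun do rewrite ImM.
by apply: rintegrableD; [exact: (prod_rintegrable u1 v2 c2)|exact: (prod_rintegrable u2 v1 c1)].
Qed.

Lemma cint_prod (u : T1 -> C) (v : T2 -> C) (c : R) : cintegrable m1 u -> cmeasurable v ->
  (forall y, `|Re (v y)| <= c) -> (forall y, `|Im (v y)| <= c) ->
  cint mu (fun z => u z.1 * v z.2) = cint m1 u * cint m2 v.
Proof.
move=> [u1 u2] [v1 v2] c1 c2; apply: complexRI; rewrite ?ReM ?ImM /=.
  transitivity (\int[mu]_z (Re (u z.1) * Re (v z.2) - Im (u z.1) * Im (v z.2))).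
    by apply: eq_Rintegral => z _; rewrite ReM.
  rewrite (RintB (prod_rintegrable u1 v1 c1) (prod_rintegrable u2 v2 c2)).
  by rewrite -(prod_Rintegral u1 v1 c1) -(prod_Rintegral u2 v2 c2).
transitivity (\int[mu]_z (Re (u z.1) * Im (v z.2) + Im (u z.1) * Re (v z.2))).
  by apply: eq_Rintegral => z _; rewrite ImM.
rewrite (RintD (prod_rintegrable u1 v2 c2) (prod_rintegrable u2 v1 c1)).
by rewrite -(prod_Rintegral u1 v2 c2) -(prod_Rintegral u2 v1 c1).
Qed.

End product_integrals.

Lemma cint_mp d (T : measurableType d) {R : realType} (mu : {measure set T -> \bar R}) (h : T -> T)
    (f : T -> R[i]) : measurable_fun setT h ->
  (forall A, measurable A -> mu (h @^-1` A) = mu A) -> cmeasurable f ->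
  cint mu (fun x => f (h x)) = cint mu f.
Proof.
move=> mh muh [f1 f2]; congr (_ +i* _)%C.
  exact: (Rintegral_mp mh muh f1).
exact: (Rintegral_mp mh muh f2).
Qed.

Lemma conjCD {R : realType} (a b : R[i]) : (a + b)^* = a^* + b^*.
Proof. by apply: complexRI; rewrite ?(ReD, ImD, ReJ, ImJ) //; ring. Qed.
Lemma conjCM {R : realType} (a b : R[i]) : (a * b)^* = a^* * b^*.
Proof. by apply: complexRI; rewrite ?(ReM, ImM, ReJ, ImJ) //; ring. Qed.
Lemma conjC_sum {R : realType} (I : Type) (s : seq I) (f : I -> R[i]) :
  (\sum_(i <- s) f i)^* = \sum_(i <- s) (f i)^*.
Proof.
elim: s => [|i s IH]; last by rewrite !big_cons conjCD IH.
by rewrite !big_nil; apply: complexRI; rewrite ?ReJ ?ImJ //= oppr0.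
Qed.

Section schur.
Context {R : realType} {m : nat} {G : lieGroupType R m}.
Variables (muG : probability (borel G) R).
Hypothesis haarG : haar_probability muG.
Local Notation C := R[i].
Variables (d : nat) (pi : G -> 'M[C]_d) (j : 'I_d).
Hypothesis pi_irrep : unitary_irrep pi.

Lemma rep_normc_le1 g k l : Normc.normc (pi g k l) <= 1.
Proof. by rewrite normcE -[leRHS]sqrtr1 ler_wsqrtr// rep_sqn_le1. Qed.

Lemma conj_prod_cmeasurable k l : cmeasurable (fun g : borel G => (pi g j k)^* * pi g j l).
Proof. by apply: cmeasurableM; [apply: cmeasurableJ|]; exact: rep_cmeasurable. Qed.

Lemma conj_prod_bound g k l : Normc.normc ((pi g j k)^* * pi g j l) <= 1.
Proof.
rewrite Normc.normcM [X in X * _]normcE sqnJ -normcE.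
by rewrite mulr_ile1 ?normc_ge0 ?rep_normc_le1.
Qed.

Lemma conj_prod_Re_bound g k l : `|complex.Re ((pi g j k)^* * pi g j l)| <= 1.
Proof. exact: le_trans (Re_le_normc _) (conj_prod_bound _ _ _). Qed.

Lemma conj_prod_Im_bound g k l : `|complex.Im ((pi g j k)^* * pi g j l)| <= 1.
Proof. exact: le_trans (Im_le_normc _) (conj_prod_bound _ _ _). Qed.

Lemma conj_prod_cintegrable k l : cintegrable muG (fun g => (pi g j k)^* * pi g j l).
Proof.
have [h1 h2] := conj_prod_cmeasurable k l; split.
  by apply: (bounded_rintegrable muG h1 (M := 1)) => g; exact: conj_prod_Re_bound.
by apply: (bounded_rintegrable muG h2 (M := 1)) => g; exact: conj_prod_Im_bound.
Qed.

(** The Gram matrix of the matrix elements in the [j]-th row commutes with the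
    representation, by right invariance of the Haar measure, hence is scalar;
    its trace is 1. *)
Lemma schur_orthogonality k l : cint muG (fun g => (pi g j k)^* * pi g j l) = (k == l)%:R / d%:R.
Proof.
pose K : 'M[C]_d := \matrix_(k, l) cint muG (fun g => (pi g j k)^* * pi g j l).
have KE k' l' : K k' l' = cint muG (fun g => (pi g j k')^* * pi g j l') by rewrite mxE.
have comm h : K = adj (pi h) *m K *m pi h.
  apply/matrixP => k' l'; rewrite KE.
  have := cint_mp (measurable_mulgr h) (haar_right haarG h) (conj_prod_cmeasurable k' l').
  move=> <-; transitivity (cint muG (fun g => \sum_s \sum_r
      (pi h r k')^* * pi h s l' * ((pi g j r)^* * pi g j s))).
    apply: eq_cint => g; rewrite (repM pi_irrep) !mxE conjC_sum mulr_sumr.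
    apply: eq_bigr => s _; rewrite mulr_suml; apply: eq_bigr => r _.
    by rewrite conjCM; ring.
  rewrite cint_sum; last first.
    by move=> s; apply: cintegrable_sum => r; apply: cintegrableZ; exact: conj_prod_cintegrable.
  rewrite mxE; apply: eq_bigr => s _; rewrite cint_sum; last first.
    by move=> r; apply: cintegrableZ; exact: conj_prod_cintegrable.
  rewrite mxE mulr_suml; apply: eq_bigr => r _.
  by rewrite cintZ; [rewrite KE mxE; ring|exact: conj_prod_cintegrable].
have {}comm h : pi h *m K = K *m pi h.
  by rewrite {1}(comm h) !mulmxA (rep_unitary pi_irrep) mul1mx.
have d0 : (0 < d)%N by case: pi_irrep.
have [lam Hlam] := eigenvalue_closed K^T d0.
have [_ _ _ _ irr] := pi_irrep.
have [|V0|full] := irr (eigenspace K^T lam).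
- move=> g; apply/eigenspaceP.
  rewrite -mulmxA -trmx_mul -comm trmx_mul mulmxA.
  have /eigenspaceP -> : (eigenspace K^T lam <= eigenspace K^T lam)%MS by exact: submx_refl.
  by rewrite -scalemxAl.
- by move: Hlam; rewrite /eigenvalue V0 eqxx.
have Ks : K = lam%:M.
  move: full; rewrite -sub1mx => /eigenspaceP; rewrite mul1mx => h.
  by rewrite -[K]trmxK h linearZ /= trmx1 scalemx1.
have tr : \sum_k' K k' k' = 1.
  transitivity (cint muG (fun g => \sum_k' (pi g j k')^* * pi g j k')).
    by rewrite cint_sum; [apply: eq_bigr => k' _; rewrite KE|move=> k'; exact: conj_prod_cintegrable].
  have -> : (fun g => \sum_k' (pi g j k')^* * pi g j k') = fun=> 1.
    apply/funext => g; transitivity ((pi g *m adj (pi g)) j j).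
      by rewrite mxE; apply: eq_bigr => k' _; rewrite mxE mulrC.
    by rewrite rep_unitary// mxE eqxx.
  apply: complexRI; rewrite /= /Rintegral; last by rewrite integral0.
  by rewrite integral_cst//= probability_setT mule1.
have lamE : lam = d%:R^-1.
  move: tr; under eq_bigr do rewrite Ks mxE eqxx mulr1n.
  rewrite sumr_const card_ord -[lam *+ d]mulr_natl => h.
  have dn : (d%:R : C) != 0 by rewrite pnatr_eq0 -lt0n.
  by apply: (mulfI dn); rewrite h mulfV.
by rewrite -KE Ks mxE lamE; case: (k == l); rewrite ?mulr1n ?mulr0n ?mul1r ?mul0r.
Qed.

End schur.

Section coefficient_functions.
Context {R : realType} {n m : nat} {X : manifoldType R n} {G : lieGroupType R m}.
Variables (muX : probability (borel X) R) (muG : probability (borel G) R).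
Hypothesis haarG : haar_probability muG.
Local Notation C := R[i].
Variables (d : nat) (pi : G -> 'M[C]_d) (j : 'I_d).
Hypothesis pi_irrep : unitary_irrep pi.
Local Notation XG := (borel X * borel G)%type.
Local Notation mu := (muX \x muG)%E.
Local Notation fam := ('I_d -> borel X -> C).
Implicit Types f g : fam.

Lemma L2_coef_fun f : L2_fam muX f -> L2 mu (coef_fun pi j f).
Proof.
move=> hf; apply: L2_sum => k; have /L2P[mf jf] := hf k; apply/L2P; split.
  apply: cmeasurableM; first exact: (cmeasurable_comp (@measurable_fst _ _ _ _) mf).
  exact: (cmeasurable_comp (@measurable_snd _ _ _ _) (rep_cmeasurable pi_irrep j k)).
have -> : (fun z : XG => sqn (f k z.1 * pi z.2 j k)) =
   (fun z => (fun x => sqn (f k x)) z.1 * (fun y => sqn (pi y j k)) z.2).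
  by apply/funext => z; rewrite sqnM.
apply: (@prod_rintegrable _ _ _ _ _ muX muG _ (fun y => sqn (pi y j k)) 1 jf).
  by apply: cmeasurable_sqn; exact: rep_cmeasurable.
by move=> g; rewrite ger0_norm ?sqn_ge0// rep_sqn_le1.
Qed.

(** Up to the factor [d%:R^-1], families of coefficients embed isometrically,
    by orthogonality of the matrix elements in a row. *)
Lemma inner_coef_fun f g : L2_fam muX f -> L2_fam muX g ->
  inner mu (coef_fun pi j f) (coef_fun pi j g) = d%:R^-1 * \sum_k inner muX (f k) (g k).
Proof.
move=> hf hg; rewrite inner_cint.
pose t k l (z : XG) : C := ((f k z.1)^* * g l z.1) * ((pi z.2 j k)^* * pi z.2 j l).
have it k l : cintegrable mu (t k l).
  apply: (@cintegrable_prod _ _ _ _ _ muX muG _ (fun y => (pi y j k)^* * pi y j l) 1 (L2_prod_int (hf k) (hg l))).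
  - exact: conj_prod_cmeasurable.
  - by move=> y; exact: conj_prod_Re_bound.
  - by move=> y; exact: conj_prod_Im_bound.
transitivity (cint mu (fun z => \sum_k \sum_l t k l z)).
  apply: eq_cint => z; rewrite /coef_fun conjC_sum mulr_suml; apply: eq_bigr => k _.
  by rewrite mulr_sumr; apply: eq_bigr => l _; rewrite conjCM /t; ring.
rewrite cint_sum; last by move=> k; exact: cintegrable_sum.
rewrite mulr_sumr; apply: eq_bigr => k _; rewrite cint_sum; last by move=> l; exact: it.
have E l : cint mu (t k l) = inner muX (f k) (g l) * ((k == l)%:R / d%:R).
  rewrite -(schur_orthogonality haarG j pi_irrep).
  apply: (@cint_prod _ _ _ _ _ muX muG _ (fun y => (pi y j k)^* * pi y j l) 1 (L2_prod_int (hf k) (hg l))).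
  - exact: conj_prod_cmeasurable.
  - by move=> y; exact: conj_prod_Re_bound.
  - by move=> y; exact: conj_prod_Im_bound.
under eq_bigr do rewrite E.
rewrite (bigD1 k)//= eqxx big1 => [|l lk]; last by rewrite eq_sym (negPf lk) mul0r mulr0.
by rewrite addr0 mul1r mulrC.
Qed.

Lemma coef_funD f g : coef_fun pi j (f + g) = (fun z => coef_fun pi j f z + coef_fun pi j g z).
Proof.
apply/funext => z; rewrite /coef_fun -big_split; apply: eq_bigr => k _ /=.
by rewrite -mulrDl.
Qed.

Lemma coef_funZ (a : C) f : coef_fun pi j (fun k x => a * f k x) = (fun z => a * coef_fun pi j f z).
Proof. by apply/funext => z; rewrite /coef_fun mulr_sumr; apply: eq_bigr => k _; rewrite mulrA. Qed.

Lemma coef_funB f g : coef_fun pi j (f - g) = (fun z => coef_fun pi j f z - coef_fun pi j g z).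
Proof.
apply/funext => z; rewrite /coef_fun -sumrB; apply: eq_bigr => k _ /=.
by rewrite -mulrBl.
Qed.

Lemma re_inner_coef_fun f g : L2_fam muX f -> L2_fam muX g ->
  re_inner mu (coef_fun pi j f) (coef_fun pi j g) = d%:R^-1 * fam_inner muX f g.
Proof.
move=> hf hg; rewrite -Re_inner inner_coef_fun// ReM Re_sum.
have -> : (d%:R^-1 : C) = (d%:R^-1 : R)%:C%C by rewrite fmorphV /= rmorph_nat.
by rewrite /= mul0r subr0.
Qed.

Lemma L2_norm_coef_fun f : L2_fam muX f ->
  L2_norm mu (coef_fun pi j f) = Num.sqrt d%:R^-1 * fam_norm muX f.
Proof. by move=> hf; rewrite /L2_norm /nrm re_inner_coef_fun// sqrtrM// invr_ge0. Qed.

Lemma ae_coef_fun f g : L2_fam muX f -> L2_fam muX g -> fam_norm muX (f - g) = 0 ->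
  coef_fun pi j f = coef_fun pi j g %[ae mu].
Proof.
move=> hf hg fg; have hB := siB (L2_fam_semi_inner muX d) hf hg.
have := L2_norm_coef_fun hB; rewrite fg mulr0 => /(ae_L2_norm (L2_coef_fun hB)).
move=> /ae_imp; apply => z /(_ Logic.I) h _; apply/eqP; rewrite -subr_eq0.
by apply/eqP; rewrite -[RHS]h coef_funB.
Qed.

Lemma coef_fun_ae_inj f g : L2_fam muX f -> L2_fam muX g ->
  coef_fun pi j f = coef_fun pi j g %[ae mu] -> fam_norm muX (f - g) = 0.
Proof.
move=> hf hg fg; have hB := siB (L2_fam_semi_inner muX d) hf hg.
have h0 : L2_norm mu (coef_fun pi j (f - g)) = 0.
  have /ae_imp H := fg.
  have ae0 : coef_fun pi j (f - g) = (fun=> 0) %[ae mu].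
    by apply: H => z /(_ Logic.I) h _; rewrite coef_funB h subrr.
  have := ae_cnorm2 (L2_coef_fun hB).1 (L20 mu).1 ae0.
  rewrite !cnorm2_L2; [|exact: L20|exact: L2_coef_fun].
  by move=> [->]; rewrite /L2_norm (nrm0 (L2_semi_inner mu)).
have d0 : (0 < d)%N by case: pi_irrep.
move/eqP: h0; rewrite L2_norm_coef_fun// mulf_eq0 => /orP[|/eqP//].
by rewrite sqrtr_eq0 leNgt invr_gt0 ltr0n d0.
Qed.

End coefficient_functions.

Section skew_product.
Context {R : realType} {n m : nat} {X : manifoldType R n} {G : lieGroupType R m}.
Variables (muX : probability (borel X) R) (muG : probability (borel G) R).
Hypothesis haarG : haar_probability muG.
Local Notation C := R[i].
Variables (F : R -> X -> X) (phi : X -> G).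
Hypotheses (FC1 : C1_flow F) (Fmu : measure_preserving_flow muX F).
Hypothesis mphi : measurable_fun setT (phi : borel X -> borel G).
Local Notation XG := (borel X * borel G)%type.
Local Notation mu := (muX \x muG)%E.

Lemma skew_measurable : measurable_fun setT (skew_product F phi : XG -> XG).
Proof.
apply/measurable_fun_pair => /=.
  exact: (measurableT_comp (flow_measurable FC1 1) (@measurable_fst _ _ _ _)).
have h : measurable_fun setT (fun z : XG => (z.2, phi z.1 : borel G)).
  apply/measurable_fun_pair => /=; first exact: measurable_snd.
  exact: (measurableT_comp mphi (@measurable_fst _ _ _ _)).
exact: (measurableT_comp measurable_mulg h).
Qed.

Lemma skew_inv_measurable : measurable_fun setT (skew_product_inv F phi : XG -> XG).
Proof.
apply/measurable_fun_pair => /=.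
  exact: (measurableT_comp (flow_measurable FC1 (-1)) (@measurable_fst _ _ _ _)).
have h : measurable_fun setT (fun z : XG => (z.2, (phi (F (-1) z.1))^-1%g : borel G)).
  apply/measurable_fun_pair => /=; first exact: measurable_snd.
  apply: (measurableT_comp measurable_invg); apply: (measurableT_comp mphi).
  exact: (measurableT_comp (flow_measurable FC1 (-1)) (@measurable_fst _ _ _ _)).
exact: (measurableT_comp measurable_mulg h).
Qed.

(** Right translations preserve the Haar measure in the fibres, and the flow
    preserves the measure of the base. *)
Lemma skew_mp (A : set XG) : measurable A -> mu (skew_product F phi @^-1` A) = mu A.
Proof.
move=> mA; rewrite /= /product_measure1.
transitivity (\int[muX]_x (muG (xsection A (F 1 x))))%E.
  apply: eq_integral => x _ /=.
  rewrite -[RHS](haar_right haarG (phi x)); last exact: measurable_xsection.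
  by congr (muG _); apply/seteqP; split=> g; rewrite /xsection /= !inE.
have mf : measurable_fun setT (fun x => muG (xsection A x)).
  exact: measurable_fun_xsection.
exact: (ge0_integral_mp (flow_measurable FC1 1) (Fmu 1) mf).
Qed.

Lemma skew_inv_mp (A : set XG) : measurable A -> mu (skew_product_inv F phi @^-1` A) = mu A.
Proof.
move=> mA; have [K1 K2] := skew_productK phi FC1.
rewrite -[LHS]skew_mp; last by rewrite -[_ @^-1` _]setTI; exact: skew_inv_measurable.
by congr (mu _); apply/seteqP; split=> z /=; rewrite K1.
Qed.

End skew_product.

(** * Square integrable functions into the Lie algebra *)

Section ad_invariant_product.
Context {R : realType} {m : nat}.
Variable ip : {dot 'rV[R]_m for idfun}.
Implicit Types u v w : 'rV[R]_m.

Lemma ipC u v : ip u v = ip v u. Proof. by rewrite hermC /= mul1r. Qed.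
Lemma ipDl u v w : ip (u + v) w = ip u w + ip v w. Proof. exact: linearDl. Qed.
Lemma ipZl a u w : ip (a *: u) w = a * ip u w. Proof. exact: linearZl_LR. Qed.
Lemma ipZr a u w : ip w (a *: u) = a * ip w u. Proof. by rewrite ![ip w _]ipC ipZl. Qed.
Lemma ip0l w : ip 0 w = 0. Proof. by rewrite -(scale0r 0) ipZl mul0r. Qed.
Lemma ip_suml (I : Type) (s : seq I) (f : I -> 'rV[R]_m) w :
  ip (\sum_(i <- s) f i) w = \sum_(i <- s) ip (f i) w.
Proof. by elim: s => [|i s IH]; rewrite ?big_nil ?ip0l// !big_cons ipDl IH. Qed.
Lemma ip_sumr (I : Type) (s : seq I) (f : I -> 'rV[R]_m) w :
  ip w (\sum_(i <- s) f i) = \sum_(i <- s) ip w (f i).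
Proof. by rewrite ipC ip_suml; apply: eq_bigr => i _; rewrite ipC. Qed.
Lemma ip_gt0 u : u != 0 -> 0 < ip u u. Proof. exact: neq0_dnorm_gt0. Qed.
Lemma ip_ge0 u : 0 <= ip u u.
Proof. by have [->|/ip_gt0/ltW//] := eqVneq u 0; rewrite ip0l. Qed.
Lemma ip_eq0 u : ip u u = 0 -> u = 0.
Proof. by move=> h; apply/eqP; apply: contraT => /ip_gt0; rewrite h ltxx. Qed.

Lemma ip_semi_inner : semi_inner (fun _ : 'rV[R]_m => True) (fun a u => a *: u) ip.
Proof.
split=> //; [by move=> u v _ _; exact: ipC|by move=> *; exact: ipDl|by move=> *; exact: ipZl|].
by move=> u _; exact: ip_ge0.
Qed.

Local Notation e i := (delta_mx 0 i : 'rV[R]_m).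

Lemma ip_expand u v : ip u v = \sum_i \sum_k u 0 i * v 0 k * ip (e i) (e k).
Proof.
rewrite {1}[u]row_sum_delta ip_suml; apply: eq_bigr => i _.
rewrite {1}[v]row_sum_delta ip_sumr; apply: eq_bigr => k _.
by rewrite ipZl ipZr mulrA.
Qed.

(** The Gram matrix of the standard basis is invertible. *)
Lemma coord_ip : exists w : 'I_m -> 'rV[R]_m, forall v i, v 0 i = ip v (w i).
Proof.
pose Gm : 'M[R]_m := \matrix_(i, k) ip (e i) (e k).
have GmE v k : (v *m Gm) 0 k = ip v (e k).
  rewrite mxE {2}[v]row_sum_delta ip_suml; apply: eq_bigr => i _.
  by rewrite ipZl mxE.
have uG : Gm \in unitmx.
  apply: unitmx_inj_rows => u uG; apply: ip_eq0.
  rewrite {2}[u]row_sum_delta ip_sumr big1// => k _.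
  by rewrite ipZr -GmE uG mxE mulr0.
exists (fun i => \sum_k invmx Gm k i *: e k) => v i.
rewrite -{1}[v](mulmxK uG) mxE ip_sumr; apply: eq_bigr => k _.
by rewrite GmE ipZr mulrC.
Qed.

Lemma coord_sq_le : exists2 K : R, 0 <= K & forall v i, v 0 i ^+ 2 <= K * ip v v.
Proof.
have [w Hw] := coord_ip; exists (\sum_i ip (w i) (w i)).
  by apply: sumr_ge0 => i _; exact: ip_ge0.
move=> v i; rewrite Hw (le_trans (cauchy_schwarz_sq ip_semi_inner (x := v) (y := w i) Logic.I Logic.I))//.
rewrite mulrC ler_wpM2r ?ip_ge0// (bigD1 i)//= lerDl.
by apply: sumr_ge0 => k _; exact: ip_ge0.
Qed.

Lemma ip_le_coord_sq : exists2 K : R, 0 <= K & forall v, ip v v <= K * \sum_i v 0 i ^+ 2.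
Proof.
exists (\sum_i \sum_k `|ip (e i) (e k)|).
  by apply: sumr_ge0 => i _; apply: sumr_ge0.
move=> v; rewrite ip_expand mulr_suml; apply: ler_sum => i _.
rewrite mulr_suml; apply: ler_sum => k _.
have h l : v 0 l ^+ 2 <= \sum_i v 0 i ^+ 2.
  by rewrite (bigD1 l)//= lerDl; apply: sumr_ge0 => l' _; exact: sqr_ge0.
rewrite (le_trans (ler_norm _))// normrM mulrC ler_wpM2l// normrM.
have := h i; have := h k; rewrite -(real_normK (num_real (v 0 i))) -(real_normK (num_real (v 0 k))).
have := sqr_ge0 (`|v 0 i| - `|v 0 k|); nra.
Qed.

End ad_invariant_product.

Section L2_lie_space.
Context d (T : measurableType d) {R : realType} (mu : probability T R).

Lemma real_L2_prod_int (f g : T -> R) : real_L2 mu f -> real_L2 mu g -> rintegrable mu (fun x => f x * g x).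
Proof.
move=> [mf jf] [mg jg]; apply: (le_rintegrable _ _ (rintegrableD jf jg)).
  exact: measurable_funM.
move=> x; rewrite normrM -(real_normK (num_real (f x))) -(real_normK (num_real (g x))).
have := sqr_ge0 (`|f x| - `|g x|); have := normr_ge0 (f x); have := normr_ge0 (g x); nra.
Qed.

Lemma real_L2_int0 (f : T -> R) : real_L2 mu f -> \int[mu]_x (f x ^+ 2) = 0 -> {ae mu, forall x, f x = 0}.
Proof.
move=> [mf jf] f0.
have h : (\int[mu]_x `|(f x ^+ 2)%:E| = 0)%E.
  under eq_integral do rewrite gee0_abs ?lee_fin ?sqr_ge0//.
  by rewrite EFin_Rint// f0.
have := (ae_eq_integral_abs mu measurableT (measurable_int mu jf)).1 h.
by move=> /ae_imp; apply => x /(_ Logic.I) [] /eqP; rewrite sqrf_eq0 => /eqP.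
Qed.

Context {m : nat} (ip : {dot 'rV[R]_m for idfun}).
Implicit Types f g : T -> 'rV[R]_m.

Definition coord_real_L2 f : Prop := forall i, real_L2 mu (fun x => f x 0 i).

Lemma ip_rintegrable f g : coord_real_L2 f -> coord_real_L2 g -> rintegrable mu (fun x => ip (f x) (g x)).
Proof.
move=> hf hg; under eq_fun do rewrite ip_expand.
apply: rintegrable_sum => i; apply: rintegrable_sum => k.
under eq_fun do rewrite mulrC; apply: rintegrableZ; exact: real_L2_prod_int.
Qed.

Definition lie_scale (a : R) f : T -> 'rV[R]_m := fun x => a *: f x.
Definition lie_inner f g : R := \int[mu]_x ip (f x) (g x).

Lemma coord_real_L2_semi_inner : semi_inner (coord_real_L2 : (T -> 'rV[R]_m) -> Prop) lie_scale lie_inner.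
Proof.
split.
- move=> i; split; first by under eq_fun do rewrite mxE; exact: measurable_cst.
  by under eq_fun do rewrite mxE expr0n; exact: rintegrable0.
- by move=> f g hf hg i; under eq_fun do rewrite mxE; exact: real_L2D.
- by move=> f hf i; under eq_fun do rewrite mxE; exact: real_L2N.
- by move=> a f hf i; under eq_fun do rewrite mxE; exact: real_L2Z.
- by move=> f g _ _; apply: eq_Rintegral => x _; exact: ipC.
- move=> f g h hf hg hh; rewrite /lie_inner -RintD; [|exact: ip_rintegrable..].
  by apply: eq_Rintegral => x _; rewrite -ipDl.
- move=> a f h hf hh; rewrite /lie_inner -RintZ; last exact: ip_rintegrable.
  by apply: eq_Rintegral => x _; rewrite -ipZl.
- by move=> f _; apply: Rintegral_ge0 => x _; exact: ip_ge0.
Qed.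

Lemma coord_int_le : exists2 K : R, 0 <= K & forall f i, coord_real_L2 f ->
  \int[mu]_x (f x 0 i ^+ 2) <= K * lie_inner f f.
Proof.
have [K K0 HK] := coord_sq_le ip; exists K => // f i hf.
rewrite /lie_inner -RintZ; last exact: ip_rintegrable.
apply: le_Rintegral => //; [by case: (hf i)|by apply: rintegrableZ; exact: ip_rintegrable].
Qed.

Lemma lie_inner_le : exists2 K : R, 0 <= K & forall f, coord_real_L2 f ->
  lie_inner f f <= K * \sum_i \int[mu]_x (f x 0 i ^+ 2).
Proof.
have [K K0 HK] := ip_le_coord_sq ip; exists K => // f hf.
have ii i : rintegrable mu (fun x => f x 0 i ^+ 2) by case: (hf i).
rewrite -Rintegral_sum// -RintZ; last exact: rintegrable_sum.
apply: le_Rintegral => //; [exact: ip_rintegrable|by apply: rintegrableZ; exact: rintegrable_sum].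
Qed.

(** Coordinatewise, as [ip] is equivalent to the standard scalar product. *)
Lemma coord_real_L2_complete : si_complete (coord_real_L2 : (T -> 'rV[R]_m) -> Prop) lie_inner.
Proof.
have HS := coord_real_L2_semi_inner.
have [K K0 HK] := coord_int_le; have [K' K'0 HK'] := lie_inner_le.
move=> u hu cu.
have /choice[l Hl] : forall i, exists l, real_L2 mu l /\ forall e, 0 < e -> exists N, forall n, (N <= n)%N ->
    \int[mu]_x ((u n x 0 i - l x) ^+ 2) <= e.
  move=> i; have [] := @riesz_fischer _ _ _ mu (fun n x => u n x 0 i).
  - by move=> n; exact: hu.
  - move=> e e0; have K1 : 0 < K + 1 by rewrite ltr_wpDl.
    have e1 : 0 < Num.sqrt (e / (K + 1)) by rewrite sqrtr_gt0 divr_gt0.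
    have [N HN] := cu _ e1; exists N => n p Nn Np.
    have hB := siB HS (hu n) (hu p).
    have := HN n p Nn Np; rewrite -ltr_sqr ?nnegrE ?nrm_ge0 ?sqrtr_ge0// (nrm_sq HS hB).
    rewrite sqr_sqrtr ?divr_ge0 ?(ltW e0) ?(ltW K1)// ltr_pdivlMr// => /ltW h.
    have -> : \int[mu]_x ((u n x 0 i - u p x 0 i) ^+ 2) = \int[mu]_x ((u n - u p) x 0 i ^+ 2).
      by apply: eq_Rintegral => x _; rewrite !mxE.
    apply: (le_trans (HK _ i hB)); apply: le_trans h.
    by rewrite mulrC ler_wpM2l ?(qge0 HS)// lerDl.
  by move=> l hl Hl; exists l.
pose L x : 'rV[R]_m := \row_i l i x.
have hL : coord_real_L2 L by move=> i; under eq_fun do rewrite mxE; case: (Hl i).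
exists L => // e e0; have K1 : 0 < K' + 1 by rewrite ltr_wpDl.
have e1 : 0 < e ^+ 2 / (K' + 1) / m.+1%:R by rewrite !divr_gt0// exprn_gt0.
have [N HN] := @eventually_fin 'I_m (fun i n => \int[mu]_x ((u n x 0 i - l i x) ^+ 2) <= e ^+ 2 / (K' + 1) / m.+1%:R)
  (fun i => (Hl i).2 _ e1).
exists N => n Nn; have hB := siB HS (hu n) hL.
apply: (nrm_lt HS hB e0).
apply: (le_lt_trans (HK' _ hB)).
apply: (@le_lt_trans _ _ (K' * \sum_(i < m) (e ^+ 2 / (K' + 1) / m.+1%:R))).
  rewrite ler_wpM2l//; apply: ler_sum => i _.
  apply: le_trans (HN n Nn i).
  by rewrite le_eqVlt; apply/orP; left; apply/eqP; apply: eq_Rintegral => x _; rewrite !mxE.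
rewrite sumr_const card_ord -[_ *+ m]mulr_natl.
have -> : K' * (m%:R * (e ^+ 2 / (K' + 1) / m.+1%:R)) = e ^+ 2 * (K' / (K' + 1)) * (m%:R / m.+1%:R) by ring.
have a1 : K' / (K' + 1) < 1 by rewrite ltr_pdivrMr// mul1r ltrDl.
have a0 : 0 <= K' / (K' + 1) by rewrite divr_ge0// ltW.
have b1 : (m%:R / m.+1%:R : R) <= 1 by rewrite ler_pdivrMr// mul1r ler_nat.
have b0 : 0 <= (m%:R / m.+1%:R : R) by rewrite divr_ge0.
have e2 : 0 < e ^+ 2 by rewrite exprn_gt0.
apply: (@le_lt_trans _ _ (e ^+ 2 * (K' / (K' + 1)))).
  by rewrite ler_piMr// mulr_ge0// ltW.
by rewrite gtr_pMr.
Qed.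

Lemma nrm_lie_ae0 f : coord_real_L2 f -> nrm lie_inner f = 0 -> f = (fun=> 0) %[ae mu].
Proof.
move=> hf f0; have [K K0 HK] := coord_int_le.
have q0 : lie_inner f f = 0 by rewrite -(nrm_sq coord_real_L2_semi_inner hf) f0 expr0n.
have : {ae mu, forall x, forall i, f x 0 i = 0}.
  apply: filter_forall => i; apply: real_L2_int0 => //.
  apply/eqP; rewrite eq_le; apply/andP; split; last by apply: Rintegral_ge0 => x _; exact: sqr_ge0.
  by rewrite (le_trans (HK f i hf))// q0 mulr0.
by move=> /ae_imp; apply => x h _; apply/rowP => i; rewrite h mxE.
Qed.

Lemma lie_inner_ae f f' g : coord_real_L2 f -> coord_real_L2 f' -> coord_real_L2 g -> f = f' %[ae mu] -> lie_inner f g = lie_inner f' g.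
Proof.
move=> hf hf' hg ff; rewrite /lie_inner /Rintegral; congr fine; apply: ae_eq_integral => //.
- by apply/measurable_EFinP; apply: rintegrable_measurable; exact: ip_rintegrable.
- by apply/measurable_EFinP; apply: rintegrable_measurable; exact: ip_rintegrable.
by move/ae_imp: ff; apply => x /(_ Logic.I) -> _.
Qed.

End L2_lie_space.

Section ergodic_projection.
Context {R : realType} {n m : nat} {X : manifoldType R n} {G : lieGroupType R m}.
Variables (mu : probability (borel X) R) (F : R -> X -> X) (phi : X -> G).
Variable (ip : {dot 'rV[R]_m for idfun}).
Hypotheses (FC1 : C1_flow F) (Fmu : measure_preserving_flow mu F) (ip_Ad : Ad_invariant G ip).
Hypothesis mphi : measurable_fun setT (phi : borel X -> borel G).
Local Notation E := (coord_real_L2 mu (m := m)).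
Local Notation W := (W_phi F phi).
Local Notation q := (lie_inner mu ip).
Implicit Types f g : borel X -> 'rV[R]_m.

Lemma L2_lieP f : L2_lie mu ip f <-> E f.
Proof.
split=> [[mf jf] i|hf].
  split; first exact: mf.
  have [K K0 HK] := coord_sq_le ip.
  have mip : measurable_fun setT (fun x => ip (f x) (f x)).
    under eq_fun do rewrite ip_expand.
    apply: measurable_sum => k; apply: measurable_sum => l.
    by apply: measurable_funM; [exact: measurable_funM|exact: measurable_cst].
  have iip : rintegrable mu (fun x => ip (f x) (f x)).
    apply/integrableP; split; first exact/measurable_EFinP.
    by under eq_integral do rewrite /= ger0_norm ?ip_ge0//.
  apply: (le_rintegrable _ _ (rintegrableZ K iip)); first exact: measurable_funX.
  by move=> x; rewrite ger0_norm ?sqr_ge0//; exact: HK.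
split; first by move=> i; case: (hf i).
by rewrite EFin_Rint ?ltry//; exact: ip_rintegrable.
Qed.

Lemma AdD (g : G) (u v : 'rV[R]_m) : Ad g (u + v) = Ad g u + Ad g v.
Proof. by rewrite /Ad /mdiff linearD. Qed.
Lemma AdZ (g : G) a (u : 'rV[R]_m) : Ad g (a *: u) = a *: Ad g u.
Proof. by rewrite /Ad /mdiff linearZ. Qed.
Lemma Ad_sum (g : G) (I : Type) (s : seq I) (u : I -> 'rV[R]_m) :
  Ad g (\sum_(i <- s) u i) = \sum_(i <- s) Ad g (u i).
Proof. by rewrite /Ad /mdiff linear_sum. Qed.

Lemma W_phi_coord f x k : W f x 0 k = \sum_i f (F 1 x) 0 i * Ad (phi x) (delta_mx 0 i) 0 k.
Proof.
rewrite /W_phi {1}[f (F 1 x)]row_sum_delta Ad_sum summxE.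
by apply: eq_bigr => i _; rewrite AdZ mxE.
Qed.

Lemma W_phi_L2 f : E f -> E (W f).
Proof.
move=> /L2_lieP[mf jf]; apply/L2_lieP; split.
  move=> k; under eq_fun do rewrite W_phi_coord.
  apply: measurable_sum => i; apply: measurable_funM.
    exact: (measurableT_comp (mf i) (flow_measurable FC1 1)).
  exact: (measurableT_comp (Ad_measurable (delta_mx 0 i) k) mphi).
under eq_integral do rewrite /W_phi ip_Ad.
have mip : measurable_fun setT (fun x => (ip (f x) (f x))%:E).
  have hf : E f by apply/L2_lieP.
  by apply/measurable_EFinP; apply: rintegrable_measurable; exact: ip_rintegrable.
by rewrite (ge0_integral_mp (flow_measurable FC1 1) (Fmu 1) mip)// => x; rewrite lee_fin ip_ge0.
Qed.

Lemma W_phi_isometry f g : E f -> E g -> q (W f) (W g) = q f g.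
Proof.
move=> hf hg; rewrite /lie_inner /W_phi; under eq_Rintegral do rewrite ip_Ad.
apply: (Rintegral_mp (flow_measurable FC1 1) (Fmu 1) (f := fun x => ip (f x) (g x))).
by apply: rintegrable_measurable; exact: ip_rintegrable.
Qed.

(** [P_phi] selects one of the projections, which agree almost everywhere. The
    mean ergodic theorem for [W_phi], isometric by invariance of the scalar
    product and of the measure, exhibits one as the limit of averages. *)
Theorem P_phi_mean_ergodic M : L2_lie_class mu ip M -> exists M0, [/\ E M0, M = M0 %[ae mu],
  E (P_phi mu F phi ip M), W (P_phi mu F phi ip M) = P_phi mu F phi ip M %[ae mu] &
  forall e, 0 < e -> exists N0, forall N, (N0 <= N)%N ->
    nrm q (average (@lie_scale _ _ R m) W N M0 - P_phi mu F phi ip M) < e].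
Proof.
move=> [M0 /L2_lieP hM0 MM0]; exists M0.
have HS := @coord_real_L2_semi_inner _ _ _ mu m ip.
have WD f g : W (f + g) = W f + W g by apply/funext => x; rewrite /W_phi AdD.
have WZ a f : W (lie_scale a f) = lie_scale a (W f) by apply/funext => x; rewrite /W_phi AdZ.
have scD a f g : lie_scale a (f + g) = lie_scale a f + lie_scale a g by apply/funext => x; rewrite /lie_scale scalerDr.
have scN a f : lie_scale a (- f) = - lie_scale a f by apply/funext => x; rewrite /lie_scale scalerN.
have [s [hs Ws sorth avg]] := mean_ergodic HS (@coord_real_L2_complete _ _ _ mu m ip) W_phi_L2 WD WZ W_phi_isometry scD scN hM0.
have fixP p : ker_1_sub_W_phi mu F phi ip p -> E p /\ nrm q (W p - p) = 0.
  move=> [/L2_lieP hp Wp]; split => //.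
  have hB := siB HS (W_phi_L2 hp) hp.
  have B0 : W p - p = (0 : borel X -> 'rV[R]_m) %[ae mu].
    by move/ae_imp: Wp; apply => x /(_ Logic.I) h _; rewrite fctE h subrr.
  by rewrite /nrm (lie_inner_ae ip hB (si0 HS) hB B0) (q0l HS hB) sqrtr0.
have sfix : ker_1_sub_W_phi mu F phi ip s.
  split; first exact/L2_lieP.
  have := nrm_lie_ae0 (siB HS (W_phi_L2 hs) hs) Ws.
  by move=> /ae_imp; apply => x /(_ Logic.I) h _; apply/eqP; rewrite -subr_eq0; apply/eqP.
have sP : is_P_phi mu F phi ip M s.
  split=> //; exists M0; split => //; first exact/L2_lieP.
  by move=> r rfix; have [hr Wr] := fixP r rfix; exact: sorth.
have pP : is_P_phi mu F phi ip M (P_phi mu F phi ip M).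
  by rewrite /P_phi; have := @xgetI _ (fun=> 0) [set p | is_P_phi mu F phi ip M p] s sP.
move: pP; set p := P_phi _ _ _ _ _ => -[pfix [M1 [/L2_lieP hM1 MM1 porth]]].
have [hp Wp] := fixP p pfix; have [_ Wpae] := pfix.
split => // e e0.
have hsp := siB HS hs hp.
have dfix : ker_1_sub_W_phi mu F phi ip (s - p).
  split; first exact/L2_lieP.
  have [_ Wsae] := sfix; apply: (ae_imp2 Wsae Wpae) => x /(_ Logic.I) h1 /(_ Logic.I) h2 _.
  have -> : W (s - p) x = W s x - W p x by rewrite /W_phi AdD -scaleN1r AdZ scaleN1r.
  by rewrite h1 h2.
have [_ Wd] := fixP _ dfix.
have M01 : M0 = M1 %[ae mu].
  by apply: (ae_imp2 MM0 MM1) => x /(_ Logic.I) h1 /(_ Logic.I) h2 _; rewrite -h1 h2.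
have h1 : q (M0 - s) (s - p) = 0 by exact: sorth.
have h2 : q (M1 - p) (s - p) = 0 by exact: porth.
have h3 : q (s - p) (s - p) = 0.
  have eM := lie_inner_ae ip hM0 hM1 hsp M01.
  move: h1 h2; rewrite (qB HS hM0 hs hsp) (qB HS hM1 hp hsp) -eM.
  by rewrite (qB HS hs hp hsp) => h1 h2; lra.
have [N0 HN0] := avg e e0; exists N0 => N Nn.
have hA := averageE HS W_phi_L2 N hM0.
have -> : average (@lie_scale _ _ R m) W N M0 - p = (average (@lie_scale _ _ R m) W N M0 - s) + (s - p).
  by rewrite addrA subrK.
apply: (le_lt_trans (nrmD HS (siB HS hA hs) hsp)).
by rewrite [X in _ + X]/nrm h3 sqrtr0 addr0 HN0.
Qed.

End ergodic_projection.

(** * Matrix-valued multipliers *)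

Section matrix_bounds.
Context {R : realType} (d : nat).
Local Notation C := R[i].
Local Notation normc := Normc.normc.

Lemma normc_sum (I : Type) (s : seq I) (f : I -> C) :
  normc (\sum_(i <- s) f i) <= \sum_(i <- s) normc (f i).
Proof.
elim: s => [|i s IH]; first by rewrite !big_nil normcE sqn0 sqrtr0.
by rewrite !big_cons (le_trans (normcD _ _))// lerD2l.
Qed.

Lemma mulmx_entry_le (A B : 'M[C]_d) (a b : R) : 0 <= a ->
  (forall k l, normc (A k l) <= a) -> (forall k l, normc (B k l) <= b) ->
  forall k l, normc ((A *m B) k l) <= d%:R * (a * b).
Proof.
move=> a0 Aa Bb k l; rewrite mxE (le_trans (normc_sum _ _))//.
apply: (@le_trans _ _ (\sum_(i < d) a * b)); last by rewrite sumr_const card_ord mulr_natl.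
by apply: ler_sum => i _; rewrite Normc.normcM ler_pM ?normc_ge0.
Qed.

Lemma normcJ (a : C) : normc a^* = normc a.
Proof. by rewrite !normcE sqnJ. Qed.

Lemma adjE (A : 'M[C]_d) k l : adj A k l = (A l k)^*. Proof. by rewrite mxE. Qed.

Lemma normc_le_eucl (v : 'cV[C]_d) k : normc (v k 0) <= eucl_norm v.
Proof.
rewrite /eucl_norm -[leLHS]ger0_norm ?normc_ge0// -sqrtr_sqr ler_wsqrtr//.
by rewrite (bigD1 k)//= lerDl; apply: sumr_ge0 => i _; rewrite exprn_ge0 ?normc_ge0.
Qed.

Lemma eucl_norm_ge0 (v : 'cV[C]_d) : 0 <= eucl_norm v. Proof. exact: sqrtr_ge0. Qed.

Lemma eucl_norm_le (v : 'cV[C]_d) b : 0 <= b -> (forall k, normc (v k 0) <= b) ->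
  eucl_norm v <= Num.sqrt d%:R * b.
Proof.
move=> b0 vb; rewrite /eucl_norm -[b]ger0_norm// -sqrtr_sqr -sqrtrM// ler_wsqrtr//.
apply: (@le_trans _ _ (\sum_(k < d) b ^+ 2)); last by rewrite sumr_const card_ord mulr_natl.
by apply: ler_sum => k _; rewrite ler_sqr ?nnegrE ?normc_ge0.
Qed.

Lemma eucl_norm_delta (l : 'I_d) : eucl_norm (delta_mx l 0 : 'cV[C]_d) = 1.
Proof.
rewrite /eucl_norm (bigD1 l)//= big1 => [|k kl]; last first.
  by rewrite mxE (negPf kl) normcE sqn0 sqrtr0 expr0n.
by rewrite mxE !eqxx addr0 sqnE /sqn /= expr1n expr0n addr0 sqrtr1.
Qed.

End matrix_bounds.

Section matrix_multipliers.
Context dT (T : measurableType dT) {R : realType} (mu : probability T R) (d : nat).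
Local Notation C := R[i].
Local Notation normc := Normc.normc.
Local Notation fam := ('I_d -> T -> C).
Local Notation E := (@L2_fam _ T R mu d).
Local Notation q := (@fam_inner _ T R mu d).
Local Notation nf := (@fam_norm _ T R mu d).
Implicit Types (M : T -> 'M[C]_d) (f g : fam).

Definition mxact M f : fam := fun k x => \sum_l M x k l * f l x.

Definition bounded_mx M (c : R) : Prop :=
  (forall k l, cmeasurable (fun x => M x k l)) /\
  {ae mu, forall x, forall k l, normc (M x k l) <= c}.

Let HS : semi_inner E (@fam_rscale _ T R d) q := L2_fam_semi_inner mu d.

Lemma mxact_L2 M c f : 0 <= c -> bounded_mx M c -> E f ->
  E (mxact M f) /\ nf (mxact M f) <= (d%:R * (d%:R * c)) * nf f.
Proof.
move=> c0 [mM Mc] hf.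
have H k l : L2 mu (fun x => M x k l * f l x) /\ L2_norm mu (fun x => M x k l * f l x) <= c * L2_norm mu (f l).
  by apply: L2M_bounded => //; apply: (ae_imp Mc) => x h; exact: h.
have hM : E (mxact M f) by move=> k; apply: L2_sum => l; case: (H k l).
split => //; apply: (le_trans (fam_norm_le_sum hM)).
apply: (@le_trans _ _ (\sum_(k < d) (d%:R * c) * nf f)); last first.
  by rewrite sumr_const card_ord -[_ *+ d]mulr_natl mulrA.
apply: ler_sum => k _.
have [_] := nrm_sum (L2_semi_inner mu) (index_enum 'I_d)
  (x := fun l x => M x k l * f l x) (fun l => (H k l).1).
have -> : \sum_l (fun x => M x k l * f l x) = mxact M f k by apply/funext => x; rewrite fct_sumE.
move=> /le_trans; apply.
apply: (@le_trans _ _ (\sum_(l < d) c * nf f)); last by rewrite sumr_const card_ord -[_ *+ d]mulr_natl mulrA.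
apply: ler_sum => l _; rewrite (le_trans (H k l).2)// ler_wpM2l//.
exact: L2_norm_le_fam_norm.
Qed.

Lemma mxactD M f g : mxact M (f + g) = mxact M f + mxact M g.
Proof.
apply/funext => k; apply/funext => x; transitivity (mxact M f k x + mxact M g k x) => //.
rewrite /mxact -big_split.
by apply: eq_bigr => l _; exact: mulrDr.
Qed.

Lemma mxactZ M (a : C) f : mxact M (fun k x => a * f k x) = (fun k x => a * mxact M f k x).
Proof.
apply/funext => k; apply/funext => x; rewrite /mxact mulr_sumr.
by apply: eq_bigr => l _; rewrite mulrCA.
Qed.

Lemma mxact_mulmx M M' f : mxact M (mxact M' f) = mxact (fun x => M x *m M' x) f.
Proof.
apply/funext => k; apply/funext => x; rewrite /mxact.
under eq_bigr do rewrite mulr_sumr.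
rewrite exchange_big /=; apply: eq_bigr => l _; rewrite mxE mulr_suml.
by apply: eq_bigr => r _; rewrite mulrA.
Qed.

Lemma mxact1 f : mxact (fun=> 1%:M) f = f.
Proof.
apply/funext => k; apply/funext => x; rewrite /mxact (bigD1 k)//= mxE eqxx mul1r big1 ?addr0// => l lk.
by rewrite mxE eq_sym (negPf lk) mul0r.
Qed.

Lemma mxactB M M' f : mxact (fun x => M x - M' x) f = mxact M f - mxact M' f.
Proof.
apply/funext => k; apply/funext => x; transitivity (mxact M f k x - mxact M' f k x) => //.
rewrite /mxact -sumrB.
by apply: eq_bigr => l _; rewrite !mxE mulrBl.
Qed.

Lemma mxact_scale (a : C) M f : mxact (fun x => a *: M x) f = (fun k x => a * mxact M f k x).
Proof.
apply/funext => k; apply/funext => x; rewrite /mxact mulr_sumr.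
by apply: eq_bigr => l _; rewrite mxE mulrA.
Qed.

Lemma fam_inner_int f g : E f -> E g -> q f g = \int[mu]_x \sum_k complex.Re ((f k x)^* * g k x).
Proof.
by move=> hf hg; rewrite Rintegral_sum// => k; case: (L2_prod_int (hf k) (hg k)).
Qed.

Lemma eq_Rintegral_ae (u v : T -> R) : measurable_fun setT u -> measurable_fun setT v ->
  {ae mu, forall x, u x = v x} -> \int[mu]_x u x = \int[mu]_x v x.
Proof.
move=> mu' mv uv; rewrite /Rintegral; congr fine; apply: ae_eq_integral => //.
- exact/measurable_EFinP.
- exact/measurable_EFinP.
by apply: (ae_imp uv) => x -> _.
Qed.

Lemma fam_inner_mxact_ae M M' c f g : 0 <= c -> bounded_mx M c -> bounded_mx M' c ->
  {ae mu, forall x, M' x = adj (M x)} -> E f -> E g -> q (mxact M f) g = q f (mxact M' g).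
Proof.
move=> c0 bM bM' MM hf hg.
have [hMf _] := mxact_L2 c0 bM hf; have [hMg _] := mxact_L2 c0 bM' hg.
have mq u v : E u -> E v -> measurable_fun setT (fun x => \sum_k complex.Re ((u k x)^* * v k x)).
  move=> hu hv; apply: measurable_sum => k.
  by have [i _] := L2_prod_int (hu k) (hv k); exact: rintegrable_measurable i.
rewrite !fam_inner_int//; apply: eq_Rintegral_ae; [exact: mq|exact: mq|].
apply: (ae_imp MM) => x Mx; rewrite -!Re_sum; congr (complex.Re _).
transitivity (\sum_k \sum_l (M x k l)^* * ((f l x)^* * g k x)).
  apply: eq_bigr => k _; rewrite /mxact conjC_sum mulr_suml; apply: eq_bigr => l _.
  by rewrite conjCM mulrA.
rewrite exchange_big; apply: eq_bigr => l _; rewrite /mxact mulr_sumr; apply: eq_bigr => k _.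
by rewrite Mx adjE mulrCA.
Qed.

Lemma adj_bounded M c : bounded_mx M c -> bounded_mx (fun x => adj (M x)) c.
Proof.
move=> [mM Mc]; split.
  by move=> k l; under eq_fun do rewrite adjE; exact: cmeasurableJ.
by apply: (ae_imp Mc) => x h k l; rewrite adjE normcJ.
Qed.

Lemma fam_inner_mxact M c f g : 0 <= c -> bounded_mx M c -> E f -> E g ->
  q (mxact M f) g = q f (mxact (fun x => adj (M x)) g).
Proof.
by move=> c0 bM hf hg; apply: (fam_inner_mxact_ae c0 bM (adj_bounded bM)) => //; exact: aeW.
Qed.

Lemma mxact_ae M M' c f : 0 <= c -> bounded_mx M c -> bounded_mx M' c ->
  {ae mu, forall x, M x = M' x} -> E f -> nf (mxact M f - mxact M' f) = 0.
Proof.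
move=> c0 bM bM' MM hf.
have hB := siB HS (mxact_L2 c0 bM hf).1 (mxact_L2 c0 bM' hf).1.
have h0 k : L2_norm mu ((mxact M f - mxact M' f) k) = 0.
  have ae0 : (mxact M f - mxact M' f) k = (fun=> 0) %[ae mu].
    apply: (ae_imp MM) => x Mx _; rewrite -mxactB /mxact; apply: big1 => l _.
    by rewrite Mx subrr mxE mul0r.
  have := ae_cnorm2 (hB k).1 (L20 mu).1 ae0.
  rewrite !cnorm2_L2; [|exact: L20|exact: hB].
  by move=> [->]; rewrite /L2_norm (nrm0 (L2_semi_inner mu)).
apply/eqP; rewrite eq_le nrm_ge0 andbT; apply: (le_trans (fam_norm_le_sum hB)).
by rewrite big1.
Qed.

(** Mean ergodic averages converge in mean square but not uniformly; the
    uniform bound compensates for this, entrywise by [small_multiplier]. *)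
Lemma mxact_cvg0 (M : nat -> T -> 'M[C]_d) c f : 0 <= c -> (forall N, bounded_mx (M N) c) ->
  (forall N k l, L2 mu (fun x => M N x k l)) ->
  (forall k l e, 0 < e -> exists N0, forall N, (N0 <= N)%N -> L2_norm mu (fun x => M N x k l) < e) ->
  E f -> forall e, 0 < e -> exists N0, forall N, (N0 <= N)%N -> nf (mxact (M N) f) < e.
Proof.
move=> c0 bM hM M0 hf e e0.
pose e1 := e / d.+1%:R / d.+1%:R.
have e10 : 0 < e1 by rewrite !divr_gt0.
have H (kl : 'I_d * 'I_d) : exists N0, forall N, (N0 <= N)%N ->
    L2_norm mu (fun x => M N x kl.1 kl.2 * f kl.2 x) < e1.
  have [dl dl0 Hd] := small_multiplier c0 (hf kl.2) e10.
  have [N0 HN0] := M0 kl.1 kl.2 dl dl0; exists N0 => N NN.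
  have [mM Mc] := bM N.
  apply: Hd => //; last exact: HN0.
  by apply: (ae_imp Mc) => x h; exact: h.
have [N0 HN0] := eventually_fin H; exists N0 => N NN.
have [hMf _] := mxact_L2 c0 (bM N) hf.
apply: fam_norm_small => // k.
have Hl l : L2 mu (fun x => M N x k l * f l x).
  have [mM Mc] := bM N.
  by apply: (L2M_bounded (mM k l) c0 _ (hf l)).1; apply: (ae_imp Mc) => x h; exact: h.
have [_] := nrm_sum (L2_semi_inner mu) (index_enum 'I_d) Hl.
have -> : \sum_l (fun x => M N x k l * f l x) = mxact (M N) f k by apply/funext => x; rewrite fct_sumE.
move=> /le_lt_trans; apply.
apply: (@le_lt_trans _ _ (\sum_(l < d) e1)).
  by apply: ler_sum => l _; rewrite ltW//; exact: (HN0 N NN (k, l)).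
rewrite sumr_const card_ord -[_ *+ d]mulr_natl /e1 mulrCA gtr_pMr ?divr_gt0//.
by rewrite ltr_pdivrMr// mul1r ltr_nat.
Qed.

Lemma bounded_mxD M M' c c' : bounded_mx M c -> bounded_mx M' c' -> bounded_mx (fun x => M x - M' x) (c + c').
Proof.
move=> [mM Mc] [mM' Mc']; split.
  by move=> k l; under eq_fun do rewrite !mxE; exact: cmeasurableB.
apply: (ae_imp2 Mc Mc') => x h h' k l; rewrite !mxE (le_trans (normcD _ _))// normcN.
by rewrite lerD.
Qed.

Lemma bounded_mxZ (a : C) M c : bounded_mx M c -> bounded_mx (fun x => a *: M x) (normc a * c).
Proof.
move=> [mM Mc]; split.
  move=> k l; under eq_fun do rewrite mxE.
  by apply: cmeasurableM => //; exact: cmeasurable_cst.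
by apply: (ae_imp Mc) => x h k l; rewrite mxE Normc.normcM ler_wpM2l ?normc_ge0.
Qed.

Lemma bounded_mx_L2 M c k l : 0 <= c -> bounded_mx M c -> L2 mu (fun x => M x k l).
Proof.
move=> c0 [mM Mc].
have hc : L2 mu (fun=> (c%:C)%C).
  by apply: (bounded_L2 mu (c := c)); [exact: cmeasurable_cst|move=> x; rewrite normcRC ger0_norm].
have [] := ae_le_L2 (mM k l) hc => //.
by apply: (ae_imp Mc) => x h; rewrite normcRC (ger0_norm c0).
Qed.

Lemma bounded_mx_Linfty M c : 0 <= c -> bounded_mx M c -> Linfty_mx mu M.
Proof.
move=> c0 [mM Mc]; split => //; exists (Num.sqrt d%:R * (d%:R * c)).
apply: (ae_imp Mc) => x h v; rewrite -mulrA; apply: eucl_norm_le.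
  by rewrite !mulr_ge0// eucl_norm_ge0.
move=> k; rewrite mxE (le_trans (normc_sum _ _))//.
apply: (@le_trans _ _ (\sum_(l < d) c * eucl_norm v)); last by rewrite sumr_const card_ord -[_ *+ d]mulr_natl mulrA.
by apply: ler_sum => l _; rewrite Normc.normcM ler_pM ?normc_ge0 ?normc_le_eucl.
Qed.

Lemma Linfty_bounded_mx M : Linfty_mx mu M -> exists2 c, 0 <= c & bounded_mx M c.
Proof.
move=> [mM [c Hc]]; exists `|c| => //; split => //.
apply: (ae_imp Hc) => x h k l.
have -> : M x k l = (M x *m delta_mx l 0) k (0 : 'I_1) by rewrite -colE mxE.
apply: (le_trans (normc_le_eucl _ _)); apply: (le_trans (h _)).
by rewrite eucl_norm_delta mulr1 ler_norm.
Qed.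

End matrix_multipliers.

(** * The Koopman operator on coefficients *)

Section koopman_on_coefficients.
Context {R : realType} {n m : nat} {X : manifoldType R n} {G : lieGroupType R m}.
Variables (mu : probability (borel X) R).
Local Notation C := R[i].
Local Notation normc := Normc.normc.
Variables (d : nat) (pi : G -> 'M[C]_d) (j : 'I_d).
Hypothesis pi_irrep : unitary_irrep pi.
Variables (F : R -> X -> X) (phi : X -> G).
Hypotheses (FC1 : C1_flow F) (Fmu : measure_preserving_flow mu F).
Hypothesis mphi : measurable_fun setT (phi : borel X -> borel G).
Local Notation fam := ('I_d -> borel X -> C).
Local Notation E := (@L2_fam _ (borel X) R mu d).
Local Notation q := (@fam_inner _ (borel X) R mu d).
Local Notation nf := (@fam_norm _ (borel X) R mu d).
Implicit Types f g h : fam.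

Let HS : semi_inner E (@fam_rscale _ (borel X) R d) q := L2_fam_semi_inner mu d.

Definition cocycle (x : borel X) : 'M[C]_d := pi (phi x).
Definition famflow t f : fam := fun k x => f k (F t x).
(** The Koopman operator read on coefficients: [pi (g * phi x)] has the
    entries [\sum_l pi g j l * pi (phi x) l k]. *)
Definition koopc f : fam := mxact cocycle (famflow 1 f).
Definition koopc_inv f : fam := mxact (fun x : borel X => adj (cocycle (F (-1) x))) (famflow (-1) f).

Lemma cocycle_bounded : bounded_mx mu cocycle 1.
Proof.
split; last by apply: aeW => x k l; exact: rep_normc_le1.
by move=> k l; exact: (cmeasurable_comp mphi (rep_cmeasurable pi_irrep k l)).
Qed.

Lemma famflow_L2 t f : E f -> E (famflow t f).
Proof. by move=> hf k; exact: (L2_flow FC1 Fmu t (hf k)). Qed.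

Lemma famflow_isometry t f g : E f -> E g -> q (famflow t f) (famflow t g) = q f g.
Proof. by move=> hf hg; apply: eq_bigr => k _; exact: (re_inner_flow FC1 Fmu t (hf k) (hg k)). Qed.

Lemma koopc_L2 f : E f -> E (koopc f).
Proof. by move=> hf; exact: (mxact_L2 ler01 cocycle_bounded (famflow_L2 1 hf)).1. Qed.

Lemma koopc_inv_L2 f : E f -> E (koopc_inv f).
Proof.
move=> hf; apply: (mxact_L2 ler01 _ (famflow_L2 (-1) hf)).1.
apply: adj_bounded; split; last by apply: aeW => x k l; exact: rep_normc_le1.
move=> k l.
exact: (cmeasurable_comp (measurableT_comp mphi (flow_measurable FC1 (-1))) (rep_cmeasurable pi_irrep k l)).
Qed.

Lemma famflow_mxact t (M : borel X -> 'M[C]_d) f :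
  famflow t (mxact M f) = mxact (fun x : borel X => M (F t x)) (famflow t f).
Proof. by []. Qed.

Lemma famflowK t f : famflow t (famflow (- t) f) = f.
Proof. by apply/funext => k; apply/funext => x; rewrite /famflow (flowK FC1). Qed.

Lemma koopc_invK f : koopc (koopc_inv f) = f.
Proof.
rewrite /koopc /koopc_inv famflow_mxact famflowK mxact_mulmx -[RHS]mxact1; congr mxact.
by apply/funext => x; rewrite (flowK FC1) rep_unitary.
Qed.

Lemma koopc_isometry f g : E f -> E g -> q (koopc f) (koopc g) = q f g.
Proof.
move=> hf hg; rewrite /koopc (fam_inner_mxact ler01 cocycle_bounded (famflow_L2 1 hf) (koopc_L2 hg)).
rewrite mxact_mulmx.
have -> : mxact (fun x => adj (cocycle x) *m cocycle x) (famflow 1 g) = famflow 1 g.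
  by rewrite -[RHS]mxact1; congr mxact; apply/funext => x; rewrite rep_unitary'.
exact: famflow_isometry.
Qed.

Lemma koopcD f g : koopc (f + g) = koopc f + koopc g.
Proof. by rewrite /koopc -mxactD. Qed.

Lemma koopcZ (a : C) f : koopc (fun k x => a * f k x) = (fun k x => a * koopc f k x).
Proof. by rewrite /koopc -mxactZ. Qed.

Lemma iterkoopc_L2 N f : E f -> E (iter N koopc f).
Proof. by move=> hf; elim: N => //= N; exact: koopc_L2. Qed.

Lemma iterkoopc_isometry N f g : E f -> E g -> q (iter N koopc f) (iter N koopc g) = q f g.
Proof. by move=> hf hg; elim: N => //= N IH; rewrite koopc_isometry//; exact: iterkoopc_L2. Qed.

Lemma fam_norm_iterkoopc N f : E f -> nf (iter N koopc f) = nf f.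
Proof. by move=> hf; rewrite /fam_norm /nrm iterkoopc_isometry. Qed.

Lemma iterkoopcD N f g : iter N koopc (f + g) = iter N koopc f + iter N koopc g.
Proof. by elim: N => //= N ->; rewrite koopcD. Qed.

Lemma iterkoopcZ N (a : C) f : iter N koopc (fun k x => a * f k x) = (fun k x => a * iter N koopc f k x).
Proof. by elim: N => //= N ->; rewrite koopcZ. Qed.

Lemma iterkoopc_inv_L2 N f : E f -> E (iter N koopc_inv f).
Proof. by move=> hf; elim: N => //= N; exact: koopc_inv_L2. Qed.

Lemma iterkoopc_invK N f : iter N koopc (iter N koopc_inv f) = f.
Proof. by elim: N f => // N IH f; rewrite iterSr iterS koopc_invK IH. Qed.

Lemma koopman_coef_fun f : koopman F phi (coef_fun pi j f) = coef_fun pi j (koopc f).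
Proof.
apply/funext => z; rewrite /koopman /coef_fun /= /skew_product /=.
transitivity (\sum_k \sum_l f k (F 1 z.1) * (pi z.2 j l * pi (phi z.1) l k)).
  by apply: eq_bigr => k _; rewrite (repM pi_irrep) mxE mulr_sumr.
rewrite exchange_big; apply: eq_bigr => l _; rewrite /koopc /mxact mulr_suml; apply: eq_bigr => k _.
by rewrite /cocycle /famflow; ring.
Qed.

Lemma iter_koopman_coef_fun N f : iter N (koopman F phi) (coef_fun pi j f) = coef_fun pi j (iter N koopc f).
Proof. by elim: N => //= N ->; rewrite koopman_coef_fun. Qed.

Lemma koopman_inv_coef_fun f : koopman_inv F phi (coef_fun pi j f) = coef_fun pi j (koopc_inv f).
Proof.
have [K1 K2] := skew_productK phi FC1.
have := koopman_coef_fun (koopc_inv f); rewrite koopc_invK => <-.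
by apply/funext => z; rewrite /koopman_inv /koopman /= K2.
Qed.

Lemma iter_koopman_inv_coef_fun N f :
  iter N (koopman_inv F phi) (coef_fun pi j f) = coef_fun pi j (iter N koopc_inv f).
Proof. by elim: N => //= N ->; rewrite koopman_inv_coef_fun. Qed.

Variables (L : borel X -> 'M[C]_d) (c : R).
Hypothesis c0 : 0 <= c.
Hypothesis bL : bounded_mx mu L c.
Hypothesis gL : forall k l, generator mu F (fun x => pi (phi x) k l) (fun x => 'i%C * L x k l).

Definition famgen f h : Prop := forall k, generator mu F (f k) (h k).

Lemma famgen_L2 f h : famgen f h -> E f /\ E h.
Proof. by move=> H; split => k; have [] := generator_L2 (H k). Qed.

(** The inverse of the unitary matrix [cocycle x] is its adjoint. *)
Definition logder (x : borel X) : 'M[C]_d := L x *m adj (cocycle x).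

(** The iterates on matrices of the counterpart of [W_phi], which conjugates
    by [cocycle]. *)
Fixpoint logder_conj (N : nat) (x : borel X) : 'M[C]_d :=
  if N is N'.+1 then cocycle x *m logder_conj N' (F 1 x) *m adj (cocycle x) else logder x.

Definition logder_sum (N : nat) (x : borel X) : 'M[C]_d := \sum_(i < N) logder_conj i x.

Lemma logder_sumS N x :
  logder_sum N.+1 x = logder x + cocycle x *m logder_sum N (F 1 x) *m adj (cocycle x).
Proof.
rewrite /logder_sum big_ord_recl /= mulmx_sumr mulmx_suml; congr (_ + _).
Qed.

(** The product rule for the entries of [pi \o phi] and of [f \o F 1]. With
    [U] the Koopman operator and [m] the logarithmic derivative, this is [A U
    = U A + i m U]. *)
Lemma famgen_koopc f h : famgen f h -> famgen (koopc f) (koopc h + mxact (fun x => 'i%C *: logder x) (koopc f)).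
Proof.
move=> H k; have [mL Lc] := bL.
have G1 l := generator_product FC1 Fmu (fun x => rep_normc_le1 pi_irrep (phi x) k l) c0
  (_ : {ae mu, forall x, normc (L x k l) <= c}) (gL k l) (generator_flow FC1 Fmu 1 (H l)).
have Hl l : {ae mu, forall x, normc (L x k l) <= c} by apply: (ae_imp Lc) => x hx; exact: hx.
have := generator_sum FC1 Fmu (index_enum 'I_d) (G1 Hl).
congr (generator _ _ _ _); apply/funext => x; rewrite big_split; congr (_ + _).
rewrite /koopc mxact_mulmx /mxact; apply: eq_bigr => l _; rewrite /famflow; congr (_ * _).
rewrite -scalemxAl mxE; congr (_ * _).
by rewrite /logder -mulmxA rep_unitary' ?mulmx1.
Qed.

(** With [S N] the sum of the first [N] conjugates, [A U^N = U^N A + i (S N)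
    U^N]: each step conjugates the multiplier already present and adds a
    logarithmic derivative. *)
Lemma famgen_iterkoopc N f h : famgen f h ->
  famgen (iter N koopc f) (iter N koopc h + mxact (fun x => 'i%C *: logder_sum N x) (iter N koopc f)).
Proof.
move=> H; elim: N => [|N IH].
  suff -> : mxact (fun x => 'i%C *: logder_sum 0 x) (iter 0 koopc f) = 0 by rewrite addr0.
  apply/funext => k; apply/funext => x; rewrite /mxact; apply: big1 => l _.
  by rewrite /logder_sum big_ord0 scaler0 mxE mul0r.
have := famgen_koopc IH; congr famgen; rewrite koopcD -addrA; congr (_ + _).
apply/funext => k; apply/funext => x.
transitivity (koopc (mxact (fun x => 'i%C *: logder_sum N x) (iter N koopc f)) k x +
  mxact (fun x => 'i%C *: logder x) (iter N.+1 koopc f) k x) => //.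
have -> : koopc (mxact (fun x => 'i%C *: logder_sum N x) (iter N koopc f)) =
    mxact (fun x => 'i%C *: (cocycle x *m logder_sum N (F 1 x) *m adj (cocycle x))) (iter N.+1 koopc f).
  rewrite /= {1 3}/koopc famflow_mxact !mxact_mulmx; congr mxact; apply/funext => y.
  by rewrite -scalemxAr -!scalemxAl -!mulmxA rep_unitary' ?mulmx1.
rewrite /mxact -big_split; apply: eq_bigr => l _ /=.
by rewrite -mulrDl logder_sumS !mxE -mulrDr addrC.
Qed.

(** Each term is the conjugate by a unitary of the logarithmic derivative at a
    point of the orbit, so that the bound does not grow with [N]. *)
Lemma logder_conj_bounded N : bounded_mx mu (logder_conj N) (d%:R * (d%:R * (d%:R * c))).
Proof.
have [mL Lc] := bL; have [mp _] := cocycle_bounded.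
have mm (A B : borel X -> 'M[C]_d) :
  (forall k l, cmeasurable (fun x => A x k l)) ->
   (forall k l, cmeasurable (fun x => B x k l)) -> forall k l, cmeasurable (fun x => (A x *m B x) k l).
  move=> mA mB k l; under eq_fun do rewrite mxE.
  by apply: cmeasurable_sum => i; exact: cmeasurableM.
have ma (A : borel X -> 'M[C]_d) : (forall k l, cmeasurable (fun x => A x k l)) ->
   forall k l, cmeasurable (fun x => adj (A x) k l).
  by move=> mA k l; under eq_fun do rewrite adjE; exact: cmeasurableJ.
split.
  elim: N => [|N IH] /=; first by apply: mm => //; exact: ma.
  apply: (mm); last exact: ma.
  apply: (mm) => //.
  by move=> k l; exact: (cmeasurable_comp (flow_measurable FC1 1) (IH k l)).
have conjE x : exists g : G, logder_conj N x = pi g *m logder (F N%:R x) *m adj (pi g).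
  elim: N x => [|N IH] x.
    by exists 1%g; rewrite -(repV pi_irrep) invg1 (rep1 pi_irrep) mul1mx mulmx1 (flow0 FC1).
  have [g Hg] := IH (F 1 x); exists (phi x * g)%g.
  rewrite /= Hg -(flowD FC1) natr1 (repM pi_irrep) /cocycle !mulmxA.
  have -> : adj (pi (phi x) *m pi g) = adj (pi g) *m adj (pi (phi x)).
    by rewrite -(repM pi_irrep) -!(repV pi_irrep) invgM (repM pi_irrep).
  by rewrite !mulmxA.
have := ae_flow FC1 Fmu N%:R Lc => /ae_imp; apply => x hx k l.
have [g ->] := conjE x.
have p1 (g' : G) k' l' : normc (adj (pi g') k' l') <= 1 by rewrite adjE normcJ rep_normc_le1.
have lb k' l' : normc (logder (F N%:R x) k' l') <= d%:R * c.
  by rewrite -[c]mulr1; apply: mulmx_entry_le => // k2 l2; rewrite adjE normcJ rep_normc_le1.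
have lb2 k' l' : normc ((pi g *m logder (F N%:R x)) k' l') <= d%:R * (d%:R * c).
  rewrite -[d%:R * c]mul1r; apply: mulmx_entry_le => // k2 l2; exact: rep_normc_le1.
rewrite -[d%:R * (d%:R * c)]mulr1; apply: mulmx_entry_le => //.
by rewrite !mulr_ge0.
Qed.

Lemma logder_sum_bounded N : bounded_mx mu (logder_sum N) (N%:R * (d%:R * (d%:R * (d%:R * c)))).
Proof.
have b i := logder_conj_bounded i; split.
  move=> k l; under eq_fun do rewrite summxE.
  by apply: cmeasurable_sum => i; case: (b i).
have : {ae mu, forall x, forall i : 'I_N, forall k l, normc (logder_conj i x k l) <= d%:R * (d%:R * (d%:R * c))}.
  by apply: filter_forall => i; case: (b i).
move=> /ae_imp; apply => x h k l; rewrite summxE (le_trans (normc_sum _ _))//.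
apply: (@le_trans _ _ (\sum_(i < N) d%:R * (d%:R * (d%:R * c)))).
  by apply: ler_sum => i _; exact: h.
by rewrite sumr_const card_ord -[_ *+ N]mulr_natl.
Qed.

End koopman_on_coefficients.

(** * Operators on the isotypic subspace *)

Section operators_on_coefficients.
Context {R : realType} {n m : nat} {X : manifoldType R n} {G : lieGroupType R m}.
Variables (muX : probability (borel X) R) (muG : probability (borel G) R).
Hypothesis haarG : haar_probability muG.
Local Notation C := R[i].
Variables (d : nat) (pi : G -> 'M[C]_d) (j : 'I_d).
Hypothesis pi_irrep : unitary_irrep pi.
Local Notation XG := (borel X * borel G)%type.
Local Notation mu := (muX \x muG)%E.
Local Notation fam := ('I_d -> borel X -> C).
Local Notation E := (@L2_fam _ (borel X) R muX d).
Local Notation q := (@fam_inner _ (borel X) R muX d).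
Local Notation nf := (@fam_norm _ (borel X) R muX d).
Local Notation H := (Hj muX muG pi j).
Local Notation cf := (coef_fun pi j).
Implicit Types (f g : fam) (psi : XG -> C).

Let HS : semi_inner E (@fam_rscale _ (borel X) R d) q := L2_fam_semi_inner muX d.
Let HSX : semi_inner (L2 mu : (XG -> C) -> Prop) (@rscale _ XG R) (re_inner mu) := L2_semi_inner mu.

Lemma Hj_coef_fun f : E f -> H (cf f).
Proof. by move=> hf; split; [exact: L2_coef_fun|exists f => //; exact: aeW]. Qed.

Lemma Hj_L2 psi : H psi -> L2 mu psi. Proof. by case. Qed.

Lemma HjD a psi psi' : H psi -> H psi' -> H (fun z => a * psi z + psi' z).
Proof.
move=> [h1 [f hf pf]] [h2 [g hg pg]]; split; first by apply: L2D => //; exact: L2Z.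
exists ((fun k x => a * f k x) + g).
  by apply: (siD HS) => // k; exact: L2Z.
apply: (ae_imp2 pf pg) => z /(_ Logic.I) e1 /(_ Logic.I) e2 _.
by rewrite e1 e2 coef_funD coef_funZ.
Qed.

(** Coefficients are determined almost everywhere, by [coef_fun_ae_inj]. *)
Definition coefs psi : fam :=
  xget (fun _ _ => 0) [set f | E f /\ psi = cf f %[ae mu]].

Lemma coefsP psi : H psi -> E (coefs psi) /\ psi = cf (coefs psi) %[ae mu].
Proof.
move=> [_ [f hf pf]].
exact: (@xgetI _ (fun _ _ => 0) [set f | E f /\ psi = cf f %[ae mu]] f (conj hf pf)).
Qed.

Lemma L2_norm_Hj psi f : E f -> L2 mu psi -> psi = cf f %[ae mu] ->
  L2_norm mu psi = Num.sqrt d%:R^-1 * nf f.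
Proof.
move=> hf hp pf; have hc := L2_coef_fun muG j pi_irrep hf.
have := ae_cnorm2 hp.1 hc.1 pf; rewrite !cnorm2_L2// => -[->].
exact: L2_norm_coef_fun.
Qed.

(** For [coef_bounded] maps the class of the result does not depend on the
    choice of coefficients, by [lift_coef_fun]. *)
Definition lift (Phi : fam -> fam) psi : XG -> C := cf (Phi (coefs psi)).

Record coef_bounded (Phi : fam -> fam) : Prop := CoefBounded {
  cbounded_L2 : forall f, E f -> E (Phi f) ;
  cboundedD : forall f g, Phi (f + g) = Phi f + Phi g ;
  cboundedZ : forall (a : C) f, Phi (fun k x => a * f k x) = (fun k x => a * Phi f k x) ;
  cbounded_bound : exists2 c : R, 0 <= c & forall f, E f -> nf (Phi f) <= c * nf f }.

Lemma cboundedB Phi f g : coef_bounded Phi -> Phi (f - g) = Phi f - Phi g.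
Proof.
move=> hP; have E1 h : - h = (fun k x => -1 * h k x) :> fam.
  by apply/funext => k; apply/funext => x; rewrite mulN1r.
by rewrite (cboundedD hP) E1 (cboundedZ hP) -E1.
Qed.

Lemma lift_coef_fun Phi psi f : coef_bounded Phi -> H psi -> E f -> psi = cf f %[ae mu] ->
  lift Phi psi = cf (Phi f) %[ae mu].
Proof.
move=> hP Hp hf pf; have [hc pc] := coefsP Hp.
have cc : cf (coefs psi) = cf f %[ae mu].
  by apply: (ae_imp2 pc pf) => z /(_ Logic.I) e1 /(_ Logic.I) e2 _; rewrite -e1 -e2.
have n0 := coef_fun_ae_inj haarG pi_irrep hc hf cc.
apply: (ae_coef_fun haarG) => //; [exact: (cbounded_L2 hP)|exact: (cbounded_L2 hP)|].
have [c c0 Hc] := cbounded_bound hP.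
apply/eqP; rewrite eq_le nrm_ge0 andbT -(cboundedB _ _ hP).
by rewrite (le_trans (Hc _ (siB HS hc hf)))// [nf _]n0 mulr0.
Qed.

Lemma lift_Hj Phi psi : coef_bounded Phi -> H psi -> H (lift Phi psi).
Proof. by move=> hP Hp; apply: Hj_coef_fun; apply: (cbounded_L2 hP); case: (coefsP Hp). Qed.

Lemma lift_bounded Phi : coef_bounded Phi -> bounded_op mu H (lift Phi).
Proof.
move=> hP; split; first by move=> psi; exact: lift_Hj.
  move=> a psi psi' Hp Hp'; have [hc pc] := coefsP Hp; have [hc' pc'] := coefsP Hp'.
  have hl : E ((fun k x => a * coefs psi k x) + coefs psi').
    by apply: (siD HS) => // k; exact: L2Z.
  have pl : (fun z => a * psi z + psi' z) = cf ((fun k x => a * coefs psi k x) + coefs psi') %[ae mu].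
    apply: (ae_imp2 pc pc') => z /(_ Logic.I) e1 /(_ Logic.I) e2 _.
    by rewrite coef_funD coef_funZ -e1 -e2.
  have := lift_coef_fun hP (HjD a Hp Hp') hl pl.
  by rewrite (cboundedD hP) (cboundedZ hP) coef_funD coef_funZ.
have [c c0 Hc] := cbounded_bound hP; exists c => psi Hp.
have [hc pc] := coefsP Hp.
rewrite !cnorm2_L2; [|exact: Hj_L2|exact: Hj_L2 (lift_Hj hP Hp)].
rewrite -EFinM lee_fin (L2_norm_Hj hc (Hj_L2 Hp) pc) /lift L2_norm_coef_fun//; last exact: (cbounded_L2 hP).
by rewrite mulrCA ler_wpM2l ?sqrtr_ge0//; exact: Hc.
Qed.

Lemma mxact_cbounded M c : 0 <= c -> bounded_mx muX M c -> coef_bounded (mxact M).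
Proof.
move=> c0 bM; split.
- by move=> f hf; exact: (mxact_L2 c0 bM hf).1.
- by move=> f g; exact: mxactD.
- by move=> a f; exact: mxactZ.
exists (d%:R * (d%:R * c)); first by rewrite !mulr_ge0.
by move=> f hf; exact: (mxact_L2 c0 bM hf).2.
Qed.

Lemma lift_multiplication M c : 0 <= c -> bounded_mx muX M c ->
  is_multiplication muX muG pi j M (lift (mxact M)).
Proof.
move=> c0 bM; split; first exact: (bounded_mx_Linfty c0 bM).
by move=> psi f Hp hf pf; exact: (lift_coef_fun (mxact_cbounded c0 bM)).
Qed.

Lemma inner_Hj psi psi' f g : E f -> E g -> L2 mu psi -> L2 mu psi' ->
  psi = cf f %[ae mu] -> psi' = cf g %[ae mu] ->
  inner mu psi psi' = d%:R^-1 * \sum_k inner muX (f k) (g k).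
Proof.
move=> hf hg hp hp' pf pg.
rewrite -(inner_coef_fun haarG j pi_irrep hf hg).
by apply: ae_inner => //; exact: L2_coef_fun.
Qed.

Variable F : R -> X -> X.
Hypotheses (FC1 : C1_flow F) (Fmu : measure_preserving_flow muX F).

Lemma famgen_dense f e : E f -> 0 < e -> exists g h, famgen muX F g h /\ nf (f - g) < e.
Proof.
move=> hf e0; have e1 : 0 < e / d.+1%:R by rewrite divr_gt0.
have /choice[gh Hgh] : forall k, exists gh : (borel X -> C) * (borel X -> C),
    generator muX F gh.1 gh.2 /\ L2_norm muX (fun x => f k x - gh.1 x) < e / d.+1%:R.
  by move=> k; have [g [h [H1 H2]]] := generator_dense FC1 Fmu (hf k) e1; exists (g, h).
have Hg : famgen muX F (fun k => (gh k).1) (fun k => (gh k).2) by move=> k; case: (Hgh k).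
exists (fun k => (gh k).1), (fun k => (gh k).2); split => //.
apply: fam_norm_small => //; first exact: (siB HS hf (famgen_L2 Hg).1).
by move=> k; case: (Hgh k).
Qed.

Lemma opA_coef_fun f h : famgen muX F f h -> opA muX muG F pi j (cf f) (cf h).
Proof.
move=> Hf; have [hf hh] := famgen_L2 Hf; split; [exact: L2_coef_fun|exact: L2_coef_fun|].
by exists f, h; split; [exact: Hf|exact: aeW|exact: aeW].
Qed.

Lemma orth_domain_eq0 w : E w -> (forall g h, famgen muX F g h -> q g w = 0) -> nf w = 0.
Proof.
move=> hw Hw.
suff q0 : q w w = 0 by rewrite /fam_norm /nrm q0 sqrtr0.
apply: (@small_eq0 _ _ (nf w)); first exact: nrm_ge0.
move=> e e0; have [g [h [Hg Hn]]] := famgen_dense hw e0.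
have hg := (famgen_L2 Hg).1.
have -> : q w w = q (w - g) w by rewrite (qB HS hw hg hw) (Hw g h Hg) subr0.
rewrite (le_trans (cauchy_schwarz HS (siB HS hw hg) hw))//.
by rewrite ler_wpM2r ?nrm_ge0// ltW.
Qed.

(** The form determines the operator: first from its diagonal values, by
    polarization over the complex numbers, then by density of the domain of
    the generator. *)
Lemma commutator_unique S B B' psi : is_commutator muX muG F pi j S B ->
  is_commutator muX muG F pi j S B' -> H psi -> B psi = B' psi %[ae mu].
Proof.
move=> [bB cB] [bB' cB'] Hp.
have [BH Blin [cb Hcb]] := bB; have [BH' Blin' [cb' Hcb']] := bB'.
pose T psi (z : XG) : C := B psi z - B' psi z.
have HN u v : H u -> H v -> H (fun z => u z - v z).
  move=> hu hv; have -> : (fun z => u z - v z) = (fun z => -1 * v z + u z).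
    by apply/funext => z; rewrite mulN1r addrC.
  exact: HjD.
have TH u : H u -> H (T u) by move=> hu; apply: HN; [exact: BH|exact: BH'].
have Tlin a u v : H u -> H v -> T (fun z => a * u z + v z) = (fun z => a * T u z + T v z) %[ae mu].
  move=> hu hv; apply: (ae_imp2 (Blin a u v hu hv) (Blin' a u v hu hv)) => z /(_ Logic.I) e1 /(_ Logic.I) e2 _.
  by rewrite /T e1 e2; ring.
have T0 u : (exists u', opA muX muG F pi j u u') -> H u -> inner mu u (T u) = 0.
  move=> [u' Au] hu; have e1 := cB _ _ Au; have e2 := cB' _ _ Au.
  have -> : T u = (fun z => B u z + (-1) * B' u z) by apply/funext => z; rewrite mulN1r.
  have h1 := Hj_L2 (BH _ hu); have h2 := Hj_L2 (BH' _ hu).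
  rewrite inner_Dr//; [|exact: Hj_L2|exact: L2Z].
  by rewrite inner_Zr//; [rewrite e1 e2 mulN1r subrr|exact: Hj_L2].
(* Mixed values from the diagonal ones at [a f + g], for [a = 1] and [a = i]. *)
have T1 f h g h' : famgen muX F f h -> famgen muX F g h' -> inner mu (cf f) (T (cf g)) = 0.
  move=> Gf Gg; have [hf hh] := famgen_L2 Gf; have [hg hh'] := famgen_L2 Gg.
  have Hf := Hj_coef_fun hf; have Hg := Hj_coef_fun hg.
  have Lf := Hj_L2 Hf; have Lg := Hj_L2 Hg.
  have Ltf := Hj_L2 (TH _ Hf); have Ltg := Hj_L2 (TH _ Hg).
  have P a : a * inner mu (cf g) (T (cf f)) + a^* * inner mu (cf f) (T (cf g)) = 0.
    have Gs : famgen muX F ((fun k x => a * f k x) + g) ((fun k x => a * h k x) + h').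
      by move=> k; apply: (generatorD FC1 Fmu); [exact: (generatorZ FC1 Fmu)|exact: Gg].
    have hs := (famgen_L2 Gs).1; have Hs := Hj_coef_fun hs.
    have := T0 _ (ex_intro _ _ (opA_coef_fun Gs)) Hs.
    have Es : cf ((fun k x => a * f k x) + g) = (fun z => a * cf f z + cf g z).
      by rewrite coef_funD coef_funZ.
    have tl := Tlin a _ _ Hf Hg; rewrite Es => S0.
    have Ls := Hj_L2 Hs; rewrite Es in Ls.
    have Lt : L2 mu (fun z => a * T (cf f) z + T (cf g) z) by apply: L2D => //; exact: L2Z.
    have Hs' := Hs; rewrite Es in Hs'.
    have := ae_inner Ls Ls (Hj_L2 (TH _ Hs')) Lt (aeW _ (fun z _ => erefl)) tl.
    rewrite S0 inner_Dr//; last exact: L2Z.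
    rewrite inner_Zr// !inner_Dl//; [|exact: L2Z..].
    rewrite !inner_Zl// (T0 _ (ex_intro _ _ (opA_coef_fun Gf)) Hf) (T0 _ (ex_intro _ _ (opA_coef_fun Gg)) Hg).
    by rewrite mulr0 add0r addr0 => /esym.
  have p1 := P 1; have pi' := P 'i%C.
  have c1 : (1 : C)^* = 1 by apply: complexRI; rewrite ?ReJ ?ImJ //= oppr0.
  have ci : ('i%C : C)^* = - 'i%C by apply: complexRI; rewrite ?(ReJ, ImJ, ReN, ImN) //= ?oppr0.
  have I2 : ('i%C : C) * 'i%C = -1 by apply: complexRI; rewrite !(ReM, ImM) /=; ring.
  move: p1 pi'; rewrite c1 ci !mul1r => p1 p2.
  have : - 'i%C * ('i%C * inner mu (cf g) (T (cf f)) + - 'i%C * inner mu (cf f) (T (cf g))) = 0 by rewrite p2 mulr0.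
  have -> : - 'i%C * ('i%C * inner mu (cf g) (T (cf f)) + - 'i%C * inner mu (cf f) (T (cf g))) =
    - ('i%C * 'i%C) * inner mu (cf g) (T (cf f)) + ('i%C * 'i%C) * inner mu (cf f) (T (cf g)) by ring.
  rewrite I2 opprK mul1r mulN1r => p3.
  have : inner mu (cf f) (T (cf g)) *+ 2 = 0.
    by rewrite -[RHS](subrr 0) -{1}p1 -{1}p3 mulr2n; ring.
  by move/eqP; rewrite mulrn_eq0 /= => /eqP.
have T2 g h : famgen muX F g h -> L2_norm mu (T (cf g)) = 0.
  move=> Gg; have [hg hh] := famgen_L2 Gg; have Hg := Hj_coef_fun hg.
  have Ht := TH _ Hg; have [hw pw] := coefsP Ht.
  rewrite (L2_norm_Hj hw (Hj_L2 Ht) pw) orth_domain_eq0 ?mulr0// => f h' Gf.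
  have [hf _] := famgen_L2 Gf; have := T1 _ _ _ _ Gf Gg.
  have Lf := L2_coef_fun muG j pi_irrep hf; have Lw := L2_coef_fun muG j pi_irrep hw.
  rewrite (ae_inner Lf Lf (Hj_L2 Ht) Lw (aeW _ (fun z _ => erefl)) pw).
  move=> /(congr1 (@complex.Re R)); rewrite Re_inner re_inner_coef_fun// => /eqP; rewrite mulf_eq0.
  have d0 : (0 < d)%N by case: pi_irrep.
  by rewrite invr_eq0 pnatr_eq0 eqn0Ngt d0 /= => /eqP.
have [hc pc] := coefsP Hp.
have n0 : L2_norm mu (T psi) = 0.
  apply: (@small_eq0 _ _ (`|cb| + `|cb'|)); first by rewrite addr_ge0.
  move=> e e0; rewrite ger0_norm ?nrm_ge0//.
  have [g [h [Gg Hn]]] := famgen_dense hc e0.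
  have hg := (famgen_L2 Gg).1; have Hg := Hj_coef_fun hg.
  have Hd := HN _ _ Hp Hg.
  have hB := siB HS hc hg.
  have nd : L2_norm mu (fun z => psi z - cf g z) <= e.
    rewrite (@L2_norm_Hj _ (coefs psi - g) hB (Hj_L2 Hd)); last first.
      by apply: (ae_imp pc) => z /(_ Logic.I) -> _; rewrite coef_funB.
    apply: le_trans (ltW Hn); rewrite ler_piMl ?nrm_ge0// -[leRHS]sqrtr1 ler_wsqrtr//.
    have d0 : (0 < d)%N by case: pi_irrep.
    by rewrite invf_le1 ?ltr0n// ler1n.
  have tE : T psi = (fun z => T (fun z => psi z - cf g z) z + T (cf g) z) %[ae mu].
    have := Tlin 1 _ _ Hd Hg.
    have -> : (fun z => 1 * (psi z - cf g z) + cf g z) = psi by apply/funext => z; rewrite mul1r subrK.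
    by move=> /ae_imp; apply => z /(_ Logic.I) -> _; rewrite mul1r.
  have Lt1 := Hj_L2 (TH _ Hd); have Lt2 := Hj_L2 (TH _ Hg).
  have := ae_cnorm2 (Hj_L2 (TH _ Hp)).1 (L2D Lt1 Lt2).1 tE.
  rewrite !cnorm2_L2; [|exact: L2D|exact: Hj_L2 (TH _ Hp)] => -[->].
  apply: (le_trans (nrmD HSX Lt1 Lt2)); have := T2 _ _ Gg; rewrite /L2_norm => ->; rewrite addr0.
  have B1 := Hj_L2 (BH _ Hd); have B2 := Hj_L2 (BH' _ Hd).
  apply: (le_trans (nrmB HSX B1 B2)).
  have k1 := Hcb _ Hd; have k2 := Hcb' _ Hd.
  rewrite cnorm2_L2// cnorm2_L2 in k1; last exact: Hj_L2.
  rewrite cnorm2_L2// cnorm2_L2 in k2; last exact: Hj_L2.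
  move: k1 k2; rewrite -!EFinM !lee_fin => k1 k2.
  have nn := nrm_ge0 (re_inner mu) (fun z => psi z - cf g z).
  rewrite mulrDr lerD//.
    apply: (le_trans k1); rewrite mulrC (le_trans (ler_wpM2l nn (ler_norm cb)))//.
    by rewrite ler_wpM2r.
  apply: (le_trans k2); rewrite mulrC (le_trans (ler_wpM2l nn (ler_norm cb')))//.
  by rewrite ler_wpM2r.
apply: (ae_imp (ae_L2_norm (Hj_L2 (TH _ Hp)) n0)) => z /(_ Logic.I) h _.
by apply/eqP; rewrite -subr_eq0; apply/eqP.
Qed.

End operators_on_coefficients.

(** * The degree operator *)

Section degree_operator.
Context {R : realType} {n m : nat} {X : manifoldType R n} {G : lieGroupType R m}.
Variables (muX : probability (borel X) R) (muG : probability (borel G) R).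
Variables (F : R -> X -> X) (phi : X -> G) (ip : {dot 'rV[R]_m for idfun}).
Local Notation C := R[i].
Local Notation normc := Normc.normc.
Variables (d : nat) (pi : G -> 'M[C]_d) (j : 'I_d).
Hypotheses (FC1 : C1_flow F) (Fmu : measure_preserving_flow muX F).
Hypotheses (cG : compact [set: G]) (haarG : haar_probability muG) (ip_Ad : Ad_invariant G ip).
Hypothesis mphi : measurable_fun setT (phi : borel X -> borel G).
Hypothesis pi_irrep : unitary_irrep pi.
Variables (L : borel X -> 'M[C]_d) (c : R).
Hypothesis c0 : 0 <= c.
Hypothesis bL : bounded_mx muX L c.
Hypothesis gL : forall k l, generator muX F (fun x => pi (phi x) k l) (fun x => 'i%C * L x k l).
Hypothesis Lphi : {ae muX, forall x, Lie_derivable F phi x}.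
Variables (M0 p : borel X -> 'rV[R]_m).
Hypotheses (hM0 : coord_real_L2 muX M0) (MM0 : M_phi F phi = M0 %[ae muX]) (hp : coord_real_L2 muX p).
Hypothesis Wp : W_phi F phi p = p %[ae muX].
Hypothesis avg : forall e, 0 < e -> exists N0, forall N, (N0 <= N)%N ->
    nrm (lie_inner muX ip) (average (@lie_scale _ _ R m) (W_phi F phi) N M0 - p) < e.

Local Notation XG := (borel X * borel G)%type.
Local Notation mu := (muX \x muG)%E.
Local Notation fam := ('I_d -> borel X -> C).
Local Notation E := (@L2_fam _ (borel X) R muX d).
Local Notation q := (@fam_inner _ (borel X) R muX d).
Local Notation nf := (@fam_norm _ (borel X) R muX d).
Local Notation H := (Hj muX muG pi j).
Local Notation cf := (coef_fun pi j).
Local Notation U := (koopman F phi : (XG -> C) -> (XG -> C)).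
Local Notation Uf := (koopc pi F phi).
Local Notation Ufi := (koopc_inv pi F phi).
Local Notation W := (W_phi F phi).
Local Notation ldsum := (logder_sum pi F phi L).
Local Notation drep := (drep pi).
Implicit Types (f g h : fam) (psi : XG -> C).

Let HS : semi_inner E (@fam_rscale _ (borel X) R d) q := L2_fam_semi_inner muX d.
Let HSX : semi_inner (L2 mu : (XG -> C) -> Prop) (@rscale _ XG R) (re_inner mu) := L2_semi_inner mu.
Let HSl := @coord_real_L2_semi_inner _ _ _ muX m ip.

(** The derivative in mean square agrees with the pointwise one, which the
    chain rule computes. *)
Lemma logder_drep : {ae muX, forall x, logder pi phi L x = drep (M0 x)}.
Proof.
have H1 k l : {ae muX, forall x, L x k l = (drep (M_phi F phi x) *m pi (phi x)) k l}.
  apply: (generator_derivative FC1 Fmu (gL k l)).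
  by apply: (ae_imp Lphi) => x hx; exact: (Lie_derivative_rep haarG cG pi_irrep FC1).
have H2 : {ae muX, forall x, forall k l, L x k l = (drep (M_phi F phi x) *m pi (phi x)) k l}.
  by apply: filter_forall => k; apply: filter_forall => l; exact: H1.
apply: (ae_imp2 H2 MM0) => x hx /(_ Logic.I) <-.
rewrite /logder /cocycle.
have -> : L x = drep (M_phi F phi x) *m pi (phi x) by apply/matrixP => k l; exact: hx.
by rewrite -mulmxA rep_unitary// mulmx1.
Qed.

(** [drep] turns [Ad] into conjugation, by [drep_Ad]. *)
Lemma logder_conj_drep N : {ae muX, forall x, logder_conj pi F phi L N x = drep (iter N W M0 x)}.
Proof.
elim: N => [|N IH]; first exact: logder_drep.
apply: (ae_imp (ae_flow FC1 Fmu 1 IH)) => x /= ->.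
by rewrite /W_phi (drep_Ad haarG cG pi_irrep).
Qed.

Lemma logder_sum_drep N : {ae muX, forall x, ldsum N x = drep (\sum_(i < N) iter i W M0 x)}.
Proof.
have : {ae muX, forall x, forall i : 'I_N, logder_conj pi F phi L i x = drep (iter i W M0 x)}.
  by apply: filter_forall => i; exact: logder_conj_drep.
move=> /ae_imp; apply => x h; rewrite drep_sum.
by apply: eq_bigr => i _; exact: h.
Qed.

Definition limit_mx (x : borel X) : 'M[C]_d := 'i%C *: drep (p x).
Definition average_mx (N : nat) (x : borel X) : 'M[C]_d := (N%:R^-1 : C) *: ('i%C *: ldsum N x).

Lemma inv_natC (N : nat) : (N%:R^-1 : C) = (N%:R^-1 : R)%:C%C.
Proof. by rewrite fmorphV /= rmorph_nat. Qed.

Lemma average_mx_drep N : {ae muX, forall x,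
  average_mx N x = 'i%C *: drep (average (@lie_scale _ _ R m) W N M0 x)}.
Proof.
apply: (ae_imp (logder_sum_drep N)) => x hx.
rewrite /average_mx hx scalerA mulrC -scalerA; congr (_ *: _).
rewrite /average /lie_scale fct_sumE drepZ inv_natC.
by [].
Qed.

Lemma adj_i_drep Z : adj ('i%C *: drep Z) = 'i%C *: drep Z.
Proof.
have := drep_skew haarG cG pi_irrep Z => /matrixP h; apply/matrixP => k l.
have := h k l; rewrite !adjE !mxE conjCM => ->.
have -> : ('i%C : C)^* = - 'i%C by apply: complexRI; rewrite ?(ReJ, ImJ, ReN, ImN) //= ?oppr0.
by rewrite mulrNN.
Qed.

(** [drep] is linear on a space of finite dimension. *)
Lemma L2_norm_drep : exists2 K : R, 0 <= K & forall (f : borel X -> 'rV[R]_m) k l, coord_real_L2 muX f ->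
  L2 muX (fun x => drep (f x) k l) /\ L2_norm muX (fun x => drep (f x) k l) <= K * nrm (lie_inner muX ip) f.
Proof.
have [K0 K00 HK0] := coord_int_le muX ip.
pose b k l i := normc (drep (delta_mx 0 i) k l).
have b0 k l i : 0 <= b k l i by exact: normc_ge0.
exists (\sum_k \sum_l \sum_i b k l i * Num.sqrt K0).
  by do 3 (apply: sumr_ge0 => ? _); rewrite mulr_ge0 ?sqrtr_ge0.
move=> f k l hf.
pose t i (x : borel X) : C := drep (delta_mx 0 i) k l * (f x 0 i)%:C%C.
have hr i : L2 muX (fun x => (f x 0 i)%:C%C).
  apply/L2_real_L2; split; first exact: hf.
  by split; [exact: measurable_cst|under eq_fun do rewrite /= expr0n; exact: rintegrable0].
have ht i : L2 muX (t i) by exact: L2Z.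
have fE : (fun x => drep (f x) k l) = \sum_i t i.
  apply/funext => x; rewrite fct_sumE drep_coord summxE.
  by apply: eq_bigr => i _; rewrite mxE mulrC.
have [h1 h2] := nrm_sum (L2_semi_inner muX) (index_enum 'I_m) ht.
rewrite fE; split => //; apply: (le_trans h2).
apply: (@le_trans _ _ (\sum_i b k l i * Num.sqrt K0 * nrm (lie_inner muX ip) f)).
  apply: ler_sum => i _; have := L2_normZ (drep (delta_mx 0 i) k l) (hr i); rewrite /L2_norm => ->.
  rewrite -mulrA ler_wpM2l ?normc_ge0// /nrm -sqrtrM// ler_wsqrtr//.
  apply: le_trans (HK0 f i hf); rewrite re_inner_sqn le_eqVlt; apply/orP; left; apply/eqP.
  by apply: eq_Rintegral => x _; rewrite /sqn /= expr0n addr0.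
rewrite -mulr_suml ler_wpM2r ?nrm_ge0//.
rewrite [leRHS](bigD1 k)//= [X in _ <= X + _](bigD1 l)//= -addrA lerDl.
apply: addr_ge0; first by do 2 (apply: sumr_ge0 => ? _); rewrite mulr_ge0 ?sqrtr_ge0.
by do 3 (apply: sumr_ge0 => ? _); rewrite mulr_ge0 ?sqrtr_ge0.
Qed.

Let bC := d%:R * (d%:R * (d%:R * c)).
Let bC0 : 0 <= bC. Proof. by rewrite !mulr_ge0. Qed.

Lemma average_mx_bounded N : bounded_mx muX (average_mx N) bC.
Proof.
have [mS bS] := bounded_mxZ (N%:R^-1 : C) (bounded_mxZ 'i%C (logder_sum_bounded pi_irrep FC1 Fmu mphi c0 bL N)).
split => //; apply: (ae_imp bS) => x h k l; apply: (le_trans (h k l)).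
have -> : normc ('i%C : C) = 1 by rewrite normcE /sqn /= expr0n expr1n add0r sqrtr1.
rewrite inv_natC normcRC ger0_norm ?invr_ge0// mul1r mulrA.
have [->|Nn] := eqVneq N 0%N; first by rewrite mulr0n invr0 mul0r.
by rewrite -(mulrA N%:R) mulKf ?pnatr_eq0.
Qed.

Lemma ae_L2_norm_eq (u v : borel X -> C) : L2 muX u -> L2 muX v -> {ae muX, forall x, u x = v x} -> L2_norm muX u = L2_norm muX v.
Proof.
move=> hu hv uv; have : u = v %[ae muX] by apply: (ae_imp uv) => x -> _.
by move=> /(ae_cnorm2 hu.1 hv.1); rewrite !cnorm2_L2// => -[].
Qed.

Lemma limit_mx_L2 k l : L2 muX (fun x => limit_mx x k l).
Proof.
have [K K0 HK] := L2_norm_drep; under eq_fun do rewrite mxE.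
by apply: L2Z; case: (HK _ k l hp).
Qed.

Lemma average_mx_L2 N k l : L2 muX (fun x => average_mx N x k l).
Proof. exact: (bounded_mx_L2 k l bC0 (average_mx_bounded N)). Qed.

Lemma average_mx_cvg k l e : 0 < e -> exists N0, forall N, (N0 <= N)%N ->
  L2_norm muX (fun x => average_mx N x k l - limit_mx x k l) < e.
Proof.
move=> e0; have [K K0 HK] := L2_norm_drep.
have K1 : 0 < K + 1 by rewrite ltr_wpDl.
have [N0 HN0] := avg (divr_gt0 e0 K1); exists N0 => N NN.
have hA := averageE HSl (W_phi_L2 FC1 Fmu ip_Ad mphi) N hM0.
have hB := siB HSl hA hp.
have [h1 h2] := HK _ k l hB.
have -> : L2_norm muX (fun x => average_mx N x k l - limit_mx x k l) =
    L2_norm muX (fun x => 'i%C * drep ((average (@lie_scale _ _ R m) W N M0 - p) x) k l).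
  apply: ae_L2_norm_eq; [by apply: L2B; [exact: average_mx_L2|exact: limit_mx_L2]|exact: L2Z|].
  apply: (ae_imp (average_mx_drep N)) => x ->.
  have -> : (average (@lie_scale _ _ R m) W N M0 - p) x = average (@lie_scale _ _ R m) W N M0 x + (-1) *: p x.
    by rewrite scaleN1r.
  have m1 : ((-1 : R)%:C)%C = (-1 : C) by apply: complexRI; rewrite /= ?oppr0.
  rewrite drepD [drep (-1 *: _)]drepZ m1 /limit_mx !mxE.
  by rewrite mulrDr mulN1r mulrN.
rewrite L2_normZ//.
have -> : normc ('i%C : C) = 1 by rewrite normcE /sqn /= expr0n expr1n add0r sqrtr1.
rewrite mul1r; apply: (le_lt_trans h2).
apply: (@le_lt_trans _ _ ((K + 1) * nrm (lie_inner muX ip) (average (@lie_scale _ _ R m) W N M0 - p))).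
  by rewrite ler_wpM2r ?nrm_ge0// lerDl.
by rewrite mulrC -ltr_pdivlMr//; exact: HN0.
Qed.

(** The averages have a common bound, which passes to their limit in mean
    square. *)
Lemma limit_mx_bounded : bounded_mx muX limit_mx bC.
Proof.
have mD k l : cmeasurable (fun x => limit_mx x k l) by case: (limit_mx_L2 k l).
split => //; apply: filter_forall => k; apply: filter_forall => l.
apply: ae_bound_closed => // e e0.
have [N0 HN0] := average_mx_cvg k l e0.
exists (fun x => average_mx N0 x k l); have hL := L2B (limit_mx_L2 k l) (average_mx_L2 N0 k l).
split => //.
- by case: (average_mx_L2 N0 k l).
- by have [_ h] := average_mx_bounded N0; apply: (ae_imp h) => x hx; exact: hx.
apply: le_lt_trans (HN0 N0 (leqnn N0)).
have -> : (fun x => limit_mx x k l - average_mx N0 x k l) = - (fun x => average_mx N0 x k l - limit_mx x k l).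
  by apply/funext => x; rewrite fctE opprB.
by have := nrmN (L2_semi_inner muX) (L2B (average_mx_L2 N0 k l) (limit_mx_L2 k l)); rewrite /L2_norm => ->.
Qed.

Local Notation Df := (mxact limit_mx).
Local Notation DN N := (mxact (average_mx N)).

Lemma limit_op_L2 f : E f -> E (Df f).
Proof. by move=> hf; exact: (mxact_L2 bC0 limit_mx_bounded hf).1. Qed.

Lemma limit_op_selfadjoint f g : E f -> E g -> q (Df f) g = q f (Df g).
Proof.
move=> hf hg; apply: (fam_inner_mxact_ae bC0 limit_mx_bounded limit_mx_bounded) => //.
by apply: aeW => x; rewrite /limit_mx adj_i_drep.
Qed.

Lemma average_op_selfadjoint N f g : E f -> E g -> q (DN N f) g = q f (DN N g).
Proof.
move=> hf hg; apply: (fam_inner_mxact_ae bC0 (average_mx_bounded N) (average_mx_bounded N)) => //.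
by apply: (ae_imp (average_mx_drep N)) => x ->; rewrite adj_i_drep.
Qed.

Lemma average_op_cvg f e : E f -> 0 < e -> exists N0, forall N, (N0 <= N)%N -> nf (DN N f - Df f) < e.
Proof.
move=> hf e0.
have [|||||N0 HN0] := @mxact_cvg0 _ _ _ muX d (fun N x => average_mx N x - limit_mx x) (bC + bC) f _ _ _ _ _ e e0.
- by rewrite addr_ge0.
- by move=> N; apply: bounded_mxD; [exact: average_mx_bounded|exact: limit_mx_bounded].
- move=> N k l; under eq_fun do rewrite !mxE -/(average_mx N _ k l) -/(limit_mx _ k l).
  by have := L2B (average_mx_L2 N k l) (limit_mx_L2 k l); congr (L2 _ _); apply/funext => x; rewrite !mxE.
- move=> k l e1 e10; have [N0 HN0] := average_mx_cvg k l e10; exists N0 => N NN.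
  by apply: le_lt_trans (HN0 N NN); rewrite le_eqVlt; apply/orP; left; apply/eqP; congr (L2_norm _ _);
     apply/funext => x; rewrite !mxE.
- exact: hf.
by exists N0 => N NN; rewrite -mxactB; exact: HN0.
Qed.

(** The commutator [A U^N - U^N A], which is [i (S N) U^N], read on
    coefficients. *)
Definition comm_coef (N : nat) f : fam := mxact (fun x => 'i%C *: ldsum N x) (iter N Uf f).

Lemma ildsum_bounded N : exists2 b, 0 <= b & bounded_mx muX (fun x => 'i%C *: ldsum N x) b.
Proof.
have h := bounded_mxZ 'i%C (logder_sum_bounded pi_irrep FC1 Fmu mphi c0 bL N).
by eexists; last exact: h; rewrite !mulr_ge0 ?normc_ge0.
Qed.

Lemma comm_coef_cbounded N : coef_bounded muX (comm_coef N).
Proof.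
have [b b0 bb] := ildsum_bounded N.
have [P1 P2 P3 [K K0 P4]] := mxact_cbounded b0 bb.
split.
- by move=> f hf; apply: P1; exact: (iterkoopc_L2 pi_irrep FC1 Fmu mphi).
- by move=> f g; rewrite /comm_coef iterkoopcD mxactD.
- by move=> a f; rewrite /comm_coef iterkoopcZ mxactZ.
exists K => // f hf; rewrite -(fam_norm_iterkoopc pi_irrep FC1 Fmu mphi N hf); apply: P4.
exact: (iterkoopc_L2 pi_irrep FC1 Fmu mphi).
Qed.

Lemma comm_coef_generator N f h : famgen muX F f h ->
  famgen muX F (iter N Uf f) (iter N Uf h + comm_coef N f).
Proof. exact: (famgen_iterkoopc pi_irrep FC1 Fmu c0 bL gL N). Qed.

Lemma skew_ae (P : XG -> Prop) : {ae mu, forall z, P z} -> {ae mu, forall z, P (skew_product F phi z)}.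
Proof. exact: (ae_mp (skew_measurable FC1 mphi) (skew_mp haarG phi FC1 Fmu)). Qed.

Lemma iter_koopman_L2 N psi : L2 mu psi -> L2 mu (iter N U psi).
Proof.
move=> hpsi; elim: N => //= N.
exact: (L2_mp (skew_measurable FC1 mphi) (skew_mp haarG phi FC1 Fmu)).
Qed.

Lemma iter_koopman_ae N psi psi' : psi = psi' %[ae mu] -> iter N U psi = iter N U psi' %[ae mu].
Proof. by move=> h; elim: N => //= N IH; exact: (skew_ae IH). Qed.

Lemma iter_koopman_inv_L2 N psi : L2 mu psi -> L2 mu (iter N (koopman_inv F phi) psi).
Proof.
move=> hpsi; elim: N => //= N.
exact: (L2_mp (skew_inv_measurable FC1 mphi) (skew_inv_mp haarG FC1 Fmu mphi)).
Qed.

Lemma iter_koopman_inv_ae N psi psi' : psi = psi' %[ae mu] ->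
  iter N (koopman_inv F phi) psi = iter N (koopman_inv F phi) psi' %[ae mu].
Proof.
move=> h; elim: N => //= N IH.
exact: (ae_mp (skew_inv_measurable FC1 mphi) (skew_inv_mp haarG FC1 Fmu mphi) IH).
Qed.

Lemma iter_koopman_coef N psi f : psi = cf f %[ae mu] -> iter N U psi = cf (iter N Uf f) %[ae mu].
Proof. by move=> /(iter_koopman_ae N); rewrite iter_koopman_coef_fun. Qed.

Lemma iter_koopman_inv_coef N psi f : psi = cf f %[ae mu] ->
  iter N (koopman_inv F phi) psi = cf (iter N Ufi f) %[ae mu].
Proof. by move=> /(iter_koopman_inv_ae N); rewrite (iter_koopman_inv_coef_fun j pi_irrep phi FC1). Qed.

(** As [U^N] preserves the domain of [A], symmetry of the generator turns the
    form into the inner product of [psi] with [(A U^N - U^N A) psi]. *)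
Lemma commutator_of_iterate N : is_commutator muX muG F pi j (iter N U) (lift muX muG pi j (comm_coef N)).
Proof.
split; first exact: (lift_bounded haarG j pi_irrep (comm_coef_cbounded N)).
move=> psi psi' [hpsi hpsi' [f [h [Gf pf ph]]]].
have [hf hh] := famgen_L2 (Gf : famgen muX F f h).
have Hp : H psi by split => //; exists f.
have hP := comm_coef_cbounded N.
have hU u : E u -> E (iter N Uf u) by exact: (iterkoopc_L2 pi_irrep FC1 Fmu mphi).
have lP := lift_coef_fun haarG pi_irrep hP Hp hf pf.
have hl := Hj_L2 (lift_Hj pi_irrep hP Hp).
rewrite (inner_Hj haarG pi_irrep hf (cbounded_L2 hP hf) hpsi hl pf lP).
rewrite (inner_Hj haarG pi_irrep hh (hU _ hf) hpsi' (iter_koopman_L2 N hpsi) ph (iter_koopman_coef N pf)).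
rewrite (inner_Hj haarG pi_irrep hf (hU _ hh) hpsi (iter_koopman_L2 N hpsi') pf (iter_koopman_coef N ph)).
rewrite -mulrBr -sumrB; congr (_ * _); apply: eq_bigr => k _.
have Gk := comm_coef_generator N (Gf : famgen muX F f h).
rewrite (generator_symmetric FC1 Fmu (Gf k) (Gk k)).
have := inner_Dr (hf k) (hU _ hh k) (cbounded_L2 hP hf k); rewrite -[inner _ _ (fun x => _ + _)]/(inner muX (f k) ((iter N Uf h + comm_coef N f) k)).
by move=> ->; rewrite addrC addKr.
Qed.

(** With [DN N] the normalised commutator, [q (DN N f) (U^N g)] is [q (A f)
    (U^N g) - q f (U^N (A g))] divided by [N]; the numerator is bounded in
    [N], and [DN N f] tends to [Df f]. *)
Lemma correlation_decay_on_domain f h g h' e : famgen muX F f h -> famgen muX F g h' -> 0 < e ->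
  exists N0, forall N, (N0 <= N)%N -> `|q (Df f) (iter N Uf g)| < e.
Proof.
move=> Gf Gg e0; have [hf hh] := famgen_L2 Gf; have [hg hh'] := famgen_L2 Gg.
have hU N u : E u -> E (iter N Uf u) by exact: (iterkoopc_L2 pi_irrep FC1 Fmu mphi).
have nU N u : E u -> nf (iter N Uf u) = nf u by exact: (fam_norm_iterkoopc pi_irrep FC1 Fmu mphi).
pose a := nf h * nf g + nf f * nf h'.
have a0 : 0 <= a by rewrite addr_ge0 ?mulr_ge0 ?nrm_ge0.
have e20 : 0 < e / 2 by rewrite divr_gt0.
have e30 : 0 < e / 2 / (nf g + 1) by rewrite divr_gt0// ltr_wpDl ?nrm_ge0.
have e40 : 0 < e / 2 / (a + 1) by rewrite divr_gt0// ltr_wpDl.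
have [N1 HN1] := average_op_cvg hf e30.
have [N2 HN2] := harmonic_small e40.
exists (maxn N1 N2.+1) => -[|N]; first by rewrite geq_max ltn0 andbF.
rewrite geq_max => /andP[nN1 nN2].
have hD := limit_op_L2 hf; have hDN : E (DN N.+1 f) := (mxact_L2 bC0 (average_mx_bounded N.+1) hf).1.
have hUg := hU N.+1 g hg.
have -> : q (Df f) (iter N.+1 Uf g) = q (DN N.+1 f) (iter N.+1 Uf g) - q (DN N.+1 f - Df f) (iter N.+1 Uf g).
  by rewrite (qB HS hDN hD hUg) opprB addrC subrK.
rewrite (le_lt_trans (ler_normB _ _))// [ltRHS]splitr ltrD//; last first.
  apply: (le_lt_trans (cauchy_schwarz HS (siB HS hDN hD) hUg)).
  have := HN1 _ nN1; rewrite ltr_pdivlMr; last by rewrite ltr_wpDl ?nrm_ge0.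
  have := nU N.+1 g hg; rewrite /fam_norm => ->; apply: le_lt_trans.
  by rewrite ler_wpM2l ?nrm_ge0// lerDl.
have hP := cbounded_L2 (comm_coef_cbounded N.+1) hg.
rewrite (average_op_selfadjoint N.+1 hf hUg) /average_mx mxact_scale inv_natC.
rewrite [X in `|X|](_ : _ = N.+1%:R^-1 * q f (comm_coef N.+1 g)); last first.
  exact: (qZr HS N.+1%:R^-1 hP hf).
have sym : q h (iter N.+1 Uf g) = q f (iter N.+1 Uf h' + comm_coef N.+1 g).
  by apply: eq_bigr => k _; exact: (generator_re_inner_symmetric FC1 Fmu (Gf k) (comm_coef_generator N.+1 Gg k)).
have hUh := hU N.+1 h' hh'.
have -> : q f (comm_coef N.+1 g) = q h (iter N.+1 Uf g) - q f (iter N.+1 Uf h').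
  by rewrite sym (qDr HS hUh hP hf); ring.
have qa : `|q h (iter N.+1 Uf g) - q f (iter N.+1 Uf h')| <= a.
  rewrite (le_trans (ler_normB _ _))// lerD//.
    by rewrite -(nU N.+1 g hg); exact: (cauchy_schwarz HS hh hUg).
  by rewrite -(nU N.+1 h' hh'); exact: (cauchy_schwarz HS hf hUh).
rewrite normrM ger0_norm ?invr_ge0//.
have := HN2 N nN2; rewrite ltr_pdivlMr; last by rewrite ltr_wpDl.
apply: le_lt_trans; rewrite ler_wpM2l ?invr_ge0//.
by rewrite (le_trans qa)// lerDl.
Qed.

(** The orthogonal complement of the kernel of a self-adjoint operator is the
    closure of its range, and correlations are continuous in both arguments
    uniformly in [N], as [U] is isometric. *)
Lemma correlation_decay f g e : E f -> E g -> (forall s, E s -> nf (Df s) = 0 -> q s f = 0) -> 0 < e ->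
  exists N0, forall N, (N0 <= N)%N -> `|q f (iter N Uf g)| < e.
Proof.
move=> hf hg orthf e0.
have hU N u : E u -> E (iter N Uf u) by exact: (iterkoopc_L2 pi_irrep FC1 Fmu mphi).
have nU N u : E u -> nf (iter N Uf u) = nf u by exact: (fam_norm_iterkoopc pi_irrep FC1 Fmu mphi).
have [P1 P2 P3 [B B0 P4]] := mxact_cbounded bC0 limit_mx_bounded.
pose K k := exists2 u, E u & k = Df u.
have KE k : K k -> E k by move=> [u hu ->]; exact: limit_op_L2.
have K0 : K 0.
  exists 0; first exact: (si0 HS).
  have := mxactD limit_mx 0 (0 : fam); rewrite addr0 => /(congr1 (fun t => t - Df 0)).
  by rewrite subrr addrK => <-.
have KD k l : K k -> K l -> K (k + l).
  by move=> [u hu ->] [v hv ->]; exists (u + v); [exact: (siD HS)|rewrite mxactD].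
have KZ a k : K k -> K (fam_rscale a k).
  by move=> [u hu ->]; exists (fam_rscale a u); [exact: (siZ HS)|rewrite [RHS]mxactZ].
have KN k : K k -> K (- k).
  move=> [u hu ->]; exists (fun k x => -1 * u k x); first by move=> i; exact: L2Z.
  by rewrite mxactZ; apply/funext => i; apply/funext => x; rewrite mulN1r.
have closure := biorthogonal_closure HS (@L2_fam_complete _ _ _ muX d) KE K0 KD KZ KN hf.
have g1 : 0 < nf g + 1 by rewrite ltr_wpDl ?nrm_ge0.
have e10 : 0 < e / 4 / (nf g + 1) by rewrite !divr_gt0.
have [|k [u hu ->] Hk] := closure _ _ e10.
  move=> s hs sK; rewrite (qC HS hf hs); apply: orthf => //.
  have : q s (Df (Df s)) = 0 by apply: sK; exists (Df s) => //; exact: limit_op_L2.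
  by rewrite -limit_op_selfadjoint//; [move=> h; rewrite /fam_norm /nrm h sqrtr0|exact: limit_op_L2].
have e20 : 0 < e / 4 / (nf g + 1) / (B + 1) by rewrite !divr_gt0// ltr_wpDl.
have [v [v' [Gv Hv]]] := famgen_dense FC1 Fmu hu e20.
have hv := (famgen_L2 Gv).1; have hDv := limit_op_L2 hv; have hDu := limit_op_L2 hu.
have v1 : 0 < nf (Df v) + 1 by rewrite ltr_wpDl ?nrm_ge0.
have e30 : 0 < e / 4 / (nf (Df v) + 1) by rewrite !divr_gt0.
have [w [w' [Gw Hw]]] := famgen_dense FC1 Fmu hg e30.
have hw := (famgen_L2 Gw).1.
have e40 : 0 < e / 4 by rewrite divr_gt0.
have [N0 HN0] := correlation_decay_on_domain Gv Gw e40.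
exists N0 => N NN; have hUg := hU N g hg; have hUw := hU N w hw.
have Hfv : nf (f - Df v) < e / 2 / (nf g + 1).
  have -> : f - Df v = (f - Df u) + (Df u - Df v) by rewrite addrA subrK.
  apply: (le_lt_trans (nrmD HS (siB HS hf hDu) (siB HS hDu hDv))).
  have -> : e / 2 / (nf g + 1) = e / 4 / (nf g + 1) + e / 4 / (nf g + 1) by field; rewrite gt_eqF.
  rewrite ltrD//.
  have -> : Df u - Df v = Df (u - v) by rewrite (cboundedB _ _ (mxact_cbounded bC0 limit_mx_bounded)).
  apply: (le_lt_trans (P4 _ (siB HS hu hv))).
  apply: (@le_lt_trans _ _ ((B + 1) * nf (u - v))); first by rewrite ler_wpM2r ?nrm_ge0// lerDl.
  by rewrite mulrC -ltr_pdivlMr// ltr_wpDl.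
have UB : iter N Uf g - iter N Uf w = iter N Uf (g - w).
  have -> : g - w = g + (fun k x => -1 * w k x).
    by congr (_ + _); apply/funext => i; apply/funext => x; rewrite mulN1r.
  rewrite iterkoopcD iterkoopcZ; congr (_ + _).
  by apply/funext => i; apply/funext => x; rewrite mulN1r.
have -> : q f (iter N Uf g) = q (f - Df v) (iter N Uf g) + q (Df v) (iter N Uf (g - w)) + q (Df v) (iter N Uf w).
  by rewrite -UB (qB HS hf hDv hUg) (qBr HS hUg hUw hDv); ring.
have b1 : `|q (f - Df v) (iter N Uf g)| < e / 2.
  apply: (le_lt_trans (cauchy_schwarz HS (siB HS hf hDv) hUg)).
  have := nU N g hg; rewrite /fam_norm => ->; move: Hfv; rewrite ltr_pdivlMr//; apply: le_lt_trans.
  by rewrite ler_wpM2l ?nrm_ge0// lerDl.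
have b2 : `|q (Df v) (iter N Uf (g - w))| < e / 4.
  have hB := siB HS hg hw.
  apply: (le_lt_trans (cauchy_schwarz HS hDv (hU N _ hB))).
  have := nU N _ hB; rewrite /fam_norm => ->; move: Hw; rewrite ltr_pdivlMr// mulrC; apply: le_lt_trans.
  by rewrite ler_wpM2r ?nrm_ge0// lerDl.
have b3 := HN0 N NN.
apply: (le_lt_trans (ler_normD _ _)); apply: (@le_lt_trans _ _ (`|q (f - Df v) (iter N Uf g)| + `|q (Df v) (iter N Uf (g - w))| + `|q (Df v) (iter N Uf w)|)).
  by rewrite lerD2r ler_normD.
move: b1 b2 b3; lra.
Qed.

(** The limit commutes with the Koopman operator, because [p] is fixed by
    [W_phi]. *)
Lemma limit_op_kernel_koopc_inv s : E s -> nf (Df s) = 0 -> nf (Df (Ufi s)) = 0.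
Proof.
move=> hs s0.
have hi := koopc_inv_L2 pi_irrep FC1 Fmu mphi hs.
have := fam_norm_iterkoopc pi_irrep FC1 Fmu mphi 1 (limit_op_L2 hi) => /= <-.
pose M x := cocycle pi phi x *m limit_mx (F 1 x) *m adj (cocycle pi phi x).
have MD : {ae muX, forall x, M x = limit_mx x}.
  apply: (ae_imp Wp) => x /(_ Logic.I) h; rewrite /M /limit_mx -h /W_phi (drep_Ad haarG cG pi_irrep).
  by rewrite -scalemxAr -scalemxAl.
have UD : Uf (Df (Ufi s)) = mxact M s.
  rewrite -{2}[s](koopc_invK pi_irrep phi FC1) /koopc famflow_mxact !mxact_mulmx; congr mxact.
  apply/funext => x; congr (_ *m _).
  by rewrite /M -!mulmxA /cocycle (rep_unitary' pi_irrep) mulmx1.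
have [mp _] := cocycle_bounded muX pi_irrep mphi.
have [mD bD] := limit_mx_bounded.
have bM : bounded_mx muX M (d%:R * (d%:R * bC)).
  split; last first.
    apply: (ae_imp (ae_flow FC1 Fmu 1 bD)) => x hx.
    have lb2 k' l' : normc ((cocycle pi phi x *m limit_mx (F 1 x)) k' l') <= d%:R * bC.
      rewrite -[bC]mul1r; apply: mulmx_entry_le => // k2 l2; exact: rep_normc_le1.
    move=> k l; rewrite -[d%:R * bC]mulr1; apply: mulmx_entry_le => //.
      by rewrite mulr_ge0.
    by move=> k2 l2; rewrite adjE normcJ rep_normc_le1.
  move=> k l; under eq_fun do rewrite mxE.
  apply: cmeasurable_sum => r; apply: cmeasurableM; last first.
    by under eq_fun do rewrite adjE; exact: cmeasurableJ.
  under eq_fun do rewrite mxE; apply: cmeasurable_sum => r'; apply: cmeasurableM => //.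
  exact: (cmeasurable_comp (flow_measurable FC1 1) (mD r' r)).
have bD' : bounded_mx muX limit_mx (Num.max bC (d%:R * (d%:R * bC))).
  by split => //; apply: (ae_imp bD) => x h k l; rewrite le_max h.
have bM' : bounded_mx muX M (Num.max bC (d%:R * (d%:R * bC))).
  by split; [case: bM|apply: (ae_imp bM.2) => x h k l; rewrite le_max h orbT].
have mx0 : 0 <= Num.max bC (d%:R * (d%:R * bC)) by rewrite le_max bC0.
have hM := (mxact_L2 mx0 bM' hs).1; have hD := limit_op_L2 hs.
rewrite UD -[mxact M s](subrK (Df s)).
apply/eqP; rewrite eq_le nrm_ge0 andbT (le_trans (nrmD HS (siB HS hM hD) hD))//.
have := mxact_ae mx0 bM' bD' MD hs; rewrite /fam_norm in s0 * => ->.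
by rewrite s0 addr0.
Qed.

End degree_operator.

(** * The theorem *)

Theorem theorem3p10 (R : realType) (n m : nat)
    (X : manifoldType R n) (cX : compact [set: X])
    (muX : probability (borel X) R)
    (F : R -> X -> X) (FC1 : C1_flow F)
    (Fmu : measure_preserving_flow muX F)
    (G : lieGroupType R m) (cG : compact [set: G])
    (muG : probability (borel G) R) (haarG : haar_probability muG)
    (ip : {dot 'rV[R]_m for idfun}) (ip_Ad : Ad_invariant G ip)
    (phi : X -> G) (mphi : measurable_fun setT (phi : borel X -> borel G))
    (d : nat) (pi : G -> 'M[R[i]]_d) (pi_irrep : unitary_irrep pi)
    (j : 'I_d)
    (Lphi : {ae muX, forall x, Lie_derivable F phi x})
    (L2M : L2_lie_class muX ip (M_phi F phi))
    (Lpi : Lie_rep_Linfty muX F phi pi) :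
  let mu := (muX \x muG)%E in
  let H := Hj muX muG pi j in
  let U := koopman F phi in
  let comm N := commutator muX muG F pi j (iter N U) in
  (forall N, exists B, is_commutator muX muG F pi j (iter N U) B) /\
  exists D,
    [/\ strong_limit muX muG pi j
          (fun N psi z => (N%:R)^-1 *
            comm N (iter N (koopman_inv F phi) psi) z) D,
        is_multiplication muX muG pi j
          (fun x => 'i%C *: drep pi (P_phi muX F phi ip (M_phi F phi) x)) D,
        forall phi' psi,
          orth muX muG pi j (ker_op muX muG pi j D) phi' -> H psi ->
          Normc.normc (inner mu phi' (iter N U psi)) @[N --> \oo] --> 0 &
        purely_continuous_on muX muG U
          (orth muX muG pi j (ker_op muX muG pi j D))].
Proof.
move=> mu H U comm.
have [L LL gL] := Lpi.
have [c c0 bL] := Linfty_bounded_mx LL.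
have [M0 [hM0 MM0 hp Wp avg]] := P_phi_mean_ergodic FC1 Fmu ip_Ad mphi L2M.
set p := P_phi _ _ _ _ _ in hp Wp avg *.
have HS := L2_fam_semi_inner muX d.
pose b : R := d%:R * (d%:R * (d%:R * c)).
have b0 : 0 <= b by rewrite !mulr_ge0.
pose Dm := limit_mx pi p.
have bD : bounded_mx muX Dm b.
  exact: (limit_mx_bounded FC1 Fmu cG haarG ip_Ad mphi pi_irrep c0 bL gL Lphi hM0 MM0 hp avg).
have commN N : is_commutator muX muG F pi j (iter N U) (lift muX muG pi j (comm_coef F phi pi L N)).
  exact: (commutator_of_iterate j FC1 Fmu haarG mphi pi_irrep c0 bL gL N).
split; first by move=> N; eexists; exact: commN.
pose D := lift muX muG pi j (mxact Dm).
have cboundedD := mxact_cbounded b0 bD.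
have DE psi f : H psi -> L2_fam muX f -> psi = coef_fun pi j f %[ae mu] ->
    D psi = coef_fun pi j (mxact Dm f) %[ae mu].
  exact: (lift_coef_fun haarG pi_irrep cboundedD).
have nuc N f : L2_fam muX f -> L2_fam muX (iter N (koopc pi F phi) f).
  exact: (iterkoopc_L2 pi_irrep FC1 Fmu mphi).
have HU N psi : H psi -> H (iter N U psi).
  move=> Hp; have [hf pf] := coefsP Hp; split.
    exact: (iter_koopman_L2 FC1 Fmu haarG mphi N (Hj_L2 Hp)).
  exists (iter N (koopc pi F phi) (coefs muX muG pi j psi)); first exact: nuc.
  exact: (iter_koopman_coef FC1 Fmu haarG mphi pi_irrep N pf).
have HUi N psi : H psi -> H (iter N (koopman_inv F phi) psi).
  move=> Hp; have [hf pf] := coefsP Hp; split.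
    exact: (iter_koopman_inv_L2 FC1 Fmu haarG mphi N (Hj_L2 Hp)).
  exists (iter N (koopc_inv pi F phi) (coefs muX muG pi j psi)).
    exact: (iterkoopc_inv_L2 pi_irrep FC1 Fmu mphi).
  exact: (iter_koopman_inv_coef FC1 Fmu haarG mphi pi_irrep N pf).
have ker_coef f : L2_fam muX f -> fam_norm muX (mxact Dm f) = 0 -> ker_op muX muG pi j D (coef_fun pi j f).
  move=> hf f0; have Hf := Hj_coef_fun muG j pi_irrep hf; split; first exact: Hf.
  have e1 := DE _ _ Hf hf (aeW _ (fun z _ => erefl)).
  have hD := cbounded_L2 cboundedD hf; have h0 := si0 HS.
  have e2 : coef_fun pi j (mxact Dm f) = coef_fun pi j 0 %[ae mu].
    by apply: (ae_coef_fun haarG) => //; rewrite subr0.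
  apply: (ae_imp2 e1 e2) => z /(_ Logic.I) -> /(_ Logic.I) -> _.
  by rewrite /coef_fun big1// => k _; rewrite mul0r.
have coef_ker psi : ker_op muX muG pi j D psi -> fam_norm muX (mxact Dm (coefs muX muG pi j psi)) = 0.
  move=> [Hp D0]; have [hf pf] := coefsP Hp.
  have e1 := DE _ _ Hp hf pf; have hD := cbounded_L2 cboundedD hf.
  have e2 : coef_fun pi j (mxact Dm (coefs muX muG pi j psi)) = coef_fun pi j 0 %[ae mu].
    apply: (ae_imp2 e1 D0) => z /(_ Logic.I) <- /(_ Logic.I) -> _.
    by rewrite /coef_fun big1// => k _; rewrite mul0r.
  by have := coef_fun_ae_inj haarG pi_irrep hD (si0 HS) e2; rewrite subr0.
have orth_coef psi s : orth muX muG pi j (ker_op muX muG pi j D) psi -> L2_fam muX s ->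
    fam_norm muX (mxact Dm s) = 0 -> fam_inner muX s (coefs muX muG pi j psi) = 0.
  move=> [Hp orthp] hs s0; have [hf pf] := coefsP Hp.
  have Hs := Hj_coef_fun muG j pi_irrep hs : H _.
  have := orthp _ (ker_coef s hs s0).
  rewrite (inner_Hj haarG pi_irrep hs hf (Hj_L2 Hs) (Hj_L2 Hp) (aeW _ (fun z _ => erefl)) pf).
  move=> /(congr1 (@complex.Re R)); rewrite inv_natC ReM Re_sum /= mul0r subr0 => /eqP.
  rewrite mulf_eq0 invr_eq0 pnatr_eq0.
  have d0 : (0 < d)%N by case: pi_irrep.
  by rewrite eqn0Ngt d0 /= => /eqP.
have decayA phi' psi : orth muX muG pi j (ker_op muX muG pi j D) phi' -> H psi ->
    Normc.normc (inner mu phi' (iter N U psi)) @[N --> \oo] --> 0.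
  move=> Op Hpsi; have [Hp orthp] := Op.
  have [hf pf] := coefsP Hp; have [hg pg] := coefsP Hpsi.
  set f := coefs muX muG pi j phi' in hf pf *; set g := coefs muX muG pi j psi in hg pg *.
  have hif : L2_fam muX (fun k x => 'i%C * f k x) by move=> k; exact: L2Z.
  have orthf s : L2_fam muX s -> fam_norm muX (mxact Dm s) = 0 -> fam_inner muX s f = 0 by exact: orth_coef.
  have orthif s : L2_fam muX s -> fam_norm muX (mxact Dm s) = 0 -> fam_inner muX s (fun k x => 'i%C * f k x) = 0.
    move=> hs s0; have his : L2_fam muX (fun k x => - 'i%C * s k x) by move=> k; exact: L2Z.
    have <- : fam_inner muX (fun k x => - 'i%C * s k x) f = fam_inner muX s (fun k x => 'i%C * f k x).
      apply: eq_bigr => k _; apply: eq_Rintegral => x _.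
      by rewrite !(ReM, ImM, ReJ, ImJ, ReN, ImN) /=; ring.
    apply: orthf => //; rewrite mxactZ.
    apply/eqP; rewrite eq_le nrm_ge0 andbT; apply: (le_trans (fam_norm_le_sum _)).
      by move=> k; apply: L2Z; exact: (cbounded_L2 cboundedD hs k).
    rewrite big1// => k _; rewrite L2_normZ; last exact: (cbounded_L2 cboundedD hs k).
    have := L2_norm_le_fam_norm k (cbounded_L2 cboundedD hs); rewrite s0 => h.
    by have -> : L2_norm muX (mxact Dm s k) = 0; [apply/eqP; rewrite eq_le h nrm_ge0|rewrite mulr0].
  (* [correlation_decay] concerns real parts; the imaginary part of a
     correlation is the real part of the one for [i f]. *)
  have dec f' e : L2_fam muX f' -> (forall s, L2_fam muX s -> fam_norm muX (mxact Dm s) = 0 -> fam_inner muX s f' = 0) ->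
      0 < e -> exists N0, forall N, (N0 <= N)%N -> `|fam_inner muX f' (iter N (koopc pi F phi) g)| < e.
    move=> hf' of'.
    exact: (correlation_decay FC1 Fmu cG haarG ip_Ad mphi pi_irrep c0 bL gL Lphi hM0 MM0 hp avg hf' hg of').
  have dn : 0 <= (d%:R^-1 : R) by rewrite invr_ge0.
  have d1 : (d%:R^-1 : R) <= 1.
    have d0 : (0 < d)%N by case: pi_irrep.
    by rewrite invf_le1 ?ltr0n// ler1n.
  apply/cvgrPdist_lt => e e0; have e20 : 0 < e / 2 by rewrite divr_gt0.
  have [N1 HN1] := dec f _ hf orthf e20; have [N2 HN2] := dec _ _ hif orthif e20.
  exists (maxn N1 N2) => // N nn; have {nn}/andP[nN1 nN2] : (N1 <= N)%N && (N2 <= N)%N by rewrite -geq_max.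
  change (`|0 - Normc.normc (inner mu phi' (iter N U psi))| < e).
  rewrite sub0r normrN ger0_norm ?normc_ge0//.
  have LU := iter_koopman_L2 FC1 Fmu haarG mphi N (Hj_L2 Hpsi).
  have cU := iter_koopman_coef FC1 Fmu haarG mphi pi_irrep N pg.
  have hU := nuc N g hg.
  have Lf := L2_coef_fun muG j pi_irrep hf; have LUg := L2_coef_fun muG j pi_irrep hU.
  rewrite (ae_inner (Hj_L2 Hp) Lf LU LUg pf cU).
  apply: (le_lt_trans (normc_le _)); rewrite Re_inner Im_inner// -coef_funZ.
  rewrite !re_inner_coef_fun// !normrM (ger0_norm dn) [ltRHS]splitr.
  apply: ltrD.
    by apply: le_lt_trans (HN1 N nN1); rewrite ler_piMl.
  by apply: le_lt_trans (HN2 N nN2); rewrite ler_piMl.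
exists D; split.
- split; first exact: (lift_bounded haarG j pi_irrep cboundedD).
  move=> psi Hp; have [hf pf] := coefsP Hp.
  set f := coefs muX muG pi j psi in hf pf.
  have commE N psi' : H psi' -> comm N psi' = lift muX muG pi j (comm_coef F phi pi L N) psi' %[ae mu].
    move=> Hp'; apply: (commutator_unique haarG pi_irrep FC1 Fmu _ (commN N) Hp').
    exact: (@xgetI _ (fun _ _ => 0) [set B | is_commutator muX muG F pi j (iter N U) B] _ (commN N)).
  have key N : cnorm2 mu (fun z => (N%:R)^-1 * comm N (iter N (koopman_inv F phi) psi) z - D psi z) =
      (Num.sqrt d%:R^-1 * fam_norm muX (mxact (average_mx F phi pi L N) f - mxact Dm f))%:E.
    have Hi := HUi N psi Hp.
    have pi' := iter_koopman_inv_coef FC1 Fmu haarG mphi pi_irrep N pf.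
    have hi := iterkoopc_inv_L2 pi_irrep FC1 Fmu mphi N hf.
    have cboundedN := comm_coef_cbounded FC1 Fmu mphi pi_irrep c0 bL N.
    have e1 := lift_coef_fun haarG pi_irrep cboundedN Hi hi pi'.
    have e2 := commE N _ Hi; have e3 := DE _ _ Hp hf pf.
    have E1 : mxact (average_mx F phi pi L N) f = (fun k x => N%:R^-1 * comm_coef F phi pi L N (iter N (koopc_inv pi F phi) f) k x).
      by rewrite /comm_coef (iterkoopc_invK pi_irrep) //; exact: mxact_scale.
    have bA := average_mx_bounded FC1 Fmu mphi pi_irrep c0 bL N.
    have hA := (mxact_L2 b0 bA hf).1; have hD := cbounded_L2 cboundedD hf.
    have hB := siB HS hA hD.
    rewrite -(L2_norm_coef_fun haarG j pi_irrep hB) -cnorm2_L2; last exact: L2_coef_fun.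
    apply: ae_cnorm2.
    + apply: cmeasurableB; last by have [] := Hj_L2 (lift_Hj pi_irrep cboundedD Hp).
      apply: cmeasurableM; first exact: cmeasurable_cst.
      have [[+ _ _] _] := xgetI (fun _ _ => 0) (commN N : [set B | is_commutator muX muG F pi j (iter N U) B] _).
      by move=> /(_ _ Hi) /Hj_L2[].
    + by have [] := L2_coef_fun muG j pi_irrep hB.
    apply: (ae_imp2 (filterI e1 e2) e3) => z [/(_ Logic.I) h1 /(_ Logic.I) h2] /(_ Logic.I) h3 _.
    by rewrite h3 h2 h1 coef_funB E1 coef_funZ.
  under eq_fun do rewrite key.
  apply: cvg_EFin; first exact: nearW.
  apply/cvgrPdist_lt => e e0.
  have [N0 HN0] := average_op_cvg FC1 Fmu cG haarG ip_Ad mphi pi_irrep c0 bL gL Lphi hM0 MM0 hp avg hf e0.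
  exists N0 => // N /= NN; rewrite sub0r normrN ger0_norm ?mulr_ge0 ?sqrtr_ge0 ?nrm_ge0//.
  apply: le_lt_trans (HN0 N NN); rewrite ler_piMl ?nrm_ge0// -[leRHS]sqrtr1 ler_wsqrtr//.
  have d0 : (0 < d)%N by case: pi_irrep.
  by rewrite invf_le1 ?ltr0n// ler1n.
- exact: (lift_multiplication haarG j pi_irrep b0 bD).
- exact: decayA.
split.
  move=> psi Op; have [Hp orthp] := Op; split; first exact: (HU 1%N).
  move=> xi kxi; have Hxi : H xi by case: kxi.
  have [hs ps] := coefsP Hxi; have s0 := coef_ker xi kxi.
  set s := coefs muX muG pi j xi in hs ps s0.
  have hi := koopc_inv_L2 pi_irrep FC1 Fmu mphi hs.
  have i0 := limit_op_kernel_koopc_inv FC1 Fmu cG haarG ip_Ad mphi pi_irrep c0 bL gL Lphi hM0 MM0 hp Wp avg hs s0.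
  have kc := ker_coef _ hi i0.
  have xiE : xi = U (coef_fun pi j (koopc_inv pi F phi s)) %[ae mu].
    by rewrite /U (koopman_coef_fun j pi_irrep) (koopc_invK pi_irrep phi FC1).
  have Lc := L2_coef_fun muG j pi_irrep hi.
  have LU := iter_koopman_L2 FC1 Fmu haarG mphi 1 (Hj_L2 Hp).
  have Lkoopc := iter_koopman_L2 FC1 Fmu haarG mphi 1 Lc.
  rewrite (ae_inner (Hj_L2 Hxi) Lkoopc LU LU xiE (aeW _ (fun z _ => erefl))).
  rewrite [LHS](inner_mp (skew_measurable FC1 mphi) (skew_mp haarG phi FC1 Fmu) Lc (Hj_L2 Hp)).
  exact: orthp.
(* The correlations of an eigenvector with itself have constant modulus, so
   their decay forces it to vanish. *)
move=> lam psi Op Ul; have [Hp _] := Op; have Lp := Hj_L2 Hp.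
apply: ae_L2_norm => //; apply/eqP; apply: contraT => n0.
have HSX := L2_semi_inner mu.
have LU := iter_koopman_L2 FC1 Fmu haarG mphi 1 Lp.
have nl : Normc.normc lam = 1.
  have := ae_cnorm2 LU.1 (L2Z lam Lp).1 Ul; rewrite !cnorm2_L2//; last exact: L2Z.
  move=> [] /=; rewrite (L2_norm_mp (skew_measurable FC1 mphi) (skew_mp haarG phi FC1 Fmu) Lp) L2_normZ// => h.
  by apply: (mulIf n0); rewrite mul1r.
have UN N : iter N U psi = (fun z => lam ^+ N * psi z) %[ae mu].
  elim: N => [|N IH]; first by apply: aeW => z _; rewrite expr0 mul1r.
  have h := skew_ae FC1 Fmu haarG mphi IH.
  apply: (ae_imp2 h Ul) => z /(_ Logic.I) h1 /(_ Logic.I) h2 _.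
  by rewrite iterS /U /koopman /= [LHS]h1 exprSr -mulrA -[in RHS]h2.
have c1 := decayA psi psi Op Hp.
have E N : Normc.normc (inner mu psi (iter N U psi)) = L2_norm mu psi ^+ 2.
  rewrite (ae_inner Lp Lp (iter_koopman_L2 FC1 Fmu haarG mphi N Lp) (L2Z (lam ^+ N) Lp) (aeW _ (fun z _ => erefl)) (UN N)).
  rewrite inner_Zr// Normc.normcM.
  have -> : Normc.normc (lam ^+ N) = 1.
    elim: N => [|N IH]; first by rewrite expr0 normcE /sqn /= expr0n expr1n addr0 sqrtr1.
    by rewrite exprS Normc.normcM IH nl mulr1.
  have -> : inner mu psi psi = (re_inner mu psi psi)%:C%C.
    apply: complexRI => //=; rewrite /Rintegral.
    have -> : (\int[mu]_x (complex.Im ((psi x)^* * psi x))%:E = \int[mu]_x 0%E)%E.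
      by apply: eq_integral => z _; rewrite mulJ_sqn.
    by rewrite integral0.
  by rewrite mul1r normcRC ger0_norm ?(qge0 HSX)// (nrm_sq HSX).
move: c1; under eq_fun do rewrite E.
move=> /(cvg_lim (@Rhausdorff R)); rewrite lim_cst; last exact: Rhausdorff.
by move=> /eqP; rewrite sqrf_eq0 (negPf n0).
Qed.
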